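(* Let $0<T\le 1$ and let $\delta_1>\delta_2>0$ be sufficiently small (i.e. $0<\delta_2<\delta_1<\delta_0$ for some absolute constant $\delta_0>0$). Then, for every $s\ge 0$, there is a constant $C>0$, independent of $T$, $u$ and $v$, such that $$\|u\,\overline{v}\|_{X_T^{s,-\frac12+\delta_1}}\le C\,\|u\|_{X_T^{s,\frac12+\delta_2}}\,\|v\|_{X_T^{s,\frac12+\delta_2}}$$ for all $u,v\in X_T^{s,\frac12+\delta_2}$.
   Context: $\mathbb{T}^2=(\mathbb{R}/\mathbb{Z})^2$ and $\langle\,\cdot\,\rangle=(1+|\cdot|^2)^{1/2}$. For $s,b\in\mathbb{R}$, $X^{s,b}=X^{s,b}(\mathbb{R}\times\mathbb{T}^2)$ is the completion of the (complex-valued) functions that are $C^\infty$ in space and Schwartz in time under the norm $$\|u\|_{X^{s,b}}=\Big(\sum_{n\in\mathbb{Z}^2}\int_{\mathbb{R}}\langle n\rangle^{2s}\langle\tau+|n|^2\rangle^{2b}|\widehat u(\tau,n)|^2\,d\tau\Big)^{1/2},$$ where $\widehat u(\tau,n)=\int_{\mathbb{R}}\int_{\mathbb{T}^2}u(t,x)e^{-2\pi i(t\tau+n\cdot x)}\,dx\,dt$ is the space-time Fourier transform (inessential factors of $2\pi$ are disregarded). For $T>0$, $X_T^{s,b}$ is the restriction of $X^{s,b}$ to the time interval $[-T,T]$, with norm $$\|u\|_{X_T^{s,b}}=\inf\{\|v\|_{X^{s,b}}:v|_{[-T,T]}=u\},$$ where the restriction is understood in the sense of distributions on $(-T,T)\times\mathbb{T}^2$.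 *)

(* Defs.v *)
From HB Require Import structures.
From mathcomp Require Import all_boot all_order all_algebra.
From mathcomp Require Import complex.
From mathcomp Require Import all_classical all_reals all_analysis.

Set Implicit Arguments.
Unset Strict Implicit.
Unset Printing Implicit Defensive.

Import Order.TTheory GRing.Theory Num.Theory.
Import numFieldNormedType.Exports.

Local Open Scope classical_set_scope.
Local Open Scope ring_scope.
Local Open Scope complex_scope.

(* The point (t, (x1, x2)) of R x T^2.  Functions on R x T^2 are functions of
   (t, (x1, x2)) that are 1-periodic in x1 and x2, and T^2 is integrated over
   through its fundamental domain [0, 1]^2. *)
Notation spacetime R := (R * (R * R))%type.

(* Inference does not find the sigma-finite structure of a bare m1 \x m2, hence
   the named product measures below. *)
Lemma product_sigma_finite d1 d2 (T1 : measurableType d1)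
    (T2 : measurableType d2) (R : realType)
    (m1 : {sigma_finite_measure set T1 -> \bar R})
    (m2 : {sigma_finite_measure set T2 -> \bar R}) :
  sigma_finite setT (m1 \x m2)%E.
Proof.
have /sigma_finiteP[F [TF ndF Foo]] := sigma_finiteT m1.
have /sigma_finiteP[G [TG ndG Goo]] := sigma_finiteT m2.
exists (fun n => F n `*` G n).
  rewrite -setXTT TF TG predeqE => -[x y]; split.
    move=> [/= [n _ Fnx] [k _ Gky]]; exists (maxn n k) => //; split.
    - by move: x Fnx; exact/subsetPset/ndF/leq_maxl.
    - by move: y Gky; exact/subsetPset/ndG/leq_maxr.
  by move=> [n _ []/= ? ?]; split; exists n.
move=> k; have [? ?] := Foo k; have [? ?] := Goo k.
split; first exact: measurableX.
by rewrite product_measure1E// lte_mul_pinfty// ge0_fin_numE.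
Qed.

Section Measures.
Context {R : realType}.

Definition plane_measure :
    set (measurableTypeR R * measurableTypeR R)%type -> \bar R :=
  (@lebesgue_measure R \x @lebesgue_measure R)%E.
HB.instance Definition _ := Measure.on plane_measure.
HB.instance Definition _ := Measure_isSigmaFinite.Build _ _ _ plane_measure
  (product_sigma_finite (@lebesgue_measure R) (@lebesgue_measure R)).

Definition st_measure :
    set (measurableTypeR R * (measurableTypeR R * measurableTypeR R))%type ->
    \bar R :=
  (@lebesgue_measure R \x plane_measure)%E.
HB.instance Definition _ := Measure.on st_measure.
HB.instance Definition _ := Measure_isSigmaFinite.Build _ _ _ st_measure
  (product_sigma_finite (@lebesgue_measure R) plane_measure).

End Measures.

Section Spacetime.
Context {R : realType}.
Local Notation ST := (spacetime R).

Definition unit_square : set (R * R) := `[0, 1] `*` `[0, 1].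

Definition cintegral (D : set ST) (f : ST -> R[i]) : R[i] :=
  (\int[st_measure]_(p in D) complex.Re (f p)) +i*
  (\int[st_measure]_(p in D) complex.Im (f p)).

Definition cintegrable (D : set ST) (f : ST -> R[i]) : Prop :=
  st_measure.-integrable D (fun p => (complex.Re (f p))%:E) /\
  st_measure.-integrable D (fun p => (complex.Im (f p))%:E).

Fixpoint iter_derive (w : seq ST) (f : ST -> R) : ST -> R :=
  if w is v :: w' then fun p => 'D_v (iter_derive w' f) p else f.

(* All iterated directional derivatives exist and decay faster than any power
   of t, uniformly in x: f is smooth in space and Schwartz in time. *)
Definition real_schwartz (f : ST -> R) : Prop :=
  (forall (w : seq ST) (v p : ST), derivable (iter_derive w f) p v) /\
  (forall (w : seq ST) (k : nat), exists M : R, forall p : ST,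
      `|p.1| ^+ k * `|iter_derive w f p| <= M).

Definition periodic (f : ST -> R[i]) : Prop :=
  forall t x1 x2, f (t, (x1 + 1, x2)) = f (t, (x1, x2)) /\
                  f (t, (x1, x2 + 1)) = f (t, (x1, x2)).

Definition schwartz (f : ST -> R[i]) : Prop :=
  [/\ periodic f, real_schwartz (fun p => complex.Re (f p)) &
      real_schwartz (fun p => complex.Im (f p))].

Definition cexpi (a : R) : R[i] := cos a +i* sin a.

Definition st_fourier (u : ST -> R[i]) (tau : R) (n : int * int) : R[i] :=
  cintegral (setT `*` unit_square) (fun p =>
    u p * cexpi (- (2 * pi * (p.1 * tau +
                              (n.1%:~R * p.2.1 + n.2%:~R * p.2.2))))).

Definition freq_sqr (n : int * int) : R := n.1%:~R ^+ 2 + n.2%:~R ^+ 2.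

Definition japanese (x : R) : R := Num.sqrt (1 + x ^+ 2).

(* The X^{s,b} norm of a function that is smooth in space and Schwartz in time;
   it is finite for such functions. *)
Definition X_norm (s b : R) (u : ST -> R[i]) : \bar R :=
  ((\esum_(n in [set: int * int])
     \int[lebesgue_measure]_(tau in [set: R])
       (japanese (Num.sqrt (freq_sqr n)) `^ (2 * s) *
        japanese (tau + freq_sqr n) `^ (2 * b) *
        (complex.Re (st_fourier u tau n) ^+ 2 +
         complex.Im (st_fourier u tau n) ^+ 2))%:E) `^ (2^-1))%E.

(* The completion X^{s,b}: its elements are presented by Cauchy sequences.  Two
   presentations may denote the same element; everything below depends only on
   the element. *)
Record X_space (s b : R) : Type := XSpace {
  X_seq : nat -> ST -> R[i];
  X_seq_schwartz : forall k, schwartz (X_seq k);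
  X_seq_cauchy : forall eps : R, 0 < eps -> exists N : nat, forall j k : nat,
    (N <= j)%N -> (N <= k)%N ->
    (X_norm s b (fun p => (X_seq j p - X_seq k p)%R) < eps%:E)%E
}.

Definition X_space_norm (s b : R) (v : X_space s b) : \bar R :=
  limn (fun k => X_norm s b (X_seq v k)).

(* Test functions on (-T, T) x T^2. *)
Record test_fun (T : R) : Type := TestFun {
  test_val :> ST -> R[i];
  test_schwartz : schwartz test_val;
  test_supp : exists r : R, r < T /\
    forall t x, r <= `|t| -> test_val (t, x) = 0
}.

(* Linearity and continuity are not required: they are automatic for the
   functionals in [in_XT], which are pointwise limits of distributions. *)
Definition st_distribution (T : R) : Type := test_fun T -> R[i].

Definition restricts_to (T s b : R) (v : X_space s b) (u : st_distribution T) :=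
  forall psi : test_fun T,
    let pairing k :=
      cintegral (setT `*` unit_square) (fun p => X_seq v k p * psi p) in
    (fun k => complex.Re (pairing k)) @ \oo --> complex.Re (u psi) /\
    (fun k => complex.Im (pairing k)) @ \oo --> complex.Im (u psi).

Definition in_XT (T s b : R) (u : st_distribution T) : Prop :=
  exists v : X_space s b, restricts_to v u.

Definition XT_norm (T s b : R) (u : st_distribution T) : \bar R :=
  ereal_inf [set X_space_norm v | v in [set v : X_space s b | restricts_to v u]].

Definition slab (T : R) : set ST := `]- T, T[ `*` unit_square.

Definition has_density (T : R) (u : st_distribution T) (f : ST -> R[i]) : Prop :=
  cintegrable (slab T) f /\
  forall psi : test_fun T, u psi = cintegral (slab T) (fun p => f p * psi p).

(* w = u * conj v.  The product is taken pointwise on densities, which are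
   unique up to null sets, so that w is determined by u and v.  For s, b >= 0
   the elements of X_T^{s,b} are L^2 functions on (-T, T) x T^2, so the product
   of two of them exists. *)
Definition is_mul_conj (T : R) (u v w : st_distribution T) : Prop :=
  exists f g : ST -> R[i],
    [/\ has_density u f, has_density v g &
        has_density w (fun p => f p * (g p)^*)].

End Spacetime.

(* Main.v *)
(** By duality the estimate for smooth functions is a bound for a trilinear form
    in the Fourier variables.  With [n] the frequency of the product, [l] that of
    [v] and [sigma_0, sigma, sigma_1] the three modulations, the resonance identity
    is [sigma_1 = sigma_0 + sigma + 2 (n . l)], so that one modulation is at least
    of the size of [n . l].  If it is one of those of the factors, a gain
    [|n . l|^(-1/2-)] remains, which is summable by counting lattice points on lines
    and primitive vectors close to a direction.  If it is that of the product, the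
    sum is organised along the lines [om . l = m], where [om] is the primitive vector
    in the direction of [n]: for short [l] the number of points of a line is
    [O(sqrt m)], and for long [l] few primitive [om] have [|om . l|] small.  As
    [s >= 0], the weight [<n>^s] is distributed over the factors.

    The Fourier transform of a product is dominated by the convolution of the
    transforms: mollify one factor by the nonnegative kernel (Poisson in time, Fejer
    in space), whose mass is bounded below, and use Parseval for the kernel; this
    costs a constant but avoids Fourier inversion.  Taking [v = u] gives the L^2
    bound on the slab.  Hence elements of [X^{s,1/2+}] are L^2 limits on
    [(-T, T)], the products of approximating sequences converge to the product of
    the densities, and the density of the product pairs with test functions in the
    same way for every choice of extensions, so one may pass to the infimum. *)
Require Import Defs.
From HB Require Import structures.
From mathcomp Require Import all_boot all_order all_algebra.
From mathcomp Require Import complex.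
From mathcomp Require Import zify ring lra.
From mathcomp Require Import all_classical all_reals all_analysis measurable_realfun.

Set Implicit Arguments.
Unset Strict Implicit.
Unset Printing Implicit Defensive.

Import Order.TTheory GRing.Theory Num.Theory.
Import numFieldNormedType.Exports.

Local Open Scope classical_set_scope.
Local Open Scope ring_scope.

(** The weight of the product is only [<x>^(-3/8)], short of the exponent above 1/2 that the factors
    carry. Squared, it gives [|m|^(-3/4)] along the lines [om . l = m], which is not summable in
    [m], so the Cauchy-Schwarz argument of the other two regions does not close. The summation in
    [m] is therefore left to the factor [<z>^(-(1 + eta))], whose argument runs through an
    arithmetic progression of step at least 2, and [|m|^(-3/4)] only has to beat a count of order
    [sqrt |m|]: of points on a line for short [l], of directions [om] for long [l]. Any exponent
    above 1/2 would do this; 3/4 is a convenient choice and explains the threshold 1/8 for [delta1].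
    All discrete estimates are proved for finite index sets, with constants that do not see the set.
    This is forced by the mollification: it bounds the transform of a product by a finite sum plus
    an error, and the set of frequencies in that sum grows as the error tends to 0. *)

Section translation.
Context {R : realType}.
Local Notation mu := (@lebesgue_measure R).

Lemma measurable_shift (c : R) :
  measurable_fun setT (fun x : measurableTypeR R => (x + c : measurableTypeR R)).
Proof. by apply: measurable_funD => //; exact: measurable_id. Qed.

(** By uniqueness: the pushforward under a translation is a measure that gives every half-open
    interval its length. *)
Lemma lebesgue_measure_shift (c : R) (A : set (measurableTypeR R)) :
  measurable A -> mu A = pushforward mu (fun x : measurableTypeR R => (x + c : measurableTypeR R)) A.
Proof.
move=> mA.
pose m : {measure set (measurableTypeR R) -> \bar R} :=
  measure_function_pushforward__canonical__measure_function_Measure mu (measurable_shift c).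
apply: (@lebesgue_measure_unique R m) mA.
move=> _ [[a b] _ <-] /=; rewrite /m/= /pushforward.
rewrite (_ : _ @^-1` _ = `](a - c), (b - c)]%classic); last first.
  by apply/seteqP; split=> x /=; rewrite !in_itv/= ltrBlDr lerBrDr.
rewrite !lebesgue_measure_itv/= !lte_fin ltrD2r.
by case: ifP => // _; rewrite -!EFinB; congr (_%:E); ring.
Qed.

Lemma ge0_integral_shift (c : R) (f : measurableTypeR R -> \bar R) :
  measurable_fun setT f -> (forall x, 0 <= f x)%E ->
  (\int[mu]_x f (x + c)%R = \int[mu]_x f x)%E.
Proof.
move=> mf f0.
rewrite [RHS](eq_measure_integral
  (measure_function_pushforward__canonical__measure_function_Measure mu
     (measurable_shift c))); last first.
  by move=> A mA _; exact: lebesgue_measure_shift.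
by rewrite ge0_integral_pushforward//; exact: measurable_shift.
Qed.

End translation.

Section uniq_int.

Lemma uniq_int_size (s : seq int) (lo hi : int) :
  uniq s -> (forall x : int, x \in s -> lo <= x <= hi) -> (size s <= absz (hi - lo + 1)%R)%N.
Proof.
move=> us h.
have sub (x : int) : x \in s ->
    x \in [seq lo + i%:Z | i <- iota 0 (absz (hi - lo + 1)%R)].
  move=> xs; have /andP[lx xh] := h _ xs; have e : x = lo + (absz (x - lo)%R)%:Z by lia.
  apply/mapP; exists (absz (x - lo)%R); last exact: e.
    by rewrite mem_iota add0n leq0n /=; lia.
by have := uniq_leq_size us sub; rewrite size_map size_iota.
Qed.

End uniq_int.

(** * Finite sums grouped by the fibres of a map *)

Section big_seq.
Context {R : realDomainType}.

Lemma partition_big_undup (I J : eqType) (s : seq I) (phi : I -> J) (F : I -> R) :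
  \sum_(x <- s) F x =
  \sum_(j <- undup (map phi s)) \sum_(x <- s | phi x == j) F x.
Proof.
rewrite (exchange_big_dep xpredT)//=; apply: eq_big_seq => x xs.
rewrite -big_filter (_ : [seq j <- _ | _] = [:: phi x]) ?big_seq1//.
rewrite (eq_filter (a2 := pred1 (phi x))); last by move=> j; rewrite /= eq_sym.
by rewrite filter_pred1_uniq ?undup_uniq// mem_undup map_f.
Qed.

(** The device behind most lattice sums below: the points are grouped by a dot product, a floor or a
    dyadic level [phi], a geometric count bounds the fibres by [c], and a one-dimensional series is
    left. *)
Lemma sum_fibers_le (I J : eqType) (s : seq I) (phi : I -> J) (F : I -> R)
    (h : J -> R) (c : J -> R) :
  (forall x, x \in s -> F x <= h (phi x)) -> (forall j, 0 <= h j) ->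
  (forall j, j \in map phi s -> (size [seq x <- s | phi x == j])%:R <= c j) ->
  \sum_(x <- s) F x <= \sum_(j <- undup (map phi s)) c j * h j.
Proof.
move=> Fh h0 hc; rewrite (partition_big_undup s phi).
rewrite big_seq [leRHS]big_seq; apply: ler_sum => j; rewrite mem_undup => js.
apply: (@le_trans _ _ (\sum_(x <- s | phi x == j) h j)).
  rewrite big_seq_cond [leRHS]big_seq_cond.
  by apply: ler_sum => x /andP[xs /eqP <-]; exact: Fh.
rewrite -big_filter big_const_seq count_predT iter_addr_0 -mulr_natl.
by apply: ler_wpM2r => //; exact: hc.
Qed.

Lemma ler_sum_subset (I : eqType) (s t : seq I) (F : I -> R) :
  uniq s -> uniq t -> {subset s <= t} -> (forall x, x \in t -> 0 <= F x) ->
  \sum_(x <- s) F x <= \sum_(x <- t) F x.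
Proof.
move=> us ut st F0; rewrite [leRHS](bigID (mem s))/=.
have -> : \sum_(x <- t | x \in s) F x = \sum_(x <- s) F x.
  rewrite -big_filter; apply: perm_big; apply: uniq_perm; rewrite ?filter_uniq// => x.
  by rewrite mem_filter; apply: andb_idr => /st.
by rewrite lerDl big_seq_cond sumr_ge0// => x /andP[xs _]; exact: F0.
Qed.

End big_seq.

Notation Z2 := (int * int)%type.

(** * Counting lattice points *)

Section planar.

Definition dotz (a b : Z2) : int := a.1 * b.1 + a.2 * b.2.
Definition crossz (a b : Z2) : int := a.1 * b.2 - a.2 * b.1.
Definition primitive (a : Z2) : bool := coprimez a.1 a.2.

Lemma dotzBr a x y : dotz a (x - y) = dotz a x - dotz a y.
Proof. by rewrite /dotz/=; ring. Qed.

Lemma dotzDr a x y : dotz a (x + y) = dotz a x + dotz a y.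
Proof. by rewrite /dotz/=; ring. Qed.

Lemma crosszBr a x y : crossz a (x - y) = crossz a x - crossz a y.
Proof. by rewrite /crossz/=; ring. Qed.

Lemma dotz_crossz_sqr a b : dotz a b ^+ 2 + crossz a b ^+ 2 = dotz a a * dotz b b.
Proof. by rewrite /dotz /crossz; ring. Qed.

Lemma dotz_ge0 a : 0 <= dotz a a.
Proof. by rewrite /dotz; nia. Qed.

Lemma dotz_eq0 a : (dotz a a == 0) = (a == 0).
Proof.
case: a => a b; rewrite /dotz/=; apply/eqP/eqP => [h|[-> ->]]; last by rewrite !mul0r.
by congr pair; nia.
Qed.

Lemma dotz_gt0 a : a != 0 -> 1 <= dotz a a.
Proof. by rewrite -dotz_eq0; have := dotz_ge0 a; lia. Qed.

Lemma primitive_neq0 a : primitive a -> a != 0.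
Proof. by apply: contraTneq => ->. Qed.

(** With the Bezout relation [u a + v b = 1] the multiplier of [d = (c, d)] is [t = u d - v c]: each
    coordinate is multiplied by 1 in this form and simplified by the orthogonality. *)
Lemma primitive_orth a d : primitive a -> dotz a d = 0 ->
  exists t : int, d = (- t * a.2, t * a.1).
Proof.
case: a d => a b [c d]; rewrite /primitive /dotz /= => /eqP cp h.
have [u [v uv]] := Bezoutz a b; rewrite cp in uv.
exists (u * d - v * c); congr pair.
  rewrite -[LHS]mul1r -uv (_ : _ * c = u * (a * c + b * d) + - (u * d - v * c) * b).
    by rewrite h mulr0 add0r.
  by ring.
rewrite -[LHS]mul1r -uv (_ : _ * d = v * (a * c + b * d) + (u * d - v * c) * a).
  by rewrite h mulr0 add0r.
by ring.
Qed.

Lemma dotz_orth_ge a d : primitive a -> dotz a d = 0 -> d != 0 ->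
  dotz a a <= `|crossz a d|.
Proof.
move=> pa h d0; have [t dt] := primitive_orth pa h.
have t0 : t != 0.
  by apply: contraNneq d0 => t0; rewrite dt t0 oppr0 !mul0r.
by rewrite dt /crossz /dotz /=; nia.
Qed.

Lemma dotz_crossz_inj a x y : a != 0 ->
  dotz a x = dotz a y -> crossz a x = crossz a y -> x = y.
Proof.
move=> a0 h1 h2; apply/eqP; rewrite -subr_eq0 -dotz_eq0.
have := dotz_crossz_sqr a (x - y); have := dotz_gt0 a0.
rewrite dotzBr crosszBr h1 h2 !subrr.
by move: (dotz _ _) (dotz (x - y) _) => p q; nia.
Qed.

(** Two points of the line differ by a multiple of the rotated vector [a], so their cross products
    with [a] differ by at least [|a|^2], while [|x| <= r |a|] confines these cross products to
    [[- r |a|^2, r |a|^2]]. Hence the quotients [phi] are distinct integers in [[-r, r]]. *)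
Lemma size_line (a : Z2) (m : int) (r : nat) (s : seq Z2) : primitive a -> uniq s ->
  (forall x, x \in s -> dotz a x = m) ->
  (forall x, x \in s -> dotz x x <= r%:Z ^+ 2 * dotz a a) ->
  (size s <= 2 * r + 1)%N.
Proof.
move=> pa us hm hr; have a0 := primitive_neq0 pa; have N0 := dotz_gt0 a0.
pose phi x := (crossz a x %/ dotz a a)%Z.
rewrite -(size_map phi).
have crb x : x \in s -> - (r%:Z * dotz a a) <= crossz a x <= r%:Z * dotz a a.
  move=> xs; have := dotz_crossz_sqr a x; have := hr _ xs; move: N0.
  by move: (dotz a x) (crossz a x) (dotz x x) (dotz a a) => p q t N; nia.
apply: (@leq_trans (absz (r%:Z - (- r%:Z) + 1)%R)); last by lia.
apply: uniq_int_size.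
  rewrite map_inj_in_uniq// => x y xs ys; rewrite /phi => hxy.
  apply: (dotz_crossz_inj a0); first by rewrite !hm.
  apply/eqP; apply/negP => /negP cxy.
  have xy : x - y != 0 by apply: contraNneq cxy => /eqP; rewrite subr_eq0 => /eqP ->.
  have := dotz_orth_ge pa _ xy.
  rewrite dotzBr (hm _ xs) (hm _ ys) subrr => /(_ erefl).
  rewrite crosszBr.
  move: hxy N0 cxy; move: (crossz a x) (crossz a y) (dotz a a) => p q N h N0 pq.
  have := divz_eq p N; have := divz_eq q N; rewrite h.
  have := modz_ge0 p (_ : N != 0); have := modz_ge0 q (_ : N != 0).
  have := ltz_pmod p (_ : 0 < N); have := ltz_pmod q (_ : 0 < N).
  by lia.
move=> _ /mapP[x xs ->]; rewrite /phi; have /andP[c1 c2] := crb _ xs.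
rewrite lez_divRL ?mulNr; last by lia.
by rewrite c1 -ltzD1 ltz_divLR ?mulrDl; lia.
Qed.

End planar.

(** * Primitive vectors in a box *)

Section primitive_count.
Context {R : realType}.

(** A vanishing cross product is orthogonality to the rotated [a], so [b] is a multiple [t] of [a];
    then [t] divides the gcd of the coordinates of [b], which is 1. *)
Lemma primitive_parallel a b : primitive a -> primitive b -> crossz a b = 0 ->
  b = a \/ b = - a.
Proof.
move=> pa pb ab.
have pa' : primitive (- a.2, a.1).
  by rewrite /primitive /coprimez /= gcdzC gcdzN; exact: pa.
have [|t] := @primitive_orth _ b pa'; first by rewrite -ab /dotz /crossz /=; ring.
case: a b pa pb {pa' ab} => a1 a2 [b1 b2] /= pa pb [b1E b2E].
have tb : (t %| gcdz b1 b2)%Z.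
  by rewrite dvdz_gcd; apply/andP; split; apply/dvdzP;
    [exists (- a1); rewrite b1E; ring|exists (- a2); rewrite b2E; ring].
move: pb; rewrite /primitive/coprimez/= => /eqP pb; rewrite pb in tb.
have : t = 1 \/ t = -1 by move: tb; rewrite dvdzE dvdn1; lia.
by case=> tE; rewrite tE in b1E b2E; [right|left];
  rewrite b1E b2E; congr pair => /=; ring.
Qed.

Lemma size_parallel (s : seq Z2) : uniq s -> (forall x, x \in s -> primitive x) ->
  (forall x y, x \in s -> y \in s -> crossz x y = 0) -> (size s <= 2)%N.
Proof.
case: s => [//|a s] us ps cs.
have sub : {subset a :: s <= [:: a; - a]}.
  move=> b bs; rewrite !inE.
  have [||->|->] := @primitive_parallel a b _ _ (cs _ _ (mem_head _ _) bs).
  - by apply: ps; exact: mem_head.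
  - exact: ps.
  - by rewrite eqxx.
  - by rewrite eqxx orbT.
exact: (uniq_leq_size us sub).
Qed.

(** In [2 * A + 2] one unit pays for counting both ends of an interval of integers, the other for
    rounding [- A] downwards. *)
Lemma floor_range_size (A : R) (s : seq int) : uniq s -> 0 <= A ->
  (forall x, x \in s -> exists2 y : R, x = Num.floor y & `|y| <= A) ->
  (size s)%:R <= 2 * A + 2.
Proof.
move=> us A0 h.
have := @uniq_int_size s (Num.floor (- A)) (Num.floor A) us.
have le1 : Num.floor (- A) <= Num.floor A by apply: le_floor; lra.
move=> /(_ _)/wrap[|hs].
  by move=> x xs; have [y -> /ler_normlP[y1 y2]] := h _ xs; rewrite !le_floor//; lra.
have : ((size s)%:Z)%:~R <= (Num.floor A - Num.floor (- A) + 1)%:~R :> R.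
  by rewrite ler_int; lia.
rewrite rmorphD rmorphB/= -pmulrn => /le_trans; apply.
have := floor_le A; have := floorD1_gt (- A).
rewrite intrD; lra.
Qed.

Section chart.
Variables (P : seq Z2) (p q : Z2 -> int) (L : int) (Pm Q : R).
Hypotheses (uP : uniq P) (prP : forall x, x \in P -> primitive x).
Hypotheses (L0 : 0 < L) (Q0 : 0 < Q) (Pm0 : 0 < Pm).
Hypothesis pq : forall x y, `|p x * q y - p y * q x| = `|crossz x y| * L.
Hypothesis q0 : forall x, x \in P -> q x != 0.
Hypothesis qQ : forall x, x \in P -> `|(q x)%:~R| <= Q.
Hypothesis pP : forall x, x \in P -> `|(p x)%:~R| * Q <= Pm * `|(q x)%:~R|.

Let slope x : R := (p x)%:~R / (q x)%:~R.

(** Separation as for Farey fractions: the difference of two slopes has numerator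
    [p x * q y - p y * q x], at least [L] in size unless the vectors are parallel, and denominator
    at most [Q ^+ 2]. *)
Let slope_sep x y : x \in P -> y \in P -> `|slope x - slope y| < L%:~R / Q ^+ 2 ->
  crossz x y = 0.
Proof.
move=> xP yP h; apply/eqP; apply: contraTT h => c0; rewrite -leNgt.
have qx0 : (q x)%:~R != 0 :> R by rewrite intr_eq0 q0.
have qy0 : (q y)%:~R != 0 :> R by rewrite intr_eq0 q0.
have -> : slope x - slope y = (p x * q y - p y * q x)%:~R / ((q x)%:~R * (q y)%:~R).
  by rewrite /slope rmorphB !rmorphM/=; field; rewrite qx0 qy0.
rewrite normrM normfV normrM -intr_norm pq.
apply: ler_pM; rewrite ?invr_ge0 ?exprn_ge0 ?ler0z ?(ltW L0) ?(ltW Q0)//.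
  by rewrite ler_int ler_peMl ?(ltW L0)//; lia.
rewrite lef_pV2 ?posrE ?exprn_gt0 ?mulr_gt0 ?normr_gt0// expr2.
by apply: ler_pM => //; exact: qQ.
Qed.

(** The slopes lie in [[- Pm / Q, Pm / Q]]. Cut into intervals of length [L / Q ^+ 2], at most
    [2 Pm Q / L + 2] of them are met, and each contains the slopes of at most two vectors, which are
    parallel and hence opposite. *)
Lemma size_chart : (size P)%:R <= 4 * (Pm * Q / L%:~R) + 4.
Proof.
have L0R : 0 < L%:~R :> R by rewrite ltr0z.
pose phi x := Num.floor (slope x * (Q ^+ 2 / L%:~R)).
have K0 : 0 < Q ^+ 2 / L%:~R by rewrite divr_gt0 ?exprn_gt0.
have : \sum_(x <- P) (1 : R) <= \sum_(j <- undup (map phi P)) 2 * 1.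
  apply: (sum_fibers_le (phi := phi) (h := fun=> 1) (c := fun=> 2)) => // j _.
  rewrite ler_nat size_parallel ?filter_uniq//.
    by move=> x; rewrite mem_filter => /andP[_]; exact: prP.
  move=> x y; rewrite !mem_filter => /andP[/eqP xj xP] /andP[/eqP yj yP].
  apply: slope_sep => //.
  rewrite -(ltr_pM2r K0) (_ : L%:~R / Q ^+ 2 * _ = 1); last first.
    by field; rewrite !gt_eqF.
  rewrite -[X in _ * X < _](gtr0_norm K0) -normrM mulrBl.
  move: xj yj; rewrite /phi; set a := _ * _; set b := slope y * _ => aj bj.
  have := floor_le a; have := floorD1_gt a.
  have := floor_le b; have := floorD1_gt b.
  by rewrite aj bj intrD ltr_norml; move: (j%:~R) => jr; lra.
rewrite !big_const_seq !count_predT !iter_addr_0 mulr1 => /le_trans; apply.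
set U := undup _.
have : (size U)%:R <= 2 * (Pm * Q / L%:~R) + 2.
  apply: floor_range_size; rewrite ?undup_uniq//.
    by rewrite divr_ge0 ?mulr_ge0// ltW.
  move=> x; rewrite mem_undup => /mapP[y yP ->].
  exists (slope y * (Q ^+ 2 / L%:~R)) => //.
  rewrite normrM (gtr0_norm K0) normrM normfV.
  have qy0 : 0 < `|(q y)%:~R| :> R by rewrite normr_gt0 intr_eq0 q0.
  have := pP yP; rewrite -ler_pdivlMr// => h.
  rewrite [leRHS](_ : _ = Pm / Q * (Q ^+ 2 / L%:~R)); last by field; rewrite !gt_eqF.
  by rewrite ler_pM2r// ler_pdivrMr// mulrAC.
by rewrite -mulr_natl; lra.
Qed.

End chart.

(** The coordinates [dotz x l] and [crossz x l] have determinant [|l|^2], so [M * C / |l|^2] is the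
    area of the box up to a constant. For primitive vectors counting slopes is enough. Two charts
    are used, with slope dot over cross or cross over dot, according to which coordinate is larger
    relative to its bound; this keeps the slope bounded and its denominator nonzero. *)
Lemma size_primitive_box (l : Z2) (M C : R) (P : seq Z2) : l != 0 -> 0 < M -> 0 < C ->
  uniq P -> (forall x, x \in P -> primitive x) ->
  (forall x, x \in P -> `|(dotz x l)%:~R| <= M) ->
  (forall x, x \in P -> `|(crossz x l)%:~R| <= C) ->
  (size P)%:R <= 8 * (M * C / (dotz l l)%:~R) + 8.
Proof.
move=> l0 M0 C0 uP prP hM hC.
have L0 := dotz_gt0 l0.
pose b x : bool := `|(dotz x l)%:~R| * C <= M * `|(crossz x l)%:~R|.
have nz x : x \in P -> (dotz x l != 0) || (crossz x l != 0).
  move=> /prP/primitive_neq0/dotz_gt0 x1; have := dotz_crossz_sqr x l.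
  by rewrite -negb_and; apply: contra_eqN => /andP[/eqP -> /eqP ->]; nia.
have cr x y : `|dotz x l * crossz y l - dotz y l * crossz x l| = `|crossz x y| * dotz l l.
  by rewrite -[in RHS](ger0_norm (dotz_ge0 l)) -normrM -normrN; congr `|_|;
    rewrite /dotz/crossz; ring.
have h1 : (size [seq x <- P | b x])%:R <= 4 * (M * C / (dotz l l)%:~R) + 4.
  apply: (@size_chart _ (dotz^~ l) (crossz^~ l)) => //; first exact: filter_uniq.
  - by move=> x; rewrite mem_filter => /andP[_ /prP].
  - move=> x; rewrite mem_filter => /andP[bx xP]; apply: contraTneq bx => c0.
    have := nz _ xP; rewrite c0 eqxx orbF /b c0 normr0 mulr0 -ltNge => d0.
    by rewrite mulr_gt0// normr_gt0 intr_eq0.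
  - by move=> x; rewrite mem_filter => /andP[_ /hC].
  - by move=> x; rewrite mem_filter => /andP[].
have h2 : (size [seq x <- P | ~~ b x])%:R <= 4 * (C * M / (dotz l l)%:~R) + 4.
  apply: (@size_chart _ (crossz^~ l) (dotz^~ l)) => //; first exact: filter_uniq.
  - by move=> x; rewrite mem_filter => /andP[_ /prP].
  - by move=> x y; rewrite -cr -normrN; congr `|_|; ring.
  - move=> x; rewrite mem_filter => /andP[bx xP]; apply: contraNneq bx => c0.
    by rewrite /b c0 normr0 mul0r mulr_ge0// ltW.
  - by move=> x; rewrite mem_filter => /andP[_ /hM].
  - move=> x; rewrite mem_filter => /andP[]; rewrite /b -ltNge => /ltW.
    by rewrite (mulrC M) (mulrC _ C).
have -> : size P = (size [seq x <- P | b x] + size [seq x <- P | ~~ b x])%N.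
  by rewrite !size_filter count_predC.
by rewrite natrD (mulrC C M) in h2 *; lra.
Qed.

End primitive_count.

(** * Geometric and power series with explicit bounds *)

Section sums.
Context {R : realType}.

Lemma geometric_le (q : R) (s : seq nat) : 0 <= q -> q < 1 -> uniq s ->
  \sum_(i <- s) q ^+ i <= (1 - q)^-1.
Proof.
move=> q0 q1 us.
pose N := (\max_(i <- s) i).+1.
apply: (@le_trans _ _ (\sum_(i <- iota 0 N) q ^+ i)).
  apply: ler_sum_subset => //; first exact: iota_uniq.
    by move=> i si; rewrite mem_iota add0n ltnS/= leq_bigmax_seq.
  by move=> i _; exact: exprn_ge0.
have -> : iota 0 N = index_iota 0 N by rewrite /index_iota subn0.
rewrite big_mkord -[leRHS]mul1r ler_pdivlMr; last by lra.
have := subrX1 q N; have := exprn_ge0 N q0.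
by move: (\sum_(_ < _) _) => S; nra.
Qed.

Variable eta : R.
Hypothesis eta0 : 0 < eta.

Let c := (2 + eta) / eta.

(** A power as a telescoping difference. With [x = 1 / p] the claim reads
    [x <= c (1 - (1 + x)^(-eta))]; it follows from [ln (1 + x) >= x / 2] for [x <= 1] and
    [1 - exp (- y) >= y / (1 + y)], and [c] is what these two losses cost. *)
Let tele (p : R) : 1 <= p ->
  p `^ (- (1 + eta)) <= c * (p `^ (- eta) - (p + 1) `^ (- eta)).
Proof.
move=> p1; have p0 : 0 < p by lra.
have -> : p + 1 = p * (1 + p^-1) by field; rewrite gt_eqF.
have x0 : 0 < p^-1 by rewrite invr_gt0.
have xle1 : p^-1 <= 1 by rewrite invf_le1.
rewrite powRM ?(ltW p0)//; last by lra.
rewrite -[X in X - _]mulr1 -mulrBr opprD powRD; last by apply/implyP => _; rewrite gt_eqF.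
rewrite powR_inv1 ?(ltW p0)// mulrC mulrCA ler_pM2l ?powR_gt0//.
move: (p^-1) x0 xle1 => x x0 xle1 {p p1 p0}.
have ln0 : x / (1 + x) <= ln (1 + x).
  have /le_ln1Dx : -1 < - (x / (1 + x)) by rewrite ltrN2 ltr_pdivrMr; lra.
  rewrite (_ : 1 + - _ = (1 + x)^-1); last by field; rewrite gt_eqF//; lra.
  by rewrite lnV ?lerN2 ?posrE; lra.
have x2 : x / 2 <= ln (1 + x).
  by apply: le_trans ln0; rewrite ler_pM2l// lef_pV2 ?posrE; lra.
rewrite /powR gt_eqF; last by lra.
rewrite mulNr expRN; set y := eta * ln (1 + x).
have y0 : eta * x / 2 <= y by rewrite /y -mulrA ler_pM2l.
have yy : 0 < y by apply: lt_le_trans y0; rewrite divr_gt0 ?mulr_gt0.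
have e1 : (expR y)^-1 <= (1 + y)^-1.
  by rewrite lef_pV2 ?posrE ?expR_gt0 ?expR_ge1Dx//; lra.
apply: (@le_trans _ _ (c * (1 - (1 + y)^-1))); last first.
  by rewrite ler_pM2l ?divr_gt0 ?addr_gt0// lerD2l lerN2.
rewrite /c (_ : _ * (1 - _) = (2 + eta) * y / (eta * (1 + y))); last first.
  by field; rewrite !gt_eqF//; lra.
have h : eta * y * x <= eta * y.
  by apply: ler_piMr => //; apply: mulr_ge0; exact: ltW.
rewrite ler_pdivlMr ?mulr_gt0//; last by lra.
have -> : x * (eta * (1 + y)) = eta * x + eta * y * x by ring.
by rewrite mulrDl; lra.
Qed.

Definition pseries_bound := c.

Lemma pseries_bound_ge0 : 0 <= pseries_bound.
Proof. by rewrite divr_ge0// ltW// addr_gt0. Qed.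

Lemma pseries_le (s : seq nat) : uniq s ->
  \sum_(i <- s) (i.+1%:R : R) `^ (- (1 + eta)) <= pseries_bound.
Proof.
move=> us; pose N := (\max_(i <- s) i).+1.
apply: (@le_trans _ _ (\sum_(i <- iota 0 N) (i.+1%:R : R) `^ (- (1 + eta)))).
  apply: ler_sum_subset => //; first exact: iota_uniq.
  by move=> i si; rewrite mem_iota add0n ltnS/= leq_bigmax_seq.
have -> : iota 0 N = index_iota 0 N by rewrite /index_iota subn0.
rewrite big_mkord.
apply: (@le_trans _ _ (c * (1 - (N.+1%:R : R) `^ (- eta)))); last first.
  by apply: ler_piMr; [exact: pseries_bound_ge0 | rewrite gerBl powR_ge0].
elim: N => [|n ih]; first by rewrite big_ord0 powR1 subrr mulr0.
rewrite big_ord_recr/=; apply: le_trans (lerD ih (tele _)) _; first by rewrite ler1n.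
by rewrite natr1 -mulrDr addrA subrK.
Qed.

(** The shift by 1 makes the weight finite at 0, so that sums over all integers need no case
    distinction; [ipow_nz] undoes it away from 0. *)
Definition ipow (p : int) : R := (`|p|%:~R + 1) `^ (- (1 + eta)).

Lemma sum_ipow_le (s : seq int) : uniq s ->
  \sum_(p <- s) ipow p <= 2 * pseries_bound.
Proof.
move=> us; apply: (@le_trans _ _ (\sum_(i <- undup (map absz s))
    2 * (i.+1%:R : R) `^ (- (1 + eta)))).
  apply: (sum_fibers_le (phi := absz) (c := fun=> 2)
      (h := fun i => (i.+1%:R : R) `^ (- (1 + eta)))) => [x _|j|j _].
  - by rewrite /ipow -abszE -natr1.
  - exact: powR_ge0.
  - rewrite ler_nat; apply: (@uniq_leq_size _ _ [:: j%:Z; - j%:Z]).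
      exact: filter_uniq.
    by move=> x; rewrite mem_filter !inE => /andP[/eqP <- _]; lia.
by rewrite -mulr_sumr ler_pM2l// pseries_le// undup_uniq.
Qed.

Lemma sum_ipow_inj_le (I : eqType) (s : seq I) (phi : I -> int) : uniq s ->
  {in s &, injective phi} -> \sum_(x <- s) ipow (phi x) <= 2 * pseries_bound.
Proof.
move=> us inj; rewrite -(big_map phi xpredT ipow) sum_ipow_le//.
by rewrite map_inj_in_uniq.
Qed.

Lemma ipow_nz (m : int) : m != 0 ->
  `|m|%:~R `^ (- (1 + eta)) <= 2 `^ (1 + eta) * ipow m.
Proof.
move=> m0; have m1 : 1 <= `|m|%:~R :> R by rewrite -[1]/(1%:~R) ler_int; lia.
rewrite /ipow; move: (`|m|%:~R) m1 => a a1; rewrite /ipow !powRN.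
have a0 : 0 < a by lra.
have p1 : 0 < (a + 1) `^ (1 + eta) by rewrite powR_gt0 ?addr_gt0.
have p2 : 0 < a `^ (1 + eta) by rewrite powR_gt0.
rewrite ler_pdivlMr// ler_pdivrMl// mulrC -powRM ?(ltW a0)//.
apply: ge0_ler_powR; rewrite ?nnegrE; [by rewrite addr_ge0// ltW|lra..].
Qed.

End sums.

Section dyadic.
Context {R : realType}.

Lemma powR_antitone (a x y : R) : 0 <= a -> 0 < x -> x <= y -> y `^ (- a) <= x `^ (- a).
Proof.
move=> a0 x0 xy; have y0 : 0 < y by exact: lt_le_trans xy.
rewrite !powRN lef_pV2 ?posrE ?powR_gt0//.
by apply: ge0_ler_powR => //; rewrite nnegrE ltW.
Qed.

Lemma powR2N_lt1 (a : R) : 0 < a -> 2 `^ (- a) < 1.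
Proof.
move=> a0; rewrite powRN invf_lt1 ?powR_gt0//.
by have := @gt0_ltr_powR R a a0 1 2; rewrite !nnegrE powR1 => /(_ _ _ _)->//; lra.
Qed.

Lemma powR_exp (x a : R) (i : nat) : 0 <= x -> (x ^+ i) `^ a = (x `^ a) ^+ i.
Proof. by move=> x0; rewrite -(powR_mulrn _ x0) -(powR_mulrn _ (powR_ge0 _ _)) powRAC. Qed.

(** On the level [2^i <= mu x < 2^(i+1)] a summand is at most [2^(- a i)]; with at most [K r^i]
    points per level a geometric series of ratio [r 2^(- a)] is left. *)
Lemma dyadic_sum_le (I : eqType) (s : seq I) (mu : I -> nat) (a K r : R) :
  0 <= a -> 0 <= K -> 0 <= r -> r * 2 `^ (- a) < 1 ->
  (forall x, x \in s -> 0 < mu x)%N ->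
  (forall i, (size [seq x <- s | trunc_log 2 (mu x) == i])%:R <= K * r ^+ i) ->
  \sum_(x <- s) (mu x)%:R `^ (- a) <= K / (1 - r * 2 `^ (- a)).
Proof.
move=> a0 K0 r0 q1 mu0 hs; set q := r * _ in q1 *.
apply: (@le_trans _ _ (\sum_(i <- undup (map (fun x => trunc_log 2 (mu x)) s))
    K * r ^+ i * (2 `^ (- a)) ^+ i)).
  apply: (sum_fibers_le (phi := fun x => trunc_log 2 (mu x)) (c := fun i => K * r ^+ i)
      (h := fun i => (2 `^ (- a)) ^+ i)) => [x xs|i|i _]; last exact: hs.
  - rewrite -powR_exp//; apply: powR_antitone => //.
    by rewrite -natrX ler_nat trunc_logP//; exact: mu0.
  - by rewrite exprn_ge0// powR_ge0.
under eq_bigr do rewrite -mulrA -exprMn.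
rewrite -mulr_sumr ler_wpM2l// geometric_le ?undup_uniq//.
by rewrite mulr_ge0 ?powR_ge0.
Qed.

End dyadic.

(** * Sums over primitive vectors [x] of negative powers of [x . l] *)

Section primitive_sums.
Context {R : realType}.

Lemma intr_absz_norm (m : int) : `|m%:~R| = (absz m)%:R :> R.
Proof. by rewrite -intr_norm -abszE. Qed.

Lemma sqr_norm_le (a b : R) : 0 <= b -> a ^+ 2 <= b ^+ 2 -> `|a| <= b.
Proof. by move=> b0 h; rewrite -(ger0_norm b0) -ler_sqr ?nnegrE// !real_normK ?num_real. Qed.

Section fix_l.
Variables (l : Z2) (P : seq Z2).
Hypotheses (l0 : l != 0) (uP : uniq P) (prP : forall x, x \in P -> primitive x).

Let L : R := (dotz l l)%:~R.

Let L0 : 0 < L. Proof. by rewrite ltr0z; have := dotz_gt0 l0; lia. Qed.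

Let crossE x : (crossz x l)%:~R ^+ 2 = (dotz x x)%:~R * L - (dotz x l)%:~R ^+ 2 :> R.
Proof.
rewrite /L -intrM -dotz_crossz_sqr; move: (crossz _ _) (dotz x l) => a b; ring.
Qed.

Let tlog x := trunc_log 2 (absz (dotz x l)).

(** The vectors of level [i] lie in the box [|x . l| <= 2^(i+1)], [|crossz x l| <= C], because
    [|crossz x l| <= |x| |l|]. The bound on [|x| |l|] is required only from level [i] on, which
    allows [C] to shrink with [i] in [sum_primitive_thin]. *)
Let fiber_bound (i : nat) (C : R) : 0 < C ->
  (forall x, x \in P -> dotz x l != 0) ->
  (forall x, x \in P -> (2 ^ i <= absz (dotz x l))%N -> (dotz x x)%:~R * L <= C ^+ 2) ->
  (size [seq x <- P | tlog x == i])%:R <= 16 * 2 ^+ i * (C / L) + 8.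
Proof.
move=> C0 nz hC.
rewrite (_ : 16 * _ * _ = 8 * (2 ^+ i.+1 * C / L)); last by rewrite exprS; ring.
apply: size_primitive_box; rewrite ?exprn_gt0 ?filter_uniq// => x;
  rewrite mem_filter => /andP[/eqP xi xP].
- exact: prP.
- rewrite intr_absz_norm -natrX ler_nat -xi ltnW// trunc_log_ltn//.
- apply: sqr_norm_le; first exact: ltW.
  rewrite crossE; apply: (@le_trans _ _ ((dotz x x)%:~R * L)).
    by rewrite gerBl sqr_ge0.
  apply: hC => //; rewrite -xi trunc_logP//.
  by have := nz _ xP; lia.
Qed.

(** With [C = L] level [i] has at most [16 * 2^i + 8 <= 24 * 2^i] vectors, and the levels contribute
    a geometric series of ratio [2^(- eta)]. *)
Lemma sum_primitive_short (eta : R) : 0 < eta ->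
  (forall x, x \in P -> dotz x l != 0) ->
  (forall x, x \in P -> dotz x x <= dotz l l) ->
  \sum_(x <- P) `|(dotz x l)%:~R| `^ (- (1 + eta)) <= 24 / (1 - 2 `^ (- eta)) :> R.
Proof.
move=> eta0 nz hP; under eq_bigr do rewrite intr_absz_norm.
have e : 2 * 2 `^ (- (1 + eta)) = 2 `^ (- eta) :> R.
  by rewrite -[X in X * _]powRr1// -powRD ?pnatr_eq0 ?implybT//; congr (_ `^ _); ring.
rewrite -e; apply: dyadic_sum_le => //.
- by rewrite addr_ge0// ltW.
- by rewrite e powR2N_lt1.
- by move=> x /nz; rewrite absz_gt0.
move=> i; apply: le_trans (@fiber_bound i L L0 nz _) _.
  by move=> x xP _; rewrite expr2 ler_pM2r// ler_int hP.
rewrite divff ?gt_eqF// mulr1.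
by have : 1 <= 2 ^+ i :> R by [rewrite exprn_ege1// ler1n]; lra.
Qed.

(** On level [i] the hypothesis gives [|x|^2 |l|^2 <= |l|^4 / 2^i], so the box narrows to
    [C = L / 2^(i/2)] and at most [24 * 2^(i/2)] vectors are left. Against the weight
    [2^(- 3 i / 4)] the ratio is [2^(- 1/4)]. *)
Lemma sum_primitive_thin :
  (forall x, x \in P -> dotz x l != 0) ->
  (forall x, x \in P -> `|dotz x l| * dotz x x <= dotz l l) ->
  \sum_(x <- P) `|(dotz x l)%:~R| `^ (- (3 / 4)) <= 24 / (1 - 2 `^ (- (1 / 4))) :> R.
Proof.
move=> nz hP; under eq_bigr do rewrite intr_absz_norm.
pose r : R := 2 `^ (1 / 2).
have e : r * 2 `^ (- (3 / 4)) = 2 `^ (- (1 / 4)) :> R.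
  by rewrite /r -powRD ?pnatr_eq0 ?implybT//; congr (_ `^ _); lra.
have r1 : 1 <= r by rewrite -(powRr0 2); apply: ler_powR; lra.
have r2 : r ^+ 2 = 2 by rewrite -powR_mulrn ?powR_ge0// -powRrM mulfVK// powRr1.
have r0 : 0 < r by lra.
rewrite -e; apply: dyadic_sum_le => //.
- exact: ltW.
- by rewrite e powR2N_lt1.
- by move=> x /nz; rewrite absz_gt0.
move=> i; have ri0 : 0 < r ^+ i by rewrite exprn_gt0.
apply: le_trans (@fiber_bound i (L / r ^+ i) _ nz _) _; first by rewrite divr_gt0.
  move=> x xP hx; rewrite expr_div_n -exprM mulnC exprM r2 expr2 -mulrA (mulrC L).
  rewrite -ler_pdivrMr// mulfK ?gt_eqF// -[leRHS]mulrC ler_pdivlMl ?exprn_gt0//.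
  apply: (@le_trans _ _ (`|dotz x l| * dotz x x)%:~R); last by rewrite ler_int hP.
  rewrite rmorphM/= ler_wpM2r ?ler0z ?dotz_ge0//.
  by rewrite intr_norm intr_absz_norm -natrX ler_nat.
have -> : 16 * 2 ^+ i * (L / r ^+ i / L) = 16 * r ^+ i.
  rewrite -r2 -exprM mulnC exprM (expr2 (r ^+ i)); field.
  by rewrite !gt_eqF.
by have : 1 <= r ^+ i :> R by [rewrite exprn_ege1]; lra.
Qed.

End fix_l.

Lemma size_primitive_orth (l : Z2) (P : seq Z2) : l != 0 -> uniq P ->
  (forall x, x \in P -> primitive x) -> (forall x, x \in P -> dotz x l = 0) ->
  (size P <= 2)%N.
Proof.
move=> l0 uP prP h; apply: size_parallel => // x y xP yP.
have := dotz_gt0 l0; have : crossz x y * dotz l l = dotz y l * crossz x l - dotz x l * crossz y l.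
  by rewrite /crossz/dotz; ring.
rewrite (h _ xP) (h _ yP); nia.
Qed.

End primitive_sums.

(** * A frequency as a gcd times a primitive direction *)

Section gcd_decomposition.

Definition gz (n : Z2) : int := gcdz n.1 n.2.
Definition om (n : Z2) : Z2 := ((n.1 %/ gz n)%Z, (n.2 %/ gz n)%Z).

Variable n : Z2.
Hypothesis n0 : n != 0.

Lemma gz_ge1 : 1 <= gz n.
Proof.
have : gz n != 0 by rewrite /gz gcdz_eq0; apply: contra n0; case: n => a b /= /andP[/eqP-> /eqP->].
by have : 0 <= gz n by []; lia.
Qed.

Lemma gz_om : n = (gz n * (om n).1, gz n * (om n).2).
Proof.
by case: n => a b; rewrite /om /gz/=; congr pair; rewrite mulrC divzK// ?dvdz_gcdl ?dvdz_gcdr.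
Qed.

Lemma om_primitive : primitive (om n).
Proof.
rewrite /primitive /coprimez; apply/eqP/(@mulfI _ (gz n)); first by have := gz_ge1; lia.
have g0 : 0 <= gz n by [].
rewrite mulr1 -[X in X * gcdz _ _](ger0_norm g0) mulz_gcdr.
by have [<- <-] : n.1 = gz n * (om n).1 /\ n.2 = gz n * (om n).2 by split; rewrite {1}gz_om.
Qed.

End gcd_decomposition.

Lemma dotz_om n l : n != 0 -> dotz n l = gz n * dotz (om n) l.
Proof. by move=> n0; rewrite {1}(gz_om n) /dotz/=; ring. Qed.

(** * Sums of powers of [n . l] in one of the two variables *)

Section counting_sums.
Context {R : realType}.
Variable eta : R.
Hypothesis eta0 : 0 < eta.

Let e1 : 0 <= 1 + eta. Proof. by rewrite addr_ge0// ltW. Qed.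

(** As [|l| <= |om n|], each line [om n . l = m] carries at most [2 * 1 + 1] points, and
    [|n . l| >= |m|] because the gcd of [n] is at least 1; the series in [m] is left. *)
Lemma sum_dotz_left_le (n : Z2) (S : seq Z2) : n != 0 -> uniq S ->
  (forall l, l \in S -> dotz n l != 0) ->
  (forall l, l \in S -> dotz l l <= dotz (om n) (om n)) ->
  \sum_(l <- S) `|(dotz n l)%:~R| `^ (- (1 + eta)) <=
    3 * (2 `^ (1 + eta) * (2 * pseries_bound eta)) :> R.
Proof.
move=> n0 uS nz hS; have pn := om_primitive n0.
apply: (@le_trans _ _ (\sum_(m <- undup (map (dotz (om n)) S))
   3 * (2 `^ (1 + eta) * ipow eta m))).
  apply: (sum_fibers_le (phi := dotz (om n)) (c := fun=> 3)
    (h := fun m => 2 `^ (1 + eta) * ipow eta m)) => [l lS|m|m _].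
  - have := nz _ lS; rewrite dotz_om// mulf_eq0 negb_or => /andP[g0 m0].
    apply: le_trans (ipow_nz eta0 m0); apply: powR_antitone => //.
      by rewrite ltr0z; lia.
    rewrite intr_norm -!intr_norm ler_int normrM.
    by have := gz_ge1 n0; nia.
  - by rewrite mulr_ge0 ?powR_ge0.
  - rewrite ler_nat; apply: (@size_line (om n) m 1) => //.
    + exact: filter_uniq.
    + by move=> l; rewrite mem_filter => /andP[/eqP].
    + by move=> l; rewrite mem_filter expr1n mul1r => /andP[_]; exact: hS.
by rewrite -!mulr_sumr !ler_pM2l ?powR_gt0// sum_ipow_le// undup_uniq.
Qed.

(** The vectors [n] are sorted by their gcd, whose power splits off. Among vectors of equal gcd the
    direction determines [n], so that [sum_primitive_short] applies to the directions, and the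
    series over the gcd is left. *)
Lemma sum_dotz_right_le (l : Z2) (S : seq Z2) : l != 0 -> uniq S ->
  (forall n, n \in S -> n != 0) ->
  (forall n, n \in S -> dotz n l != 0) ->
  (forall n, n \in S -> dotz (om n) (om n) <= dotz l l) ->
  \sum_(n <- S) `|(dotz n l)%:~R| `^ (- (1 + eta)) <=
    (24 / (1 - 2 `^ (- eta))) * pseries_bound eta :> R.
Proof.
move=> l0 uS n0 nz hS.
pose g n := (absz (gz n)).-1.
have gE n : n \in S -> gz n = (g n).+1%:Z.
  by move=> /n0/gz_ge1; rewrite /g; lia.
rewrite (partition_big_undup S g).
apply: (@le_trans _ _ (\sum_(i <- undup (map g S))
   (24 / (1 - 2 `^ (- eta))) * i.+1%:R `^ (- (1 + eta)))).
  apply: ler_sum => i _; rewrite -big_filter.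
  set Si := [seq n <- S | g n == i].
  have SiS n : n \in Si -> n \in S /\ gz n = i.+1.
    by rewrite mem_filter => /andP[/eqP gi nS]; rewrite -gi; split => //; exact: gE.
  rewrite big_seq (eq_bigr (fun n => i.+1%:R `^ (- (1 + eta)) *
     `|(dotz (om n) l)%:~R| `^ (- (1 + eta)))); last first.
    move=> n /SiS[nS gn]; rewrite dotz_om ?n0// gn intrM normrM powRM//.
    by rewrite ger0_norm.
  rewrite -big_seq -mulr_sumr mulrC ler_pM2r ?powR_gt0//.
  rewrite -(big_map om xpredT (fun x => `|(dotz x l)%:~R| `^ (- (1 + eta)))).
  apply: sum_primitive_short => //.
  - rewrite map_inj_in_uniq ?filter_uniq// => x y /SiS[xS gx] /SiS[yS gy] xy.
    by rewrite (gz_om x) (gz_om y) xy gx gy.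
  - by move=> _ /mapP[n /SiS[nS _] ->]; exact/om_primitive/n0.
  - move=> _ /mapP[n /SiS[nS _] ->]; have := nz _ nS; rewrite dotz_om ?n0//.
    by rewrite mulf_eq0 negb_or => /andP[].
  - by move=> _ /mapP[n /SiS[nS _] ->]; exact: hS.
rewrite -mulr_sumr ler_wpM2l ?pseries_le ?undup_uniq//.
by rewrite divr_ge0// subr_ge0 ltW// powR2N_lt1.
Qed.

End counting_sums.

Section thin_sum.
Context {R : realType}.

(** Up to a constant, the square of the output weight [<x>^(-3/8)] where [|x| >= |m| / 2]. At
    [m = 0] the modulation gives nothing; the value 1 is affordable because at most two primitive
    vectors are orthogonal to a given [l], which is the 2 in [thin_bound]. *)
Definition thin_weight (m : int) : R := if m == 0 then 1 else `|m%:~R| `^ (- (3 / 4)).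

Lemma thin_weight_ge0 m : 0 <= thin_weight m.
Proof. by rewrite /thin_weight; case: ifP => // _; exact: powR_ge0. Qed.

Definition thin_bound : R := 2 + 24 / (1 - 2 `^ (- (1 / 4))).

Lemma thin_bound_ge0 : 0 <= thin_bound.
Proof. by rewrite addr_ge0// divr_ge0// subr_ge0 ltW// powR2N_lt1//; lra. Qed.

Lemma sum_thin_le (l : Z2) (P : seq Z2) : l != 0 -> uniq P ->
  (forall x, x \in P -> primitive x) ->
  (forall x, x \in P -> `|dotz x l| * dotz x x <= dotz l l) ->
  \sum_(x <- P) thin_weight (dotz x l) <= thin_bound.
Proof.
move=> l0 uP pP hP; rewrite (bigID (fun x => dotz x l == 0))/=; apply: lerD.
  rewrite (eq_bigr (fun=> 1)); last by move=> x; rewrite /thin_weight => ->.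
  rewrite -big_filter big_const_seq count_predT iter_addr_0 ler_nat.
  apply: (size_primitive_orth l0); first exact: filter_uniq.
    by move=> x; rewrite mem_filter => /andP[_ /pP].
  by move=> x; rewrite mem_filter => /andP[/eqP].
rewrite (eq_bigr (fun x => `|(dotz x l)%:~R| `^ (- (3 / 4)))); last first.
  by move=> x /negbTE; rewrite /thin_weight => ->.
rewrite -big_filter; apply: sum_primitive_thin => //; first exact: filter_uniq.
- by move=> x; rewrite mem_filter => /andP[_ /pP].
- by move=> x; rewrite mem_filter => /andP[].
- by move=> x; rewrite mem_filter => /andP[_ /hP].
Qed.

End thin_sum.

(** * Integrals of nonnegative functions *)

Section nonneg_integrals.
Context d (T : measurableType d) (R : realType) (mu : {measure set T -> \bar R}).
Implicit Types f g : T -> R.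
Local Open Scope ereal_scope.

(** Measurability and sign in one hypothesis: together they give linearity, monotonicity and Tonelli
    for integrals that may be infinite. *)
Definition nnm f := measurable_fun setT f /\ forall x, (0 <= f x)%R.

Lemma nnmE f : nnm f -> measurable_fun setT (EFin \o f).
Proof. by case=> mf _; exact/measurable_EFinP. Qed.

Lemma nnm_ge0 f x : nnm f -> 0 <= (f x)%:E. Proof. by case=> _; rewrite lee_fin. Qed.

Lemma nnmD f g : nnm f -> nnm g -> nnm (fun x => f x + g x)%R.
Proof. by case=> mf f0 [mg g0]; split=> [|x]; [exact: measurable_funD|exact: addr_ge0]. Qed.

Lemma nnmM f g : nnm f -> nnm g -> nnm (fun x => f x * g x)%R.
Proof. by case=> mf f0 [mg g0]; split=> [|x]; [exact: measurable_funM|exact: mulr_ge0]. Qed.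

Lemma nnmX f n : nnm f -> nnm (fun x => f x ^+ n)%R.
Proof. by case=> mf f0; split=> [|x]; [exact: measurable_funX|exact: exprn_ge0]. Qed.

Lemma nnm_cst (k : R) : (0 <= k)%R -> nnm (fun=> k).
Proof. by move=> k0; split => // ?; exact: measurable_cst. Qed.

Lemma nnm_sum (I : Type) (s : seq I) (p : pred I) (F : I -> T -> R) :
  (forall i, nnm (F i)) -> nnm (fun x => \sum_(i <- s | p i) F i x)%R.
Proof.
move=> hF; split=> [|x]; last by apply: sumr_ge0 => i _; case: (hF i).
elim: s => [|i s ih].
  by under eq_fun do rewrite big_nil; exact: measurable_cst.
under eq_fun do rewrite big_cons.
by case: (p i) => //; apply: measurable_funD => //; case: (hF i).
Qed.

Lemma nnm_indic (A : set T) : measurable A -> nnm (\1_A : T -> R).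
Proof. by move=> mA; split => //; exact: measurable_indic. Qed.

Lemma nn_le f g : nnm f -> nnm g -> (forall x, f x <= g x)%R ->
  \int[mu]_x (f x)%:E <= \int[mu]_x (g x)%:E.
Proof.
move=> nf ng fg; apply: ge0_le_integral => //.
- by move=> x _; exact: nnm_ge0.
- exact: nnmE.
- exact: nnmE.
- by move=> x _; rewrite lee_fin.
Qed.

Lemma nn_ge0 f : nnm f -> 0 <= \int[mu]_x (f x)%:E.
Proof. by move=> nf; apply: integral_ge0 => x _; exact: nnm_ge0. Qed.

Lemma nnD f g : nnm f -> nnm g ->
  \int[mu]_x (f x + g x)%:E = \int[mu]_x (f x)%:E + \int[mu]_x (g x)%:E.
Proof.
move=> nf ng; under eq_integral do rewrite EFinD.
rewrite ge0_integralD//; try exact: nnmE; by move=> x _; exact: nnm_ge0.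
Qed.

Lemma nnZl (k : R) f : (0 <= k)%R -> nnm f ->
  \int[mu]_x (k * f x)%:E = k%:E * \int[mu]_x (f x)%:E.
Proof.
move=> k0 nf; under eq_integral do rewrite EFinM.
by rewrite ge0_integralZl_EFin//; [move=> x _; exact: nnm_ge0|exact: nnmE].
Qed.

Lemma nnZr (k : R) f : (0 <= k)%R -> nnm f ->
  \int[mu]_x (f x * k)%:E = \int[mu]_x (f x)%:E * k%:E.
Proof.
move=> k0 nf; rewrite muleC -nnZl//.
by apply: eq_integral => x _; rewrite mulrC.
Qed.

Lemma nn_sum (I : Type) (s : seq I) (p : pred I) (F : I -> T -> R) :
  (forall i, nnm (F i)) ->
  \int[mu]_x (\sum_(i <- s | p i) F i x)%:E = \sum_(i <- s | p i) \int[mu]_x (F i x)%:E.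
Proof.
move=> hF; elim: s => [|i s ih].
  by under eq_integral do rewrite big_nil; rewrite big_nil integral0.
rewrite big_cons; under eq_integral do rewrite big_cons.
by case: (p i) => //; rewrite -ih -nnD//; exact: nnm_sum.
Qed.

End nonneg_integrals.

Section nonneg_line.
Context {R : realType}.
Local Notation mu := (@lebesgue_measure R).
Local Notation RT := (measurableTypeR R).
Implicit Types f g : RT -> R.
Local Open Scope ereal_scope.

Lemma nnm_shift f (c : R) : nnm f -> nnm (fun x : RT => f (x + c)%R).
Proof.
case=> mf f0; split => // ; apply: (measurableT_comp mf); exact: measurable_shift.
Qed.

Lemma nnm_shiftl f (c : R) : nnm f -> nnm (fun x : RT => f (c + x)%R).
Proof.
by move=> nf; under [X in nnm X]eq_fun do rewrite addrC; exact: nnm_shift.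
Qed.

Lemma nn_shift f (c : R) : nnm f -> \int[mu]_x (f (x + c)%R)%:E = \int[mu]_x (f x)%:E.
Proof.
move=> nf; rewrite -[RHS](ge0_integral_shift c)//; first exact: nnmE.
by move=> x; exact: nnm_ge0.
Qed.

Lemma nn_shiftl f (c : R) : nnm f -> \int[mu]_x (f (c + x)%R)%:E = \int[mu]_x (f x)%:E.
Proof. by move=> nf; rewrite -[RHS](nn_shift c)//; apply: eq_integral => x _; rewrite addrC. Qed.

(** The line is folded onto [[0, 2)]: the integral becomes that of the sum over a coset of [2 Z].
    The period 2 is that of the progressions [2 (n . l)] of the resonance identity, so that one
    bound on coset sums serves for sums and for integrals. *)
Lemma integral_le_coset_sums f (K : R) : nnm f -> (0 <= K)%R ->
  (forall x (s : seq int), uniq s -> \sum_(m <- s) f (x + 2 * m%:~R) <= K)%R ->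
  \int[mu]_x (f x)%:E <= (2 * K)%:E.
Proof.
move=> nf K0 hK.
pose D (N : nat) : set RT := `[(- (2 * N%:R))%R, (2 * N%:R)%R[%classic.
have mD N : measurable (D N) by exact: measurable_itv.
have DT : setT = \bigcup_N D N.
  apply/seteqP; split => // x _; exists (`|Num.floor x|.+1)%N => //.
  rewrite /D/= in_itv/=.
  have := floor_le x; have := floorD1_gt x; rewrite intrD.
  have : ((Num.floor x)%:~R <= (`|Num.floor x|%N)%:R :> R)%R.
    by rewrite pmulrn ler_int; lia.
  have : (- (Num.floor x)%:~R <= (`|Num.floor x|%N)%:R :> R)%R.
    by rewrite pmulrn -mulrNz ler_int; lia.
  rewrite -natr1; have : (0 <= (`|Num.floor x|%N)%:R :> R)%R by [].
  lra.
have ndD : nondecreasing_seq D.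
  move=> i j ij; apply/subsetPset => x; rewrite /D/= !in_itv/= => /andP[xi xj].
  have : (i%:R <= j%:R :> R)%R by rewrite ler_nat.
  by move=> h; apply/andP; split; lra.
have lim : \int[mu]_(x in D N) (f x)%:E @[N --> \oo] --> \int[mu]_x (f x)%:E.
  rewrite [X in _ --> \int[mu]_(x in X) _]DT.
  apply: ge0_nondecreasing_set_cvg_integral => // [N|N x _]; last exact: nnm_ge0.
  by apply: measurable_funTS; exact: nnmE.
apply: cvge_le lim; apply: nearW => N.
pose I : set RT := `[0%R, 2%R[%classic.
have nI : nnm (\1_I : RT -> R) by apply: nnm_indic; exact: measurable_itv.
(* The translates of [[0, 2)] by [2 m] with [- N <= m < N] tile [D N]. *)
pose s : seq int := [seq (i%:Z - N%:Z)%R | i <- iota 0 (2 * N)].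
have us : uniq s by rewrite map_inj_uniq ?iota_uniq// => a b /=; lia.
apply: (@le_trans _ _ (\int[mu]_x (\sum_(m <- s) \1_I (x + - (2 * m%:~R)) * f x)%:E)).
  rewrite integral_mkcond.
  rewrite [leLHS](_ : _ = \int[mu]_x (\1_(D N) x * f x)%:E); last first.
    apply: eq_integral => x _; rewrite patchE indicE; case: ifPn => _; first by rewrite mul1r.
    by rewrite mul0r.
  apply: nn_le.
  - by apply: nnmM => //; exact: (nnm_indic (mD N)).
  - by apply: nnm_sum => m; apply: nnmM => //; exact: nnm_shift.
  move=> x; rewrite -mulr_suml ler_wpM2r//; first by case: nf.
  rewrite indicE; case: (boolP (x \in D N)) => [|_]; last exact: sumr_ge0.
  rewrite inE /D/= in_itv/= => /andP[x1 x2].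
  pose p := Num.floor (x / 2).
  have := floor_le (x / 2); have := floorD1_gt (x / 2); rewrite -/p intrD => p1 p2.
  have ps : p \in s.
    apply/mapP; exists (absz (p + N%:Z)%R); last first.
      rewrite gez0_abs ?addrK//.
      have : (0 <= (p + N%:Z + 1)%:~R :> R)%R by rewrite !intrD; lra.
      rewrite ler0z => h.
      have : (0 < (p + N%:Z + 1)%:~R :> R)%R by rewrite !intrD; lra.
      by rewrite ltr0z; lia.
    rewrite mem_iota /= add0n.
    have : (0 < (p + N%:Z + 1)%:~R :> R)%R by rewrite !intrD; lra.
    have : ((p - N%:Z)%:~R < 0 :> R)%R by rewrite intrB; lra.
    by rewrite ltr0z ltrz0; lia.
  rewrite (big_rem p)//= -[leLHS]addr0 lerD//; last exact: sumr_ge0.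
  by rewrite indicE mem_set// /I/= in_itv/=; apply/andP; split; lra.
rewrite nn_sum; last by move=> m; apply: nnmM => //; exact: nnm_shift.
rewrite (eq_bigr (fun m => \int[mu]_x (\1_I x * f (x + 2 * m%:~R)%R)%:E)); last first.
  move=> m _; rewrite -(nn_shift (2 * m%:~R)); last by apply: nnmM => //; exact: nnm_shift.
  by under eq_integral do rewrite addrK.
rewrite -nn_sum; last by move=> m; apply: nnmM => //; exact: nnm_shift.
apply: (@le_trans _ _ (\int[mu]_x (\1_I x * K)%:E)).
  apply: nn_le.
  - by apply: nnm_sum => m; apply: nnmM => //; exact: nnm_shift.
  - by apply: nnmM => //; exact: nnm_cst.
  by move=> x; rewrite -mulr_sumr ler_wpM2l// hK.
rewrite nnZr// integral_indic//= ?setIT//; last exact: measurable_itv.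
by rewrite lebesgue_measure_itv/= lte_fin ltr0n/= sube0 -EFinM.
Qed.

End nonneg_line.

(** * Sums and integrals of negative powers of the Japanese bracket *)

Section weights.
Context {R : realType}.
Local Notation mu := (@lebesgue_measure R).
Local Notation RT := (measurableTypeR R).
Implicit Types x y a eta : R.

Lemma japanese_ge1 y : 1 <= japanese y.
Proof. by rewrite -[leLHS]sqrtr1 ler_wsqrtr// lerDl sqr_ge0. Qed.

Lemma japanese_gt0 y : 0 < japanese y.
Proof. exact: lt_le_trans (japanese_ge1 y). Qed.

Lemma norm_le_japanese y : `|y| <= japanese y.
Proof. by rewrite -sqrtr_sqr ler_wsqrtr// lerDr. Qed.

Definition jw a : RT -> R := fun y => japanese y `^ (- a).

Lemma jw_ge0 a y : 0 <= jw a y. Proof. exact: powR_ge0. Qed.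

Lemma jwE a y : jw a y = (1 + y ^+ 2) `^ (- a / 2).
Proof.
by rewrite /jw /japanese -powR12_sqrt ?addr_ge0 ?sqr_ge0// -powRrM mulrC.
Qed.

Lemma nnm_jw a : nnm (jw a).
Proof.
split=> [|y]; last exact: jw_ge0.
rewrite (_ : jw a = fun y => (1 + y ^+ 2) `^ (- a / 2)); last exact/funext/jwE.
apply: (measurableT_comp (@measurable_powR R (- a / 2))).
by apply: measurable_funD; [exact: measurable_cst|exact: measurable_funX].
Qed.

Lemma jw_sqr a y : jw a y ^+ 2 = jw (a * 2) y.
Proof. by rewrite /jw -powR_mulrn ?powR_ge0// -powRrM mulNr. Qed.

Lemma jw_le1 a y : 0 <= a -> jw a y <= 1.
Proof.
move=> a0; rewrite /jw powRN invf_le1 ?powR_gt0 ?japanese_gt0//.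
rewrite -(powRr0 (japanese y)); apply: ler_powR => //; exact: japanese_ge1.
Qed.

Lemma jw_le_far a y (k : R) : 0 <= a -> 0 < k -> k / 2 <= `|y| ->
  jw a y <= 2 `^ a * k `^ (- a).
Proof.
move=> a0 k0 ky.
apply: (@le_trans _ _ ((k / 2) `^ (- a))).
  apply: powR_antitone => //; first by rewrite divr_gt0.
  exact: le_trans (norm_le_japanese y).
by rewrite powRM ?(ltW k0) ?invr_ge0 ?ler0n// -(@powR_inv1 _ 2)// -powRrM mulN1r opprK mulrC.
Qed.

Section summable.
Variable eta : R.
Hypothesis eta0 : 0 < eta.

Definition coset_bound : R := 3 `^ (1 + eta) * (2 * pseries_bound eta).

Lemma coset_bound_ge0 : 0 <= coset_bound.
Proof. by apply: mulr_ge0; [exact: powR_ge0|apply: mulr_ge0 => //; exact: pseries_bound_ge0]. Qed.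

(** The points of a progression of step [2 j >= 2] have distinct integer parts, and
    [|floor y| + 1 <= 3 <y>] compares the weight at [y] with [ipow] of the integer part; this is the
    origin of [3^(1 + eta)] in [coset_bound]. *)
Lemma sum_jw_coset_le x (j : int) (s : seq int) : 1 <= j -> uniq s ->
  \sum_(m <- s) jw (1 + eta) (x + 2 * (j * m)%:~R) <= coset_bound.
Proof.
move=> j1 us; pose phi m := Num.floor (x + 2 * (j * m)%:~R).
have le1 m : jw (1 + eta) (x + 2 * (j * m)%:~R) <= 3 `^ (1 + eta) * ipow eta (phi m).
  rewrite /phi /ipow; set y := x + _; have e1 : 0 <= 1 + eta by rewrite addr_ge0// ltW.
  have := floor_le y; have := floorD1_gt y; rewrite intrD intr_norm.
  set p := (Num.floor y)%:~R => p1 p2.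
  have j3 : `|p| + 1 <= 3 * japanese y.
    have h1 := norm_le_japanese y; have h2 := japanese_ge1 y.
    suff : `|p| <= `|y| + 1 by lra.
    have /ler_normlP[] := lexx `|y| => h3 h4.
    by rewrite ler_norml; apply/andP; split; lra.
  apply: (@le_trans _ _ (3 `^ (1 + eta) * (3 * japanese y) `^ (- (1 + eta)))).
    rewrite powRM ?(ltW (japanese_gt0 _))// mulrA -powRD ?subrr ?powRr0 ?mul1r//.
    by apply/implyP => _; rewrite pnatr_eq0.
  rewrite ler_pM2l ?powR_gt0//; apply: powR_antitone => //.
apply: le_trans (ler_sum _ (fun m _ => le1 m)) _.
rewrite -mulr_sumr ler_pM2l ?powR_gt0//.
apply: sum_ipow_inj_le => // m m' _ _; rewrite /phi.
set y := x + _; set y' := x + _ => yy'.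
have := floor_le y; have := floorD1_gt y; have := floor_le y'; have := floorD1_gt y'.
rewrite yy' intrD; set p := (Num.floor y')%:~R => h1 h2 h3 h4.
have : (2 * (j * (m - m')))%:~R < 1%:~R :> R.
  rewrite intrM mulrBr intrB mulrBr; rewrite /y /y' in h1 h2 h3 h4; lra.
have : (-1)%:~R < (2 * (j * (m - m')))%:~R :> R.
  rewrite intrM mulrBr intrB mulrBr mulrNz; rewrite /y /y' in h1 h2 h3 h4; lra.
by rewrite !ltr_int; nia.
Qed.

Definition jw_mass : R := 2 * coset_bound.

Lemma jw_mass_ge0 : 0 <= jw_mass.
Proof. by rewrite mulr_ge0// coset_bound_ge0. Qed.

Lemma integral_jw_le : (\int[mu]_x (jw (1 + eta) x)%:E <= jw_mass%:E)%E.
Proof.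
apply: integral_le_coset_sums; [exact: nnm_jw|exact: coset_bound_ge0|].
move=> x s us; under eq_bigr do rewrite -[_%:~R]mulr1z -[X in X%:~R]mul1r.
exact: sum_jw_coset_le.
Qed.

End summable.

(* With [r ~ sqrt |m|], [2 r + 1] bounds the number of lattice points on the line
   [om . l = m] with [|l|^2 <= |m| |om|^2]. *)
Lemma sum_near_le (eta x y : R) (n : Z2) (S : seq Z2) : 0 < eta -> n != 0 -> uniq S ->
  (forall l, l \in S -> dotz l l <= `|dotz (om n) l| * dotz (om n) (om n)) ->
  (forall l, l \in S -> (dotz n l)%:~R != 0 :> R -> `|(dotz n l)%:~R| / 2 <= `|x|) ->
  \sum_(l <- S) jw (3 / 4) x * jw (1 + eta) (x + y + 2 * (dotz n l)%:~R) <=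
    10 * coset_bound eta.
Proof.
move=> eta0 n0 uS hS hx; have pn := om_primitive n0.
have w0 : 0 < jw (3 / 4) x by rewrite powR_gt0// japanese_gt0.
pose h m := jw (3 / 4) x * jw (1 + eta) (x + y + 2 * (gz n * m)%:~R).
apply: (@le_trans _ _ (\sum_(m <- undup (map (dotz (om n)) S)) 10 / jw (3 / 4) x * h m)).
  apply: (sum_fibers_le (phi := dotz (om n)) (c := fun=> 10 / jw (3 / 4) x) (h := h)).
  - by move=> l lS; rewrite /h -dotz_om.
  - by move=> m; rewrite mulr_ge0// jw_ge0.
  move=> m /mapP[l lS mE]; rewrite ler_pdivlMr//.
  (* On the line [m = 0] the hypothesis leaves only [l = 0]: this is [size_line] with radius 0. *)
  have [m0|m0] := eqVneq m 0.
    apply: (@le_trans _ _ (1 * 1)); last by lra.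
    apply: ler_pM; rewrite ?ler0n// ?jw_ge0//; last by apply: jw_le1; lra.
    rewrite (_ : 1 = 1%:R)// ler_nat.
    apply: (@size_line (om n) 0 0) => //; first exact: filter_uniq.
      by move=> z; rewrite mem_filter m0 => /andP[/eqP].
    move=> z; rewrite mem_filter m0 => /andP[/eqP z0 zS].
    by have := hS _ zS; rewrite z0 normr0 expr2 !mul0r.
  pose q : R := Num.sqrt `|m%:~R|.
  have am1 : 1 <= `|m%:~R| :> R by rewrite -intr_norm -[1]/(1%:~R) ler_int; lia.
  have q1 : 1 <= q by rewrite -[leLHS]sqrtr1 ler_wsqrtr.
  pose r := `|Num.ceil q|%N.
  have rE : r%:R = (Num.ceil q)%:~R :> R.
    by rewrite /r pmulrn gez0_abs// ceil_ge0; lra.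
  have r1 : q <= r%:R by rewrite rE ceil_ge.
  have r2 : r%:R <= q + 1 by rewrite rE; have := ceilB1_lt q; rewrite intrB; lra.
  have cnt : (size [seq x <- S | dotz (om n) x == m])%:R <= 2 * r%:R + 1 :> R.
    rewrite -natrM natr1 ler_nat -addn1; apply: (@size_line (om n) m r) => //.
    - exact: filter_uniq.
    - by move=> z; rewrite mem_filter => /andP[/eqP].
    - move=> z; rewrite mem_filter => /andP[/eqP z0 zS].
      apply: le_trans (hS _ zS) _; rewrite z0 ler_wpM2r ?dotz_ge0//.
      rewrite -(ler_int R) intr_norm rmorphXn/= -pmulrn -[X in X <= _]sqr_sqrtr//.
      by rewrite ler_sqr ?nnegrE ?sqrtr_ge0.
  apply: (@le_trans _ _ (5 * q * jw (3 / 4) x)).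
    by rewrite ler_pM2r//; apply: le_trans cnt _; lra.
  have xm : `|m%:~R| / 2 <= `|x|.
    have nl : dotz n l = gz n * m by rewrite dotz_om// mE.
    have := hx _ lS; rewrite intr_eq0 nl mulf_eq0 negb_or m0 gt_eqF; last first.
      exact: (lt_le_trans _ (gz_ge1 n0)).
    move=> /(_ isT); apply: le_trans; rewrite ler_pM2r// -!intr_norm ler_int.
    by rewrite normrM ler_peMl// (le_trans (gz_ge1 n0))// ler_norm.
  have w1 := @jw_le_far (3 / 4) x `|m%:~R| _ _ xm.
  apply: (@le_trans _ _ (5 * q * (2 `^ (3 / 4) * `|m%:~R| `^ (- (3 / 4))))).
    by rewrite ler_wpM2l ?mulr_ge0//; [lra|apply: w1; lra].
  (* The weight pays for the points of the line: [|m|^(1/2) |m|^(-3/4) = |m|^(-1/4) <= 1], and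
     [5 * 2^(3/4) <= 10]. *)
  rewrite (_ : 5 * q * _ = 5 * 2 `^ (3 / 4) * `|m%:~R| `^ (- (1 / 4))); last first.
    rewrite (_ : 5 * q * _ = 5 * 2 `^ (3 / 4) * (q * `|m%:~R| `^ (- (3 / 4)))); last by ring.
    congr (_ * _); rewrite /q -powR12_sqrt//.
    by rewrite -powRD; [congr (_ `^ _); lra|apply/implyP => _; rewrite gt_eqF//; lra].
  have p1 : `|m%:~R| `^ (- (1 / 4)) <= 1 :> R.
    by rewrite powRN invf_le1 ?powR_gt0//; [rewrite -[leLHS](powRr0 `|m%:~R|); apply: ler_powR; lra|lra].
  have p2 : 2 `^ (3 / 4) <= 2 :> R by apply: ler1_powR; lra.
  have p0 : 0 <= `|m%:~R| `^ (- (1 / 4)) :> R by exact: powR_ge0.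
  by move: p0 p1 p2; nra.
rewrite /h; under eq_bigr do rewrite mulrA divfK ?gt_eqF//.
by rewrite -mulr_sumr ler_pM2l// sum_jw_coset_le// ?gz_ge1// undup_uniq.
Qed.

End weights.

(** * The trilinear estimate *)

Section discrete_trilinear.
Context {R : realType}.
Variable eta : R.
Hypothesis eta0 : 0 < eta.

(** Lagrange's identity: twice the difference of the two sides is the double sum of
    [(x i * y j - x j * y i) ^+ 2]. *)
Lemma cauchy_schwarz_sum (I : Type) (s : seq I) (p : pred I) (x y : I -> R) :
  (\sum_(i <- s | p i) x i * y i) ^+ 2 <=
  (\sum_(i <- s | p i) x i ^+ 2) * (\sum_(i <- s | p i) y i ^+ 2).
Proof.
rewrite expr2 !mulr_suml -subr_ge0 -sumrB.
under eq_bigr do rewrite !mulr_sumr -sumrB.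
rewrite -(pmulr_rge0 _ (ltr0n R 2)) mulr2n mulrDl mul1r {2}exchange_big/= -big_split/=.
apply: sumr_ge0 => i _; rewrite -big_split/=; apply: sumr_ge0 => j _.
have -> : x i ^+ 2 * y j ^+ 2 - x i * y i * (x j * y j) +
  (x j ^+ 2 * y i ^+ 2 - x j * y j * (x i * y i)) = (x i * y j - x j * y i) ^+ 2 by ring.
exact: sqr_ge0.
Qed.

Let alpha : R := (1 + eta) / 2.

(** The gain when a factor has modulation at least [|n . l| / 2]. It is 0 where [n . l = 0] and [n]
    is nonzero, since these pairs are assigned to the resonant region, and 1 at [n = 0], where a
    single frequency needs no gain. *)
Definition kap (n l : Z2) : R :=
  if n == 0 then 1 else if dotz n l == 0 then 0 else `|(dotz n l)%:~R| `^ (- alpha).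

Lemma kap_ge0 n l : 0 <= kap n l.
Proof. by rewrite /kap; do 2 case: ifP => //; rewrite powR_ge0. Qed.

Definition l1_le1 (g : Z2 -> R) :=
  (forall n, 0 <= g n) /\ forall S : seq Z2, uniq S -> \sum_(n <- S) g n <= 1.

Lemma l1_le1_shift g (S : seq Z2) (a : Z2) : l1_le1 g -> uniq S ->
  \sum_(n <- S) g (n + a) <= 1.
Proof.
move=> [_ gS] uS; rewrite -(big_map (+%R^~ a) xpredT g); apply: gS.
by rewrite map_inj_uniq//; exact: addIr.
Qed.

Lemma l1_le1_conv g h (S : seq Z2) : l1_le1 g -> l1_le1 h -> uniq S ->
  \sum_(n <- S) \sum_(l <- S) g l * h (n + l) <= 1.
Proof.
move=> hg hh uS; rewrite exchange_big/=.
apply: le_trans (hg.2 _ uS); apply: ler_sum => l _.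
by rewrite -mulr_sumr ler_piMr ?(hg.1)// l1_le1_shift.
Qed.

Lemma l1_le1_prod g h (S : seq Z2) : l1_le1 g -> l1_le1 h -> uniq S ->
  \sum_(n <- S) \sum_(l <- S) g n * h (n + l) <= 1.
Proof.
move=> hg hh uS; apply: le_trans (hg.2 _ uS); apply: ler_sum => n _.
rewrite -mulr_sumr ler_piMr ?(hg.1)//.
by under eq_bigr do rewrite addrC; exact: l1_le1_shift.
Qed.

Definition left_bound : R := 3 * (2 `^ (1 + eta) * (2 * pseries_bound eta)).
Definition right_bound : R := 1 + (24 / (1 - 2 `^ (- eta))) * pseries_bound eta.

Lemma left_bound_ge0 : 0 <= left_bound.
Proof.
apply: mulr_ge0 => //; apply: mulr_ge0; first exact: powR_ge0.
by apply: mulr_ge0 => //; exact: pseries_bound_ge0.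
Qed.

Lemma short_bound_ge0 : 0 <= (24 / (1 - 2 `^ (- eta))) * pseries_bound eta :> R.
Proof.
by apply: mulr_ge0; [rewrite divr_ge0// subr_ge0 ltW// powR2N_lt1|exact: pseries_bound_ge0].
Qed.

Lemma right_bound_ge0 : 0 <= right_bound.
Proof. by apply: addr_ge0 => //; exact: short_bound_ge0. Qed.

(** Decides which variable is summed: if [|l| <= |om n|] the lines contain few points and the sum of
    [kap ^+ 2] over [l] is bounded, otherwise the sum over [n] is. *)
Let left_case (n l : Z2) : bool :=
  [&& n != 0, dotz n l != 0 & dotz l l <= dotz (om n) (om n)].

Let kap_sqr n l : n != 0 -> dotz n l != 0 ->
  kap n l ^+ 2 = `|(dotz n l)%:~R| `^ (- (1 + eta)).
Proof.
move=> n0 k0; rewrite /kap (negbTE n0) (negbTE k0) -powR_mulrn ?powR_ge0// -powRrM.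
by congr (_ `^ _); rewrite /alpha; field.
Qed.

Let sum_left n S : uniq S -> \sum_(l <- S | left_case n l) kap n l ^+ 2 <= left_bound.
Proof.
move=> uS; have [n0|n0] := eqVneq n 0.
  by rewrite big1 ?left_bound_ge0// => l; rewrite /left_case n0 eqxx.
rewrite -big_filter big_seq (eq_bigr (fun l => `|(dotz n l)%:~R| `^ (- (1 + eta)))).
  rewrite -big_seq; apply: sum_dotz_left_le => //; first exact: filter_uniq.
    by move=> l; rewrite mem_filter => /andP[/and3P[]].
  by move=> l; rewrite mem_filter => /andP[/and3P[]].
by move=> l; rewrite mem_filter => /andP[/and3P[_ k0 _] _]; exact: kap_sqr.
Qed.

Let sum_right l S : uniq S ->
  \sum_(n <- S | ~~ left_case n l) kap n l ^+ 2 <= right_bound.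
Proof.
move=> uS; rewrite (bigID (fun n => n == 0))/=; apply: lerD.
  rewrite (eq_bigr (fun=> 1)); last first.
    by move=> n /andP[_ /eqP ->]; rewrite /kap eqxx expr1n.
  rewrite -big_filter big_const_seq count_predT iter_addr_0 lern1.
  apply: (@uniq_leq_size _ _ [:: 0]); first exact: filter_uniq.
  by move=> n; rewrite mem_filter inE => /andP[/andP[_ ->]].
rewrite (bigID (fun n => dotz n l == 0))/= [X in X + _]big1 ?add0r; last first.
  by move=> n /andP[/andP[_ /negbTE n0] k0]; rewrite /kap n0 k0 expr0n.
have [->|l0] := eqVneq l 0.
  rewrite big1 ?short_bound_ge0//.
  by move=> n; rewrite /dotz/= !mulr0 addr0 eqxx andbF.
rewrite -big_filter big_seq (eq_bigr (fun n => `|(dotz n l)%:~R| `^ (- (1 + eta)))).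
  rewrite -big_seq; apply: sum_dotz_right_le => //; first exact: filter_uniq.
  - by move=> n; rewrite mem_filter => /andP[/andP[/andP[]]].
  - by move=> n; rewrite mem_filter => /andP[/andP[/andP[]]].
  - move=> n; rewrite mem_filter /left_case => /andP[/andP[/andP[h n0] k0] _].
    by move: h; rewrite n0 k0/= -ltNge => /ltW.
by move=> n; rewrite mem_filter => /andP[/andP[/andP[_ n0] k0] _]; exact: kap_sqr.
Qed.

(** By AM-GM the kernel is attached to [G0 n] in the left case and to [G2 l] otherwise, so that it
    is summed over the variable that this function does not contain. The products of the remaining
    two functions have squares of total mass at most 1, which gives the final [+ 2]. *)
Lemma discrete_kap_le (G0 G1 G2 : Z2 -> R) (S : seq Z2) :
  (forall n, 0 <= G0 n) -> (forall n, 0 <= G1 n) -> (forall n, 0 <= G2 n) ->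
  l1_le1 (fun n => G0 n ^+ 2) -> l1_le1 (fun n => G1 n ^+ 2) ->
  l1_le1 (fun n => G2 n ^+ 2) -> uniq S ->
  \sum_(n <- S) \sum_(l <- S) kap n l * (G0 n * G2 l * G1 (n + l)) <=
    2^-1 * (left_bound + right_bound + 2).
Proof.
move=> p0 p1 p2 h0 h1 h2 uS.
apply: (@le_trans _ _ (\sum_(n <- S) \sum_(l <- S) 2^-1 * (
    (if left_case n l then kap n l ^+ 2 * G0 n ^+ 2 else 0) +
    (if ~~ left_case n l then kap n l ^+ 2 * G2 l ^+ 2 else 0) +
    G2 l ^+ 2 * G1 (n + l) ^+ 2 + G0 n ^+ 2 * G1 (n + l) ^+ 2))).
  apply: ler_sum => n _; apply: ler_sum => l _.
  have := kap_ge0 n l; have := p0 n; have := p1 (n + l); have := p2 l.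
  move: (kap n l) (G0 n) (G1 _) (G2 l) => k a b c c0 b0 a0 k0.
  case: ifP => _ /=.
    have := sqr_ge0 (k * a - c * b); have := sqr_ge0 (a * b).
    by rewrite !exprMn sqrrB !exprMn; lra.
  have := sqr_ge0 (k * c - a * b); have := sqr_ge0 (c * b).
  by rewrite !exprMn sqrrB !exprMn; lra.
under eq_bigr do rewrite -mulr_sumr !big_split/=.
rewrite -mulr_sumr ler_pM2l ?invr_gt0// !big_split/=.
rewrite (_ : 2 = 1 + 1)// addrA; apply: lerD; last exact: (l1_le1_prod h0 h1 uS).
apply: lerD; last exact: (l1_le1_conv h2 h1 uS).
apply: lerD.
  apply: (@le_trans _ _ (\sum_(n <- S) G0 n ^+ 2 * left_bound)).
    apply: ler_sum => n _; rewrite -big_mkcond/= -mulr_suml mulrC ler_wpM2l ?sqr_ge0//.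
    exact: sum_left.
  rewrite -mulr_suml ler_piMl//; last exact: h0.2.
  exact: left_bound_ge0.
rewrite exchange_big/=.
apply: (@le_trans _ _ (\sum_(l <- S) G2 l ^+ 2 * right_bound)).
  apply: ler_sum => l _; rewrite -big_mkcond/= -mulr_suml mulrC ler_wpM2l ?sqr_ge0//.
  exact: sum_right.
rewrite -mulr_suml ler_piMl//; last exact: h2.2.
exact: right_bound_ge0.
Qed.

(** On the line [om n . l = m] this is [|l| <= sqrt |m| |om n|], the range in which a line has
    [O(sqrt |m|)] points. A nonzero [l] orthogonal to [om n] does not satisfy it. *)
Definition near_orth (n l : Z2) : bool := dotz l l <= `|dotz (om n) l| * dotz (om n) (om n).

(** For fixed [l] the frequencies [n] are sorted by their direction [o]. The points [n + l'], with
    [n] in direction [o] and [l'] on one line orthogonal to [o], are pairwise distinct and so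
    collect at most the total mass 1 of [g1]. There remains the sum of [thin_weight] over
    directions, and the failure of [near_orth] is what [sum_thin_le] asks for. *)
Lemma discrete_thin_le (g1 g2 : Z2 -> R) (S : seq Z2) : l1_le1 g1 -> l1_le1 g2 -> uniq S ->
  \sum_(n <- S | n != 0) \sum_(l <- S | ~~ near_orth n l) thin_weight (dotz (om n) l) *
     (g2 l * \sum_(l' <- S | dotz (om n) l' == dotz (om n) l) g1 (n + l')) <=
  thin_bound :> R.
Proof.
move=> h1 h2 uS.
rewrite (exchange_big_dep xpredT)//=.
apply: (@le_trans _ _ (\sum_(l <- S) g2 l * thin_bound)); last first.
  rewrite -mulr_suml ler_piMl ?thin_bound_ge0//; exact: h2.2.
apply: ler_sum => l _.
under eq_bigr do rewrite mulrCA.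
rewrite -mulr_sumr; apply: ler_wpM2l; first exact: h2.1.
rewrite -big_filter; set S' := [seq _ <- _ | _].
have [l0|l0] := eqVneq l 0.
  rewrite big_seq big_pred0 ?thin_bound_ge0// => n.
  apply/negbTE; rewrite mem_filter l0 /near_orth /dotz/= !(mulr0, addr0, normr0) mul0r.
  by rewrite lexx andbF.
rewrite (partition_big_undup S' om).
apply: (@le_trans _ _ (\sum_(o <- undup (map om S')) thin_weight (dotz o l))); last first.
  apply: sum_thin_le; rewrite ?undup_uniq// => o; rewrite mem_undup => /mapP[n];
    rewrite mem_filter => /andP[/andP[n0 nn] nS] ->.
  - exact: om_primitive.
  - by move: nn; rewrite /near_orth -ltNge => /ltW.
apply: ler_sum => o _.
rewrite (eq_bigr (fun n => thin_weight (dotz o l) *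
    \sum_(l' <- S | dotz o l' == dotz o l) g1 (n + l'))); last by move=> n /eqP ->.
rewrite -mulr_sumr ler_piMr ?thin_weight_ge0//.
rewrite -big_filter; under eq_bigr do rewrite -big_filter.
set s := [seq _ <- S' | _]; set t := [seq _ <- S | _].
have -> : \sum_(n <- s) \sum_(l' <- t) g1 (n + l') =
    \sum_(z <- [seq n + l' | n <- s, l' <- t]) g1 z by rewrite big_allpairs_dep.
apply: h1.2; apply: allpairs_uniq => /=.
- by rewrite !filter_uniq.
- by rewrite filter_uniq.
move=> _ _ /allpairsP[[n m] /= [ns mt ->]] /allpairsP[[n' m'] /= [ns' mt' ->]] /= e.
move: ns ns' mt mt'; rewrite !mem_filter => /andP[/eqP on /andP[/andP[n0 _] _]].
move=> /andP[/eqP on' /andP[/andP[n0' _] _]] /andP[/eqP om_ _] /andP[/eqP om_' _].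
have po : primitive o by rewrite -on om_primitive.
(* The product of [o] with [n + l'] is [gz n * |o|^2] plus the constant of the line, so the point
   determines the gcd of [n], hence [n], hence [l']. *)
suff nn : n = n' by move: e; rewrite nn => /addrI ->.
have := congr1 (dotz o) e; rewrite !dotzDr om_ om_' => /addIr.
rewrite (gz_om n) (gz_om n') on on' /dotz/= => h.
have oo := dotz_gt0 (primitive_neq0 po).
suff -> : gz n = gz n' by [].
apply: (@mulIf _ (dotz o o)); first by rewrite gt_eqF//; lia.
by rewrite /dotz; lia.
Qed.

End discrete_trilinear.

Section am_gm.
Context {R : realType}.

(** Cauchy-Schwarz from a weighted AM-GM: the optimal weight is [b / a], and both numbers are moved
    away from 0 by [d] before the quotient is formed, so that vanishing norms need no case of their
    own. *)
Lemma am_gm_opt (X : \bar R) (a b : R) : 0 <= a -> 0 <= b ->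
  (forall k, 0 < k -> (X <= (k * a ^+ 2 + k^-1 * b ^+ 2)%:E)%E) ->
  (X <= (2 * (a * b))%:E)%E.
Proof.
move=> a0 b0 h; apply/lee_addgt0Pr => e e0.
pose d := Num.min 1 (e / (2 * (a + b + 1))).
have ab0 : 0 < 2 * (a + b + 1) by lra.
have d0 : 0 < d by rewrite lt_min ltr01 divr_gt0.
have d1 : d <= 1 by rewrite ge_min lexx.
have d2 : d * (2 * (a + b + 1)) <= e by rewrite -ler_pdivlMr// ge_min lexx orbT.
have ad : 0 < a + d by lra.
have bd : 0 < b + d by lra.
apply: le_trans (h ((b + d) / (a + d)) (divr_gt0 bd ad)) _.
rewrite -EFinD lee_fin invf_div.
apply: (@le_trans _ _ (2 * ((a + d) * (b + d)))); last by nra.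
have -> : 2 * ((a + d) * (b + d)) = (b + d) / (a + d) * (a + d) ^+ 2 +
    (a + d) / (b + d) * (b + d) ^+ 2 by field; rewrite !gt_eqF.
apply: lerD; (apply: ler_wpM2l; first by rewrite divr_ge0// ltW);
  by apply: lerXn2r; rewrite ?nnegrE; lra.
Qed.

End am_gm.

(** * Cauchy-Schwarz and Young inequalities for trilinear integrals *)

Section plane.
Context {R : realType}.
Local Notation mu := (@lebesgue_measure R).
Local Notation RT := (measurableTypeR R).
Local Notation mu2 := (mu \x mu)%E.
Implicit Types f g h : RT -> R.

Lemma nnm_fst f : nnm f -> nnm (fun p : RT * RT => f p.1).
Proof. by case=> mf f0; split => //; exact: measurableT_comp. Qed.

Lemma nnm_snd f : nnm f -> nnm (fun p : RT * RT => f p.2).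
Proof. by case=> mf f0; split => //; exact: measurableT_comp. Qed.

Lemma nnm_addc f (c : R) : nnm f -> nnm (fun p : RT * RT => f (p.1 + p.2 + c)).
Proof.
case=> mf f0; split => //; apply: (measurableT_comp mf).
by apply: measurable_funD => //; apply: measurable_funD.
Qed.

Lemma integral_fst_snd f g : nnm f -> nnm g ->
  (\int[mu2]_p (f p.1 * g p.2)%:E = \int[mu]_x (f x)%:E * \int[mu]_x (g x)%:E)%E.
Proof.
move=> nf ng.
have nfg : nnm (fun p : RT * RT => f p.1 * g p.2).
  by apply: nnmM; [exact: nnm_fst|exact: nnm_snd].
rewrite fubini_tonelli1/=; [|exact: nnmE|by move=> p; exact: (nnm_ge0 p nfg)].
rewrite -ge0_integralZr//; last 3 first.
- exact: nnmE.
- by move=> x _; exact: nnm_ge0.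
- exact: nn_ge0.
by apply: eq_integral => x _; rewrite /fubini_F/= nnZl//; case: nf.
Qed.

Lemma integral_fst_add f h (c : R) : nnm f -> nnm h ->
  (\int[mu2]_p (f p.1 * h (p.1 + p.2 + c))%:E = \int[mu]_x (f x)%:E * \int[mu]_x (h x)%:E)%E.
Proof.
move=> nf nh.
have nfh : nnm (fun p : RT * RT => f p.1 * h (p.1 + p.2 + c)).
  by apply: nnmM; [exact: nnm_fst|exact: nnm_addc].
rewrite fubini_tonelli1/=; [|exact: nnmE|by move=> p; exact: (nnm_ge0 p nfh)].
rewrite -ge0_integralZr//; last 3 first.
- exact: nnmE.
- by move=> x _; exact: nnm_ge0.
- exact: nn_ge0.
apply: eq_integral => x _; rewrite /fubini_F/=.
under eq_integral do rewrite addrAC.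
by rewrite nnZl ?nn_shiftl//; [case: nf|exact: (nnm_shiftl (x + c) nh)].
Qed.

Lemma integral_snd_add g h (c : R) : nnm g -> nnm h ->
  (\int[mu2]_p (g p.2 * h (p.1 + p.2 + c))%:E = \int[mu]_x (g x)%:E * \int[mu]_x (h x)%:E)%E.
Proof.
move=> ng nh.
have ngh : nnm (fun p : RT * RT => g p.2 * h (p.1 + p.2 + c)).
  by apply: nnmM; [exact: nnm_snd|exact: nnm_addc].
rewrite fubini_tonelli2/=; [|exact: nnmE|by move=> p; exact: (nnm_ge0 p ngh)].
rewrite -ge0_integralZr//; last 3 first.
- exact: nnmE.
- by move=> x _; exact: nnm_ge0.
- exact: nn_ge0.
apply: eq_integral => y _; rewrite /fubini_G/=.
under eq_integral do rewrite -addrA.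
by rewrite nnZl ?nn_shift//; [case: ng|exact: (nnm_shift (y + c) nh)].
Qed.

Lemma integral_mul_le f g (a b : R) : nnm f -> nnm g -> 0 <= a -> 0 <= b ->
  (\int[mu]_x (f x ^+ 2)%:E <= (a ^+ 2)%:E)%E ->
  (\int[mu]_x (g x ^+ 2)%:E <= (b ^+ 2)%:E)%E ->
  (\int[mu]_x (f x * g x)%:E <= (a * b)%:E)%E.
Proof.
move=> nf ng a0 b0 ha hb.
have s2 : (Num.sqrt 2^-1 ^+ 2 = 2^-1 :> R) by rewrite sqr_sqrtr.
have -> : a * b = 2 * ((Num.sqrt 2^-1 * a) * (Num.sqrt 2^-1 * b)).
  by rewrite mulrACA -expr2 s2; field.
apply: am_gm_opt; rewrite ?mulr_ge0 ?sqrtr_ge0// => k k0.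
apply: (@le_trans _ _ (\int[mu]_x (k / 2 * f x ^+ 2 + k^-1 / 2 * g x ^+ 2)%:E)%E).
  apply: nn_le; first exact: nnmM.
    by apply: nnmD; apply: nnmM; rewrite //; (try exact: nnmX); apply: nnm_cst;
      rewrite divr_ge0 ?invr_ge0// ltW.
  move=> x; have := sqr_ge0 (k * f x - g x).
  rewrite -(pmulr_rge0 _ (_ : 0 < k^-1 / 2)) ?divr_gt0 ?invr_gt0//.
  rewrite sqrrB; have -> : k^-1 / 2 * ((k * f x) ^+ 2 - k * f x * g x *+ 2 + g x ^+ 2) =
    k / 2 * f x ^+ 2 - f x * g x + k^-1 / 2 * g x ^+ 2 by field; rewrite gt_eqF.
  lra.
rewrite nnD; [|by apply: nnmM; [apply: nnm_cst; rewrite divr_ge0// ltW|exact: nnmX]|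
  by apply: nnmM; [apply: nnm_cst; rewrite divr_ge0 ?invr_ge0// ltW|exact: nnmX]].
rewrite nnZl ?nnZl ?divr_ge0 ?invr_ge0 ?(ltW k0)//; try exact: nnmX.
rewrite !exprMn s2 EFinD (mulrA k) (mulrA k^-1); apply: leeD.
  by rewrite [leRHS]EFinM; apply: lee_wpmul2l; rewrite // lee_fin divr_ge0// ltW.
by rewrite [leRHS]EFinM; apply: lee_wpmul2l; rewrite // lee_fin divr_ge0 ?invr_ge0// ltW.
Qed.

(** The product [q = w f2] is integrable with mass at most [A G2]. AM-GM for [f0] and [f1] against
    the density [q] then decouples the integral: a square-integrable weight in one variable controls
    the convolution form. *)
Lemma young_snd w f0 f1 f2 (c A G0 G1 G2 : R) : nnm w -> nnm f0 -> nnm f1 -> nnm f2 ->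
  0 <= A -> 0 <= G0 -> 0 <= G1 -> 0 <= G2 ->
  (\int[mu]_x (w x ^+ 2)%:E <= (A ^+ 2)%:E)%E ->
  (\int[mu]_x (f0 x ^+ 2)%:E <= (G0 ^+ 2)%:E)%E ->
  (\int[mu]_x (f1 x ^+ 2)%:E <= (G1 ^+ 2)%:E)%E ->
  (\int[mu]_x (f2 x ^+ 2)%:E <= (G2 ^+ 2)%:E)%E ->
  (\int[mu2]_p (w p.2 * (f0 p.1 * f2 p.2 * f1 (p.1 + p.2 + c)))%:E <=
    (A * (G0 * G2 * G1))%:E)%E.
Proof.
move=> nw n0 n1 n2 A0 G00 G10 G20 hw h0 h1 h2.
have nP : nnm (fun x => w x * f2 x) by exact: nnmM.
have hP := integral_mul_le nw n2 A0 G20 hw h2.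
(* Half of the mass bound, so that the factor 2 in [am_gm_opt] restores [A * (G0 * G2 * G1)]. *)
pose P := Num.sqrt (A * G2 / 2).
have P2 : P ^+ 2 = A * G2 / 2 by rewrite sqr_sqrtr// divr_ge0 ?mulr_ge0.
have -> : A * (G0 * G2 * G1) = 2 * ((P * G0) * (P * G1)).
  by rewrite mulrACA -expr2 P2; field.
apply: am_gm_opt; rewrite ?mulr_ge0 ?sqrtr_ge0// => k k0.
have k2 : 0 <= k / 2 by rewrite divr_ge0// ltW.
have k2' : 0 <= k^-1 / 2 by rewrite divr_ge0 ?invr_ge0// ltW.
have na : nnm (fun p : RT * RT => f0 p.1 ^+ 2 * (w p.2 * f2 p.2)).
  by apply: nnmM; [exact: (nnm_fst (nnmX 2 n0))|exact: (nnm_snd nP)].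
have nb : nnm (fun p : RT * RT => w p.2 * f2 p.2 * f1 (p.1 + p.2 + c) ^+ 2).
  by apply: nnmM; [exact: (nnm_snd nP)|exact: (nnm_addc c (nnmX 2 n1))].
apply: (@le_trans _ _ (\int[mu2]_p (k / 2 * (f0 p.1 ^+ 2 * (w p.2 * f2 p.2)) +
    k^-1 / 2 * (w p.2 * f2 p.2 * f1 (p.1 + p.2 + c) ^+ 2))%:E)%E).
  apply: nn_le.
  - apply: nnmM; first exact: nnm_snd.
    by apply: nnmM; [apply: nnmM; [exact: nnm_fst|exact: nnm_snd]|exact: nnm_addc].
  - by apply: nnmD; apply: nnmM => //; exact: nnm_cst.
  move=> p; have w0 : 0 <= w p.2 * f2 p.2 by case: nP.
  move: (f0 p.1) (f1 _) w0 => a b; set q := w p.2 * f2 p.2 => q0.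
  rewrite (_ : w p.2 * _ = q * (a * b)); last by rewrite /q; ring.
  have := mulr_ge0 q0 (sqr_ge0 (k * a - b)).
  rewrite -(pmulr_rge0 _ (_ : 0 < k^-1 / 2)) ?divr_gt0 ?invr_gt0//.
  have -> : k^-1 / 2 * (q * (k * a - b) ^+ 2) =
    k / 2 * (a ^+ 2 * q) - q * (a * b) + k^-1 / 2 * (q * b ^+ 2) by field; rewrite gt_eqF.
  lra.
rewrite nnD; [|by apply: nnmM => //; exact: nnm_cst|by apply: nnmM => //; exact: nnm_cst].
rewrite nnZl// nnZl// (integral_fst_snd (nnmX 2 n0) nP) (integral_snd_add c nP (nnmX 2 n1)).
rewrite EFinD; apply: leeD.
  rewrite (_ : k * (P * _) ^+ 2 = k / 2 * (G0 ^+ 2 * (A * G2))); last by rewrite exprMn P2; field.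
  rewrite (EFinM (k / 2)); apply: lee_wpmul2l => //; rewrite EFinM.
  by apply: lee_pmul => //; apply: nn_ge0 => //; exact: nnmX.
rewrite (_ : k^-1 * (P * _) ^+ 2 = k^-1 / 2 * (A * G2 * G1 ^+ 2)); last by rewrite exprMn P2; field; rewrite gt_eqF.
rewrite (EFinM (k^-1 / 2)); apply: lee_wpmul2l => //; rewrite EFinM.
by apply: lee_pmul => //; apply: nn_ge0 => //; exact: nnmX.
Qed.

(** The same with the density [w f1], which depends on [p.1 + p.2 + c]; translation invariance
    removes the shift in either variable. *)
Lemma young_add w f0 f1 f2 (c A G0 G1 G2 : R) : nnm w -> nnm f0 -> nnm f1 -> nnm f2 ->
  0 <= A -> 0 <= G0 -> 0 <= G1 -> 0 <= G2 ->
  (\int[mu]_x (w x ^+ 2)%:E <= (A ^+ 2)%:E)%E ->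
  (\int[mu]_x (f0 x ^+ 2)%:E <= (G0 ^+ 2)%:E)%E ->
  (\int[mu]_x (f1 x ^+ 2)%:E <= (G1 ^+ 2)%:E)%E ->
  (\int[mu]_x (f2 x ^+ 2)%:E <= (G2 ^+ 2)%:E)%E ->
  (\int[mu2]_p (w (p.1 + p.2 + c) * (f0 p.1 * f2 p.2 * f1 (p.1 + p.2 + c)))%:E <=
    (A * (G0 * G2 * G1))%:E)%E.
Proof.
move=> nw n0 n1 n2 A0 G00 G10 G20 hw h0 h1 h2.
have nP : nnm (fun x => w x * f1 x) by exact: nnmM.
have hP := integral_mul_le nw n1 A0 G10 hw h1.
pose P := Num.sqrt (A * G1 / 2).
have P2 : P ^+ 2 = A * G1 / 2 by rewrite sqr_sqrtr// divr_ge0 ?mulr_ge0.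
have -> : A * (G0 * G2 * G1) = 2 * ((P * G0) * (P * G2)).
  by rewrite mulrACA -expr2 P2; field.
apply: am_gm_opt; rewrite ?mulr_ge0 ?sqrtr_ge0// => k k0.
have k2 : 0 <= k / 2 by rewrite divr_ge0// ltW.
have k2' : 0 <= k^-1 / 2 by rewrite divr_ge0 ?invr_ge0// ltW.
have na : nnm (fun p : RT * RT => f0 p.1 ^+ 2 * (w (p.1 + p.2 + c) * f1 (p.1 + p.2 + c))).
  by apply: nnmM; [exact: (nnm_fst (nnmX 2 n0))|exact: (nnm_addc c nP)].
have nb : nnm (fun p : RT * RT => f2 p.2 ^+ 2 * (w (p.1 + p.2 + c) * f1 (p.1 + p.2 + c))).
  by apply: nnmM; [exact: (nnm_snd (nnmX 2 n2))|exact: (nnm_addc c nP)].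
apply: (@le_trans _ _ (\int[mu2]_p
    (k / 2 * (f0 p.1 ^+ 2 * (w (p.1 + p.2 + c) * f1 (p.1 + p.2 + c))) +
     k^-1 / 2 * (f2 p.2 ^+ 2 * (w (p.1 + p.2 + c) * f1 (p.1 + p.2 + c))))%:E)%E).
  apply: nn_le.
  - apply: nnmM; first exact: nnm_addc.
    by apply: nnmM; [apply: nnmM; [exact: nnm_fst|exact: nnm_snd]|exact: nnm_addc].
  - by apply: nnmD; apply: nnmM => //; exact: nnm_cst.
  move=> p; set x := p.1 + p.2 + c; have w0 : 0 <= w x * f1 x by case: nP.
  move: (f0 p.1) (f2 p.2) w0 => a b; set q := w x * f1 x => q0.
  rewrite (_ : w x * _ = q * (a * b)); last by rewrite /q; ring.
  have := mulr_ge0 q0 (sqr_ge0 (k * a - b)).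
  rewrite -(pmulr_rge0 _ (_ : 0 < k^-1 / 2)) ?divr_gt0 ?invr_gt0//.
  have -> : k^-1 / 2 * (q * (k * a - b) ^+ 2) =
    k / 2 * (a ^+ 2 * q) - q * (a * b) + k^-1 / 2 * (b ^+ 2 * q) by field; rewrite gt_eqF.
  lra.
rewrite nnD; [|by apply: nnmM => //; exact: nnm_cst|by apply: nnmM => //; exact: nnm_cst].
rewrite nnZl// nnZl// (integral_fst_add c (nnmX 2 n0) nP) (integral_snd_add c (nnmX 2 n2) nP).
rewrite EFinD; apply: leeD.
  rewrite (_ : k * (P * _) ^+ 2 = k / 2 * (G0 ^+ 2 * (A * G1))); last by rewrite exprMn P2; field.
  rewrite (EFinM (k / 2)); apply: lee_wpmul2l => //; rewrite EFinM.
  by apply: lee_pmul => //; apply: nn_ge0 => //; exact: nnmX.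
rewrite (_ : k^-1 * (P * _) ^+ 2 = k^-1 / 2 * (G2 ^+ 2 * (A * G1))); last by rewrite exprMn P2; field; rewrite gt_eqF.
rewrite (EFinM (k^-1 / 2)); apply: lee_wpmul2l => //; rewrite EFinM.
by apply: lee_pmul => //; apply: nn_ge0 => //; exact: nnmX.
Qed.

End plane.

(** * The three modulation regions of the trilinear form *)

Section trilinear.
Context {R : realType}.
Local Notation mu := (@lebesgue_measure R).
Local Notation RT := (measurableTypeR R).
Local Notation mu2 := (mu \x mu)%E.
Variable eta : R.
Hypothesis eta0 : 0 < eta.

Let alpha : R := (1 + eta) / 2.
(** The exponent 3/8 bounds [1/2 - delta1] from below for [delta1 <= 1/8]; its double is the 3/4 of
    [thin_weight]. *)
Let w0 : RT -> R := jw (3 / 8).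
Let w : RT -> R := jw alpha.

Definition mass1 (f : Z2 -> RT -> R) := (forall n, nnm (f n)) /\
  forall S, uniq S -> (\sum_(n <- S) \int[mu]_x (f n x ^+ 2)%:E <= 1)%E.

Definition sqmass (f : Z2 -> RT -> R) (n : Z2) : R := fine (\int[mu]_x (f n x ^+ 2)%:E).

Lemma sqmassE f n : mass1 f -> (\int[mu]_x (f n x ^+ 2)%:E)%E = (sqmass f n)%:E.
Proof.
case=> nf hf; rewrite fineK// ge0_fin_numE; last by apply: nn_ge0; exact: nnmX.
by have := hf [:: n] isT; rewrite big_seq1 => /le_lt_trans; apply; exact: ltry.
Qed.

Lemma sqmass_ge0 f n : mass1 f -> 0 <= sqmass f n.
Proof. by case=> nf _; apply: fine_ge0; apply: nn_ge0; exact: nnmX. Qed.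

Lemma sqmass_l1 f : mass1 f -> l1_le1 (sqmass f).
Proof.
move=> hf; split=> [n|S uS]; first exact: sqmass_ge0.
rewrite -lee_fin -sumEFin; under eq_bigr do rewrite -sqmassE//.
exact: hf.2.
Qed.

Let nw0 : nnm w0. Proof. exact: nnm_jw. Qed.
Let nw : nnm w. Proof. exact: nnm_jw. Qed.

Let w2E x : w x ^+ 2 = jw (1 + eta) x.
Proof. by rewrite /w jw_sqr /alpha mulfVK. Qed.

Let w02E x : w0 x ^+ 2 = jw (3 / 4) x.
Proof. by rewrite /w0 jw_sqr; congr (jw _ _); field. Qed.

Let alpha0 : 0 <= alpha. Proof. by rewrite divr_ge0// addr_ge0// ltW. Qed.

Let M := jw_mass eta.
Let M0 : 0 <= M. Proof. exact: jw_mass_ge0. Qed.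

Let int_w2 : (\int[mu]_x (w x ^+ 2)%:E <= M%:E)%E.
Proof. by under eq_integral do rewrite w2E; exact: integral_jw_le. Qed.

(* The region where the output modulation is comparable to the resonance function. *)
Let resonant (n l : Z2) (x : R) : bool :=
  (n != 0) && ((dotz n l == 0) || (`|(dotz n l)%:~R| / 2 <= `|x|)).

Let rr (n l : Z2) : RT -> R := fun x => (resonant n l x)%:R.

Let nrr n l : nnm (rr n l).
Proof.
split=> [|x]; last by rewrite ler0n.
rewrite (_ : rr n l = \1_[set x | resonant n l x]); last first.
  apply/funext => x; rewrite indicE /rr; case: (boolP (resonant n l x)) => h.
    by rewrite mem_set.
  by rewrite memNset//; exact/negP.
apply: measurable_indic; rewrite /resonant.
case: (n != 0) => /=; last by rewrite (_ : mkset _ = set0)//; apply/seteqP; split.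
case: (dotz n l == 0) => /=; first by rewrite (_ : mkset _ = setT)//; apply/seteqP; split.
have : measurable_fun setT (fun x : RT => `|(dotz n l)%:~R| / 2 <= `|x| :> R).
  by apply: measurable_fun_ler; [exact: measurable_cst|exact: normr_measurable].
by move=> /(_ measurableT [set true] I); rewrite setTI.
Qed.

(** Since [z - x - y = 2 (n . l)], one of the three modulations is at least [|n . l| / 2]. If it is
    [y] or [z], its weight is traded for [kap] and the weight of the other factor is kept: Young's
    inequality needs exactly one square-integrable weight. *)
Let weight_split n l x y z : z = x + y + 2 * (dotz n l)%:~R ->
  w0 x * w y * w z <= 2 `^ alpha * kap eta n l * w y + 2 `^ alpha * kap eta n l * w z +
    rr n l x * (w0 x * w y * w z).
Proof.
move=> zE; have [w0x wy wz] : [/\ 0 <= w0 x, 0 <= w y & 0 <= w z] by split; exact: jw_ge0.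
have [w0x1 wy1 wz1] : [/\ w0 x <= 1, w y <= 1 & w z <= 1].
  by split; apply: jw_le1 => //; lra.
have a2 : 1 <= 2 `^ alpha :> R by rewrite -[leLHS](powRr0 2); apply: ler_powR; rewrite // ler1n.
have k0 := kap_ge0 eta n l.
have p1 : 0 <= 2 `^ alpha * kap eta n l by rewrite mulr_ge0// powR_ge0.
have w0w : w0 x * w y * w z <= w y.
  by rewrite -mulrA mulrCA; apply: (ler_piMr wy); exact: mulr_ile1 w0x wz w0x1 wz1.
have w0w' : w0 x * w y * w z <= w z.
  by apply: (ler_piMl wz); exact: mulr_ile1 w0x wy w0x1 wy1.
have [n0|n0] := eqVneq n 0.
  rewrite /rr /resonant n0 eqxx mul0r addr0 /kap eqxx mulr1 -[leLHS]addr0.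
  apply: lerD; last by rewrite mulr_ge0 ?powR_ge0.
  by apply: le_trans w0w _; rewrite ler_peMl.
have [r|] := boolP (resonant n l x).
  by rewrite /rr r mul1r lerDr; apply: (addr_ge0 (mulr_ge0 p1 wy) (mulr_ge0 p1 wz)).
move=> nr; rewrite /rr (negbTE nr); move: nr; rewrite /resonant n0/= negb_or -ltNge => /andP[d0 xk].
rewrite mul0r addr0 /kap (negbTE n0) (negbTE d0).
rewrite /kap (negbTE n0) (negbTE d0) in p1.
have d0' : 0 < `|(dotz n l)%:~R| :> R by rewrite normr_gt0 intr_eq0.
have [yk|yk] := leP (`|(dotz n l)%:~R| / 2) `|y|.
  have := jw_le_far alpha0 d0' yk; rewrite -/(w y) => h.
  rewrite -[leLHS]add0r; apply: (lerD (mulr_ge0 p1 wy)).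
  by apply: (ler_wpM2r wz); apply: le_trans h; exact: (ler_piMl wy w0x1).
have zk : `|(dotz n l)%:~R| / 2 <= `|z|.
  have : `|2 * (dotz n l)%:~R| <= `|z| + `|x| + `|y|.
    rewrite (_ : 2 * _ = z - x - y); last by rewrite zE; ring.
    by apply: le_trans (ler_normB _ _) _; rewrite lerD2r ler_normB.
  by rewrite normrM ger0_norm//; lra.
have := jw_le_far alpha0 d0' zk; rewrite -/(w z) => h.
rewrite -[leLHS]addr0; apply: lerD (mulr_ge0 p1 wz).
by rewrite mulrAC; apply: (ler_wpM2r wy); apply: le_trans h; exact: (ler_piMl wz w0x1).
Qed.

Section functions.
Variables f0 f1 f2 : Z2 -> RT -> R.
Hypotheses (h0 : mass1 f0) (h1 : mass1 f1) (h2 : mass1 f2).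

Let s (n l : Z2) (p : RT * RT) : RT := p.1 + p.2 + 2 * (dotz n l)%:~R.
Let F n l p := f0 n p.1 * f2 l p.2 * f1 (n + l) (s n l p).

Let nF n l : nnm (F n l).
Proof.
apply: nnmM; last by apply: nnm_addc; exact: h1.1.
by apply: nnmM; [exact: (nnm_fst (h0.1 n))|exact: (nnm_snd (h2.1 l))].
Qed.

Let nwz n l : nnm (fun p => w (s n l p)). Proof. exact: nnm_addc. Qed.
Let nwy : nnm (fun p : RT * RT => w p.2). Proof. exact: nnm_snd. Qed.
Let nw0x : nnm (fun p : RT * RT => w0 p.1). Proof. exact: nnm_fst. Qed.
Let nrx n l : nnm (fun p : RT * RT => rr n l p.1). Proof. exact: nnm_fst. Qed.

Let www n l p := w0 p.1 * w p.2 * w (s n l p).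
Let nwww n l : nnm (www n l). Proof. exact: (nnmM (nnmM nw0x nwy) (nwz n l)). Qed.

(** Young's inequality integrates out the modulations and leaves the L^2 norms [G] at each
    frequency, for which [discrete_kap_le] is the estimate. *)
Let kap_part (S : seq Z2) : uniq S -> (\sum_(n <- S) \sum_(l <- S)
   (\int[mu2]_p (kap eta n l * (w p.2 * F n l p))%:E +
    \int[mu2]_p (kap eta n l * (w (s n l p) * F n l p))%:E) <=
   (Num.sqrt M * (left_bound eta + right_bound eta + 2))%:E)%E.
Proof.
move=> uS.
pose G f n := Num.sqrt (sqmass f n).
have G2 f n : mass1 f -> G f n ^+ 2 = sqmass f n by move=> hf; rewrite sqr_sqrtr// sqmass_ge0.
have iG f n : mass1 f -> (\int[mu]_x (f n x ^+ 2)%:E <= (G f n ^+ 2)%:E)%E.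
  by move=> hf; rewrite G2// sqmassE.
have iM : (\int[mu]_x (w x ^+ 2)%:E <= ((Num.sqrt M) ^+ 2)%:E)%E by rewrite sqr_sqrtr.
have lG f : mass1 f -> l1_le1 (fun n => G f n ^+ 2).
  by move=> hf; under [X in l1_le1 X]eq_fun do rewrite G2//; exact: sqmass_l1.
apply: (@le_trans _ _ (\sum_(n <- S) \sum_(l <- S)
    (2 * Num.sqrt M * (kap eta n l * (G f0 n * G f2 l * G f1 (n + l))))%:E)%E).
  apply: lee_sum => n _; apply: lee_sum => l _.
  rewrite (nnZl _ (kap_ge0 _ _ _) (nnmM nwy (nF n l))).
  rewrite (nnZl _ (kap_ge0 _ _ _) (nnmM (nwz n l) (nF n l))).
  rewrite (_ : 2 * _ * _ = kap eta n l * (Num.sqrt M * (G f0 n * G f2 l * G f1 (n + l))) +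
     kap eta n l * (Num.sqrt M * (G f0 n * G f2 l * G f1 (n + l)))); last by ring.
  rewrite EFinD EFinM; apply: leeD; apply: lee_wpmul2l; rewrite ?lee_fin ?kap_ge0//.
    by apply: young_snd; rewrite ?sqrtr_ge0//; [exact: h0.1|exact: h1.1|exact: h2.1|exact: iG..].
  by apply: young_add; rewrite ?sqrtr_ge0//; [exact: h0.1|exact: h1.1|exact: h2.1|exact: iG..].
under eq_bigr do rewrite sumEFin -mulr_sumr.
rewrite sumEFin lee_fin -mulr_sumr -mulrA mulrCA ler_wpM2l ?sqrtr_ge0//.
rewrite mulrC -ler_pdivlMr// mulrC.
by apply: discrete_kap_le => //; try exact: lG; move=> n; exact: sqrtr_ge0.
Qed.

Let conv_part (S : seq Z2) (P : Z2 -> Z2 -> bool) : uniq S ->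
  (\sum_(n <- S) \sum_(l <- S | P n l)
    \int[mu2]_p (f2 l p.2 ^+ 2 * f1 (n + l) (s n l p) ^+ 2)%:E <= 1)%E.
Proof.
move=> uS; apply: (@le_trans _ _ (\sum_(n <- S) \sum_(l <- S)
  (sqmass f2 l * sqmass f1 (n + l))%:E)%E).
  apply: lee_sum => n _; rewrite [leRHS](bigID (P n))/= -[leLHS]adde0; apply: leeD.
    apply: lee_sum => l _.
    by rewrite (integral_snd_add _ (nnmX 2 (h2.1 l)) (nnmX 2 (h1.1 (n + l)))) !sqmassE.
  by apply: sume_ge0 => l _; rewrite lee_fin mulr_ge0// sqmass_ge0.
under eq_bigr do rewrite sumEFin.
by rewrite sumEFin lee_fin; apply: l1_le1_conv => //; exact: sqmass_l1.
Qed.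

(** AM-GM puts all weights on [f0]: the term [A] carries them, while [B] is a convolution of total
    mass at most 1. In [A] the sum over [l] is bounded at each point by [sum_near_le], and the
    remaining [w p.2 ^+ 2] makes the integral in the second modulation finite. *)
Let near_part (S : seq Z2) : uniq S -> (\sum_(n <- S) \sum_(l <- S | near_orth n l)
   \int[mu2]_p (rr n l p.1 * (www n l p * F n l p))%:E <=
   (2^-1 * (10 * coset_bound eta * M + 1))%:E)%E.
Proof.
move=> uS.
pose A n l p := f0 n p.1 ^+ 2 * w p.2 ^+ 2 * (rr n l p.1 * (w0 p.1 ^+ 2 * w (s n l p) ^+ 2)).
pose B n l p := f2 l p.2 ^+ 2 * f1 (n + l) (s n l p) ^+ 2.
have nfw n : nnm (fun p : RT * RT => f0 n p.1 ^+ 2 * w p.2 ^+ 2).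
  by apply: nnmM; [exact: (nnm_fst (nnmX 2 (h0.1 n)))|exact: (nnm_snd (nnmX 2 nw))].
have nA n l : nnm (A n l).
  apply: nnmM => //; apply: nnmM => //; apply: nnmM; exact: nnmX.
have nB n l : nnm (B n l).
  by apply: nnmM; [exact: (nnm_snd (nnmX 2 (h2.1 l)))|exact: (nnm_addc _ (nnmX 2 (h1.1 (n + l))))].
apply: (@le_trans _ _ ((2^-1)%:E * \sum_(n <- S) \sum_(l <- S | near_orth n l)
   (\int[mu2]_p (A n l p)%:E + \int[mu2]_p (B n l p)%:E))%E).
  rewrite ge0_sume_distrr; last first.
    by move=> n _; apply: sume_ge0 => l _; apply: adde_ge0; [exact: nn_ge0 (nA _ _)|exact: nn_ge0 (nB _ _)].
  apply: lee_sum => n _.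
  rewrite ge0_sume_distrr; last by move=> l _; apply: adde_ge0; [exact: nn_ge0 (nA _ _)|exact: nn_ge0 (nB _ _)].
  apply: lee_sum => l _.
  rewrite -nnD// -nnZl//; last exact: nnmD.
  apply: nn_le.
  - by apply: nnmM => //; exact: nnmM.
  - by apply: nnmM; [exact: nnm_cst|exact: nnmD].
  move=> p; rewrite /A /B /www /F /rr.
  case: (resonant _ _ _); last first.
    rewrite !mul0r mulr0 add0r; apply: mulr_ge0; first by rewrite invr_ge0.
    by apply: mulr_ge0; exact: sqr_ge0.
  rewrite !mul1r; set a := f0 _ _; set b := f2 _ _; set c := f1 _ _.
  have := sqr_ge0 (a * w p.2 * (w0 p.1 * w (s n l p)) - b * c).
  by rewrite sqrrB !exprMn; lra.
rewrite EFinM; apply: lee_wpmul2l; rewrite ?lee_fin ?invr_ge0//.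
under eq_bigr do rewrite big_split/=.
rewrite big_split/= EFinD; apply: leeD; last exact: conv_part.
apply: (@le_trans _ _ (\sum_(n <- S) (10 * coset_bound eta * M * sqmass f0 n)%:E)%E); last first.
  rewrite sumEFin lee_fin -mulr_sumr ler_piMr//; last exact: (sqmass_l1 h0).2.
  by rewrite mulr_ge0// mulr_ge0// coset_bound_ge0.
apply: lee_sum => n _; rewrite -nn_sum//.
have [n0|n0] := eqVneq n 0.
  rewrite integral0_eq; last first.
    move=> p _; congr EFin; apply: big1 => l _.
    by rewrite /A /rr /resonant n0 eqxx mul0r mulr0.
  by rewrite lee_fin mulr_ge0 ?sqmass_ge0// mulr_ge0// mulr_ge0// coset_bound_ge0.
apply: (@le_trans _ _ (\int[mu2]_p (f0 n p.1 ^+ 2 * w p.2 ^+ 2 * (10 * coset_bound eta))%:E)%E).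
  apply: nn_le; first exact: nnm_sum.
    by apply: nnmM => //; apply: nnm_cst; rewrite mulr_ge0// coset_bound_ge0.
  move=> p; rewrite /A -mulr_sumr; apply: ler_wpM2l.
    by apply: mulr_ge0; exact: sqr_ge0.
  rewrite /rr (bigID (fun l => resonant n l p.1))/= [X in _ + X]big1 ?addr0; last first.
    by move=> l /andP[_ /negbTE ->]; rewrite mul0r.
  rewrite -big_filter.
  rewrite big_seq (eq_bigr (fun l => jw (3 / 4) p.1 *
      jw (1 + eta) (p.1 + p.2 + 2 * (dotz n l)%:~R))); last first.
    move=> l; rewrite mem_filter => /andP[/andP[_ ->] _].
    by rewrite mul1r w02E w2E.
  rewrite -big_seq; apply: sum_near_le => //; first exact: filter_uniq.
    by move=> l; rewrite mem_filter => /andP[/andP[]].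
  move=> l; rewrite mem_filter /resonant n0/= => /andP[/andP[_ /orP[/eqP->|]] //].
  by rewrite eqxx.
rewrite nnZr//; last by rewrite mulr_ge0// coset_bound_ge0.
rewrite (integral_fst_snd (nnmX 2 (h0.1 n)) (nnmX 2 nw)) sqmassE//.
rewrite (_ : 10 * _ * _ * _ = sqmass f0 n * M * (10 * coset_bound eta)); last by ring.
rewrite !EFinM; apply: lee_wpmul2r; first by rewrite -EFinM lee_fin mulr_ge0// coset_bound_ge0.
by apply: lee_wpmul2l => //; rewrite lee_fin sqmass_ge0.
Qed.

(** On a line [om n . l = m] the modulation [z] does not depend on [l], so the weights leave the sum
    and Cauchy-Schwarz is applied to the points of one line only. Here [r] is the output weight cut
    to the resonant region, with [r ^+ 2 <= 2 * thin_weight m]; this 2 cancels the one half of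
    AM-GM. *)
Let far_pointwise (n : Z2) (S : seq Z2) p : n != 0 -> uniq S ->
  \sum_(l <- S | ~~ near_orth n l) rr n l p.1 * (www n l p * F n l p) <=
  \sum_(m <- undup (map (dotz (om n)) [seq l <- S | ~~ near_orth n l]))
    (2^-1 * (f0 n p.1 ^+ 2 * w p.2 ^+ 2 * jw (1 + eta) (p.1 + p.2 + 2 * (gz n * m)%:~R)) +
     thin_weight m *
       ((\sum_(l <- [seq l <- S | ~~ near_orth n l] | dotz (om n) l == m) f2 l p.2 ^+ 2) *
        (\sum_(l <- S | dotz (om n) l == m)
            f1 (n + l) (p.1 + p.2 + 2 * (gz n * m)%:~R) ^+ 2))).
Proof.
move=> n0 uS; rewrite -big_filter; set T := [seq l <- S | _].
rewrite (partition_big_undup T (dotz (om n))); apply: ler_sum => m _.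
set z := p.1 + p.2 + 2 * (gz n * m)%:~R.
pose r : R := ((gz n * m == 0) || (`|(gz n * m)%:~R| / 2 <= `|p.1 : R|))%:R * w0 p.1.
have r2 : r ^+ 2 <= 2 * thin_weight m.
  rewrite /r; have [rs|_] := boolP (_ || _); last first.
    by rewrite mul0r expr0n/= mulr_ge0// thin_weight_ge0.
  rewrite mul1r w02E /thin_weight; have g1 := gz_ge1 n0.
  have [m0|m0] := eqVneq m 0.
    by apply: (@le_trans _ _ 1); [apply: jw_le1; lra|lra].
  move: rs; rewrite mulf_eq0 (negbTE m0) orbF gt_eqF/=; last by lia.
  move=> xk; have xm : `|m%:~R| / 2 <= `|p.1 : R|.
    apply: le_trans xk; rewrite ler_pM2r// -!intr_norm ler_int.
    by nia.
  have m1 : 0 < `|m%:~R| :> R by rewrite normr_gt0 intr_eq0.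
  apply: le_trans (@jw_le_far _ (3 / 4) p.1 `|m%:~R| _ m1 xm) _; first by lra.
  rewrite ler_wpM2r ?powR_ge0//; apply: ler1_powR; lra.
have r0 : 0 <= r by apply: mulr_ge0 => //; exact: jw_ge0.
have zw0 : 0 <= w z by exact: jw_ge0.
have yw0 : 0 <= w p.2 by exact: jw_ge0.
have x0 : 0 <= f0 n p.1 by case: (h0.1 n).
rewrite (eq_bigr (fun l => (f0 n p.1 * w p.2 * w z * r) * (f2 l p.2 * f1 (n + l) z))); last first.
  move=> l /eqP lm; rewrite /rr /resonant n0/= /www /F /s dotz_om// lm -/z /r.
  by move: (_%:R) => q; ring.
rewrite -mulr_sumr; set Y := \sum_(_ <- _ | _) _.
have hY : Y ^+ 2 <= (\sum_(l <- T | dotz (om n) l == m) f2 l p.2 ^+ 2) *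
        (\sum_(l <- S | dotz (om n) l == m) f1 (n + l) z ^+ 2).
  apply: le_trans (cauchy_schwarz_sum _ _ _ _) _.
  apply: ler_wpM2l; first by apply: sumr_ge0 => l _; exact: sqr_ge0.
  rewrite /T big_filter_cond big_mkcond [leRHS]big_mkcond; apply: ler_sum => l _.
  by case: (dotz _ _ == m); rewrite ?andbF//; case: ifP => // _; exact: sqr_ge0.
move: hY; set Q := _ * _ => hY.
have := sqr_ge0 (f0 n p.1 * w p.2 * w z - r * Y).
have : r ^+ 2 * Y ^+ 2 <= 2 * thin_weight m * Q by apply: ler_pM => //; exact: sqr_ge0.
rewrite -w2E sqrrB !exprMn; lra.
Qed.

(** In the terms [X] the argument of the weight runs through a progression in [m], summed by
    [sum_jw_coset_le]. The terms [Z] carry no weight in the modulations; integration leaves the sum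
    of [discrete_thin_le]. There [f2] is restricted to the far points of a line, while [f1] sees the
    whole line. *)
Let far_part (S : seq Z2) : uniq S -> (\sum_(n <- S) \sum_(l <- S | ~~ near_orth n l)
   \int[mu2]_p (rr n l p.1 * (www n l p * F n l p))%:E <=
   (2^-1 * (coset_bound eta * M) + thin_bound)%:E)%E.
Proof.
move=> uS.
have nrF n l : nnm (fun p => rr n l p.1 * (www n l p * F n l p)).
  by apply: nnmM => //; exact: nnmM.
pose T n := [seq l <- S | ~~ near_orth n l].
pose Y2 n m (y : RT) := \sum_(l <- T n | dotz (om n) l == m) f2 l y ^+ 2.
pose Y1 n m (z : RT) := \sum_(l <- S | dotz (om n) l == m) f1 (n + l) z ^+ 2.
pose X n m p := 2^-1 * (f0 n p.1 ^+ 2 * w p.2 ^+ 2 *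
   jw (1 + eta) (p.1 + p.2 + 2 * (gz n * m)%:~R)).
pose Z n m (p : RT * RT) := thin_weight m * (Y2 n m p.2 * Y1 n m (p.1 + p.2 + 2 * (gz n * m)%:~R)).
have nY2 n m : nnm (Y2 n m) by apply: nnm_sum => l; exact: (nnmX 2 (h2.1 l)).
have nY1 n m : nnm (Y1 n m) by apply: nnm_sum => l; exact: (nnmX 2 (h1.1 (n + l))).
have nfw n : nnm (fun p : RT * RT => f0 n p.1 ^+ 2 * w p.2 ^+ 2).
  by apply: nnmM; [exact: (nnm_fst (nnmX 2 (h0.1 n)))|exact: (nnm_snd (nnmX 2 nw))].
have nX n m : nnm (X n m).
  apply: nnmM; first by apply: nnm_cst; rewrite invr_ge0.
  by apply: nnmM => //; apply: nnm_addc; exact: nnm_jw.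
have nYY n m : nnm (fun p : RT * RT => Y2 n m p.2 * Y1 n m (p.1 + p.2 + 2 * (gz n * m)%:~R)).
  by apply: nnmM; [exact: (nnm_snd (nY2 n m))|exact: (nnm_addc _ (nY1 n m))].
have nZ n m : nnm (Z n m) by apply: nnmM => //; apply: nnm_cst; exact: thin_weight_ge0.
have c0 : 0 <= 2^-1 * (coset_bound eta * M).
  by apply: mulr_ge0; [rewrite invr_ge0|apply: mulr_ge0 => //; exact: coset_bound_ge0].
pose E (n : Z2) : R := 2^-1 * (coset_bound eta * M) * sqmass f0 n +
  \sum_(l <- S | ~~ near_orth n l) thin_weight (dotz (om n) l) *
     (sqmass f2 l * \sum_(l' <- S | dotz (om n) l' == dotz (om n) l) sqmass f1 (n + l')).
have step n : n != 0 -> (\sum_(l <- S | ~~ near_orth n l)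
   \int[mu2]_p (rr n l p.1 * (www n l p * F n l p))%:E <=
   (E n)%:E)%E.
  move=> n0; rewrite -nn_sum// /E.
  set Mn := undup (map (dotz (om n)) (T n)).
  apply: (@le_trans _ _ (\int[mu2]_p (\sum_(m <- Mn) (X n m p + Z n m p))%:E)%E).
    apply: nn_le; first exact: nnm_sum.
      by apply: nnm_sum => m; exact: nnmD.
    by move=> p; exact: far_pointwise.
  under eq_integral do rewrite big_split/=.
  rewrite nnD; [|exact: nnm_sum|exact: nnm_sum].
  rewrite EFinD; apply: leeD.
    apply: (@le_trans _ _ (\int[mu2]_p (f0 n p.1 ^+ 2 * w p.2 ^+ 2 *
        (2^-1 * coset_bound eta))%:E)%E).
      apply: nn_le; first exact: nnm_sum.
        apply: nnmM => //; apply: nnm_cst; apply: mulr_ge0; first by rewrite invr_ge0.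
        exact: coset_bound_ge0.
      move=> p; rewrite /X -!mulr_sumr mulrCA; apply: ler_wpM2l.
        by apply: mulr_ge0; exact: sqr_ge0.
      by rewrite ler_pM2l ?invr_gt0// sum_jw_coset_le ?gz_ge1// undup_uniq.
    rewrite nnZr//; last first.
      by apply: mulr_ge0; [rewrite invr_ge0|exact: coset_bound_ge0].
    rewrite (integral_fst_snd (nnmX 2 (h0.1 n)) (nnmX 2 nw)) sqmassE//.
    rewrite (_ : 2^-1 * _ * sqmass f0 n = sqmass f0 n * M * (2^-1 * coset_bound eta)); last by ring.
    rewrite (EFinM (sqmass f0 n * M)); apply: lee_wpmul2r.
      by rewrite lee_fin; apply: mulr_ge0; [rewrite invr_ge0|exact: coset_bound_ge0].
    by rewrite EFinM; apply: lee_wpmul2l => //; rewrite lee_fin sqmass_ge0.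
  rewrite nn_sum//.
  under eq_bigr => m _.
    rewrite nnZl ?thin_weight_ge0// (integral_snd_add _ (nY2 n m) (nY1 n m)).
    rewrite /Y2 /Y1 nn_sum; last by move=> l; exact: (nnmX 2 (h2.1 l)).
    rewrite nn_sum; last by move=> l; exact: (nnmX 2 (h1.1 (n + l))).
    under eq_bigr do rewrite sqmassE//.
    under [X in (_ * (_ * X))%E]eq_bigr do rewrite sqmassE//.
    rewrite !sumEFin -!EFinM; over.
  rewrite sumEFin lee_fin -[leRHS]big_filter -/(T n).
  rewrite [leRHS](partition_big_undup (T n) (dotz (om n))).
  apply: ler_sum => m _; rewrite mulr_suml mulr_sumr.
  by apply: ler_sum => l /eqP ->.
apply: (@le_trans _ _ (\sum_(n <- S | n != 0%R)
   (E n)%:E)%E).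
  rewrite [leRHS]big_mkcond; apply: lee_sum => n _; case: ifPn => [n0|]; first exact: step.
  rewrite negbK => /eqP ->; rewrite big1// => l _.
  apply: integral0_eq => p _; congr EFin.
  by rewrite /rr /resonant eqxx mul0r.
rewrite sumEFin lee_fin /E big_split/=; apply: lerD; last first.
  by apply: discrete_thin_le => //; exact: sqmass_l1.
rewrite -mulr_sumr ler_piMr// -big_filter; apply: (sqmass_l1 h0).2; exact: filter_uniq.
Qed.

Definition trilinear_bound : R :=
  2 `^ alpha * (Num.sqrt M * (left_bound eta + right_bound eta + 2)) +
  (2^-1 * (10 * coset_bound eta * M + 1) + (2^-1 * (coset_bound eta * M) + thin_bound)).

Lemma trilinear_mass1 (S : seq Z2) : uniq S -> (\sum_(n <- S) \sum_(l <- S)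
   \int[mu2]_p (w0 p.1 * w p.2 * w (p.1 + p.2 + 2 * (dotz n l)%:~R) *
     (f0 n p.1 * f2 l p.2 * f1 (n + l) (p.1 + p.2 + 2 * (dotz n l)%:~R)))%:E <=
   trilinear_bound%:E)%E.
Proof.
move=> uS; have nka n l : nnm (fun p => kap eta n l * (w p.2 * F n l p)).
  by apply: nnmM; [apply: nnm_cst; exact: kap_ge0|exact: nnmM].
have nkb n l : nnm (fun p => kap eta n l * (w (s n l p) * F n l p)).
  by apply: nnmM; [apply: nnm_cst; exact: kap_ge0|exact: nnmM].
have nrF n l : nnm (fun p => rr n l p.1 * (www n l p * F n l p)).
  by apply: nnmM => //; exact: nnmM.
have p0 : 0 <= 2 `^ alpha :> R by exact: powR_ge0.
apply: (@le_trans _ _ (\sum_(n <- S) \sum_(l <- S)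
   ((2 `^ alpha)%:E * (\int[mu2]_p (kap eta n l * (w p.2 * F n l p))%:E +
       \int[mu2]_p (kap eta n l * (w (s n l p) * F n l p))%:E) +
    \int[mu2]_p (rr n l p.1 * (www n l p * F n l p))%:E))%E).
  apply: lee_sum => n _; apply: lee_sum => l _.
  rewrite -nnD// -nnZl//; last exact: nnmD.
  rewrite -nnD//; last by apply: nnmM; [exact: nnm_cst|exact: nnmD].
  apply: nn_le; first exact: (nnmM (nwww n l) (nF n l)).
    by apply: nnmD => //; apply: nnmM; [exact: nnm_cst|exact: nnmD].
  move=> p; have := @weight_split n l p.1 p.2 (s n l p) erefl.
  have F0 : 0 <= F n l p by case: (nF n l).
  move=> /(ler_wpM2r F0) /le_trans; apply.
  by rewrite le_eqVlt; apply/orP; left; apply/eqP; rewrite /www; ring.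
under eq_bigr do rewrite big_split/=.
rewrite big_split/= EFinD; apply: leeD.
  under eq_bigr => n _.
    rewrite -ge0_sume_distrr; last first.
      by move=> l _; apply: adde_ge0; [exact: nn_ge0 (nka _ _)|exact: nn_ge0 (nkb _ _)].
    over.
  rewrite -ge0_sume_distrr; last first.
    move=> n _; apply: sume_ge0 => l _.
    by apply: adde_ge0; [exact: nn_ge0 (nka _ _)|exact: nn_ge0 (nkb _ _)].
  by rewrite EFinM; apply: lee_wpmul2l => //; exact: kap_part.
under eq_bigr => n _ do rewrite (bigID (near_orth n))/=.
by rewrite big_split/= EFinD; apply: leeD; [exact: near_part|exact: far_part].
Qed.

End functions.
End trilinear.

(** * Schwartz functions *)

Section schwartz_calculus.
Context {R : realType}.
Local Notation ST := (spacetime R).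
Implicit Types f g : ST -> R.

Lemma iter_derive_rcons w v f : iter_derive w ('D_v f) = iter_derive (rcons w v) f.
Proof. by elim: w => //= u w ->. Qed.

Lemma real_schwartz_derive v f : real_schwartz f -> real_schwartz ('D_v f).
Proof. by case=> df bf; split=> [w u p|w k]; rewrite iter_derive_rcons. Qed.

Section combination.
Variables (a : R) (f g : ST -> R).
Hypotheses (sf : real_schwartz f) (sg : real_schwartz g).

Lemma iter_derive_comb w : iter_derive w (fun p => f p + a * g p) =
  fun p => iter_derive w f p + a * iter_derive w g p.
Proof.
elim: w => //= v w ->; apply/funext => p.
rewrite (@deriveD _ _ _ (iter_derive w f) (fun p => a * iter_derive w g p)).
- by congr (_ + _); apply: (@deriveZ _ _ _ (iter_derive w g) a); exact: sg.1.
- exact: sf.1.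
- by apply: (@derivableZ _ _ _ (iter_derive w g) a); exact: sg.1.
Qed.

Lemma real_schwartz_comb : real_schwartz (fun p => f p + a * g p).
Proof.
split=> [w v p|w k]; rewrite iter_derive_comb.
  apply: (@derivableD _ _ _ (iter_derive w f) (fun p => a * iter_derive w g p)).
    exact: sf.1.
  by apply: (@derivableZ _ _ _ (iter_derive w g) a); exact: sg.1.
have [A hA] := sf.2 w k; have [B hB] := sg.2 w k.
exists (A + `|a| * B) => p; apply: (@le_trans _ _
  (`|p.1| ^+ k * (`|iter_derive w f p| + `|a| * `|iter_derive w g p|))).
  rewrite ler_wpM2l ?exprn_ge0//; apply: le_trans (ler_normD _ _) _.
  by rewrite normrM.
by rewrite mulrDr lerD// mulrCA ler_wpM2l.
Qed.

End combination.

Lemma real_schwartz0 : real_schwartz (fun=> 0 : R).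
Proof.
have e w : iter_derive w (fun _ : ST => 0 : R) = fun=> 0.
  by elim: w => //= v w ->; apply/funext => p; exact: derive_cst.
split=> [w v p|w k]; rewrite e; first exact: derivable_cst.
by exists 0 => p; rewrite normr0 mulr0.
Qed.

Lemma real_schwartzD f g : real_schwartz f -> real_schwartz g ->
  real_schwartz (fun p => f p + g p).
Proof.
move=> sf sg; have := real_schwartz_comb 1 sf sg.
by under [X in real_schwartz X -> _]eq_fun do rewrite mul1r.
Qed.

Lemma real_schwartzB f g : real_schwartz f -> real_schwartz g ->
  real_schwartz (fun p => f p - g p).
Proof.
move=> sf sg; have := real_schwartz_comb (-1) sf sg.
by under [X in real_schwartz X -> _]eq_fun do rewrite mulN1r.
Qed.

Lemma real_schwartzN f : real_schwartz f -> real_schwartz (fun p => - f p).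
Proof.
move=> sf; have := real_schwartzB real_schwartz0 sf.
by under [X in real_schwartz X -> _]eq_fun do rewrite sub0r.
Qed.

(* Leibniz' rule: the pairs of words enumerate the terms. *)
Fixpoint leibniz (w : seq ST) : seq (seq ST * seq ST) :=
  if w is v :: w' then
    [seq (v :: x.1, x.2) | x <- leibniz w'] ++ [seq (x.1, v :: x.2) | x <- leibniz w']
  else [:: ([::], [::])].

Lemma derivable_bigsum (I : Type) (s : seq I) (F : I -> ST -> R) p v :
  (forall i, derivable (F i) p v) ->
  derivable (fun p => \sum_(i <- s) F i p) p v /\
  'D_v (fun p => \sum_(i <- s) F i p) p = \sum_(i <- s) 'D_v (F i) p.
Proof.
move=> dF; elim: s => [|i s [ih1 ih2]].
  have -> : (fun p => \sum_(i <- [::]) F i p) = cst 0 by apply/funext => q; rewrite big_nil.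
  by rewrite big_nil; split; [exact: derivable_cst|exact: derive_cst].
have e : (fun p => \sum_(j <- i :: s) F j p) = F i + (fun p => \sum_(j <- s) F j p).
  by apply/funext => q; rewrite big_cons.
rewrite e; split; first exact: derivableD.
by rewrite deriveD// big_cons ih2.
Qed.

Section product.
Variables f g : ST -> R.
Hypotheses (sf : real_schwartz f) (sg : real_schwartz g).

Lemma derivable_prod p v (w1 w2 : seq ST) :
  derivable (fun p => iter_derive w1 f p * iter_derive w2 g p) p v /\
  'D_v (fun p => iter_derive w1 f p * iter_derive w2 g p) p =
    iter_derive (v :: w1) f p * iter_derive w2 g p +
    iter_derive w1 f p * iter_derive (v :: w2) g p.
Proof.
split; first by apply: (@derivableM _ _ (iter_derive w1 f) (iter_derive w2 g)); [exact: sf.1|exact: sg.1].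
rewrite (@deriveM _ _ (iter_derive w1 f) (iter_derive w2 g)); [|exact: sf.1|exact: sg.1].
by rewrite addrC /= [X in X + _]mulrC.
Qed.

Lemma iter_derive_prod w : iter_derive w (fun p => f p * g p) =
  fun p => \sum_(x <- leibniz w) iter_derive x.1 f p * iter_derive x.2 g p.
Proof.
elim: w => [|v w ih]; first by apply/funext => p /=; rewrite big_seq1.
rewrite /= ih; apply/funext => p.
rewrite (derivable_bigsum _ _).2; last by move=> x; exact: (derivable_prod p v x.1 x.2).1.
rewrite big_cat/= !big_map -big_split/=; apply: eq_bigr => x _.
by rewrite (derivable_prod _ _ _ _).2.
Qed.

Lemma real_schwartzM : real_schwartz (fun p => f p * g p).
Proof.
split=> [w v p|w k]; rewrite iter_derive_prod.
  by apply: (derivable_bigsum _ _).1 => x; exact: (derivable_prod p v x.1 x.2).1.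
elim: (leibniz w) => [|x s [M hM]].
  by exists 0 => p; rewrite big_nil normr0 mulr0.
have [A hA] := sf.2 x.1 k; have [B hB] := sg.2 x.2 0%N.
exists (A * B + M) => p; rewrite big_cons.
apply: (@le_trans _ _ (`|p.1| ^+ k * (`|iter_derive x.1 f p * iter_derive x.2 g p| +
   `|\sum_(j <- s) iter_derive j.1 f p * iter_derive j.2 g p|))).
  by rewrite ler_wpM2l ?exprn_ge0// ler_normD.
rewrite mulrDr lerD// normrM mulrA; apply: ler_pM => //.
by have := hB p; rewrite expr0 mul1r.
Qed.

End product.

Lemma real_schwartz_decay f : real_schwartz f ->
  exists2 M, 0 < M & forall p, `|f p| * ((1 + p.1 ^+ 2) * (1 + `|p.1|)) <= M.
Proof.
case=> _ bf; have [A hA] := bf [::] 0%N; have [B hB] := bf [::] 1%N.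
have [C hC] := bf [::] 2%N; have [D hD] := bf [::] 3%N.
have M0 : 0 <= A + B + C + D.
  have := hA 0; have := hB 0; have := hC 0; have := hD 0 => /=.
  rewrite normr0 expr0 expr1 !expr0n/= !mul0r mul1r => d0 c0 b0 a0.
  by have := normr_ge0 (f 0); lra.
exists (A + B + C + D + 1) => [|p]; first by lra.
have := hA p; have := hB p; have := hC p; have := hD p => /=.
rewrite expr0 mul1r expr1 -[p.1 ^+ 2]real_normK ?num_real//.
move: (`|f p|) (`|p.1|) => x y d c b a.
have -> : x * ((1 + y ^+ 2) * (1 + y)) = x + y * x + y ^+ 2 * x + y ^+ 3 * x by ring.
lra.
Qed.

Definition st1 : ST := (1, (0, 0)).
Definition st2 : ST := (0, (1, 0)).
Definition st3 : ST := (0, (0, 1)).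

Lemma is_derive_line f (p v : ST) : (forall q, derivable f q v) ->
  forall h : R, is_derive h 1 (fun h : R => f (p + h *: v)) ('D_v f (p + h *: v)).
Proof.
move=> df h.
have e : (fun k : R => k^-1 *: (((fun h : R => f (p + h *: v)) \o shift h) (k *: 1) -
    f (p + h *: v))) =
  (fun k : R => k^-1 *: ((f \o shift (p + h *: v)) (k *: v) - f (p + h *: v))).
  apply/funext => k /=; congr (_ *: (f _ - _)).
  by rewrite [_%:A]mulr1 scalerDl addrCA.
by apply: DeriveDef; rewrite /derivable /derive e//; exact: df.
Qed.

Lemma line_lipschitz f (p v : ST) (M h : R) : (forall q, derivable f q v) ->
  (forall q, `|'D_v f q| <= M) -> `|f (p + h *: v) - f p| <= M * `|h|.
Proof.
move=> df bM; have dl := is_derive_line p df.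
have cl : continuous (fun h : R => f (p + h *: v)).
  move=> x; apply: differentiable_continuous; apply/derivable1_diffP.
  exact: (@ex_derive _ _ _ _ _ _ _ (dl x)).
have fp : f p = f (p + 0 *: v) by rewrite scale0r addr0.
have [h0|h0] := leP 0 h.
  have [|c _ ] := @MVT_segment R (fun h => f (p + h *: v)) _ 0 h h0 (fun x _ => dl x).
    exact: continuous_subspaceT.
  by rewrite -fp => ->; rewrite subr0 normrM ler_wpM2r.
have [|c _ ] := @MVT_segment R (fun h => f (p + h *: v)) _ h 0 (ltW h0) (fun x _ => dl x).
  exact: continuous_subspaceT.
by rewrite -fp sub0r => e; rewrite distrC e normrM normrN ler_wpM2r.
Qed.

Definition st_lipschitz (L : R) f := forall p q : ST,
  `|f p - f q| <= L * (`|p.1 - q.1| + `|p.2.1 - q.2.1| + `|p.2.2 - q.2.2|).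

(** The hypothesis speaks of directional derivatives only, so the increment is split along the three
    axes and the mean value theorem applied to each piece. The Lipschitz bound serves twice: for
    measurability and for the mollification error. *)
Lemma real_schwartz_lipschitz f : real_schwartz f -> exists2 L, 0 < L & st_lipschitz L f.
Proof.
move=> sf; have df v q : derivable f q v by exact: (sf.1 [::] v q).
have [A hA] := sf.2 [:: st1] 0%N; have [B hB] := sf.2 [:: st2] 0%N.
have [C hC] := sf.2 [:: st3] 0%N.
have dA q : `|'D_st1 f q| <= A by have := hA q; rewrite expr0 mul1r.
have dB q : `|'D_st2 f q| <= B by have := hB q; rewrite expr0 mul1r.
have dC q : `|'D_st3 f q| <= C by have := hC q; rewrite expr0 mul1r.
have [A0 B0 C0] : [/\ 0 <= A, 0 <= B & 0 <= C].
  by split; [apply: le_trans (dA 0)|apply: le_trans (dB 0)|apply: le_trans (dC 0)].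
exists (A + B + C + 1) => [|[t [x y]] [t' [x' y']] /=]; first by lra.
have h1 := line_lipschitz (t', (x', y')) (t - t') (df st1) dA.
have h2 := line_lipschitz (t, (x', y')) (x - x') (df st2) dB.
have h3 := line_lipschitz (t, (x, y')) (y - y') (df st3) dC.
have e1 : (t', (x', y')) + (t - t') *: st1 = (t, (x', y')).
  by congr (_, (_, _)) => /=; rewrite ?[_ *: 1]mulr1 ?[_ *: 0]mulr0 ?addr0// addrC subrK.
have e2 : (t, (x', y')) + (x - x') *: st2 = (t, (x, y')).
  by congr (_, (_, _)) => /=; rewrite ?[_ *: 1]mulr1 ?[_ *: 0]mulr0 ?addr0// addrC subrK.
have e3 : (t, (x, y')) + (y - y') *: st3 = (t, (x, y)).
  by congr (_, (_, _)) => /=; rewrite ?[_ *: 1]mulr1 ?[_ *: 0]mulr0 ?addr0// addrC subrK.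
rewrite e1 in h1; rewrite e2 in h2; rewrite e3 in h3.
have -> : f (t, (x, y)) - f (t', (x', y')) = (f (t, (x, y)) - f (t, (x, y'))) +
  (f (t, (x, y')) - f (t, (x', y'))) + (f (t, (x', y')) - f (t', (x', y'))) by ring.
apply: le_trans (ler_normD _ _) _.
have := ler_normD (f (t, (x, y)) - f (t, (x, y'))) (f (t, (x, y')) - f (t, (x', y'))).
have := normr_ge0 (t - t'); have := normr_ge0 (x - x'); have := normr_ge0 (y - y').
move: h1 h2 h3; move: (`|t - t'|) (`|x - x'|) (`|y - y'|) => a b c.
move: (`|_ - _|) (`|_ - _|) (`|_ - _|) (`|_ + _|) => u v w z.
by nra.
Qed.

End schwartz_calculus.

(** * Measurability of Lipschitz functions for the product structure *)

Section lipschitz_measurable.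
Context {R : realType}.
Local Notation RT := (measurableTypeR R).
Local Notation ST := (RT * (RT * RT))%type.

Definition cell (N : nat) (i : int) : RT -> R := fun x => (Num.floor (N.+1%:R * x) == i)%:R.

Lemma nnm_cell N i : nnm (cell N i).
Proof.
split=> [|x]; last by rewrite ler0n.
have -> : cell N i = \1_[set x : RT | i%:~R <= N.+1%:R * x < (i + 1)%:~R].
  apply/funext => x; rewrite /cell floor_eq indicE.
  by case: (boolP (_ <= _ < _)) => h; [rewrite mem_set|rewrite memNset//; exact/negP].
apply: measurable_indic.
have m : measurable_fun setT (fun x : RT => (N.+1%:R * x : R)).
  by apply: measurable_funM => //; exact: measurable_cst.
have := m measurableT `[i%:~R, (i + 1)%:~R[%classic (measurable_itv _); rewrite setTI.
by congr (measurable _); apply/seteqP; split => x /=; rewrite in_itv.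
Qed.

(** The [2 (N + 1)^2] cells of width [1 / (N + 1)] that cover [[- (N + 1), N + 1)]: the mesh tends
    to 0 while the range grows. *)
Let grid (N : nat) : seq int := [seq i%:Z - (N.+1 * N.+1)%:Z | i <- iota 0 (2 * (N.+1 * N.+1))].

Let grid_uniq N : uniq (grid N).
Proof. by rewrite map_inj_uniq ?iota_uniq// => a b /=; lia. Qed.

Let grid_floor N (x : R) : `|x| < N.+1%:R -> Num.floor (N.+1%:R * x) \in grid N.
Proof.
move=> xN; have N0 : 0 < N.+1%:R :> R by rewrite ltr0n.
set j := Num.floor _; have NN : `|N.+1%:R * x| < (N.+1 * N.+1)%:R.
  by rewrite normrM ger0_norm// natrM ltr_pM2l.
move: NN; rewrite ltr_norml => /andP[h1 h2].
have j1 : - (N.+1 * N.+1)%:Z <= j.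
  by rewrite floor_ge_int mulrNz -pmulrn ltW.
have j2 : j < (N.+1 * N.+1)%:Z by rewrite floor_lt_int -pmulrn.
apply/mapP; exists (absz (j + (N.+1 * N.+1)%:Z)%R).
  by rewrite mem_iota; lia.
by rewrite gez0_abs ?addrK//; lia.
Qed.

Let sum_cell N (x : R) (a : int -> R) : `|x| < N.+1%:R ->
  \sum_(i <- grid N) cell N i x * a i = a (Num.floor (N.+1%:R * x)).
Proof.
move=> xN; rewrite (big_rem (Num.floor (N.+1%:R * x)))/=; last exact: grid_floor.
rewrite /cell eqxx mul1r big_seq big1 ?addr0// => i.
rewrite (mem_rem_uniq _ (grid_uniq N)) inE => /andP[/negbTE]; rewrite eq_sym => -> _.
by rewrite mul0r.
Qed.

(** The function is the pointwise limit of step functions on products of cells, which are measurable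
    for the product sigma-algebra coordinate by coordinate. *)
Lemma st_lipschitz_measurable (L : R) (f : spacetime R -> R) :
  st_lipschitz L f -> measurable_fun setT (f : ST -> R).
Proof.
move=> lf.
pose pt (N : nat) (i : int) : R := i%:~R / N.+1%:R.
pose h N (p : ST) := \sum_(i <- grid N) cell N i p.1 * (\sum_(j <- grid N) cell N j p.2.1 *
   (\sum_(k <- grid N) cell N k p.2.2 * f (pt N i, (pt N j, pt N k)))).
apply: (@measurable_fun_cvg _ _ _ setT h) => [N|p _].
  have ms (g : int -> ST -> R) : (forall i, measurable_fun setT (g i)) ->
      measurable_fun setT (fun p => \sum_(i <- grid N) g i p).
    move=> mg; elim: (grid N) => [|i s ih].
      by rewrite (_ : (fun p => _) = cst 0)//; apply/funext => p; rewrite big_nil.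
    rewrite (_ : (fun p => _) = g i \+ (fun p => \sum_(j <- s) g j p)); last first.
      by apply/funext => p; rewrite big_cons.
    exact: measurable_funD.
  have m1 i : measurable_fun setT (fun p : ST => cell N i p.1).
    by apply: (measurableT_comp (nnm_cell N i).1).
  have m2 i : measurable_fun setT (fun p : ST => cell N i p.2.1).
    apply: (measurableT_comp (nnm_cell N i).1).
    exact: (measurableT_comp measurable_fst measurable_snd).
  have m3 i : measurable_fun setT (fun p : ST => cell N i p.2.2).
    apply: (measurableT_comp (nnm_cell N i).1).
    exact: (measurableT_comp measurable_snd measurable_snd).
  apply: (ms (fun i p => _)) => i; apply: measurable_funM => //.
  apply: (ms (fun j p => _)) => j; apply: measurable_funM => //.
  apply: (ms (fun k p => _)) => k; apply: measurable_funM => //; exact: measurable_cst.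
have L0 : 0 <= L.
  have := lf 0 (1, (0, 0)) => /=; rewrite !subrr sub0r normrN normr0 normr1 !addr0 mulr1.
  exact: le_trans.
apply/cvgrPdist_le => e e0.
pose K := `|p.1| + `|p.2.1| + `|p.2.2| + 3 * L / e.
near=> N.
have KN : K < N.+1%:R.
  apply: (@le_lt_trans _ _ N%:R); last by rewrite ltr_nat.
  by near: N; exact: nbhs_infty_ger.
have N0 : 0 < N.+1%:R :> R by rewrite ltr0n.
have Le0 : 0 <= 3 * L / e by rewrite divr_ge0// ?mulr_ge0// ltW.
have a1 := normr_ge0 p.1; have a2 := normr_ge0 p.2.1; have a3 := normr_ge0 p.2.2.
have -> : h N p = f (pt N (Num.floor (N.+1%:R * p.1)), (pt N (Num.floor (N.+1%:R * p.2.1)),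
    pt N (Num.floor (N.+1%:R * p.2.2)))).
  rewrite /h sum_cell; last by rewrite /K in KN; lra.
  rewrite sum_cell; last by rewrite /K in KN; lra.
  by rewrite sum_cell//; rewrite /K in KN; lra.
have close (x : R) : `|x - pt N (Num.floor (N.+1%:R * x))| <= N.+1%:R^-1.
  rewrite -(ler_pM2l N0) mulfV ?gt_eqF// -[X in X * _](gtr0_norm N0) -normrM mulrBr /pt.
  rewrite [N.+1%:R * (_ / _)]mulrC mulfVK ?gt_eqF//.
  have := floor_le (N.+1%:R * x); have := floorD1_gt (N.+1%:R * x); rewrite intrD => h1 h2.
  by rewrite ler_norml; apply/andP; split; lra.
apply: le_trans (lf _ _) _ => /=.
apply: (@le_trans _ _ (L * (N.+1%:R^-1 + N.+1%:R^-1 + N.+1%:R^-1))).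
  by rewrite ler_wpM2l// !lerD//; exact: close.
rewrite (_ : L * _ = 3 * L / N.+1%:R); last by field; rewrite gt_eqF.
rewrite ler_pdivrMr// [e * _]mulrC -ler_pdivrMr// ltW//.
by apply: le_lt_trans KN; rewrite /K; lra.
Unshelve. all: by end_near. Qed.

End lipschitz_measurable.

(** * Fubini for functions dominated by a tensor product *)

Section dominated_fubini.
Context d1 d2 (T1 : measurableType d1) (T2 : measurableType d2) (R : realType).
Variables (m1 : {sigma_finite_measure set T1 -> \bar R}).
Variables (m2 : {sigma_finite_measure set T2 -> \bar R}).
Variables (a : T1 -> R) (b : T2 -> R).
Hypotheses (na : nnm a) (nb : nnm b).

Lemma nnm_tensor : nnm (fun p : T1 * T2 => a p.1 * b p.2).
Proof.
by apply: nnmM; [case: na|case: nb] => mf f0; split => //; exact: measurableT_comp.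
Qed.

Lemma integral_tensor :
  (\int[m1 \x m2]_p (a p.1 * b p.2)%:E = \int[m1]_x (a x)%:E * \int[m2]_y (b y)%:E)%E.
Proof.
rewrite fubini_tonelli1/=; [|exact: (nnmE nnm_tensor)|by move=> p; exact: (nnm_ge0 p nnm_tensor)].
rewrite -ge0_integralZr//; last 3 first.
- exact: nnmE.
- by move=> x _; exact: nnm_ge0.
- exact: nn_ge0.
by apply: eq_integral => x _; rewrite /fubini_F/= nnZl//; case: na.
Qed.

Hypotheses (fa : (\int[m1]_x (a x)%:E < +oo)%E) (fb : (\int[m2]_y (b y)%:E < +oo)%E).

Lemma integral_tensor_lty : (\int[m1 \x m2]_p (a p.1 * b p.2)%:E < +oo)%E.
Proof. by rewrite integral_tensor; apply: lte_mul_pinfty => //; rewrite ?nn_ge0// ge0_fin_numE ?nn_ge0. Qed.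

Variable f : T1 * T2 -> R.
Hypothesis mf : measurable_fun setT f.
Hypothesis fab : forall x y, `|f (x, y)| <= a x * b y.

Lemma dominated_integrable d (T : measurableType d) (m : {measure set T -> \bar R})
    (g h : T -> R) : measurable_fun setT g -> nnm h -> (forall x, `|g x| <= h x) ->
  (\int[m]_x (h x)%:E < +oo)%E -> m.-integrable setT (EFin \o g).
Proof.
move=> mg nh gh fh; apply/integrableP; split; first exact/measurable_EFinP.
apply: le_lt_trans fh; apply: ge0_le_integral => //.
- by apply: measurableT_comp => //; exact/measurable_EFinP.
- exact: nnmE.
- by move=> x _; rewrite lee_fin.
Qed.

Lemma fubini_integrable : (m1 \x m2)%E.-integrable setT (EFin \o f).
Proof.
apply: (dominated_integrable mf nnm_tensor); last exact: integral_tensor_lty.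
by case=> x y; exact: fab.
Qed.

Lemma section1_integrable x : m2.-integrable setT (fun y => (f (x, y))%:E).
Proof.
apply: (@dominated_integrable _ _ m2 (fun y => f (x, y)) (fun y => a x * b y)).
- exact: measurable_fun_pair2.
- by apply: nnmM => //; apply: nnm_cst; case: na.
- by move=> y; exact: fab.
rewrite nnZl//; last by case: na.
by apply: lte_mul_pinfty => //; rewrite lee_fin; case: na.
Qed.

Lemma section2_integrable y : m1.-integrable setT (fun x => (f (x, y))%:E).
Proof.
apply: (@dominated_integrable _ _ m1 (fun x => f (x, y)) (fun x => a x * b y)).
- exact: measurable_fun_pair1.
- by apply: nnmM => //; apply: nnm_cst; case: nb.
- by move=> x; exact: fab.
rewrite nnZr//; last by case: nb.
rewrite muleC; apply: lte_mul_pinfty => //; first by rewrite lee_fin; case: nb.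
Qed.

Lemma EFin_section1 x : ((\int[m2]_y f (x, y))%:E = \int[m2]_y (f (x, y))%:E)%E.
Proof. by rewrite /Rintegral fineK//; apply: integrable_fin_num => //; exact: section1_integrable. Qed.

Lemma EFin_section2 y : ((\int[m1]_x f (x, y))%:E = \int[m1]_x (f (x, y))%:E)%E.
Proof. by rewrite /Rintegral fineK//; apply: integrable_fin_num => //; exact: section2_integrable. Qed.

Lemma measurable_section1 : measurable_fun setT (fun x => \int[m2]_y f (x, y)).
Proof.
apply/measurable_EFinP; rewrite (_ : EFin \o _ = fubini_F m2 (EFin \o f)).
  by apply: measurable_fubini_F; exact: fubini_integrable.
by apply/funext => x /=; rewrite EFin_section1.
Qed.

Lemma Rfubini1 : \int[m1]_x \int[m2]_y f (x, y) = \int[(m1 \x m2)%E]_p f p.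
Proof.
rewrite /Rintegral -(integral12_prod_meas1 fubini_integrable); congr fine.
by apply: eq_integral => x _; rewrite /fubini_F/= -EFin_section1.
Qed.

Lemma Rfubini2 : \int[m2]_y \int[m1]_x f (x, y) = \int[(m1 \x m2)%E]_p f p.
Proof.
rewrite /Rintegral -(integral21_prod_meas1 fubini_integrable); congr fine.
by apply: eq_integral => y _; rewrite /fubini_G/= -EFin_section2.
Qed.

End dominated_fubini.

(** * Complex-valued integrals *)

Section complex_integral.
Context {R : realType}.
Implicit Types z : R[i].

(** A submultiplicative norm equivalent to the modulus, which splits into real and imaginary parts
    without square roots; the price is the factor 2 of [c1_le_nsq]. *)
Definition c1 z : R := `|complex.Re z| + `|complex.Im z|.

Lemma c1_ge0 z : 0 <= c1 z. Proof. by rewrite addr_ge0. Qed.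

Lemma c1D z1 z2 : c1 (z1 + z2) <= c1 z1 + c1 z2.
Proof.
case: z1 z2 => a b [c d]; rewrite /c1/=.
by have := ler_normD a c; have := ler_normD b d; lra.
Qed.

Lemma c1M z1 z2 : c1 (z1 * z2) <= c1 z1 * c1 z2.
Proof.
case: z1 z2 => a b [c d]; rewrite /c1/= mulrDl !mulrDr -!normrM.
by have := ler_normB (a * c) (b * d); have := ler_normD (a * d) (b * c); lra.
Qed.

Lemma c1J z : c1 (conjc z) = c1 z. Proof. by case: z => a b; rewrite /c1/= normrN. Qed.

Lemma c1N z : c1 (- z) = c1 z. Proof. by case: z => a b; rewrite /c1/= !normrN. Qed.

Lemma c1_sum (I : Type) (s : seq I) (F : I -> R[i]) :
  c1 (\sum_(i <- s) F i) <= \sum_(i <- s) c1 (F i).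
Proof.
elim: s => [|i s ih]; first by rewrite !big_nil /c1 normr0 addr0.
by rewrite !big_cons; apply: le_trans (c1D _ _) _; rewrite lerD2l.
Qed.

Lemma Re_le_c1 z : `|complex.Re z| <= c1 z. Proof. by rewrite lerDl. Qed.
Lemma Im_le_c1 z : `|complex.Im z| <= c1 z. Proof. by rewrite lerDr. Qed.

Lemma cReM z1 z2 : complex.Re (z1 * z2) =
  complex.Re z1 * complex.Re z2 - complex.Im z1 * complex.Im z2.
Proof. by case: z1 z2 => a b [c d]. Qed.
Lemma cImM z1 z2 : complex.Im (z1 * z2) =
  complex.Re z1 * complex.Im z2 + complex.Im z1 * complex.Re z2.
Proof. by case: z1 z2 => a b [c d]. Qed.
Lemma cReD z1 z2 : complex.Re (z1 + z2) = complex.Re z1 + complex.Re z2.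
Proof. by case: z1 z2 => a b [c d]. Qed.
Lemma cImD z1 z2 : complex.Im (z1 + z2) = complex.Im z1 + complex.Im z2.
Proof. by case: z1 z2 => a b [c d]. Qed.
Lemma cReN z : complex.Re (- z) = - complex.Re z. Proof. by case: z. Qed.
Lemma cImN z : complex.Im (- z) = - complex.Im z. Proof. by case: z. Qed.
Lemma cReJ z : complex.Re (conjc z) = complex.Re z. Proof. by case: z. Qed.
Lemma cImJ z : complex.Im (conjc z) = - complex.Im z. Proof. by case: z. Qed.

Section one.
Context d (T : measurableType d) (m : {measure set T -> \bar R}).
Implicit Types f g : T -> R[i].

Definition cmeas f := measurable_fun setT (@complex.Re R \o f) /\ measurable_fun setT (@complex.Im R \o f).

(** The dominating function is carried along explicitly, so that integrability of sums, products and
    sections is arithmetic on dominating functions. *)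
Definition cdom f (a : T -> R) :=
  [/\ cmeas f, nnm a, (\int[m]_x (a x)%:E < +oo)%E & forall x, c1 (f x) <= a x].

Definition cint f : R[i] := Complex (\int[m]_x complex.Re (f x)) (\int[m]_x complex.Im (f x)).

Lemma cmeasD f g : cmeas f -> cmeas g -> cmeas (fun x => f x + g x).
Proof.
case=> f1 f2 [g1 g2]; split.
  by rewrite (_ : _ \o _ = (@complex.Re R \o f) \+ (@complex.Re R \o g)); [exact: measurable_funD|
    apply/funext => x /=; rewrite cReD].
by rewrite (_ : _ \o _ = (@complex.Im R \o f) \+ (@complex.Im R \o g)); [exact: measurable_funD|
    apply/funext => x /=; rewrite cImD].
Qed.

Lemma cmeasM f g : cmeas f -> cmeas g -> cmeas (fun x => f x * g x).
Proof.
case=> f1 f2 [g1 g2]; split.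
  rewrite (_ : _ \o _ = ((@complex.Re R \o f) \* (@complex.Re R \o g)) \-
     ((@complex.Im R \o f) \* (@complex.Im R \o g))); last by apply/funext => x /=; rewrite cReM.
  by apply: measurable_funB; exact: measurable_funM.
rewrite (_ : _ \o _ = ((@complex.Re R \o f) \* (@complex.Im R \o g)) \+
   ((@complex.Im R \o f) \* (@complex.Re R \o g))); last by apply/funext => x /=; rewrite cImM.
by apply: measurable_funD; exact: measurable_funM.
Qed.

Lemma cmeasJ f : cmeas f -> cmeas (fun x => conjc (f x)).
Proof.
case=> f1 f2; split.
  by rewrite (_ : _ \o _ = @complex.Re R \o f)//; apply/funext => x /=; rewrite cReJ.
rewrite (_ : _ \o _ = \- (@complex.Im R \o f)); last by apply/funext => x /=; rewrite cImJ.
exact: measurable_funN.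
Qed.

Lemma cmeas_cst (z : R[i]) : cmeas (fun=> z).
Proof. by split; exact: measurable_cst. Qed.

Lemma cmeas_c1 f : cmeas f -> nnm (fun x => c1 (f x)).
Proof.
case=> f1 f2; split=> [|x]; last exact: c1_ge0.
by apply: measurable_funD; apply: measurableT_comp.
Qed.

Lemma cdom_Re f a : cdom f a -> m.-integrable setT (EFin \o (fun x => complex.Re (f x))).
Proof.
case=> -[f1 _] na fa fle; apply: (dominated_integrable f1 na) fa => x.
exact: le_trans (Re_le_c1 _) (fle x).
Qed.

Lemma cdom_Im f a : cdom f a -> m.-integrable setT (EFin \o (fun x => complex.Im (f x))).
Proof.
case=> -[_ f1] na fa fle; apply: (dominated_integrable f1 na) fa => x.
exact: le_trans (Im_le_c1 _) (fle x).
Qed.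

Lemma cintD f g a b : cdom f a -> cdom g b ->
  cint (fun x => f x + g x) = cint f + cint g.
Proof.
move=> fa gb; apply/eqP; rewrite eq_complex /cint cReD cImD/=; apply/andP; split; apply/eqP.
  rewrite -RintegralD//; [|exact: cdom_Re fa|exact: cdom_Re gb].
  by apply: eq_Rintegral => x _; rewrite cReD.
rewrite -RintegralD//; [|exact: cdom_Im fa|exact: cdom_Im gb].
by apply: eq_Rintegral => x _; rewrite cImD.
Qed.

Lemma cintZ (z : R[i]) f a : cdom f a -> cint (fun x => z * f x) = z * cint f.
Proof.
move=> fa; have iR := cdom_Re fa; have iI := cdom_Im fa.
have iZ (k : R) (g : T -> R) : m.-integrable setT (EFin \o g) ->
    m.-integrable setT (EFin \o (fun x => k * g x)).
  by move=> ig; rewrite (_ : _ \o _ = (fun x => k%:E * (EFin \o g) x)%E)//; exact: integrableZl.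
apply/eqP; rewrite eq_complex /cint cReM cImM/=; apply/andP; split; apply/eqP.
  rewrite -!RintegralZl// -RintegralB//; [|exact: iZ|exact: iZ].
  by apply: eq_Rintegral => x _; rewrite cReM.
rewrite -!RintegralZl// -RintegralD//; [|exact: iZ|exact: iZ].
by apply: eq_Rintegral => x _; rewrite cImM.
Qed.

Lemma cintJ f a : cdom f a -> cint (fun x => conjc (f x)) = conjc (cint f).
Proof.
move=> fa; apply/eqP; rewrite eq_complex /cint/=; apply/andP; split; apply/eqP.
  by apply: eq_Rintegral => x _; rewrite cReJ.
rewrite -mulN1r -RintegralZl//; last exact: cdom_Im fa.
by apply: eq_Rintegral => x _; rewrite cImJ mulN1r.
Qed.

End one.
End complex_integral.

Section reflection.
Context {R : realType}.
Local Notation mu := (@lebesgue_measure R).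
Local Notation RT := (measurableTypeR R).

Let measurable_opp : measurable_fun setT (fun x : RT => (- x : RT)).
Proof. by apply: measurable_funN; exact: measurable_id. Qed.

Lemma nn_opp (f : RT -> R) : nnm f -> (\int[mu]_x (f (- x))%:E = \int[mu]_x (f x)%:E)%E.
Proof.
move=> nf.
pose m : {measure set RT -> \bar R} :=
  measure_function_pushforward__canonical__measure_function_Measure mu measurable_opp.
rewrite [RHS](eq_measure_integral m); last first.
  move=> A mA _; apply: (@lebesgue_measure_unique R m) mA.
  move=> _ [[a b] _ <-] /=; rewrite /m/= /pushforward.
  rewrite (_ : _ @^-1` _ = `[- b, - a[%classic); last first.
    by apply/seteqP; split=> x /=; rewrite !in_itv/= ltrNr lerNl andbC.
  rewrite !lebesgue_measure_itv/= !lte_fin ltrN2.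
  by case: ifP => // _; rewrite -!EFinB opprK addrC.
rewrite ge0_integral_pushforward//; [exact: nnmE|move=> x *; exact: nnm_ge0].
Qed.

End reflection.

(** * The Fourier transform of a product *)

Section poisson_kernel.
Context {R : realType}.
Local Notation mu := (@lebesgue_measure R).
Local Notation RT := (measurableTypeR R).

Section fixed.
Variables (e a : R) (e0 : 0 < e).

Let k := e ^+ 2 + a ^+ 2.
Let k0 : 0 < k. Proof. by rewrite ltr_pwDl ?exprn_gt0// sqr_ge0. Qed.

(** The added 1 makes the integrand nonnegative, as the improper integral by antiderivatives
    requires; its contribution is subtracted again in [Rintegral_pweight_cos]. *)
Let f (x : R) : R := expR (- e * x) * (1 + cos (a * x)).
Let F (x : R) : R := - e^-1 * expR (- e * x) +
   k^-1 * (expR (- e * x) * (a * sin (a * x) - e * cos (a * x))).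

Let dF (x : R) : is_derive x (1 : R) F (f x).
Proof.
have d1 : is_derive x 1 (fun x => expR (- e * x)) (- e * expR (- e * x)).
  have -> : (fun x => expR (- e * x)) = expR \o (fun x => - e * x) by [].
  by apply: is_derive_eq; rewrite /GRing.scale/= mulr1 mulrC.
have d2 : is_derive x 1 (fun x => cos (a * x)) (- a * sin (a * x)).
  have -> : (fun x => cos (a * x)) = cos \o (fun x => a * x) by [].
  by apply: is_derive_eq; rewrite /GRing.scale/= mulr1; ring.
have d3 : is_derive x 1 (fun x => sin (a * x)) (a * cos (a * x)).
  have -> : (fun x => sin (a * x)) = sin \o (fun x => a * x) by [].
  by apply: is_derive_eq; rewrite /GRing.scale/= mulr1; ring.
apply: is_derive_eq; rewrite /GRing.scale/= /f.
have ek : k != 0 by rewrite gt_eqF.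
rewrite /k in ek *; field; rewrite ek gt_eqF//.
Qed.

Let F0 : F x @[x --> +oo] --> (0 : R).
Proof.
pose K := e^-1 + k^-1 * (`|a| + e).
have c : K * expR (- (e * x)) @[x --> +oo] --> (0 : R).
  rewrite -[X in _ --> X](mulr0 K); apply: cvgMr.
  apply: (cvg_comp (fun x => e * x) (fun x => expR (- x)) _ (@cvgr_expR R)).
  by apply: gt0_cvgMry => //; exact: cvg_id.
apply: (squeeze_cvgr _ _ c); last first.
  by rewrite -[X in _ --> X]oppr0; exact: cvgN c.
near=> x; rewrite -ler_norml.
rewrite (_ : F x = expR (- (e * x)) * (- e^-1 + k^-1 * (a * sin (a * x) - e * cos (a * x)))); last first.
  by rewrite /F [- e * x]mulNr; move: (expR _) (cos _) (sin _) => E c1 s1; rewrite /=; ring.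
rewrite normrM (ger0_norm (expR_ge0 _)) mulrC ler_wpM2r ?expR_ge0//.
apply: le_trans (ler_normD _ _) _; rewrite normrN (gtr0_norm (_ : 0 < e^-1)) ?invr_gt0// lerD2l.
rewrite normrM (gtr0_norm (_ : 0 < k^-1)) ?invr_gt0// ler_wpM2l ?invr_ge0 ?(ltW k0)//.
apply: le_trans (ler_normB _ _) _; rewrite !normrM (gtr0_norm e0).
have h1 : `|sin (a * x)| <= 1 by rewrite ler_norml sin_geN1 sin_le1.
have h2 : `|cos (a * x)| <= 1 by rewrite ler_norml cos_geN1 cos_le1.
by rewrite lerD//; [rewrite ler_piMr|rewrite ler_piMr// ltW].
Unshelve. all: by end_near. Qed.

Let cf : continuous f.
Proof.
move=> x; apply: cvgM.
  by apply: continuous_comp; [exact: mulrl_continuous|exact: continuous_expR].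
apply: cvgD; first exact: cvg_cst.
by apply: continuous_comp; [exact: mulrl_continuous|exact: continuous_cos].
Qed.

Lemma integral_half_poisson :
  (\int[mu]_(x in `[0%R, +oo[) (f x)%:E = (e^-1 + e / k)%:E)%E.
Proof.
rewrite (@ge0_continuous_FTC2y R f F 0 0).
- rewrite sub0e -EFinN /F !mulr0 sin0 cos0 expR0 mulr0 sub0r !mulr1 mul1r; congr (_%:E).
  by ring.
- by move=> x _; rewrite mulr_ge0 ?expR_ge0//; have := cos_geN1 (a * x); lra.
- exact: continuous_subspaceT.
- exact: F0.
- by move=> x _; exact: (@ex_derive _ _ _ _ _ _ _ (dF x)).
- apply: cvg_at_right_filter.
  by apply: differentiable_continuous; apply/derivable1_diffP; exact: (@ex_derive _ _ _ _ _ _ _ (dF 0)).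
- by move=> x _; rewrite derive1E; exact: (@derive_val _ _ _ _ _ _ _ (dF x)).
Qed.

End fixed.

Definition pweight (e t : R) : R := expR (- (e * `|t|)).
(** The Fourier transform of [pweight e], by [Rintegral_pweight_cos] and [Rintegral_pweight_sin]. *)
Definition poisson (e a : R) : R := 2 * e / (e ^+ 2 + a ^+ 2).

Lemma continuous_pweight e : continuous (pweight e).
Proof.
move=> x; apply: (@continuous_comp _ _ _ (fun t => - (e * `|t|)) expR).
  by apply: cvgN; apply: cvgMr; exact: norm_continuous.
exact: continuous_expR.
Qed.

Lemma nnm_pweight e : nnm (pweight e : RT -> R).
Proof.
split=> [|x]; last exact: expR_ge0.
exact: (continuous_measurable_fun (@continuous_pweight e)).
Qed.

Section whole_line.
Variables (e a : R) (e0 : 0 < e).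

Let wc (t : R) : R := pweight e t * (1 + cos (a * t)).

Lemma integral_pweight_cos :
  (\int[mu]_t (wc t)%:E = (2 * (e^-1 + e / (e ^+ 2 + a ^+ 2)))%:E)%E.
Proof.
rewrite ge0_symfun_integralT.
- rewrite -set_itvcy [RHS]EFinM -integral_half_poisson//; congr *%E.
  apply: eq_integral => x; rewrite inE/= in_itv/= andbT => x0.
  by rewrite /wc /pweight ger0_norm// mulNr.
- by move=> x; rewrite mulr_ge0 ?expR_ge0//; have := cos_geN1 (a * x); lra.
- move=> x; apply: cvgM; first exact: continuous_pweight.
  apply: cvgD; first exact: cvg_cst.
  by apply: continuous_comp; [exact: mulrl_continuous|exact: continuous_cos].
- by move=> x; rewrite /wc /pweight /= normrN mulrN cosN.
Qed.

End whole_line.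

Lemma integral_pweight e : 0 < e -> (\int[mu]_t (pweight e t)%:E = (2 / e)%:E)%E.
Proof.
move=> e0; rewrite (_ : 2 / e = 2^-1 * (2 * (e^-1 + e / (e ^+ 2 + 0 ^+ 2)))); last first.
  by rewrite expr0n addr0; field; rewrite gt_eqF.
rewrite EFinM -integral_pweight_cos// -nnZl//.
  by apply: eq_integral => x _; rewrite mul0r cos0; congr (_%:E); field.
under [X in nnm X]eq_fun do rewrite mul0r cos0.
by apply: nnmM; [exact: nnm_pweight|exact: nnm_cst].
Qed.

Lemma measurable_cosM a : measurable_fun setT (fun t : RT => cos (a * t) : RT).
Proof.
apply: (measurableT_comp (continuous_measurable_fun (@continuous_cos R))).
by apply: measurable_funM; [exact: measurable_cst|exact: measurable_id].
Qed.

Lemma measurable_sinM a : measurable_fun setT (fun t : RT => sin (a * t) : RT).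
Proof.
apply: (measurableT_comp (continuous_measurable_fun (@continuous_sin R))).
by apply: measurable_funM; [exact: measurable_cst|exact: measurable_id].
Qed.

Lemma pweight_integrable e (g : RT -> R) : 0 < e -> measurable_fun setT g ->
  (forall t, `|g t| <= 1) -> mu.-integrable setT (EFin \o (fun t => pweight e t * g t)).
Proof.
move=> e0 mg g1; have nw := nnm_pweight e.
apply: (@dominated_integrable _ _ _ mu _ (pweight e)) => //.
- by apply: measurable_funM => //; case: nw.
- by move=> x; rewrite normrM ger0_norm ?expR_ge0// ler_piMr ?expR_ge0.
- by rewrite integral_pweight// ltry.
Qed.

Lemma Rintegral_pweight_cos e a : 0 < e ->
  \int[mu]_t (pweight e t * cos (a * t)) = poisson e a.
Proof.
move=> e0; have ic : mu.-integrable setT (EFin \o (fun t => pweight e t * cos (a * t))).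
  apply: pweight_integrable => //; first exact: measurable_cosM.
  by move=> t; rewrite ler_norml cos_geN1 cos_le1.
have iw : mu.-integrable setT (EFin \o (fun t => pweight e t * 1)).
  by apply: pweight_integrable => // t; rewrite normr1.
have := RintegralD measurableT iw ic.
have -> : \int[mu]_t (pweight e t * 1) = 2 / e.
  by rewrite /Rintegral; under eq_integral do rewrite mulr1; rewrite integral_pweight.
rewrite /Rintegral; under eq_integral do rewrite -mulrDr.
rewrite integral_pweight_cos//= /poisson => h.
by rewrite -[LHS](addrK (2 / e)) [X in X - _]addrC -h; ring.
Qed.

(** Oddness, phrased with the nonnegative functions [1 + sin] and [1 - sin], which the reflection
    exchanges and to which [nn_opp] applies. *)
Lemma Rintegral_pweight_sin e a : 0 < e ->
  \int[mu]_t (pweight e t * sin (a * t)) = 0.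
Proof.
move=> e0; have bs t : `|sin (a * t)| <= 1 by rewrite ler_norml sin_geN1 sin_le1.
have is_ : mu.-integrable setT (EFin \o (fun t => pweight e t * sin (a * t))).
  by apply: pweight_integrable => //; exact: measurable_sinM.
have iw : mu.-integrable setT (EFin \o (fun t => pweight e t * 1)).
  by apply: pweight_integrable => // t; rewrite normr1.
have h1 := RintegralD measurableT iw is_.
have h2 := RintegralB measurableT iw is_.
have : \int[mu]_t (pweight e t * 1 + pweight e t * sin (a * t)) =
       \int[mu]_t (pweight e t * 1 - pweight e t * sin (a * t)).
  rewrite /Rintegral; congr fine; rewrite -[RHS]nn_opp.
    by apply: eq_integral => t _; rewrite /pweight normrN mulrN sinN; congr EFin; ring.
  split=> [|t]; last by rewrite -mulrBr mulr_ge0 ?expR_ge0//; have := sin_le1 (a * t); lra.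
  have mw : measurable_fun setT (pweight e : RT -> R) by case: (nnm_pweight e).
  apply: measurable_funB; apply: measurable_funM => //; exact: measurable_sinM.
rewrite h1 h2 => /addrI/eqP; rewrite -subr_eq0 opprK -mulr2n mulrn_eq0 => /orP[//|/eqP//].
Qed.

End poisson_kernel.

Section complex_integral_theory.
Context {R : realType}.
Local Open Scope complex_scope.

Lemma c1_real (r : R) : c1 r%:C = `|r|. Proof. by rewrite /c1/= normr0 addr0. Qed.

Lemma cJM (z1 z2 : R[i]) : conjc (z1 * z2) = conjc z1 * conjc z2.
Proof. exact: rmorphM. Qed.

Lemma ReZ (r : R) (z : R[i]) : complex.Re (r%:C * z) = r * complex.Re z.
Proof. by rewrite (cReM r%:C z) /= mul0r subr0. Qed.

Lemma ImZ (r : R) (z : R[i]) : complex.Im (r%:C * z) = r * complex.Im z.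
Proof. by rewrite (cImM r%:C z) /= mul0r addr0. Qed.

Section one_measure.
Context d (T : measurableType d) (m : {measure set T -> \bar R}).
Implicit Types f g : T -> R[i].

Lemma cmeas_real (r : T -> R) : measurable_fun setT r -> cmeas (fun x => (r x)%:C).
Proof. by move=> mr; split => //; exact: measurable_cst. Qed.

Lemma cmeasN f : cmeas f -> cmeas (fun x => - f x).
Proof.
by case=> f1 f2; split; [rewrite (_ : _ \o _ = \- (@complex.Re R \o f))|
  rewrite (_ : _ \o _ = \- (@complex.Im R \o f))]; try exact: measurable_funN;
  apply/funext => x /=; rewrite ?cReN ?cImN.
Qed.

Lemma eq_cint f g : f =1 g -> cint m f = cint m g.
Proof. by move=> fg; congr cint; exact/funext. Qed.

Lemma cdom_eq f g a : f =1 g -> cdom m g a -> cdom m f a.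
Proof. by move=> /funext ->. Qed.

Lemma cdomM f g a (B : R) : 0 <= B -> cdom m f a -> cmeas g -> (forall x, c1 (g x) <= B) ->
  cdom m (fun x => f x * g x) (fun x => a x * B).
Proof.
move=> B0 [mf na fa fle] mg gB; split=> [||| y]; first exact: cmeasM.
- by apply: nnmM => //; exact: nnm_cst.
- by rewrite nnZr// muleC; apply: lte_mul_pinfty => //; rewrite lee_fin.
- by apply: le_trans (c1M _ _) _; apply: ler_pM => //; exact: c1_ge0.
Qed.

Lemma cdom0 : cdom m (fun=> 0) (fun=> 0).
Proof.
split; [exact: cmeas_cst|exact: nnm_cst| |by move=> _; rewrite /c1 normr0 addr0].
by rewrite integral0.
Qed.

Lemma cint0 : cint m (fun=> 0) = 0.
Proof. by rewrite /cint /Rintegral integral0. Qed.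

Lemma cdomD f g a b : cdom m f a -> cdom m g b ->
  cdom m (fun x => f x + g x) (fun x => a x + b x).
Proof.
case=> mf na fa fle [mg nb fb gle]; split=> [|||x]; first exact: cmeasD.
- exact: nnmD.
- by rewrite nnD//; exact: lte_add_pinfty.
- by apply: le_trans (c1D _ _) _; exact: lerD.
Qed.

Lemma cint_sum (I : Type) (s : seq I) (F : I -> T -> R[i]) (a : I -> T -> R) :
  (forall i, cdom m (F i) (a i)) ->
  cdom m (fun x => \sum_(i <- s) F i x) (fun x => \sum_(i <- s) a i x) /\
  cint m (fun x => \sum_(i <- s) F i x) = \sum_(i <- s) cint m (F i).
Proof.
move=> dF; elim: s => [|i s [ih1 ih2]].
  under eq_fun do rewrite big_nil; under [X in cdom _ _ X]eq_fun do rewrite big_nil.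
  by rewrite big_nil cint0; split => //; exact: cdom0.
under eq_fun do rewrite big_cons; under [X in cdom _ _ X]eq_fun do rewrite big_cons.
split; first exact: cdomD.
by rewrite (cintD (dF i) ih1) ih2 big_cons.
Qed.

Lemma cintZr (z : R[i]) f a : cdom m f a -> cint m (fun x => f x * z) = cint m f * z.
Proof. by move=> fa; rewrite mulrC -(cintZ z fa); apply: eq_cint => x; rewrite mulrC. Qed.

Lemma cintB f g a b : cdom m f a -> cdom m g b ->
  cint m (fun x => f x - g x) = cint m f - cint m g.
Proof.
move=> fa gb; have gN : cdom m (fun x => -1 * g x) b.
  have [mg nb bf gle] := gb; split=> // [|x]; first by apply: cmeasM => //; exact: cmeas_cst.
  by rewrite mulN1r c1N.
have := cintD fa gN; rewrite (cintZ _ gb) mulN1r => <-.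
by apply: eq_cint => x; rewrite mulN1r.
Qed.

Lemma c1_cint f a : cdom m f a -> ((c1 (cint m f))%:E <= \int[m]_x (c1 (f x))%:E)%E.
Proof.
move=> fa; have [[mf1 mf2] _ _ _] := fa.
have h (g : T -> R) : measurable_fun setT g -> m.-integrable setT (EFin \o g) ->
    (`|\int[m]_x g x|%:E <= \int[m]_x (`|g x|)%:E)%E.
  by move=> mg ig; rewrite EFin_normr_Rintegral//; apply: (@le_abse_integral _ _ _ m setT (EFin \o g)) => //; exact/measurable_EFinP.
rewrite /c1/= EFinD nnD; last 2 first.
- by split=> // ; apply: measurableT_comp.
- by split=> // ; apply: measurableT_comp.
apply: leeD; apply: h => //; [exact: cdom_Re fa|exact: cdom_Im fa].
Qed.

Lemma c1_cint_le f a : cdom m f a -> ((c1 (cint m f))%:E <= \int[m]_x (a x)%:E)%E.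
Proof.
move=> fa; apply: le_trans (c1_cint fa) _; case: fa => mf na _ fle.
by apply: nn_le => //; exact: cmeas_c1.
Qed.

End one_measure.

Section fubini.
Context d1 d2 (T1 : measurableType d1) (T2 : measurableType d2).
Variables (m1 : {sigma_finite_measure set T1 -> \bar R}).
Variables (m2 : {sigma_finite_measure set T2 -> \bar R}).
Variables (a : T1 -> R) (b : T2 -> R) (f : T1 * T2 -> R[i]).
Hypotheses (na : nnm a) (nb : nnm b).
Hypotheses (fa : (\int[m1]_x (a x)%:E < +oo)%E) (fb : (\int[m2]_y (b y)%:E < +oo)%E).
Hypotheses (mf : cmeas f) (fab : forall x y, c1 (f (x, y)) <= a x * b y).

Let f1 x y : `|complex.Re (f (x, y))| <= a x * b y.
Proof. exact: le_trans (Re_le_c1 _) (fab x y). Qed.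
Let f2 x y : `|complex.Im (f (x, y))| <= a x * b y.
Proof. exact: le_trans (Im_le_c1 _) (fab x y). Qed.

Lemma cmeas_section1 : cmeas (fun x => cint m2 (fun y => f (x, y))).
Proof.
split.
  exact: (measurable_section1 na nb fa fb mf.1 f1).
exact: (measurable_section1 na nb fa fb mf.2 f2).
Qed.

Lemma cfubini : cint m1 (fun x => cint m2 (fun y => f (x, y))) =
  cint m2 (fun y => cint m1 (fun x => f (x, y))).
Proof.
rewrite /cint/=.
rewrite (Rfubini1 na nb fa fb mf.1 f1) (Rfubini1 na nb fa fb mf.2 f2).
by rewrite -(Rfubini2 na nb fa fb mf.1 f1) -(Rfubini2 na nb fa fb mf.2 f2).
Qed.

End fubini.

Lemma cexpiD (a b : R) : cexpi (a + b) = cexpi a * cexpi b.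
Proof. by apply/eqP; rewrite eq_complex /= cosD sinD eqxx/= addrC. Qed.

Lemma cexpiN (a : R) : cexpi (- a) = conjc (cexpi a).
Proof. by rewrite /cexpi cosN sinN. Qed.

Lemma c1_cexpi (a : R) : c1 (cexpi a) <= 2.
Proof.
rewrite /c1/=; have -> : 2 = 1 + 1 :> R by [].
by rewrite lerD// ler_norml ?cos_geN1 ?cos_le1 ?sin_geN1 ?sin_le1.
Qed.

Lemma cmeas_cexpi d (T : measurableType d) (h : T -> measurableTypeR R) :
  measurable_fun setT h -> cmeas (fun x => cexpi (h x)).
Proof.
move=> mh; split; apply: (measurableT_comp _ mh).
  exact: (continuous_measurable_fun (@continuous_cos R)).
exact: (continuous_measurable_fun (@continuous_sin R)).
Qed.

Lemma cmeas_comp d1 d2 (T1 : measurableType d1) (T2 : measurableType d2)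
  (f : T2 -> R[i]) (h : T1 -> T2) : cmeas f -> measurable_fun setT h -> cmeas (f \o h).
Proof. by case=> f1 f2 mh; split; [exact: (measurableT_comp f1)|exact: (measurableT_comp f2)]. Qed.

End complex_integral_theory.

(** * Parseval's formula for the Poisson kernel *)

Section poisson_parseval.
Context {R : realType} d (X : measurableType d) (mu : {sigma_finite_measure set X -> \bar R}).
Local Notation leb := (@lebesgue_measure R).
Local Notation RT := (measurableTypeR R).
Local Open Scope complex_scope.
Variables (th : X -> RT) (mth : measurable_fun setT th) (e : R) (e0 : 0 < e).

(** Only one real frequency [t] is transformed, against an arbitrary phase [th]; in the application
    [th] is time and the space frequency is absorbed into [G]. *)
Definition phase_transform (G : X -> R[i]) (t : R) : R[i] :=
  cint mu (fun p => G p * cexpi (- (t * th p))).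

Let int_pweight_cexpi (c : R) : cint leb (fun t => (pweight e t)%:C * cexpi (c * t)) = (poisson e c)%:C.
Proof.
rewrite /cint; apply/eqP; rewrite eq_complex; apply/andP; split; apply/eqP.
  by rewrite -Rintegral_pweight_cos//; apply: eq_Rintegral => t _; exact: ReZ.
by apply: (etrans _ (Rintegral_pweight_sin c e0)); apply: eq_Rintegral => t _; exact: ImZ.
Qed.

Let mphase : measurable_fun setT (fun z : RT * X => - (z.1 * th z.2) : RT).
Proof. by apply: measurable_funN; apply: measurable_funM => //; exact: measurableT_comp. Qed.

Section one_function.
Variables (H : X -> R[i]) (b : X -> R) (dH : cdom mu H b).

Lemma phase_transform_cdom t : cdom mu (fun p => H p * cexpi (- (t * th p))) (fun p => b p * 2).
Proof.
apply: cdomM => // [|p]; last exact: c1_cexpi.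
apply: cmeas_cexpi.
by apply: measurable_funN; apply: measurable_funM => //; exact: measurable_cst.
Qed.

Let bound := fine (\int[mu]_x (b x * 2)%:E)%E.

Let b_fin : (\int[mu]_x (b x * 2)%:E)%E \is a fin_num.
Proof. by have [_ nb fb _] := phase_transform_cdom 0; rewrite ge0_fin_numE//; exact: nn_ge0. Qed.

Lemma c1_phase_transform t : c1 (phase_transform H t) <= bound.
Proof. by rewrite -lee_fin fineK//; exact: c1_cint_le (phase_transform_cdom t). Qed.

Lemma cmeas_phase_transform : cmeas (phase_transform H : RT -> R[i]).
Proof.
have nw := nnm_pweight e; have fw := integral_pweight e0.
have [mH nb fb Hle] := dH.
(* The transform has no decay in [t] to rely on. Multiplied by [pweight e] its integrand is
   dominated by a tensor product, hence sections are measurable; the inverse weight is then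
   multiplied back. *)
have m1 : cmeas (fun z : RT * X => (pweight e z.1)%:C * (H z.2 * cexpi (- (z.1 * th z.2)))).
  apply: cmeasM; first by apply: cmeas_real; apply: measurableT_comp => //; case: nw.
  by apply: cmeasM; [exact: (cmeas_comp mH)|exact: cmeas_cexpi].
have [_ nb2 fb2 _] := phase_transform_cdom 0.
have fw' : (\int[leb]_t (pweight e t)%:E < +oo)%E by rewrite fw ltry.
have le1 x y : c1 ((pweight e x)%:C * (H y * cexpi (- (x * th y)))) <= pweight e x * (b y * 2).
  apply: le_trans (c1M _ _) _; rewrite c1_real ger0_norm ?expR_ge0//= ler_wpM2l ?expR_ge0//.
  by apply: le_trans (c1M _ _) _; apply: ler_pM => //; rewrite ?c1_ge0//; exact: c1_cexpi.
have ms := cmeas_section1 nw nb2 fw' fb2 m1 le1.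
have mE : measurable_fun setT (fun t : RT => expR (e * `|t|) : RT).
  apply: (measurableT_comp (continuous_measurable_fun (@continuous_expR R))).
  by apply: measurable_funM; [exact: measurable_cst|exact: (continuous_measurable_fun (@norm_continuous _ R))].
suff -> : (phase_transform H : RT -> R[i]) = (fun t => (expR (e * `|t|))%:C *
    cint mu (fun y => (pweight e t)%:C * (H y * cexpi (- (t * th y))))).
  exact: (cmeasM (cmeas_real mE) ms).
apply/funext => t; rewrite (cintZ _ (phase_transform_cdom t)) mulrA.
rewrite (_ : _%:C * _%:C = 1) ?mul1r//.
by rewrite -rmorphM/= /pweight -expRD addrN expR0.
Qed.

End one_function.

Variables (G H : X -> R[i]) (a b : X -> R) (dG : cdom mu G a) (dH : cdom mu H b).

(** Fubini is applied once for each transform, the weight [pweight e] providing absolute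
    convergence; the time integral of the two exponentials is then the Poisson kernel. No
    integrability of the transforms is involved. *)
Lemma poisson_parseval :
  cint leb (fun t => (pweight e t)%:C * (phase_transform G t * conjc (phase_transform H t))) =
  cint mu (fun p => G p * cint mu (fun q => conjc (H q) * (poisson e (th q - th p))%:C)).
Proof.
have nw := nnm_pweight e.
have fw : (\int[leb]_t (pweight e t)%:E < +oo)%E by rewrite integral_pweight// ltry.
have [mG na fa Gle] := dG; have [mH nb fb Hle] := dH.
have mPH := cmeas_phase_transform dH.
set B := fine (\int[mu]_x (b x * 2)%:E)%E.
have hB t : c1 (phase_transform H t) <= B by exact: (c1_phase_transform dH).
have B0 : 0 <= B by apply: le_trans (hB 0); exact: c1_ge0.
have [_ na2 fa2 _] := phase_transform_cdom dG 0.
have [_ nb2 fb2 _] := phase_transform_cdom dH 0.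
pose f1 (z : RT * X) := (pweight e z.1)%:C * conjc (phase_transform H z.1) *
   (G z.2 * cexpi (- (z.1 * th z.2))).
have mf1 : cmeas f1.
  apply: cmeasM; last by apply: cmeasM; [exact: (cmeas_comp mG)|exact: cmeas_cexpi].
  apply: (@cmeas_comp _ _ _ _ _ (fun t => (pweight e t)%:C * conjc (phase_transform H t)) fst) => //.
  by apply: cmeasM; [apply: cmeas_real; case: nw|exact: cmeasJ].
have nwB : nnm (fun t : RT => pweight e t * B) by apply: nnmM => //; exact: nnm_cst.
have fwB : (\int[leb]_t (pweight e t * B)%:E < +oo)%E.
  by rewrite nnZr// muleC lte_mul_pinfty// lee_fin.
have le1 x y : c1 (f1 (x, y)) <= (pweight e x * B) * (a y * 2).
  apply: le_trans (c1M _ _) _; apply: ler_pM; rewrite ?c1_ge0//.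
    apply: le_trans (c1M _ _) _; rewrite c1_real ger0_norm ?expR_ge0// c1J.
    by apply: ler_wpM2l; [exact: expR_ge0|exact: hB].
  by apply: le_trans (c1M _ _) _; apply: ler_pM => //; rewrite ?c1_ge0//; exact: c1_cexpi.
transitivity (cint leb (fun t => cint mu (fun p => f1 (t, p)))).
  apply: eq_cint => t; rewrite /f1/= (cintZ _ (phase_transform_cdom dG t)).
  by rewrite -mulrA; congr (_ * _); exact: mulrC.
rewrite (cfubini nwB na2 fwB fa2 mf1 le1).
apply: eq_cint => p.
pose f2 (z : RT * X) := (pweight e z.1)%:C * cexpi (- (z.1 * th p)) *
  (conjc (H z.2 * cexpi (- (z.1 * th z.2)))).
have mf2 : cmeas f2.
  apply: cmeasM; last by apply: cmeasJ; apply: cmeasM; [exact: (cmeas_comp mH)|exact: cmeas_cexpi].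
  apply: cmeasM; first by apply: cmeas_real; apply: measurableT_comp => //; case: nw.
  apply: cmeas_cexpi; apply: measurable_funN; apply: measurable_funM => //; exact: measurable_cst.
have nw2 : nnm (fun t : RT => pweight e t * 2) by apply: nnmM => //; exact: nnm_cst.
have fw2 : (\int[leb]_t (pweight e t * 2)%:E < +oo)%E.
  by rewrite nnZr// muleC lte_mul_pinfty// lee_fin.
have le2 x y : c1 (f2 (x, y)) <= (pweight e x * 2) * (b y * 2).
  apply: le_trans (c1M _ _) _; apply: ler_pM; rewrite ?c1_ge0//.
    apply: le_trans (c1M _ _) _; rewrite c1_real ger0_norm ?expR_ge0//.
    by apply: ler_wpM2l; [exact: expR_ge0|exact: c1_cexpi].
  rewrite c1J.
  by apply: le_trans (c1M _ _) _; apply: ler_pM => //; rewrite ?c1_ge0//; exact: c1_cexpi.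
have dw : cdom leb (fun t : RT => (pweight e t)%:C) (pweight e).
  by split=> // [|t]; [by apply: cmeas_real; case: nw|rewrite c1_real ger0_norm ?expR_ge0].
have mlin (c : R) : cmeas (fun t : RT => cexpi (c * t)).
  by apply: cmeas_cexpi; apply: measurable_funM => //; exact: measurable_cst.
have mlinN (c : R) : cmeas (fun t : RT => cexpi (- (t * c))).
  apply: cmeas_cexpi; apply: measurable_funN; apply: measurable_funM => //; exact: measurable_cst.
transitivity (G p * cint leb (fun t => cint mu (fun q => f2 (t, q)))).
  rewrite /f1/= -(@cintZ _ _ _ leb (G p) _ (fun t : RT => pweight e t * 2 * B)).
    apply: eq_cint => t; rewrite /f2/= (cintZ _ (_ : cdom mu _ (fun y => b y * 2))); last first.
      have [m1 m2 m3 m4] := phase_transform_cdom dH t.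
      by split => //; [exact: cmeasJ|move=> y; rewrite c1J].
    rewrite (cintJ (phase_transform_cdom dH t)) -/(phase_transform H t).
    by rewrite mulrCA; congr (_ * _); rewrite -!mulrA; congr (_ * _); rewrite mulrC.
  split.
  - exact: (cmeas_section1 nw2 nb2 fw2 fb2 mf2 le2).
  - by apply: nnmM => //; exact: nnm_cst.
  - rewrite nnZr// muleC lte_mul_pinfty// lee_fin//.
  - move=> t; rewrite /f2/= (cintZ _ (_ : cdom mu _ (fun y => b y * 2))); last first.
      have [m1 m2 m3 m4] := phase_transform_cdom dH t.
      by split => //; [exact: cmeasJ|move=> y; rewrite c1J].
    rewrite (cintJ (phase_transform_cdom dH t)) -/(phase_transform H t).
    apply: le_trans (c1M _ _) _; apply: ler_pM; rewrite ?c1_ge0// ?c1J//.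
    apply: le_trans (c1M _ _) _; rewrite c1_real ger0_norm ?expR_ge0//.
    by apply: ler_wpM2l; [exact: expR_ge0|exact: c1_cexpi].
congr (_ * _); rewrite (cfubini nw2 nb2 fw2 fb2 mf2 le2).
apply: eq_cint => q; rewrite -int_pweight_cexpi -(@cintZ _ _ _ leb _ _ (fun t : RT => pweight e t * 2)).
  apply: eq_cint => t; rewrite /f2/= mulrCA -!mulrA; congr (_ * _).
  rewrite cJM -cexpiN opprK mulrCA; congr (_ * _).
  by rewrite -cexpiD; congr cexpi; ring.
by apply: (cdomM _ dw) => // t; exact: c1_cexpi.
Qed.

End poisson_parseval.

(** * The Fejer kernel and distances on the circle *)

Section fejer_kernel.
Context {R : realType}.
Local Notation leb := (@lebesgue_measure R).
Local Notation RT := (measurableTypeR R).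
Local Open Scope complex_scope.

Definition nsq (z : R[i]) : R := complex.Re z ^+ 2 + complex.Im z ^+ 2.

Lemma nsq_ge0 z : 0 <= nsq z. Proof. by rewrite addr_ge0// sqr_ge0. Qed.

Lemma nsqM z1 z2 : nsq (z1 * z2) = nsq z1 * nsq z2.
Proof. by rewrite /nsq cReM cImM; ring. Qed.

Lemma mulcJ z : z * conjc z = (nsq z)%:C.
Proof. by case: z => a b; apply/eqP; rewrite eq_complex /nsq/=; apply/andP; split; apply/eqP; ring. Qed.

Definition unitz (d : R) : R[i] := cexpi (2 * pi * d).

Lemma unitzX (d : R) n : unitz d ^+ n = cexpi (2 * pi * (n%:R * d)).
Proof.
elim: n => [|n ih]; first by rewrite expr0 mul0r mulr0 /cexpi cos0 sin0.
by rewrite exprS ih -cexpiD -natr1; congr cexpi; ring.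
Qed.

Lemma cexpi_2piz (m : int) (a : R) : cexpi (a + 2 * pi * m%:~R) = cexpi a.
Proof.
have h (n : nat) b : cexpi (b + 2 * pi * n%:R) = cexpi b :> R[i].
  rewrite (_ : 2 * pi * n%:R = (pi *+ 2) *+ n); last by rewrite -[pi *+ 2]mulr_natl mulr_natr.
  by rewrite /cexpi (periodicn (@cosD2pi R)) (periodicn (@sinD2pi R)).
case: m => n; first exact: h.
by rewrite NegzE mulrNz -pmulrn -[LHS](h n.+1); congr cexpi; ring.
Qed.

Lemma cmeas_sum d (T : measurableType d) (I : Type) (s : seq I) (F : I -> T -> R[i]) :
  (forall i, cmeas (F i)) -> cmeas (fun x => \sum_(i <- s) F i x).
Proof.
move=> mF; elim: s => [|i s ih]; first by under eq_fun do rewrite big_nil; exact: cmeas_cst.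
by under eq_fun do rewrite big_cons; exact: cmeasD.
Qed.

Lemma nnm_nsq d (T : measurableType d) (f : T -> R[i]) : cmeas f -> nnm (fun x => nsq (f x)).
Proof.
by case=> f1 f2; split=> [|x]; [apply: measurable_funD; exact: measurable_funX|exact: nsq_ge0].
Qed.

(** Written as a normalised square to exhibit its sign. Its expansion [fejer_sum] keeps the pairs
    [(j, k)] as indices, so that the coefficients [N - |n|] are never formed. *)
Definition fejer (N : nat) (d : R) : R := nsq (\sum_(j < N) unitz d ^+ j) / N%:R.

Lemma fejer_ge0 N d : 0 <= fejer N d.
Proof. by rewrite divr_ge0// nsq_ge0. Qed.

Lemma fejer_sum N d : (0 < N)%N ->
  \sum_(j < N) \sum_(k < N) cexpi (2 * pi * ((j%:Z - k%:Z)%:~R * d)) = (N%:R * fejer N d)%:C.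
Proof.
move=> N0; rewrite /fejer [N%:R * _]mulrC divfK ?pnatr_eq0 -?lt0n// -mulcJ.
rewrite rmorph_sum/= mulr_suml; apply: eq_bigr => j _; rewrite mulr_sumr; apply: eq_bigr => k _.
rewrite !unitzX -cexpiN -cexpiD; congr cexpi.
by rewrite intrB -!pmulrn; ring.
Qed.

(** The product of [z - 1] with the geometric sum is [z^N - 1], of squared modulus at most 4. This
    bound stands in for concentration of the kernel near the integers. *)
Lemma fejer_vanish N d : (0 < N)%N -> fejer N d * nsq (unitz d - 1) <= 4 / N%:R.
Proof.
move=> N0; rewrite /fejer mulrAC -nsqM mulrC [X in nsq X]mulrC -subrX1.
rewrite mulrC ler_wpM2r ?invr_ge0// unitzX; set a := 2 * pi * _.
have := @cos2Dsin2 R a; have := cos_geN1 a.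
by rewrite /nsq /cexpi/= subr0; nra.
Qed.

Definition unit_itv : RT -> R := \1_(`[0, 1]%classic : set RT).

Lemma nnm_unit_itv : nnm unit_itv.
Proof. by apply: nnm_indic; exact: measurable_itv. Qed.

Lemma integral_unit_itv : (\int[leb]_x (unit_itv x)%:E = 1)%E.
Proof.
have mI : measurable (`[0, 1]%classic : set RT) by exact: measurable_itv.
rewrite /unit_itv integral_indic//= setIT lebesgue_measure_itv/= lte_fin ltr01.
by rewrite -EFinB subr0.
Qed.

Lemma FTC01 (F f : R -> R) : (forall x : R, is_derive x (1 : R) F (f x)) -> continuous f ->
  \int[leb]_x (unit_itv x * f x) = F 1 - F 0.
Proof.
move=> dF cf; rewrite /Rintegral.
have cF : continuous F.
  by move=> x; apply: differentiable_continuous; apply/derivable1_diffP;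
     exact: (@ex_derive _ _ _ _ _ _ _ (dF x)).
have e : (\int[leb]_(x in (`[0%R, 1%R]%classic : set RT)) (f x)%:E = (F 1)%:E - (F 0)%:E)%E.
  apply: continuous_FTC2 => //; first exact: continuous_subspaceT.
    by split=> [x _||]; [exact: (@ex_derive _ _ _ _ _ _ _ (dF x))|
      exact: cvg_at_right_filter (cF 0)|exact: cvg_at_left_filter (cF 1)].
  by move=> x _; rewrite derive1E; exact: (@derive_val _ _ _ _ _ _ _ (dF x)).
rewrite integral_mkcond in e; rewrite -EFinB in e.
rewrite -[RHS]/(fine (F 1 - F 0)%:E) -e; congr fine; apply: eq_integral => x _.
rewrite patchE /unit_itv indicE.
by case: (x \in _); rewrite ?mul1r ?mul0r.
Qed.

Lemma is_derive_cos_affine (a b x : R) :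
  is_derive x (1 : R) (fun x => cos (a * (x - b)) : R) (- (a * sin (a * (x - b)))).
Proof.
have -> : (fun x => cos (a * (x - b))) = cos \o (fun x => a * (x - b)) by [].
by apply: is_derive_eq; rewrite /GRing.scale/= subr0 !mulr1; ring.
Qed.

Lemma is_derive_sin_affine (a b x : R) :
  is_derive x (1 : R) (fun x => sin (a * (x - b)) : R) (a * cos (a * (x - b))).
Proof.
have -> : (fun x => sin (a * (x - b))) = sin \o (fun x => a * (x - b)) by [].
by apply: is_derive_eq; rewrite /GRing.scale/= subr0 !mulr1; ring.
Qed.

Lemma cint_unit_itv_cexpi (m : int) (c : R) :
  cint leb (fun x => (unit_itv x)%:C * cexpi (2 * pi * (m%:~R * (x - c)))) = (m == 0)%:R%:C.
Proof.
rewrite /cint; have [->|m0] := eqVneq m 0.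
  apply/eqP; rewrite eq_complex; apply/andP; split; apply/eqP.
    apply: (@etrans _ _ (\int[leb]_x (unit_itv x))).
      by apply: eq_Rintegral => x _ ; rewrite ReZ mul0r mulr0 /= cos0 mulr1.
    by rewrite /Rintegral integral_unit_itv.
  apply: (@etrans _ _ (\int[leb]_(x in [set: RT]) 0)).
    by apply: eq_Rintegral => x _ ; rewrite ImZ mul0r mulr0 /= sin0 mulr0.
  by rewrite /Rintegral integral0.
pose a : R := 2 * pi * m%:~R.
have a0 : a != 0 by rewrite !mulf_neq0// ?intr_eq0// gt_eqF// pi_gt0.
have per : cexpi (a * (1 - c)) = cexpi (a * (0 - c)).
  by rewrite mulrBr mulr1 sub0r mulrN addrC /a cexpi_2piz.
have [p1 p2] : cos (a * (1 - c)) = cos (a * (0 - c)) /\ sin (a * (1 - c)) = sin (a * (0 - c)).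
  by move: per => [].
have cc (g : R -> R) : continuous g -> continuous (fun x => g (a * (x - c))).
  move=> cg x; apply: (@continuous_comp _ _ _ (fun x => a * (x - c)) g); last exact: cg.
  by apply: cvgMr; apply: cvgB; [exact: cvg_id|exact: cvg_cst].
apply/eqP; rewrite eq_complex; apply/andP; split; apply/eqP.
  apply: (@etrans _ _ (\int[leb]_x (unit_itv x * cos (a * (x - c))))).
    by apply: eq_Rintegral => x _ ; rewrite ReZ /= /a !mulrA.
  have h x : is_derive x (1 : R) (fun x => a^-1 * sin (a * (x - c)) : R) (cos (a * (x - c))).
    have h := is_derive_sin_affine a c x.
    by apply: is_derive_eq; rewrite /GRing.scale/= mulKf.
  by rewrite (FTC01 h (cc _ (@continuous_cos R))) p2 subrr.
apply: (@etrans _ _ (\int[leb]_x (unit_itv x * sin (a * (x - c))))).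
  by apply: eq_Rintegral => x _ ; rewrite ImZ /= /a !mulrA.
have h x : is_derive x (1 : R) (fun x => - a^-1 * cos (a * (x - c)) : R) (sin (a * (x - c))).
  have h := is_derive_cos_affine a c x.
  by apply: is_derive_eq; rewrite /GRing.scale/= mulrNN mulKf.
by rewrite (FTC01 h (cc _ (@continuous_sin R))) p1 subrr.
Qed.

Lemma nnm_fejer N c : nnm (fun x : RT => fejer N (x - c)).
Proof.
split=> [|x]; last exact: fejer_ge0.
apply: measurable_funM; last exact: measurable_cst.
suff h : cmeas (fun x : RT => \sum_(j < N) unitz (x - c) ^+ j) by exact: (nnm_nsq h).1.
apply: cmeas_sum => j; rewrite (_ : (fun x => _) = fun x : RT => cexpi (2 * pi * (j%:R * (x - c)))); last first.
  by apply/funext => x; rewrite unitzX.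
apply: cmeas_cexpi; apply: measurable_funM; first exact: measurable_cst.
apply: measurable_funM; first exact: measurable_cst.
by apply: measurable_funB; [exact: measurable_id|exact: measurable_cst].
Qed.

(** Of the exponentials in [fejer_sum] only the [N] diagonal ones survive integration over a
    period. *)
Lemma fejer_mean N c : (0 < N)%N -> (\int[leb]_x (unit_itv x * fejer N (x - c))%:E = 1)%E.
Proof.
move=> N0; have nu := nnm_unit_itv.
have nf : nnm (fun x : RT => unit_itv x * fejer N (x - c)) by apply: nnmM => //; exact: nnm_fejer.
have du : cdom leb (fun x => (unit_itv x)%:C) unit_itv.
  split=> // [||x]; [by apply: cmeas_real; case: nu|by rewrite integral_unit_itv ltry|].
  by rewrite c1_real ger0_norm//; case: nu.
have dj (j k : 'I_N) : cdom leb (fun x : RT => (unit_itv x)%:C *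
    cexpi (2 * pi * ((j%:Z - k%:Z)%:~R * (x - c)))) (fun x => unit_itv x * 2).
  apply: cdomM => // [|x]; last exact: c1_cexpi.
  apply: cmeas_cexpi; apply: measurable_funM; first exact: measurable_cst.
  apply: measurable_funM; first exact: measurable_cst.
  by apply: measurable_funB; [exact: measurable_id|exact: measurable_cst].
have dk (j : 'I_N) := cint_sum (index_enum _) (dj j).
have [dd] := cint_sum (index_enum _) (fun j => (dk j).1).
under eq_bigr => j _ do rewrite (dk j).2.
under eq_bigr => j _ do under eq_bigr => k _ do rewrite cint_unit_itv_cexpi.
rewrite (_ : \sum_(i < N) _ = N%:R); last first.
  transitivity (\sum_(i < N) (1 : R[i])); last by rewrite sumr_const card_ord.
  apply: eq_bigr => j _; rewrite (bigD1 j)//= subrr eqxx big1 ?addr0// => k.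
  move=> /eqP kj; rewrite subr_eq0 eqz_nat; case: eqP => // e; case: kj; apply/val_inj; exact: esym.
move=> eN.
set g := (X in cdom leb X _) in dd eN.
have gE : g = fun x => (N%:R * (unit_itv x * fejer N (x - c)))%:C.
  apply/funext => x; rewrite /g mulrCA rmorphM/= -fejer_sum// mulr_sumr.
  by apply: eq_bigr => j _; rewrite mulr_sumr.
rewrite gE in dd; have := congr1 (@complex.Re R) (etrans (eq_cint leb (fun x => congr1 (@^~ x) (esym gE))) eN).
rewrite /= /Rintegral => e1.
have NR : complex.Re (N%:R : R[i]) = N%:R.
  by elim: (N) => // n ih; rewrite -!natr1 cReD ih.
rewrite NR in e1.
have N1 : N%:R != 0 :> R by rewrite pnatr_eq0 -lt0n.
transitivity (\int[leb]_x (N%:R^-1 * (N%:R * (unit_itv x * fejer N (x - c))))%:E)%E.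
  by apply: eq_integral => x _; rewrite mulKf.
rewrite nnZl ?invr_ge0//; last by apply: nnmM => //; exact: nnm_cst.
have fin := integrable_fin_num measurableT (cdom_Re dd).
have -> : (\int[leb]_x (N%:R * (unit_itv x * fejer N (x - c)))%:E = N%:R%:E)%E.
  by rewrite -[LHS](fineK fin); exact: (congr1 EFin e1).
by rewrite -EFinM mulVf.
Qed.

(** With [y = 2 z]: [sin y = 2 sin z cos z >= 2 z (cos z)^2 >= z], because [(cos z)^2 >= 1/2] for
    [z <= pi / 4]. *)
Lemma sin_ge_half (y : R) : 0 <= y -> y <= pi / 2 -> y / 2 <= sin y.
Proof.
move=> y0 y1; set z := y / 2; have yz : y = z *+ 2 by rewrite /z -mulr_natr; field.
have z0 : 0 <= z by rewrite /z; lra.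
have zpi : z <= pi / 4 by rewrite /z; lra.
have p0 := @pi_gt0 R.
have cz : 0 <= cos z by apply: cos_ge0_pihalf; apply/andP; split; lra.
have c2 : 1 <= 2 * cos z ^+ 2.
  have : 0 <= cos (z *+ 2) by apply: cos_ge0_pihalf; rewrite -yz; apply/andP; split; lra.
  by rewrite cos_mulr2n -mulr_natl; lra.
have sz : z * cos z <= sin z.
  have [|c] := @MVT_segment R sin cos 0 z z0 (fun x _ => is_derive_sin x).
    exact/continuous_subspaceT/continuous_sin.
  rewrite in_itv/= sin0 !subr0 => /andP[c0 cz2] ->.
  rewrite mulrC ler_wpM2r//; move: cz2; rewrite le_eqVlt => /predU1P[->//|cz2].
  by rewrite ltW// ltr_cos ?in_itv/=//; apply/andP; split; lra.
by rewrite yz sin_mulr2n -mulr_natl; nra.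
Qed.

(** The chord has length [2 sin (pi r)]. *)
Lemma unitz_far (r : R) : 0 <= r -> r <= 2^-1 -> 4 * r ^+ 2 <= nsq (unitz r - 1).
Proof.
move=> r0 r1; have p0 := @pi_ge2 R.
have h : r <= sin (pi * r).
  apply: (@le_trans _ _ (pi * r / 2)); first by nra.
  by apply: sin_ge_half; nra.
have -> : nsq (unitz r - 1) = 4 * sin (pi * r) ^+ 2.
  rewrite /nsq /unitz /cexpi/= subr0 (_ : 2 * pi * r = (pi * r) *+ 2); last by rewrite mulr2n; ring.
  rewrite cos_mulr2n sin_mulr2n !mulr2n; have := @cos2Dsin2 R (pi * r).
  move: (cos _) (sin _) => a b ab; have ea : a ^+ 2 = 1 - b ^+ 2 by rewrite -ab addrK.
  have -> : a ^+ 2 + a ^+ 2 - 1 - 1 = - (b ^+ 2 *+ 2) by rewrite ea mulr2n; ring.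
  rewrite (_ : (a * b + a * b) ^+ 2 = 4 * (a ^+ 2 * b ^+ 2)); last by ring.
  by rewrite ea mulr2n; ring.
by rewrite ler_pM2l// ler_pXn2r ?nnegrE//; exact: le_trans h.
Qed.

Lemma unitzN d : nsq (unitz (- d) - 1) = nsq (unitz d - 1).
Proof. by rewrite /unitz mulrN cexpiN /nsq /cexpi/= !subr0 sqrrN. Qed.

Lemma unitz1 d : unitz (d + 1) = unitz d.
Proof. by rewrite /unitz mulrDr -(cexpi_2piz 1 (2 * pi * d)). Qed.

(** The witness [r] is the distance from [x - y] to the nearest integer: by periodicity it is the
    distance that counts, and [unitz_far] compares it with the chord that [fejer_vanish]
    controls. *)
Lemma periodic_lipschitz (L : R) (f : R -> R) (x y : R) :
  (forall x, f (x + 1) = f x) -> (forall x y, `|f x - f y| <= L * `|x - y|) ->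
  `|x - y| <= 1 -> exists2 r, `|f x - f y| <= L * r & 0 <= r /\ 4 * r ^+ 2 <= nsq (unitz (x - y) - 1).
Proof.
move=> pf lf; rewrite ler_norml => /andP[d1 d2].
have [h|h] := leP (x - y) 2^-1; last first.
  exists (1 - (x - y)).
    rewrite -(pf y); apply: le_trans (lf _ _) _; rewrite ler0_norm; last by lra.
    by rewrite (_ : - (x - (y + 1)) = 1 - (x - y)) //; ring.
  split; first by lra.
  rewrite -unitzN -unitz1 (_ : - (x - y) + 1 = 1 - (x - y)); last by ring.
  by apply: unitz_far; lra.
have [h2|h2] := leP (- 2^-1) (x - y); last first.
  exists (1 + (x - y)).
    rewrite -(pf x); apply: le_trans (lf _ _) _; rewrite ger0_norm; last by lra.
    by rewrite (_ : x + 1 - y = 1 + (x - y)) //; ring.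
  split; first by lra.
  by rewrite -unitz1 addrC; apply: unitz_far; lra.
exists `|x - y| => //; split => //.
have [h3|h3] := leP 0 (x - y); first by rewrite ger0_norm//; apply: unitz_far.
by rewrite ltr0_norm// -unitzN; apply: unitz_far; lra.
Qed.

End fejer_kernel.

(** * Mass and tail of the Poisson kernel *)

Section poisson_mass.
Context {R : realType}.
Local Notation leb := (@lebesgue_measure R).
Local Notation RT := (measurableTypeR R).

Definition pois (e : R) (t : R) : R := poisson e (2 * pi * t).

Lemma pois_ge0 e t : 0 < e -> 0 <= pois e t.
Proof. by move=> e0; rewrite divr_ge0// ?mulr_ge0// ?ltW// ltr_wpDr ?exprn_gt0// sqr_ge0. Qed.

Lemma nnm_pois e : 0 < e -> nnm (pois e : RT -> R).
Proof.
move=> e0; split=> [|t]; last exact: pois_ge0.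
apply: continuous_measurable_fun => x; apply: cvgM; first exact: cvg_cst.
apply: cvgV; first by rewrite gt_eqF// ltr_wpDr ?exprn_gt0// sqr_ge0.
apply: cvgD; first exact: cvg_cst.
by apply: (@continuous_comp _ _ _ (fun t => 2 * pi * t) (fun y => y ^+ 2));
  [exact: mulrl_continuous|exact: exprn_continuous].
Qed.

Let two_pi_sqr : 4 <= (2 * pi : R) ^+ 2.
Proof. by have := @pi_ge2 R; nra. Qed.

Lemma jw2E (t : R) : jw (1 + 1) t = (1 + t ^+ 2)^-1.
Proof.
rewrite /jw powRN (_ : 1 + 1 = 2%:R)// powR_mulrn; last exact: ltW (japanese_gt0 _).
by rewrite /japanese sqr_sqrtr// addr_ge0// sqr_ge0.
Qed.

Lemma pois_le e t : 0 < e -> e <= 1 -> pois e t <= 2 / e * jw (1 + 1) t.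
Proof.
move=> e0 e1; rewrite jw2E /pois /poisson exprMn; set P := (2 * pi) ^+ 2.
have P4 : 4 <= P by exact: two_pi_sqr.
have t2 := sqr_ge0 t; have d1 : 0 < 1 + t ^+ 2 by lra.
have d2 : 0 < e ^+ 2 + P * t ^+ 2 by rewrite ltr_wpDr ?exprn_gt0// mulr_ge0//; lra.
rewrite ler_pdivrMr// [leRHS]mulrAC ler_pdivlMr// [leRHS]mulrAC ler_pdivlMr//.
have : e ^+ 2 * (t ^+ 2) <= P * t ^+ 2 by rewrite ler_wpM2r//; nra.
by move: (t ^+ 2) t2 => y y0 h; nra.
Qed.

(** For fixed [d] the tail tends to 0 with [e], uniformly relative to an integrable profile. *)
Lemma pois_tail_le e d t : 0 < e -> 0 < d -> d <= 1 -> d < `|t| ->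
  pois e t <= 2 * e / d ^+ 2 * jw (1 + 1) t.
Proof.
move=> e0 d0 d1 dt; rewrite jw2E /pois /poisson exprMn; set P := (2 * pi) ^+ 2.
have P4 : 4 <= P by exact: two_pi_sqr.
have dt2 : d ^+ 2 <= t ^+ 2.
  by rewrite -[t ^+ 2]real_normK ?num_real// ler_pXn2r ?nnegrE// ltW.
have dd : 0 < d ^+ 2 by rewrite exprn_gt0.
have dd1 : d ^+ 2 <= 1 by rewrite exprn_ile1// ltW.
have e2 : 0 < e ^+ 2 by rewrite exprn_gt0.
have d1' : 0 < 1 + t ^+ 2 by lra.
have d2 : 0 < e ^+ 2 + P * t ^+ 2 by rewrite ltr_wpDr// mulr_ge0//; lra.
rewrite ler_pdivrMr// [leRHS]mulrAC ler_pdivlMr// [leRHS]mulrAC ler_pdivlMr//.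
rewrite -[leLHS]mulrA ler_pM2l ?mulr_gt0//.
have y0 : 0 <= t ^+ 2 by rewrite sqr_ge0.
have h1 : (1 + t ^+ 2) * d ^+ 2 <= 2 * t ^+ 2.
  have : t ^+ 2 * d ^+ 2 <= t ^+ 2 by rewrite ler_piMr.
  by rewrite mulrDl mul1r; lra.
have : 4 * t ^+ 2 <= P * t ^+ 2 by rewrite ler_wpM2r.
lra.
Qed.

(** The mass of [pois e] equals 1, but a lower bound independent of [e] is enough: on [[- e, e]], of
    length [2 e], the kernel is at least [2 / (e (1 + (2 pi)^2))]. *)
Definition pois_floor : R := 4 / (1 + (2 * pi) ^+ 2).

Lemma pois_floor_gt0 : 0 < pois_floor.
Proof. by rewrite divr_gt0// ltr_pwDl// sqr_ge0. Qed.

Lemma pois_mass_lty e : 0 < e -> e <= 1 -> (\int[leb]_t (pois e t)%:E < +oo)%E.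
Proof.
move=> e0 e1; have c : 0 <= 2 / e by rewrite divr_ge0// ltW.
apply: (@le_lt_trans _ _ (\int[leb]_t (2 / e * jw (1 + 1) t)%:E)%E).
  by apply: nn_le => [||t]; [exact: nnm_pois|apply: nnmM; [exact: nnm_cst|exact: nnm_jw]|exact: pois_le].
rewrite nnZl//; last exact: nnm_jw.
apply: lte_mul_pinfty => //.
exact: le_lt_trans (integral_jw_le ltr01) (ltry _).
Qed.

Lemma pois_mass_ge e : 0 < e -> (pois_floor%:E <= \int[leb]_t (pois e t)%:E)%E.
Proof.
move=> e0; set P := (2 * pi : R) ^+ 2; have P4 : 4 <= P by exact: two_pi_sqr.
pose I : set RT := `[(- e), e]%classic; have mI : measurable I by exact: measurable_itv.
pose i1 : RT -> R := \1_I; have n1 : nnm i1 by apply: nnm_indic; exact: measurable_itv.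
pose k := 2 / (e * (1 + P)).
have k0 : 0 <= k by rewrite divr_ge0// mulr_ge0 ?ltW//; lra.
apply: (@le_trans _ _ (\int[leb]_t (k * i1 t)%:E)%E); last first.
  apply: nn_le => [||t]; [by apply: nnmM; [exact: nnm_cst|exact: n1]|exact: nnm_pois|].
  rewrite /i1 indicE; case: (boolP (t \in I)) => [|_]; last by rewrite mulr0 pois_ge0.
  rewrite inE /I/= in_itv/= mulr1 -ler_norml => te.
  have t2 : t ^+ 2 <= e ^+ 2 by rewrite -[t ^+ 2]real_normK ?num_real// ler_pXn2r ?nnegrE// ltW.
  rewrite /k /pois /poisson exprMn -/P ler_pdivlMr; last first.
    by rewrite ltr_wpDr ?exprn_gt0// mulr_ge0 ?sqr_ge0//; lra.
  rewrite mulrAC ler_pdivrMr; last by rewrite mulr_gt0//; lra.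
  rewrite (_ : 2 * e * (e * (1 + P)) = 2 * (e ^+ 2 + P * e ^+ 2)); last by ring.
  by rewrite ler_pM2l// lerD2l ler_wpM2l//; lra.
rewrite (nnZl _ k0 n1) /i1.
rewrite integral_indic//= ?setIT// lebesgue_measure_itv/= lte_fin ifT; last by lra.
rewrite -EFinB -EFinM lee_fin /k /pois_floor -/P.
rewrite (_ : 2 / (e * (1 + P)) * _ = 4 / (1 + P))//.
by field; rewrite !gt_eqF//; lra.
Qed.

End poisson_mass.

(** * Integration over a spatial period as integration against [chi] *)

Section spacetime_kernel.
Context {R : realType}.
Local Notation leb := (@lebesgue_measure R).
Local Notation RT := (measurableTypeR R).
Local Notation ST := (RT * (RT * RT))%type.
Local Notation stm := (@st_measure R).
Local Open Scope complex_scope.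

Definition chi (p : ST) : R := unit_itv p.2.1 * unit_itv p.2.2.

Lemma nnm_coord (a b c : RT -> R) : nnm a -> nnm b -> nnm c ->
  nnm (fun p : ST => a p.1 * (b p.2.1 * c p.2.2)).
Proof.
move=> na nb nc; apply: (@nnm_tensor _ _ _ _ _ a (fun y => b y.1 * c y.2)) => //.
exact: nnm_tensor.
Qed.

Lemma integral_coord (a b c : RT -> R) : nnm a -> nnm b -> nnm c ->
  (\int[stm]_p (a p.1 * (b p.2.1 * c p.2.2))%:E =
   \int[leb]_x (a x)%:E * (\int[leb]_x (b x)%:E * \int[leb]_x (c x)%:E))%E.
Proof.
move=> na nb nc.
rewrite -(integral_tensor leb leb nb nc).
exact: (@integral_tensor _ _ _ _ _ leb (@plane_measure R) a (fun y => b y.1 * c y.2) na (nnm_tensor nb nc)).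
Qed.

Lemma nnm_chi : nnm chi.
Proof.
have h := nnm_coord (@nnm_cst _ RT R 1 ler01) (@nnm_unit_itv R) (@nnm_unit_itv R).
by rewrite (_ : chi = fun p : ST => 1 * (unit_itv p.2.1 * unit_itv p.2.2)) //; apply/funext => p; rewrite mul1r.
Qed.

Definition in_slab (p : spacetime R) := 0 <= p.2.1 <= 1 /\ 0 <= p.2.2 <= 1.

Lemma chiP p : (in_slab p /\ chi p = 1) \/ chi p = 0.
Proof.
rewrite /chi /unit_itv !indicE.
case: (boolP (p.2.1 \in _)); last by right; rewrite mul0r.
case: (boolP (p.2.2 \in _)); last by right; rewrite mulr0.
by rewrite !inE/= !in_itv/= => h2 h1; left; rewrite mul1r.
Qed.

Lemma cintegral_chi (f : spacetime R -> R[i]) :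
  cintegral (setT `*` unit_square) f = cint stm (fun p : ST => (chi p)%:C * f p).
Proof.
have e (g : spacetime R -> R) : \int[stm]_(p in (setT `*` unit_square : set ST)) g p =
    \int[stm]_p (chi p * g p).
  rewrite Rintegral_mkcond; apply: eq_Rintegral => p _.
  rewrite patchE /chi /unit_itv !indicE -natrM mulnb.
  have -> : (p \in (setT `*` unit_square : set ST)) = (p.2.1 \in `[0, 1]%classic) && (p.2.2 \in `[0, 1]%classic).
    by apply/idP/andP; rewrite !inE /unit_square/=; [move=> [_ []]|move=> []].
  by case: (_ && _); rewrite ?mul1r ?mul0r.
rewrite /cintegral /cint !e; apply/eqP; rewrite eq_complex/=; apply/andP; split; apply/eqP;
  apply: eq_Rintegral => p _; by rewrite ?ReZ ?ImZ.
Qed.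

End spacetime_kernel.

Lemma ord_box N (j k : 'I_N) : (j + N - k)%N \in iota 0 (2 * N) /\
  j%:Z - k%:Z = (j + N - k)%N%:Z - N%:Z.
Proof. by have := ltn_ord j; have := ltn_ord k; rewrite mem_iota; lia. Qed.

Lemma ord_diff_inj N (k l : 'I_N) (a : int) : a - k%:Z = a - l%:Z -> k = l.
Proof. by move=> /addrI/oppr_inj[] /val_inj. Qed.

(** * Mollification of one factor of a product *)

Section product_bound.
Context {R : realType}.
Local Notation leb := (@lebesgue_measure R).
Local Notation RT := (measurableTypeR R).
Local Notation ST := (RT * (RT * RT))%type.
Local Notation stm := (@st_measure R).
Local Open Scope complex_scope.

Lemma cJB (z1 z2 : R[i]) : conjc (z1 - z2) = conjc z1 - conjc z2.
Proof. exact: rmorphB. Qed.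

Lemma realM (x y : R) : (x * y)%:C = x%:C * y%:C.
Proof. exact: rmorphM. Qed.

Definition space_phase (n : int * int) (p : ST) : R := n.1%:~R * p.2.1 + n.2%:~R * p.2.2.

Definition ft (G : ST -> R[i]) (t : R) (n : int * int) : R[i] :=
  cint stm (fun p => G p * cexpi (- (2 * pi * (p.1 * t + space_phase n p)))).

Lemma st_fourier_ft (u : spacetime R -> R[i]) t n :
  st_fourier u t n = ft (fun p => (chi p)%:C * u p) t n.
Proof. by rewrite /st_fourier cintegral_chi; apply: eq_cint => p; rewrite mulrA. Qed.

Definition time_phase (p : ST) : RT := 2 * pi * p.1.

Lemma measurable_time_phase : measurable_fun setT time_phase.
Proof. by apply: measurable_funM; [exact: measurable_cst|exact: measurable_fst]. Qed.

Lemma measurable_x1 : measurable_fun setT (fun p : ST => p.2.1 : RT).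
Proof. exact: (measurableT_comp measurable_fst measurable_snd). Qed.

Lemma measurable_x2 : measurable_fun setT (fun p : ST => p.2.2 : RT).
Proof. exact: (measurableT_comp measurable_snd measurable_snd). Qed.

Lemma measurable_space_phase n : measurable_fun setT (space_phase n : ST -> RT).
Proof.
apply: measurable_funD; apply: measurable_funM; try exact: measurable_cst.
  exact: measurable_x1.
exact: measurable_x2.
Qed.

(** Absorbs the space frequency, so that [poisson_parseval] in the time variable applies to each [n]
    separately. *)
Definition twist (G : ST -> R[i]) n (p : ST) : R[i] := G p * cexpi (- (2 * pi * space_phase n p)).

Lemma ft_twist G t n : ft G t n = phase_transform stm time_phase (twist G n) t.
Proof.
apply: eq_cint => p; rewrite /twist -[RHS]mulrA -cexpiD; congr (_ * cexpi _).
by rewrite /time_phase; ring.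
Qed.

Lemma cmeas_twist n : cmeas (fun p : ST => cexpi (- (2 * pi * space_phase n p))).
Proof.
apply: cmeas_cexpi; apply: measurable_funN; apply: measurable_funM; first exact: measurable_cst.
exact: measurable_space_phase.
Qed.

Lemma cdom_twist G a n : cdom stm G a -> cdom stm (twist G n) (fun p => a p * 2).
Proof.
by move=> dG; apply: cdomM => //; [exact: cmeas_twist|move=> p; exact: c1_cexpi].
Qed.

Definition kern (e : R) (N : nat) (p q : ST) : R :=
  pois e (q.1 - p.1) * (fejer N (q.2.1 - p.2.1) * fejer N (q.2.2 - p.2.2)).

Lemma kern_ge0 e N p q : 0 < e -> 0 <= kern e N p q.
Proof. by move=> e0; rewrite mulr_ge0 ?pois_ge0// mulr_ge0 ?fejer_ge0. Qed.

Lemma nnm_pois_shift e c : 0 < e -> nnm (fun x : RT => pois e (x - c)).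
Proof. by move=> e0; exact: (nnm_shift (- c) (nnm_pois e0)). Qed.

Lemma nnm_unit_fejer N c : nnm (fun x : RT => unit_itv x * fejer N (x - c)).
Proof. by apply: nnmM; [exact: nnm_unit_itv|exact: nnm_fejer]. Qed.

Lemma nnm_kern e N p : 0 < e -> nnm (kern e N p).
Proof.
move=> e0; exact: (nnm_coord (nnm_pois_shift p.1 e0) (nnm_fejer N p.2.1) (nnm_fejer N p.2.2)).
Qed.

Definition pois_mass e : R := fine (\int[leb]_t (pois e t)%:E)%E.

Lemma pois_massE e : 0 < e -> e <= 1 -> (\int[leb]_t (pois e t)%:E = (pois_mass e)%:E)%E.
Proof.
move=> e0 e1; rewrite fineK// ge0_fin_numE; first exact: pois_mass_lty.
exact: (nn_ge0 _ (nnm_pois e0)).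
Qed.

Lemma pois_mass_gt e : 0 < e -> e <= 1 -> pois_floor <= pois_mass e.
Proof. by move=> e0 e1; rewrite -lee_fin -pois_massE//; exact: pois_mass_ge. Qed.

Lemma kern_mass e N p : 0 < e -> e <= 1 -> (0 < N)%N ->
  (\int[stm]_q (chi q * kern e N p q)%:E = (pois_mass e)%:E)%E.
Proof.
move=> e0 e1 N0; transitivity (\int[stm]_q (pois e (q.1 - p.1) *
   ((unit_itv q.2.1 * fejer N (q.2.1 - p.2.1)) * (unit_itv q.2.2 * fejer N (q.2.2 - p.2.2))))%:E)%E.
  by apply: eq_integral => q _; congr EFin; rewrite /chi /kern; ring.
rewrite (integral_coord (nnm_pois_shift p.1 e0) (nnm_unit_fejer N p.2.1) (nnm_unit_fejer N p.2.2)).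
rewrite !fejer_mean// !mule1 -(pois_massE e0 e1).
exact: (nn_shift (- p.1) (nnm_pois e0)).
Qed.

Lemma nnm_chi_kern e N p : 0 < e -> nnm (fun q => chi q * kern e N p q).
Proof. by move=> e0; apply: nnmM; [exact: nnm_chi|exact: nnm_kern]. Qed.

Section multiplier.
Variables (V : spacetime R -> R[i]) (L B : R).
Hypotheses (pV : Defs.periodic V) (L0 : 0 < L) (B0 : 0 < B).
Hypotheses (lRe : st_lipschitz L (fun p => complex.Re (V p)))
           (lIm : st_lipschitz L (fun p => complex.Im (V p))).
Hypothesis bV : forall p, c1 (V p) <= B.

Let cmV : cmeas (V : ST -> R[i]).
Proof. by split; [exact: st_lipschitz_measurable lRe|exact: st_lipschitz_measurable lIm]. Qed.

(** The coordinates are changed one at a time. For the periodic ones the distance [r] is replaced by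
    [s + r^2 / s], since the Fejer kernel is controlled only against squared chords. *)
Let component (f : spacetime R -> R) (p q : spacetime R) (s : R) :
  (forall t x y, f (t, (x + 1, y)) = f (t, (x, y)) /\ f (t, (x, y + 1)) = f (t, (x, y))) ->
  st_lipschitz L f -> in_slab p -> in_slab q -> 0 < s -> `|q.1 - p.1| <= s ->
  `|f q - f p| <= 3 * L * s + L / s * (nsq (unitz (q.2.1 - p.2.1) - 1) + nsq (unitz (q.2.2 - p.2.2) - 1)).
Proof.
case: p q => [tp [xp yp]] [tq [xq yq]] /= pf lf [/=/andP[p1 p2] /andP[p3 p4]] [/=/andP[q1 q2] /andP[q3 q4]] s0 ts.
have hr (g : R -> R) x y : (forall x, g (x + 1) = g x) -> (forall x y, `|g x - g y| <= L * `|x - y|) ->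
    `|x - y| <= 1 -> `|g x - g y| <= L * s + L / s * nsq (unitz (x - y) - 1).
  move=> pg lg xy; have [r gr [r0 r4]] := periodic_lipschitz pg lg xy.
  apply: (le_trans gr); rewrite -mulrA -mulrDr ler_wpM2l ?(ltW L0)//.
  apply: (@le_trans _ _ (s + s^-1 * r ^+ 2)); last first.
    rewrite lerD2l ler_wpM2l ?invr_ge0 ?(ltW s0)//; have := sqr_ge0 r; lra.
  have [rs|sr] := leP r s; first by rewrite -[leLHS]addr0 lerD// mulr_ge0 ?sqr_ge0// invr_ge0 ltW.
  rewrite -[leLHS]add0r lerD ?(ltW s0)// mulrC ler_pdivlMr// expr2 ler_wpM2l// ltW//.
have hx := hr (fun x => f (tp, (x, yq))) xq xp (fun x => (pf tp x yq).1).
have hy := hr (fun y => f (tp, (xp, y))) yq yp (fun y => (pf tp xp y).2).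
have {}hx : `|f (tp, (xq, yq)) - f (tp, (xp, yq))| <= L * s + L / s * nsq (unitz (xq - xp) - 1).
  apply: hx => [x y|]; first by have := lf (tp, (x, yq)) (tp, (y, yq)) => /=; rewrite !subrr normr0 add0r addr0.
  by rewrite ler_norml; apply/andP; split; lra.
have {}hy : `|f (tp, (xp, yq)) - f (tp, (xp, yp))| <= L * s + L / s * nsq (unitz (yq - yp) - 1).
  apply: hy => [x y|]; first by have := lf (tp, (xp, x)) (tp, (xp, y)) => /=; rewrite !subrr normr0 !add0r.
  by rewrite ler_norml; apply/andP; split; lra.
have ht : `|f (tq, (xq, yq)) - f (tp, (xq, yq))| <= L * s.
  have := lf (tq, (xq, yq)) (tp, (xq, yq)) => /=; rewrite !subrr normr0 !addr0 => h.
  by apply: le_trans h _; rewrite ler_wpM2l// ltW.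
rewrite (_ : _ - _ = (f (tq, (xq, yq)) - f (tp, (xq, yq))) +
  ((f (tp, (xq, yq)) - f (tp, (xp, yq))) + (f (tp, (xp, yq)) - f (tp, (xp, yp))))); last by ring.
apply: le_trans (ler_normD _ _) _.
have := ler_normD (f (tp, (xq, yq)) - f (tp, (xp, yq))) (f (tp, (xp, yq)) - f (tp, (xp, yp))).
by rewrite mulrDr; lra.
Qed.

Let far (s t : R) : R := (s < `|t|)%R%:R.

(** For time differences beyond [s] the boundedness of [V] replaces its Lipschitz bound; that region
    is left to the Poisson tail. *)
Lemma multiplier_modulus p q (s : R) : in_slab p -> in_slab q -> 0 < s ->
  c1 (V q - V p) <= 6 * L * s + 2 * L / s * nsq (unitz (q.2.1 - p.2.1) - 1) +
    2 * L / s * nsq (unitz (q.2.2 - p.2.2) - 1) + 2 * B * far s (q.1 - p.1).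
Proof.
move=> ip iq s0; have n1 := nsq_ge0 (unitz (q.2.1 - p.2.1) - 1).
have n2 := nsq_ge0 (unitz (q.2.2 - p.2.2) - 1).
have c0 : 0 <= L / s by rewrite divr_ge0// ltW.
have m1 : 0 <= L / s * nsq (unitz (q.2.1 - p.2.1) - 1) by rewrite mulr_ge0.
have m2 : 0 <= L / s * nsq (unitz (q.2.2 - p.2.2) - 1) by rewrite mulr_ge0.
have m3 : 0 <= L * s by apply: mulr_ge0; exact: ltW.
rewrite -!mulrA; rewrite /far; case: (ltP s _) => ts.
  have := c1D (V q) (- V p); rewrite c1N; have := bV p; have := bV q.
  by rewrite mulr1; lra.
have r1 := component (fun t x y => _) lRe ip iq s0 ts.
have r2 := component (fun t x y => _) lIm ip iq s0 ts.
have {}r1 := r1 (fun t x y => conj (congr1 (@complex.Re R) (pV t x y).1) (congr1 (@complex.Re R) (pV t x y).2)).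
have {}r2 := r2 (fun t x y => conj (congr1 (@complex.Im R) (pV t x y).1) (congr1 (@complex.Im R) (pV t x y).2)).
rewrite /c1 !cReD !cImD !cReN !cImN !mulr0.
by move: r1 r2; rewrite !mulrDr; lra.
Qed.

Section parameters.
Variables (e s eta : R) (N : nat).
Hypotheses (e0 : 0 < e) (e1 : e <= 1) (s0 : 0 < s) (s1 : s <= 1) (N0 : (0 < N)%N) (eta0 : 0 < eta).
Hypothesis small1 : 6 * L * s <= eta / 3.
Hypothesis small2 : 16 * L / s / N%:R <= eta / 3.
Hypothesis small3 : 2 * B * (2 * e / s ^+ 2) * jw_mass 1 <= eta / 3 * pois_floor.

Let M := pois_mass e.
Let M0 : 0 < M. Proof. exact: lt_le_trans pois_floor_gt0 (pois_mass_gt e0 e1). Qed.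

Let nnm_diff p : nnm (fun q : ST => c1 (V q - V p) * (chi q * kern e N p q)).
Proof.
apply: nnmM; last exact: nnm_chi_kern.
by apply: cmeas_c1; apply: cmeasD => //; exact: cmeas_cst.
Qed.

(** The contributions are [6 L s] from nearby points, twice [(2 L / s) (4 / N)] from the Fejer
    kernels, and the Poisson tail; the three smallness hypotheses make each group at most a third.
    Thus [s] has to be chosen before [N] and [e]. *)
Lemma kern_error p : in_slab p ->
  (\int[stm]_q (c1 (V q - V p) * (chi q * kern e N p q))%:E <= (eta * M)%:E)%E.
Proof.
move=> ip.
have nP := nnm_pois_shift p.1 e0; have nu := @nnm_unit_itv R.
have nx := nnm_unit_fejer N p.2.1; have ny := nnm_unit_fejer N p.2.2.
have nj : nnm (fun x : RT => jw (1 + 1) (x - p.1)) by exact: (nnm_shift (- p.1) (nnm_jw _)).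
(* In [T1] and [T2] one Fejer factor has been used up by [fejer_vanish], in [T3] the Poisson factor
   by its tail bound; what is left in each has explicit or bounded mass. *)
pose T0 (q : ST) := pois e (q.1 - p.1) * ((unit_itv q.2.1 * fejer N (q.2.1 - p.2.1)) * (unit_itv q.2.2 * fejer N (q.2.2 - p.2.2))).
pose T1 (q : ST) := pois e (q.1 - p.1) * (unit_itv q.2.1 * (unit_itv q.2.2 * fejer N (q.2.2 - p.2.2))).
pose T2 (q : ST) := pois e (q.1 - p.1) * ((unit_itv q.2.1 * fejer N (q.2.1 - p.2.1)) * unit_itv q.2.2).
pose T3 (q : ST) := jw (1 + 1) (q.1 - p.1) * ((unit_itv q.2.1 * fejer N (q.2.1 - p.2.1)) * (unit_itv q.2.2 * fejer N (q.2.2 - p.2.2))).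
have n0 : nnm T0 by exact: (nnm_coord nP nx ny).
have n1 : nnm T1 by exact: (nnm_coord nP nu ny).
have n2 : nnm T2 by exact: (nnm_coord nP nx nu).
have n3 : nnm T3 by exact: (nnm_coord nj nx ny).
have mP : (\int[leb]_t (pois e (t - p.1))%:E = M%:E)%E.
  by rewrite (nn_shift (- p.1) (nnm_pois e0)) pois_massE.
have i0 : (\int[stm]_q (T0 q)%:E = M%:E)%E by rewrite (integral_coord nP nx ny) !fejer_mean// !mule1.
have i1 : (\int[stm]_q (T1 q)%:E = M%:E)%E.
  by rewrite (integral_coord nP nu ny) !fejer_mean// integral_unit_itv !mule1.
have i2 : (\int[stm]_q (T2 q)%:E = M%:E)%E.
  by rewrite (integral_coord nP nx nu) !fejer_mean// integral_unit_itv !mule1.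
have i3 : (\int[stm]_q (T3 q)%:E <= (jw_mass 1)%:E)%E.
  rewrite (integral_coord nj nx ny) !fejer_mean// !mule1.
  by rewrite (nn_shift (- p.1) (nnm_jw _)); exact: integral_jw_le ltr01.
set k1 := 2 * L / s * (4 / N%:R); set k3 := 2 * B * (2 * e / s ^+ 2).
have Nr : 0 < N%:R :> R by rewrite ltr0n.
have k10 : 0 <= k1 by rewrite mulr_ge0// ?divr_ge0// ?mulr_ge0// ltW.
have k30 : 0 <= k3 by rewrite mulr_ge0// ?divr_ge0// ?mulr_ge0// ?sqr_ge0// ltW.
have k00 : 0 <= 6 * L * s by rewrite !mulr_ge0// ltW.
have h0 : nnm (fun q => 6 * L * s * T0 q) by apply: nnmM => //; exact: nnm_cst.
have h1 : nnm (fun q => k1 * T1 q) by apply: nnmM => //; exact: nnm_cst.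
have h2 : nnm (fun q => k1 * T2 q) by apply: nnmM => //; exact: nnm_cst.
have h3 : nnm (fun q => k3 * T3 q) by apply: nnmM => //; exact: nnm_cst.
apply: (@le_trans _ _ (\int[stm]_q (6 * L * s * T0 q + (k1 * T1 q + (k1 * T2 q + k3 * T3 q)))%:E)%E).
  apply: nn_le => [||q]; first exact: nnm_diff.
    by apply: nnmD => //; apply: nnmD => //; exact: nnmD.
  have [[iq cq]|cq] := chiP q; last first.
    rewrite cq mul0r mulr0 !addr_ge0//; [by case: h0|by case: h1|by case: h2|by case: h3].
  have cm := multiplier_modulus ip iq s0.
  rewrite cq mul1r; have K0 := kern_ge0 N p q e0.
  apply: le_trans (ler_wpM2r K0 cm) _.
  have ux : unit_itv q.2.1 = 1 by rewrite /unit_itv indicE mem_set//= in_itv/=; case: iq.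
  have uy : unit_itv q.2.2 = 1 by rewrite /unit_itv indicE mem_set//= in_itv/=; case: iq.
  rewrite /T0 /T1 /T2 /T3 ux uy !mul1r !mulr1 /kern.
  have P0 := pois_ge0 (q.1 - p.1) e0.
  have v1 := fejer_vanish (q.2.1 - p.2.1) N0; have v2 := fejer_vanish (q.2.2 - p.2.2) N0.
  have f1 := fejer_ge0 N (q.2.1 - p.2.1); have f2 := fejer_ge0 N (q.2.2 - p.2.2).
  have w3 : pois e (q.1 - p.1) * far s (q.1 - p.1) <= 2 * e / s ^+ 2 * jw (1 + 1) (q.1 - p.1).
    rewrite /far; case: ltP => [sq|_]; first by rewrite mulr1; exact: pois_tail_le.
    by rewrite mulr0 mulr_ge0 ?jw_ge0// divr_ge0 ?sqr_ge0// mulr_ge0// ltW.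
  move: v1 v2 f1 f2 P0 w3 K0 {cm}; rewrite /kern /k1 /k3.
  move: (fejer N (q.2.1 - p.2.1)) (fejer N (q.2.2 - p.2.2)) (pois e _) (far s _) (jw _ _).
  move: (nsq (unitz (q.2.1 - p.2.1) - 1)) (nsq (unitz (q.2.2 - p.2.2) - 1)).
  move=> x1 x2 f1 f2 P fr J v1 v2 f10 f20 P0 w3 _.
  have Ls0 : 0 <= 2 * L / s by rewrite divr_ge0// ?mulr_ge0// ltW.
  have a1 : 2 * L / s * x1 * (P * (f1 * f2)) <= 2 * L / s * (4 / N%:R) * (P * f2).
    rewrite (_ : 2 * L / s * x1 * (P * (f1 * f2)) = 2 * L / s * (f1 * x1) * (P * f2)); last by ring.
    by rewrite ler_wpM2r ?mulr_ge0// ler_wpM2l.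
  have a2 : 2 * L / s * x2 * (P * (f1 * f2)) <= 2 * L / s * (4 / N%:R) * (P * f1).
    rewrite (_ : 2 * L / s * x2 * (P * (f1 * f2)) = 2 * L / s * (f2 * x2) * (P * f1)); last by ring.
    by rewrite ler_wpM2r ?mulr_ge0// ler_wpM2l.
  have a3 : 2 * B * fr * (P * (f1 * f2)) <= 2 * B * (2 * e / s ^+ 2) * (J * (f1 * f2)).
    rewrite (_ : 2 * B * fr * (P * (f1 * f2)) = 2 * B * (P * fr) * (f1 * f2)); last by ring.
    rewrite (_ : 2 * B * (2 * e / s ^+ 2) * (J * (f1 * f2)) = 2 * B * (2 * e / s ^+ 2 * J) * (f1 * f2)); last by ring.
    by rewrite ler_wpM2r ?mulr_ge0// ler_wpM2l// mulr_ge0// ltW.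
  have dist (a b c d k : R) : (a + b + c + d) * k = a * k + (b * k + (c * k + d * k)) by ring.
  by rewrite dist; exact: (lerD (lexx _) (lerD a1 (lerD a2 a3))).
rewrite nnD//; last by apply: nnmD => //; exact: nnmD.
rewrite nnD//; last exact: nnmD.
rewrite nnD// !nnZl// i0 i1 i2.
apply: (@le_trans _ _ ((6 * L * s * M)%:E + ((k1 * M)%:E + ((k1 * M)%:E + (k3 * jw_mass 1)%:E)))%E).
  rewrite !EFinM; apply: leeD => //; apply: leeD => //; apply: leeD => //.
  by apply: lee_wpmul2l; rewrite ?lee_fin.
rewrite -!EFinD lee_fin.
have b3 : k3 * jw_mass 1 <= eta / 3 * M.
  by apply: le_trans small3 _; rewrite ler_wpM2l ?divr_ge0 ?(ltW eta0)//; exact: pois_mass_gt.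
have b1 : 6 * L * s * M <= eta / 3 * M by rewrite ler_wpM2r// ltW.
have b2 : (k1 + k1) * M <= eta / 3 * M.
  rewrite ler_wpM2r ?(ltW M0)//; apply: le_trans small2; rewrite /k1.
  by rewrite (_ : _ + _ = 16 * L / s / N%:R)//; field; rewrite !gt_eqF.
rewrite mulrDl in b2; rewrite (_ : eta * M = eta / 3 * M + (eta / 3 * M + eta / 3 * M)); last by field.
lra.
Qed.

Let H (q : ST) : R[i] := (chi q)%:C * V q.

Let c1H q : c1 (H q) <= B * chi q.
Proof.
apply: le_trans (c1M _ _) _; rewrite c1_real ger0_norm; last by case: (@nnm_chi R).
by rewrite mulrC ler_wpM2r//; case: (@nnm_chi R).
Qed.

Let cmH : cmeas H.
Proof. by apply: cmeasM => //; apply: cmeas_real; case: (@nnm_chi R). Qed.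

Let cdom_kern p : cdom stm (fun q => (chi q * kern e N p q)%:C) (fun q => chi q * kern e N p q).
Proof.
have n := nnm_chi_kern N p e0.
split => //; first by apply: cmeas_real; case: n.
  by rewrite kern_mass// ltry.
by move=> q; rewrite c1_real ger0_norm//; case: n.
Qed.

Let cdom_Hkern p : cdom stm (fun q => conjc (H q) * (kern e N p q)%:C) (fun q => B * (chi q * kern e N p q)).
Proof.
have n := nnm_chi_kern N p e0; have nk := nnm_kern N p e0.
split.
- by apply: cmeasM; [exact: (cmeasJ cmH)|apply: cmeas_real; case: nk].
- by apply: nnmM => //; apply: nnm_cst; exact: ltW.
- by rewrite nnZl ?(ltW B0)// kern_mass// -EFinM ltry.
- move=> q; apply: le_trans (c1M _ _) _; rewrite c1J c1_real ger0_norm; last by case: nk.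
  by rewrite mulrA ler_wpM2r//; case: nk.
Qed.

Definition mollify (p : ST) := cint stm (fun q => conjc (H q) * (kern e N p q)%:C).

Lemma mollify_close p : in_slab p -> c1 (mollify p - M%:C * conjc (V p)) <= eta * M.
Proof.
move=> ip; have mE : cint stm (fun q => (chi q * kern e N p q)%:C) = M%:C.
  rewrite /cint; apply/eqP; rewrite eq_complex; apply/andP; split; apply/eqP.
    by rewrite /Rintegral /= kern_mass.
  by rewrite /Rintegral /= integral0.
rewrite -mE -(cintZr _ (cdom_kern p)).
have d2 : cdom stm (fun q => (chi q * kern e N p q)%:C * conjc (V p)) (fun q => chi q * kern e N p q * B).
  by apply: cdomM; [exact: ltW|exact: cdom_kern|exact: cmeas_cst|move=> q; rewrite c1J].
rewrite /mollify -(cintB (cdom_Hkern p) d2) -lee_fin.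
have d3 : cdom stm (fun q => conjc (H q) * (kern e N p q)%:C - (chi q * kern e N p q)%:C * conjc (V p))
   (fun q => B * (chi q * kern e N p q) + chi q * kern e N p q * B).
  have [m1 na fa la] := cdom_Hkern p; have [m2 nb fb lb] := d2.
  split.
  - by apply: cmeasD => //; exact: cmeasN.
  - exact: nnmD.
  - by rewrite nnD//; exact: lte_add_pinfty.
  - by move=> q; apply: le_trans (c1D _ _) _; rewrite c1N lerD.
apply: le_trans (c1_cint d3) _; apply: le_trans (kern_error ip).
apply: nn_le => [||q]; [by apply: cmeas_c1; case: d3|exact: nnm_diff|].
rewrite (_ : _ - _ = (chi q * kern e N p q)%:C * conjc (V q - V p)); last first.
  rewrite /H cJB cJM (_ : conjc (chi q)%:C = (chi q)%:C); last by apply/eqP; rewrite eq_complex/= oppr0 !eqxx.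
  rewrite !(realM (chi q)); move: (chi q)%:C (kern e N p q)%:C (conjc (V q)) (conjc (V p)) => x y z w.
  by rewrite mulrBr; congr (_ - _); rewrite mulrAC.
apply: le_trans (c1M _ _) _; rewrite c1_real c1J ger0_norm; last by case: (nnm_chi_kern N p e0).
by rewrite mulrC.
Qed.

Section mollified.
Variables (b : ST -> R) (dH : cdom stm H b) (G : ST -> R[i]) (a : ST -> R) (dG : cdom stm G a).

Definition parseval_term n : R[i] :=
  cint leb (fun t => (pweight e t)%:C * (ft G t n * conjc (ft H t n))).

Let f n (z : ST * ST) : R[i] :=
  twist G n z.1 * (conjc (twist H n z.2) * (pois e (z.2.1 - z.1.1))%:C).

Let b' (q : ST) : R := b q * 2 * (2 / e).

Let cmeas_f n : cmeas (f n).
Proof.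
have [mG _ _ _] := cdom_twist n dG; have [mH _ _ _] := cdom_twist n dH.
apply: cmeasM; first exact: (cmeas_comp mG measurable_fst).
apply: cmeasM; first exact: (cmeasJ (cmeas_comp mH measurable_snd)).
apply: cmeas_real; apply: (measurableT_comp (nnm_pois e0).1).
by apply: measurable_funB; [exact: (measurableT_comp measurable_fst measurable_snd)|
  exact: (measurableT_comp measurable_fst measurable_fst)].
Qed.

Let c0 : 0 <= 2 / e. Proof. by rewrite divr_ge0// ltW. Qed.

Let nb' : nnm b'.
Proof. by have [_ nb _ _] := dH; rewrite /b'; do 2 (apply: nnmM; last exact: nnm_cst). Qed.

Let fb' : (\int[stm]_q (b' q)%:E < +oo)%E.
Proof.
have [_ nb fb _] := cdom_twist 0 dH.
by rewrite nnZr// muleC; apply: lte_mul_pinfty; rewrite ?lee_fin.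
Qed.

Let f_le n p q : c1 (f n (p, q)) <= a p * 2 * b' q.
Proof.
have [_ _ _ hG] := cdom_twist n dG; have [_ _ _ hH] := cdom_twist n dH.
apply: le_trans (c1M _ _) _; apply: ler_pM; rewrite ?c1_ge0//.
apply: le_trans (c1M _ _) _; apply: ler_pM; rewrite ?c1_ge0// ?c1J//.
rewrite c1_real ger0_norm ?pois_ge0//; apply: le_trans (pois_le _ e0 e1) _.
by rewrite -[leRHS]mulr1 ler_wpM2l// jw_le1.
Qed.

Let Phi n p := cint stm (fun q => f n (p, q)).

Let cdom_fp n p : cdom stm (fun q => f n (p, q)) (fun q => a p * 2 * b' q).
Proof.
have [_ na _ _] := dG; have a0 : 0 <= a p * 2 by rewrite mulr_ge0//; case: na.
split.
- exact: (cmeas_comp (cmeas_f n) (pair1_measurable p)).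
- by apply: nnmM => //; exact: nnm_cst.
- by rewrite nnZl//; apply: lte_mul_pinfty; rewrite ?lee_fin.
- by move=> q; exact: f_le.
Qed.

Let cdom_Phi n : cdom stm (Phi n) (fun p => a p * 2 * fine (\int[stm]_q (b' q)%:E)%E).
Proof.
have [_ na fa _] := cdom_twist n dG.
have K0 : 0 <= fine (\int[stm]_q (b' q)%:E)%E by rewrite fine_ge0// nn_ge0.
split.
- exact: (cmeas_section1 na nb' fa fb' (cmeas_f n) (f_le n)).
- by apply: nnmM => //; exact: nnm_cst.
- by rewrite nnZr// muleC; apply: lte_mul_pinfty; rewrite ?lee_fin.
- move=> p; rewrite -lee_fin; apply: le_trans (c1_cint_le (cdom_fp n p)) _.
  rewrite nnZl//; last by case: na.
  by rewrite [in leRHS]EFinM fineK// ge0_fin_numE// nn_ge0.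
Qed.

Let parseval n : parseval_term n = cint stm (Phi n).
Proof.
rewrite /parseval_term; under eq_cint do rewrite !ft_twist.
rewrite (poisson_parseval measurable_time_phase e0 (cdom_twist n dG) (cdom_twist n dH)).
apply: eq_cint => p; have d : cdom stm (fun q => conjc (twist H n q) * (pois e (q.1 - p.1))%:C) b'.
  have [mH nb _ hH] := cdom_twist n dH.
  split => //.
    apply: cmeasM; first exact: cmeasJ.
    apply: cmeas_real; apply: (measurableT_comp (nnm_pois e0).1).
    by apply: measurable_funB; [exact: measurable_fst|exact: measurable_cst].
  move=> q; apply: le_trans (c1M _ _) _; apply: ler_pM; rewrite ?c1_ge0// ?c1J//.
  rewrite c1_real ger0_norm ?pois_ge0//; apply: le_trans (pois_le _ e0 e1) _.
  by rewrite -[leRHS]mulr1 ler_wpM2l// jw_le1.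
rewrite /Phi /f/= (cintZ _ d); congr (_ * _); apply: eq_cint => q; congr (_ * _%:C).
by rewrite /pois /time_phase mulrBr.
Qed.

(** Both Fejer kernels stay expanded as double sums, so a frequency occurs with multiplicity. *)
Let I := (('I_N * 'I_N) * ('I_N * 'I_N))%type.
Let nn (i : I) : int * int := (i.1.1%:Z - i.1.2%:Z, i.2.1%:Z - i.2.2%:Z).

Let sum_phases (p q : ST) : \sum_(i : I) cexpi (2 * pi * (space_phase (nn i) q - space_phase (nn i) p)) =
  (N%:R ^+ 2 * (fejer N (q.2.1 - p.2.1) * fejer N (q.2.2 - p.2.2)))%:C :> R[i].
Proof.
rewrite (_ : N%:R ^+ 2 * _ = (N%:R * fejer N (q.2.1 - p.2.1)) * (N%:R * fejer N (q.2.2 - p.2.2))); last by ring.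
have fs d : (N%:R * fejer N d)%:C =
    \sum_(x : 'I_N * 'I_N) cexpi (2 * pi * ((x.1%:Z - x.2%:Z)%:~R * d)) :> R[i].
  by rewrite -fejer_sum// pair_big/=; apply: eq_bigr => -[].
rewrite realM !fs big_distrlr/= pair_big/=.
apply: eq_bigr => -[[j k] [j' k']] _ /=; rewrite -cexpiD; congr cexpi.
by rewrite /space_phase /=; ring.
Qed.

Let integrand_sum p : cint stm (fun q => \sum_(i : I) f (nn i) (p, q)) =
  G p * ((N%:R ^+ 2)%:C * mollify p).
Proof.
rewrite /mollify mulrA -(cintZ _ (cdom_Hkern p)).
apply: eq_cint => q; rewrite /f /twist/=.
transitivity (G p * conjc (H q) * (pois e (q.1 - p.1))%:C *
   \sum_(i : I) cexpi (2 * pi * (space_phase (nn i) q - space_phase (nn i) p))).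
  rewrite mulr_sumr; apply: eq_bigr => i _; rewrite cJM -cexpiN opprK.
  rewrite (_ : 2 * pi * (space_phase (nn i) q - space_phase (nn i) p) =
    2 * pi * space_phase (nn i) q + - (2 * pi * space_phase (nn i) p)); last by ring.
  by rewrite cexpiD; ring.
rewrite sum_phases /kern !realM.
move: (_%:C) (_%:C) (_%:C) (_%:C) (conjc _).
by move=> x y z w v; ring.
Qed.

(** Summed over all indices, the space exponentials build the two Fejer kernels beside the Poisson
    kernel, that is, the mollification of [V] times [N^2]. *)
Lemma sum_parseval : \sum_(i : I) parseval_term (nn i) =
  cint stm (fun p => G p * ((N%:R ^+ 2)%:C * mollify p)).
Proof.
under eq_bigr do rewrite parseval.
rewrite -(cint_sum (index_enum _) (fun i : I => cdom_Phi (nn i))).2.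
apply: eq_cint => p; rewrite /Phi -(cint_sum (index_enum _) (fun i : I => cdom_fp (nn i) p)).2.
exact: integrand_sum.
Qed.

Let box : seq (int * int) :=
  [seq (i%:Z - N%:Z, j%:Z - N%:Z) | i <- iota 0 (2 * N), j <- iota 0 (2 * N)].

Lemma uniq_box : uniq box.
Proof.
apply: allpairs_uniq; [exact: iota_uniq|exact: iota_uniq|].
move=> [i j] [i' j'] _ _ /pair_equal_spec[/= h1 h2].
by congr pair; [move: h1; clear; lia|move: h2; clear; lia].
Qed.

(** Given [(j, j')], the frequency determines [(k, k')], so it arises at most [N^2] times. This is
    the same [N^2] as in [sum_parseval], and the two cancel in [product_bound_real]. *)
Let sum_box (F : int * int -> R) : (forall n, 0 <= F n) ->
  \sum_(i : I) F (nn i) <= N%:R ^+ 2 * \sum_(n <- box) F n.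
Proof.
move=> F0; pose h (jj kk : 'I_N * 'I_N) : int * int := (jj.1%:Z - kk.1%:Z, jj.2%:Z - kk.2%:Z).
rewrite (_ : \sum_(i : I) F (nn i) = \sum_jj \sum_kk F (h jj kk)); last first.
  rewrite pair_big/= [RHS](reindex (fun i : I => ((i.1.1, i.2.1), (i.1.2, i.2.2))))//=.
  by exists (fun i : I => ((i.1.1, i.2.1), (i.1.2, i.2.2))) => -[[? ?] [? ?]].
rewrite (_ : N%:R ^+ 2 * _ = \sum_(jj : 'I_N * 'I_N) \sum_(n <- box) F n); last first.
  by rewrite sumr_const card_prod card_ord -[RHS]mulr_natl natrM expr2.
apply: ler_sum => jj _.
rewrite -(big_map (h jj) xpredT F); apply: ler_sum_subset => //; first last.
- move=> n /mapP[kk _ ->]; apply/allpairsP.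
  exists ((jj.1 + N - kk.1)%N, (jj.2 + N - kk.2)%N) => /=.
  have [i1 j1] := ord_box jj.1 kk.1; have [i2 j2] := ord_box jj.2 kk.2.
  by rewrite /h j1 j2.
- exact: uniq_box.
- rewrite map_inj_uniq ?index_enum_uniq// => -[k k'] [l l'] [] /= e1' e2'.
  by rewrite (ord_diff_inj e1') (ord_diff_inj e2').
Qed.

(** The sum of the Parseval terms is [N^2 M] times the wanted integral up to the mollification
    error. Dividing by [N^2] and using [M >= pois_floor] leaves a constant that depends neither on
    [N] nor on [e]. *)
Lemma product_bound_real : (forall p, ~ in_slab p -> G p = 0) ->
  ((c1 (cint stm (fun p => G p * conjc (V p))))%:E <=
  (pois_floor^-1 * \sum_(n <- box) c1 (parseval_term n))%:E + eta%:E * \int[stm]_p (a p)%:E)%E.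
Proof.
move=> G0; have [mG na fa hG] := dG.
have afin : (\int[stm]_p (a p)%:E)%E \is a fin_num by rewrite ge0_fin_numE// nn_ge0.
set al := fine (\int[stm]_p (a p)%:E)%E.
have alE : (\int[stm]_p (a p)%:E = al%:E)%E by rewrite fineK.
have N2 : 0 < N%:R ^+ 2 :> R by rewrite exprn_gt0// ltr0n.
have dGV : cdom stm (fun p => G p * conjc (V p)) (fun p => a p * B).
  by apply: cdomM => //; [exact: ltW|exact: cmeasJ|move=> p; rewrite c1J].
set A := cint stm (fun p => G p * conjc (V p)).
pose g1 p := G p * ((N%:R ^+ 2)%:C * mollify p).
pose g2 p := (N%:R ^+ 2 * M)%:C * (G p * conjc (V p)).
have c2 : 0 <= N%:R ^+ 2 * M by rewrite mulr_ge0 ?sqr_ge0// ltW.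
have d1 : exists a1, cdom stm g1 a1.
  have [ds _] := cint_sum (index_enum _) (fun i : I => cdom_Phi (nn i)).
  eexists; apply: cdom_eq ds => p; rewrite /g1 /Phi -(cint_sum (index_enum _) (fun i : I => cdom_fp (nn i) p)).2.
  by rewrite integrand_sum.
have [a1 {}d1] := d1.
have d2 : cdom stm g2 (fun p => N%:R ^+ 2 * M * (a p * B)).
  have [mGV nb fb hb] := dGV; split.
  - by apply: cmeasM => //; exact: cmeas_cst.
  - by apply: nnmM => //; exact: nnm_cst.
  - by rewrite nnZl//; apply: lte_mul_pinfty; rewrite ?lee_fin.
  - by move=> p; apply: le_trans (c1M _ _) _; rewrite c1_real (ger0_norm c2) ler_wpM2l.
have e12 : cint stm g1 - cint stm g2 = \sum_(i : I) parseval_term (nn i) - (N%:R ^+ 2 * M)%:C * A.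
  by rewrite sum_parseval (cintZ _ dGV).
have err : c1 (cint stm g1 - cint stm g2) <= N%:R ^+ 2 * (eta * M) * al.
  have d12 : cdom stm (fun p => g1 p - g2 p) (fun p => a1 p + N%:R ^+ 2 * M * (a p * B)).
    have [m1 n1 f1 h1] := d1; have [m2 n2 f2 h2] := d2; split.
    - by apply: cmeasD => //; exact: cmeasN.
    - exact: nnmD.
    - by rewrite nnD//; exact: lte_add_pinfty.
    - by move=> p; apply: le_trans (c1D _ _) _; rewrite c1N lerD.
  rewrite -(cintB d1 d2) -lee_fin; apply: le_trans (c1_cint d12) _.
  have c3 : 0 <= N%:R ^+ 2 * (eta * M) by rewrite !mulr_ge0 ?sqr_ge0// ltW.
  rewrite [leRHS]EFinM -alE -nnZl//; apply: nn_le => [||p].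
  - by apply: cmeas_c1; case: d12.
  - by apply: nnmM => //; exact: nnm_cst.
  rewrite /g1 /g2 (_ : _ - _ = (N%:R ^+ 2)%:C * (G p * (mollify p - M%:C * conjc (V p)))); last first.
    by rewrite realM; ring.
  have [ip|ip] := pselect (in_slab p); last first.
    by rewrite (G0 _ ip) mul0r mulr0 c1_real normr0; apply: mulr_ge0 => //; case: na.
  apply: le_trans (c1M _ _) _; rewrite c1_real ger0_norm ?sqr_ge0// -mulrA ler_wpM2l ?sqr_ge0//.
  apply: le_trans (c1M _ _) _; rewrite mulrC; apply: ler_pM => //; rewrite ?c1_ge0//.
  exact: mollify_close.
have key : N%:R ^+ 2 * (M * c1 A) <= N%:R ^+ 2 * (\sum_(n <- box) c1 (parseval_term n) + eta * M * al).
  rewrite [leRHS]mulrDr; apply: (@le_trans _ _ (c1 (\sum_(i : I) parseval_term (nn i)) +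
      c1 (cint stm g1 - cint stm g2))); last first.
    apply: lerD; last by rewrite [leRHS]mulrA.
    apply: le_trans (c1_sum _ _) _; exact: (sum_box (fun n => c1_ge0 (parseval_term n))).
  rewrite e12 mulrA (_ : N%:R ^+ 2 * M * c1 A = c1 ((N%:R ^+ 2 * M)%:C * A)); last first.
    by rewrite /c1 ReZ ImZ !(normrM (N%:R ^+ 2 * M)) (ger0_norm c2) mulrDr.
  move: (\sum_i parseval_term _) (_%:C * A) => x y.
  have e' : y = x - (x - y) by ring.
  by rewrite {1}e'; apply: le_trans (c1D _ _) _; rewrite c1N.
rewrite ler_pM2l// in key; rewrite alE -EFinM -EFinD lee_fin.
have S0 : 0 <= \sum_(n <- box) c1 (parseval_term n) by apply: sumr_ge0 => n _; exact: c1_ge0.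
have f0 := @pois_floor_gt0 R; have fM := pois_mass_gt e0 e1.
rewrite -(ler_pM2l M0); apply: (le_trans key); rewrite mulrDr; apply: lerD.
  by rewrite mulrA ler_peMl// -ler_pdivrMr ?invr_gt0// div1r invrK.
by rewrite [leRHS]mulrCA mulrA.
Qed.

End mollified.
End parameters.
End multiplier.
End product_bound.

(** * Decay of the Fourier transform *)

Section integration_by_parts.
Context {R : realType}.
Local Notation leb := (@lebesgue_measure R).
Local Notation RT := (measurableTypeR R).
Local Notation ST := (RT * (RT * RT))%type.
Local Notation stm := (@st_measure R).

Lemma is_derive_continuous (F f : R -> R) : (forall x : R, is_derive x (1 : R) F (f x)) -> continuous F.
Proof.
move=> dF x; apply: differentiable_continuous; apply/derivable1_diffP.
exact: (@ex_derive _ _ _ _ _ _ _ (dF x)).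
Qed.

(** The fundamental theorem on [[- (n + 1), n + 1]]: the boundary values vanish in the limit by the
    decay of [F], and dominated convergence reaches the whole line. *)
Lemma FTC_whole (F f : R -> R) (M : R) :
  (forall x : R, is_derive x (1 : R) F (f x)) -> continuous f ->
  (forall x, `|F x| <= M * jw (1 + 1) x) -> (forall x, `|f x| <= M * jw (1 + 1) x) ->
  \int[leb]_x f x = 0.
Proof.
move=> dF cf bF bf; have cF := is_derive_continuous dF.
have M0 : 0 <= M.
  have := le_trans (normr_ge0 _) (bF 0); rewrite jw2E expr0n addr0 invr1 mulr1; exact.
have nj : nnm (fun x : RT => M * jw (1 + 1) x) by apply: nnmM; [exact: nnm_cst|exact: nnm_jw].
have fj : (\int[leb]_x (M * jw (1 + 1) x)%:E < +oo)%E.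
  rewrite nnZl//; last exact: nnm_jw.
  apply: lte_mul_pinfty; rewrite ?lee_fin//.
  exact: le_lt_trans (integral_jw_le ltr01) (ltry _).
have mf : measurable_fun setT (f : RT -> RT) by exact: continuous_measurable_fun.
pose I (n : nat) : set RT := `[(- n.+1%:R), n.+1%:R]%classic.
have mI n : measurable (I n) by exact: measurable_itv.
pose fn n (x : RT) := (\1_(I n) x * f x)%:E.
have mfn n : measurable_fun setT (fn n).
  by apply/measurable_EFinP; apply: measurable_funM => //; exact: measurable_indic.
have ij : leb.-integrable setT (fun x => (M * jw (1 + 1) x)%:E).
  by apply: (dominated_integrable _ nj) fj => [|x]; [case: nj|rewrite ger0_norm//; case: nj].
have mEf : measurable_fun setT (fun x : RT => (f x)%:E) by exact/measurable_EFinP.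
have fnf : {ae leb, forall x, setT x -> fn ^~ x @ \oo --> (f x)%:E}.
  apply: aeW => x _; apply: cvg_near_cst; near=> n.
  rewrite /fn indicE mem_set ?mul1r// /I/= in_itv/= -ler_norml.
  apply: (@le_trans _ _ n%:R); last by rewrite ler_nat.
  by near: n; exact: nbhs_infty_ger.
have fnj : {ae leb, forall x n, setT x -> (`|fn n x| <= (M * jw (1 + 1) x)%:E)%E}.
  apply: aeW => x n _; rewrite /fn indicE; case: (x \in I n).
    by rewrite mul1r lee_fin.
  by rewrite mul0r /= normr0 lee_fin; case: nj.
have [_ _ lim] := dominated_convergence measurableT mfn mEf fnf ij fnj.
have e n : (\int[leb]_x fn n x)%E = (F n.+1%:R - F (- n.+1%:R))%:E.
  transitivity (\int[leb]_(x in I n) (f x)%:E)%E.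
    rewrite [RHS]integral_mkcond; apply: eq_integral => x _.
    by rewrite patchE /fn indicE; case: (x \in I n); rewrite ?mul1r ?mul0r.
  rewrite EFinB; apply: continuous_FTC2 => //; first by rewrite gtrN// ltr0n.
  - exact: continuous_subspaceT.
  - by split=> [x _||]; [exact: (@ex_derive _ _ _ _ _ _ _ (dF x))|
      exact: cvg_at_right_filter (cF _)|exact: cvg_at_left_filter (cF _)].
  - by move=> x _; rewrite derive1E; exact: (@derive_val _ _ _ _ _ _ _ (dF x)).
have l0 : (F n.+1%:R - F (- n.+1%:R)) @[n --> \oo] --> (0 : R).
  apply/cvgr0Pnorm_le => eps eps0; near=> n.
  have n1 : 1 <= n.+1%:R :> R by rewrite ler1n.
  have hn (x : R) : `|x| = n.+1%:R -> `|F x| <= eps / 2.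
    move=> xn; apply: le_trans (bF x) _; rewrite jw2E -[x ^+ 2]real_normK ?num_real// xn.
    rewrite ler_pdivrMr; last by rewrite ltr_pwDl// sqr_ge0.
    have : M <= eps / 2 * n.+1%:R.
      rewrite mulrC -ler_pdivrMr ?divr_gt0//; apply: (@le_trans _ _ n%:R); last by rewrite ler_nat.
      by near: n; exact: nbhs_infty_ger.
    move=> h; apply: (le_trans h); rewrite ler_wpM2l ?divr_ge0 ?(ltW eps0)//; nra.
  apply: le_trans (ler_normB _ _) _.
  rewrite [leRHS](_ : _ = eps / 2 + eps / 2); last by field.
  by rewrite lerD// hn// ?normrN ger0_norm.
rewrite /Rintegral; have : [sequence (\int[leb]_(x in setT) fn n x)%E]_n @ \oo --> (0%:E : \bar R).
  by under eq_fun do rewrite e; apply: cvg_EFin; [exact: nearW|exact: l0].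
by move=> /(cvg_unique _ lim) => ->.
Unshelve. all: by end_near. Qed.

Section derivative_integral.
Variables (F f : ST -> R) (M : R).
Hypotheses (mf : measurable_fun setT f).
Hypotheses (bF : forall p, `|F p| <= M * jw (1 + 1) p.1)
           (bf : forall p, `|f p| <= M * jw (1 + 1) p.1).
Hypothesis pF : forall t x y, F (t, (x + 1, y)) = F (t, (x, y)) /\ F (t, (x, y + 1)) = F (t, (x, y)).

Let M0 : 0 <= M.
Proof.
have := le_trans (normr_ge0 _) (bF (0, (0, 0))); rewrite /= jw2E expr0n addr0 invr1 mulr1; exact.
Qed.

Let na : nnm (fun x : RT => M * jw (1 + 1) x).
Proof. by apply: nnmM; [exact: nnm_cst|exact: nnm_jw]. Qed.

Let fa : (\int[leb]_x (M * jw (1 + 1) x)%:E < +oo)%E.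
Proof.
rewrite nnZl//; last exact: nnm_jw.
by apply: lte_mul_pinfty; rewrite ?lee_fin//; exact: le_lt_trans (integral_jw_le ltr01) (ltry _).
Qed.

Let nu := @nnm_unit_itv R.
Let fu : (\int[leb]_x (unit_itv x)%:E < +oo)%E.
Proof. by rewrite integral_unit_itv ltry. Qed.

Let nuu : nnm (fun q : RT * RT => unit_itv q.1 * unit_itv q.2) := nnm_tensor nu nu.
Let fuu := integral_tensor_lty (m1 := leb) (m2 := leb) nu nu fu fu.

Let g (p : ST) := unit_itv p.2.1 * unit_itv p.2.2 * f p.
Let mg : measurable_fun setT g.
Proof. by apply: measurable_funM => //; case: (@nnm_chi R). Qed.

Let bg t (q : RT * RT) : `|g (t, q)| <= M * jw (1 + 1) t * (unit_itv q.1 * unit_itv q.2).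
Proof.
rewrite /g normrM ger0_norm; last by case: nuu.
by rewrite mulrC; apply: ler_wpM2r; [case: nuu|exact: (bf (t, q))].
Qed.

Let gE : \int[stm]_p (chi p * f p) = \int[leb]_t \int[@plane_measure R]_q g (t, q).
Proof. by rewrite (Rfubini1 (m1 := leb) (m2 := @plane_measure R) na nuu fa fuu mg bg). Qed.

Let gE' : \int[stm]_p (chi p * f p) = \int[@plane_measure R]_q \int[leb]_t g (t, q).
Proof. by rewrite (Rfubini2 (m1 := leb) (m2 := @plane_measure R) na nuu fa fuu mg bg). Qed.

Let Rint0 d (T : measurableType d) (m : {measure set T -> \bar R}) (h : T -> R) :
  (forall x, h x = 0) -> \int[m]_x h x = 0.
Proof. by move=> h0; rewrite /Rintegral integral0_eq// => x _; rewrite h0. Qed.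

(** In time the boundary terms vanish by decay; in the space variables, treated in the two lemmas
    that follow, they cancel by periodicity. *)
Lemma integral_derive1 : (forall q (t : R), is_derive t (1 : R) (fun t => F (t, q) : R) (f (t, q))) ->
  (forall q, continuous (fun t : R => f (t, q) : R)) -> \int[stm]_p (chi p * f p) = 0.
Proof.
move=> dF cf; rewrite gE'; apply: Rint0 => q.
have := @FTC_whole (fun t => F (t, q)) (fun t => f (t, q)) M (dF q) (cf q) (fun t => bF _) (fun t => bf _).
rewrite /g /= => h; rewrite -[RHS](mulr0 (unit_itv q.1 * unit_itv q.2)) -h RintegralZl//.
apply: (@dominated_integrable _ _ _ leb _ (fun x => M * jw (1 + 1) x)) => //.
exact: (measurableT_comp mf (pair2_measurable q)).
Qed.

Let na2 t : nnm (fun x : RT => M * jw (1 + 1) t * unit_itv x).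
Proof. by apply: nnmM => //; apply: nnm_cst; case: na. Qed.

Let fa2 t : (\int[leb]_x (M * jw (1 + 1) t * unit_itv x)%:E < +oo)%E.
Proof. by rewrite nnZl//; [rewrite integral_unit_itv mule1 ltry|case: na]. Qed.

Let mg2 t : measurable_fun setT (fun q : RT * RT => g (t, q)).
Proof. exact: (measurableT_comp mg (pair1_measurable t)). Qed.

Let bg2 t x y : `|g (t, (x, y))| <= M * jw (1 + 1) t * unit_itv x * unit_itv y.
Proof. by rewrite -mulrA; exact: (bg t (x, y)). Qed.

Lemma integral_derive3 : (forall t x (y : R), is_derive y (1 : R) (fun y => F (t, (x, y)) : R) (f (t, (x, y)))) ->
  (forall t x, continuous (fun y : R => f (t, (x, y)) : R)) -> \int[stm]_p (chi p * f p) = 0.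
Proof.
move=> dF cf; rewrite gE; apply: Rint0 => t.
rewrite -(Rfubini1 (m1 := leb) (m2 := leb) (na2 t) nu (fa2 t) fu (mg2 t) (bg2 t)).
apply: Rint0 => x; have := FTC01 (dF t x) (cf t x).
have := (pF t x 0).2; rewrite add0r => ->; rewrite subrr /g /= => h.
rewrite -[RHS](mulr0 (unit_itv x)) -h -RintegralZl//.
  by apply: eq_Rintegral => y _; rewrite mulrA.
apply: (@dominated_integrable _ _ _ leb _ (fun y => M * jw (1 + 1) t * unit_itv y)) => //.
- apply: measurable_funM; first by case: nu.
  exact: (measurableT_comp mf (measurableT_comp (pair1_measurable t) (pair1_measurable x))).
- move=> y; have u0 : 0 <= unit_itv y by case: nu.
  rewrite normrM mulrC (ger0_norm u0).
  by apply: ler_wpM2r; [case: nu|exact: (bf (t, (x, y)))].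
Qed.

Lemma integral_derive2 : (forall t y (x : R), is_derive x (1 : R) (fun x => F (t, (x, y)) : R) (f (t, (x, y)))) ->
  (forall t y, continuous (fun x : R => f (t, (x, y)) : R)) -> \int[stm]_p (chi p * f p) = 0.
Proof.
move=> dF cf; rewrite gE; apply: Rint0 => t.
rewrite -(Rfubini2 (m1 := leb) (m2 := leb) (na2 t) nu (fa2 t) fu (mg2 t) (bg2 t)).
apply: Rint0 => y; have := FTC01 (dF t y) (cf t y).
have := (pF t 0 y).1; rewrite add0r => ->; rewrite subrr /g /= => h.
rewrite -[RHS](mulr0 (unit_itv y)) -h -RintegralZl//.
  by apply: eq_Rintegral => x _; rewrite mulrA [unit_itv x * _]mulrC.
apply: (@dominated_integrable _ _ _ leb _ (fun y => M * jw (1 + 1) t * unit_itv y)) => //.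
- apply: measurable_funM; first by case: nu.
  exact: (measurableT_comp mf (measurableT_comp (pair1_measurable t) (pair2_measurable y))).
- move=> x; have u0 : 0 <= unit_itv x by case: nu.
  rewrite normrM mulrC (ger0_norm u0).
  by apply: ler_wpM2r; [case: nu|exact: (bf (t, (x, y)))].
Qed.

End derivative_integral.

Implicit Types f : spacetime R -> R.

Definition real_periodic (f : spacetime R -> R) := forall t x y,
  f (t, (x + 1, y)) = f (t, (x, y)) /\ f (t, (x, y + 1)) = f (t, (x, y)).

Definition st_phase (t : R) (n : int * int) (p : ST) : R := 2 * pi * (p.1 * t + space_phase n p).

(** The Boolean chooses between the real and imaginary part of an exponential, which differentiation
    exchanges. *)
Definition trig (b : bool) : R -> R := if b then cos else sin.

Definition osc b t n (f : ST -> R) : R := \int[stm]_p (chi p * (f p * trig b (st_phase t n p))).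

Let axis (v : spacetime R) := v = st1 \/ v = st2 \/ v = st3.

Lemma derive_periodic f v : real_periodic f -> real_periodic ('D_v f).
Proof.
move=> pf t x y.
have h (c : spacetime R) : (forall p, f (p + c) = f p) -> forall p, 'D_v f (p + c) = 'D_v f p.
  move=> fc p; rewrite /derive.
  rewrite (_ : (fun k => k^-1 *: ((f \o shift (p + c)) (k *: v) - f (p + c))) =
    (fun k => k^-1 *: ((f \o shift p) (k *: v) - f p)))//.
  by apply/funext => k /=; rewrite addrA !fc.
split.
- have := h (0, (1, 0)) _ (t, (x, y)); rewrite (_ : (t, (x, y)) + (0, (1, 0)) = (t, (x + 1, y))); last first.
    by congr (_, (_, _)) => /=; rewrite addr0.
  apply=> -[t' [x' y']]; rewrite -[RHS](pf t' x' y').1.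
  by congr (f (_, (_, _))) => /=; rewrite addr0.
- have := h (0, (0, 1)) _ (t, (x, y)); rewrite (_ : (t, (x, y)) + (0, (0, 1)) = (t, (x, y + 1))); last first.
    by congr (_, (_, _)) => /=; rewrite addr0.
  apply=> -[t' [x' y']]; rewrite -[RHS](pf t' x' y').2.
  by congr (f (_, (_, _))) => /=; rewrite addr0.
Qed.

Lemma st_phase_add t n (p v : ST) (h : R) :
  st_phase t n ((p : spacetime R) + h *: (v : spacetime R)) = st_phase t n v * h + st_phase t n p.
Proof. by case: p v => a [b c] [a' [b' c']]; rewrite /st_phase /space_phase /= /GRing.scale/=; ring. Qed.

Lemma trig_periodic b t n (x y s : R) :
  trig b (st_phase t n (s, (x + 1, y))) = trig b (st_phase t n (s, (x, y))) /\
  trig b (st_phase t n (s, (x, y + 1))) = trig b (st_phase t n (s, (x, y))).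
Proof.
have h (a : R) (m : int) : trig b (a + 2 * pi * m%:~R) = trig b a.
  by have := cexpi_2piz m a; case: b => -[].
split; [rewrite -[RHS](h _ n.1)|rewrite -[RHS](h _ n.2)]; congr (trig b _);
  by rewrite /st_phase /space_phase /=; ring.
Qed.

Lemma trig_le1 b (a : R) : `|trig b a| <= 1.
Proof. by case: b; rewrite ler_norml /= ?cos_geN1 ?cos_le1 ?sin_geN1 ?sin_le1. Qed.

Lemma continuous_trig b : continuous (trig b).
Proof. by case: b; [exact: continuous_cos|exact: continuous_sin]. Qed.

Lemma measurable_st_phase t n : measurable_fun setT (st_phase t n : ST -> RT).
Proof.
apply: measurable_funM; first exact: measurable_cst.
apply: measurable_funD; last exact: measurable_space_phase.
by apply: measurable_funM; [exact: measurable_fst|exact: measurable_cst].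
Qed.

Definition dtrig b : R -> R := fun a => if b then - sin a else cos a.

Lemma schwartz_jw f : real_schwartz f -> exists2 M : R, 0 < M & forall p, `|f p| <= M * jw (1 + 1) p.1.
Proof.
move=> /real_schwartz_decay[M M0 h]; exists M => // p; rewrite jw2E.
have q : 0 < 1 + p.1 ^+ 2 by rewrite ltr_pwDl// sqr_ge0.
rewrite ler_pdivlMr//; apply: le_trans (h p); rewrite ler_wpM2l//.
by rewrite -[leLHS]mulr1 ler_wpM2l ?(ltW q)// lerDl.
Qed.

Lemma real_schwartz_measurable f : real_schwartz f -> measurable_fun setT (f : ST -> R).
Proof. by move=> /real_schwartz_lipschitz[L _ lf]; exact: st_lipschitz_measurable lf. Qed.

Lemma derive_osc b t n f v : real_schwartz f -> real_periodic f -> axis v ->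
  \int[stm]_p (chi p * ('D_v f p * trig b (st_phase t n p) +
     st_phase t n v * (f p * dtrig b (st_phase t n p)))) = 0.
Proof.
move=> sf pf av; have sD := real_schwartz_derive v sf.
have [A A0 hA] := schwartz_jw sf; have [B B0 hB] := schwartz_jw sD.
set w := st_phase t n v.
pose F (p : ST) : R := f p * trig b (st_phase t n p).
pose F' (p : ST) : R := 'D_v f p * trig b (st_phase t n p) + w * (f p * dtrig b (st_phase t n p)).
have dtrig1 a : `|dtrig b a| <= 1.
  by rewrite /dtrig; case: b {F F'}; rewrite ?normrN; [exact: (trig_le1 false)|exact: (trig_le1 true)].
have cdtrig : continuous (dtrig b).
  by rewrite /dtrig; case: b {F F' dtrig1} => x; [apply: cvgN; exact: continuous_sin|exact: continuous_cos].
have mF' : measurable_fun setT F'.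
  apply: measurable_funD; last apply: measurable_funM => //; last apply: measurable_funM.
  - apply: measurable_funM; first exact: real_schwartz_measurable.
    exact: (measurableT_comp (continuous_measurable_fun (@continuous_trig b)) (measurable_st_phase t n)).
  - exact: real_schwartz_measurable.
  - exact: (measurableT_comp (continuous_measurable_fun cdtrig) (measurable_st_phase t n)).
have j0 (x : R) : 0 <= jw (1 + 1) x by exact: jw_ge0.
have bF p : `|F p| <= (A + B + `|w| * A) * jw (1 + 1) p.1.
  rewrite normrM; apply: (@le_trans _ _ (`|f p| * 1)); first by rewrite ler_wpM2l// trig_le1.
  rewrite mulr1; apply: le_trans (hA p) _; apply: ler_wpM2r; first exact: jw_ge0.
  have w0 : 0 <= `|w| * A by apply: mulr_ge0 => //; exact: ltW.
  by move: w0 (ltW B0); move: (`|w| * A) => y y0 b0; lra.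
have bF' p : `|F' p| <= (A + B + `|w| * A) * jw (1 + 1) p.1.
  apply: le_trans (ler_normD _ _) _; rewrite (normrM ('D_v f p)) (normrM w) (normrM (f p)).
  have h1 : `|'D_v f p| * `|trig b (st_phase t n p)| <= B * jw (1 + 1) p.1.
    by rewrite -[leRHS]mulr1; apply: ler_pM => //; exact: trig_le1.
  have h2 : `|w| * (`|f p| * `|dtrig b (st_phase t n p)|) <= `|w| * (A * jw (1 + 1) p.1).
    by rewrite ler_wpM2l// -[leRHS]mulr1; apply: ler_pM.
  apply: (le_trans (lerD h1 h2)).
  rewrite [leRHS](_ : _ = A * jw (1 + 1) p.1 + (B * jw (1 + 1) p.1 + `|w| * (A * jw (1 + 1) p.1))); last by ring.
  by rewrite lerDr mulr_ge0 ?(ltW A0)// jw_ge0.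
have pF s x y : F (s, (x + 1, y)) = F (s, (x, y)) /\ F (s, (x, y + 1)) = F (s, (x, y)).
  by have [h1 h2] := pf s x y; have [h3 h4] := trig_periodic b t n x y s; rewrite /F h1 h2 h3 h4.
have df q : derivable f q v by exact: (sf.1 [::] v q).
have ddf q : derivable ('D_v f) q v by exact: (sD.1 [::] v q).
have dF (p : spacetime R) (h : R) : is_derive h (1 : R) (fun h : R => F (p + h *: v) : R) (F' (p + h *: v)).
  have d1 := is_derive_line p df h.
  have d2 : is_derive h (1 : R) (fun h : R => trig b (st_phase t n (p + h *: v)) : R)
      (w * dtrig b (st_phase t n (p + h *: v))).
    rewrite (_ : (fun h : R => trig b (st_phase t n (p + h *: v))) = trig b \o (fun h => w * h + st_phase t n p)); last first.
      by apply/funext => k /=; rewrite st_phase_add.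
    rewrite st_phase_add -/w /trig /dtrig; case: (b); apply: is_derive_eq; rewrite /GRing.scale/= addr0 mulr1; ring.
  by apply: is_derive_eq; rewrite /GRing.scale/= /F'; ring.
have cF' (p : spacetime R) : continuous (fun h : R => F' (p + h *: v) : R).
  have c1 := is_derive_continuous (is_derive_line p df).
  have c2 := is_derive_continuous (is_derive_line p ddf).
  have c3 : continuous (fun h : R => st_phase t n (p + h *: v) : R).
    rewrite (_ : (fun h => _) = (fun h => w * h + st_phase t n p)); last by apply/funext => k; rewrite st_phase_add.
    by move=> x; apply: cvgD; [exact: mulrl_continuous|exact: cvg_cst].
  have c4 (g : R -> R) : continuous g -> continuous (fun h : R => g (st_phase t n (p + h *: v)) : R).
    by move=> cg x; apply: (cvg_comp _ g (c3 x)); exact: cg.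
  move=> x; apply: cvgD; first by apply: cvgM; [exact: c2|exact: c4 (@continuous_trig b) x].
  by apply: cvgMr; apply: cvgM; [exact: c1|exact: c4 cdtrig x].
case: av => [e|[e|e]]; rewrite e in dF cF'.
- have E (q : spacetime R) h : (0, q.2) + h *: st1 = (h, q.2).
    case: q => ? [x y] /=; rewrite /st1; congr (_, (_, _)) => /=;
      by rewrite ?[_ *: 1]mulr1 ?[_ *: 0]mulr0 ?addr0 ?add0r.
  apply: (integral_derive1 mF' bF bF').
    by move=> q h; have := dF (0, q) h; rewrite (E (0, q)); under [X in is_derive _ _ X _]eq_fun do rewrite (E (0, q)).
  by move=> q; have := cF' (0, q); under eq_fun do rewrite (E (0, q)).
- have E (a c h : R) : (a, (0, c)) + h *: st2 = (a, (h, c)) :> spacetime R.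
    by rewrite /st2; congr (_, (_, _)) => /=; rewrite ?[_ *: 1]mulr1 ?[_ *: 0]mulr0 ?addr0 ?add0r.
  apply: (integral_derive2 mF' bF bF' pF).
    by move=> a c h; have := dF (a, (0, c)) h; rewrite E; under [X in is_derive _ _ X _]eq_fun do rewrite E.
  by move=> a c; have := cF' (a, (0, c)); under eq_fun do rewrite E.
- have E (a c h : R) : (a, (c, 0)) + h *: st3 = (a, (c, h)) :> spacetime R.
    by rewrite /st3; congr (_, (_, _)) => /=; rewrite ?[_ *: 1]mulr1 ?[_ *: 0]mulr0 ?addr0 ?add0r.
  apply: (integral_derive3 mF' bF bF' pF).
    by move=> a c h; have := dF (a, (c, 0)) h; rewrite E; under [X in is_derive _ _ X _]eq_fun do rewrite E.
  by move=> a c; have := cF' (a, (c, 0)); under eq_fun do rewrite E.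
Qed.

Lemma RintegrableZ d (T : measurableType d) (m : {measure set T -> \bar R}) (c : R) (g : T -> R) :
  m.-integrable setT (EFin \o g) -> m.-integrable setT (EFin \o (fun x => c * g x)).
Proof.
by move=> ig; rewrite (_ : _ \o _ = (fun x => c%:E * (EFin \o g) x)%E)//; exact: integrableZl.
Qed.

Section decay.
Variables (t : R) (n : int * int).

Lemma osc_integrable b f : real_schwartz f -> stm.-integrable setT
  (EFin \o (fun p => chi p * (f p * trig b (st_phase t n p)))) /\
  forall M, (forall p, `|f p| <= M * jw (1 + 1) p.1) -> `|osc b t n f| <= M * jw_mass 1.
Proof.
move=> sf.
have nj0 : nnm (fun p : ST => jw (1 + 1) p.1 * (unit_itv p.2.1 * unit_itv p.2.2)).
  exact: (nnm_coord (nnm_jw _) (@nnm_unit_itv R) (@nnm_unit_itv R)).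
have ij0 : (\int[stm]_p (jw (1 + 1) p.1 * (unit_itv p.2.1 * unit_itv p.2.2))%:E <= (jw_mass 1)%:E)%E.
  rewrite (integral_coord (nnm_jw _) (@nnm_unit_itv R) (@nnm_unit_itv R)) !integral_unit_itv !mule1.
  exact: integral_jw_le ltr01.
have mg : measurable_fun setT (fun p : ST => chi p * (f p * trig b (st_phase t n p))).
  apply: measurable_funM; first by case: (@nnm_chi R).
  apply: measurable_funM; first exact: real_schwartz_measurable.
  exact: (measurableT_comp (continuous_measurable_fun (@continuous_trig b)) (measurable_st_phase t n)).
have bg M p : (forall p, `|f p| <= M * jw (1 + 1) p.1) ->
    `|chi p * (f p * trig b (st_phase t n p))| <= M * (jw (1 + 1) p.1 * (unit_itv p.2.1 * unit_itv p.2.2)).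
  move=> hM; have c0 : 0 <= chi p by case: (@nnm_chi R).
  rewrite normrM (ger0_norm c0) mulrA mulrC ler_wpM2r// normrM -[leRHS]mulr1.
  by apply: ler_pM => //; exact: trig_le1.
have [M M0 hM] := schwartz_jw sf.
have nM M' : 0 <= M' -> nnm (fun p : ST => M' * (jw (1 + 1) p.1 * (unit_itv p.2.1 * unit_itv p.2.2))).
  by move=> M0'; apply: nnmM => //; exact: nnm_cst.
have fM M' : 0 <= M' -> (\int[stm]_p (M' * (jw (1 + 1) p.1 * (unit_itv p.2.1 * unit_itv p.2.2)))%:E <=
    (M' * jw_mass 1)%:E)%E.
  by move=> M0'; rewrite nnZl// EFinM; apply: lee_wpmul2l; rewrite ?lee_fin.
have ig : stm.-integrable setT (EFin \o (fun p => chi p * (f p * trig b (st_phase t n p)))).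
  apply: (dominated_integrable mg (nM M (ltW M0))) => [p|]; first exact: bg.
  exact: le_lt_trans (fM _ (ltW M0)) (ltry _).
split=> // M' hM'; have M0' : 0 <= M'.
  have := le_trans (normr_ge0 _) (hM' 0); rewrite /= jw2E expr0n addr0 invr1 mulr1; exact.
rewrite -lee_fin EFin_normr_Rintegral//; apply: le_trans (fM _ M0').
apply: (@le_trans _ _ (\int[stm]_p `|chi p * (f p * trig b (st_phase t n p))|%:E)%E).
  by apply: (@le_abse_integral _ _ _ stm setT (EFin \o (fun p => chi p * (f p * trig b (st_phase t n p))))) => //;
    exact/measurable_EFinP.
apply: nn_le => [||p]; [by split=> //; exact: measurableT_comp|exact: nM|exact: bg].
Qed.

Lemma oscD b f g c : real_schwartz f -> real_schwartz g ->
  osc b t n (fun p => f p + c * g p) = osc b t n f + c * osc b t n g.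
Proof.
move=> sf sg; have [i1 _] := osc_integrable b sf; have [i2 _] := osc_integrable b sg.
have i3 : stm.-integrable setT (EFin \o (fun p => c * (chi p * (g p * trig b (st_phase t n p))))).
  exact: RintegrableZ.
rewrite /osc -RintegralZl// -RintegralD//.
by apply: eq_Rintegral => p _; ring.
Qed.

Lemma osc_derive f v : real_schwartz f -> real_periodic f -> axis v ->
  osc true t n ('D_v f) = st_phase t n v * osc false t n f /\
  osc false t n ('D_v f) = - (st_phase t n v * osc true t n f).
Proof.
move=> sf pf av; have sD := real_schwartz_derive v sf; set w := st_phase t n v.
have key b : osc b t n ('D_v f) + w * \int[stm]_p (chi p * (f p * dtrig b (st_phase t n p))) = 0.
  rewrite -(derive_osc b t n sf pf av) -/w.
  have [i1 _] := osc_integrable b sD.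
  have i2 : stm.-integrable setT (EFin \o (fun p => chi p * (f p * dtrig b (st_phase t n p)))).
    case: b {i1}; last by have [] := osc_integrable true sf.
    have [+ _] := osc_integrable false (real_schwartzN sf).
    rewrite (_ : (fun p => chi p * (- f p * trig false (st_phase t n p))) =
      (fun p => chi p * (f p * dtrig true (st_phase t n p))))//.
    by apply/funext => p; rewrite /dtrig /trig; ring.
  have i3 : stm.-integrable setT (EFin \o (fun p => w * (chi p * (f p * dtrig b (st_phase t n p))))).
    exact: RintegrableZ.
  rewrite /osc -RintegralZl// -RintegralD//.
  by apply: eq_Rintegral => p _; ring.
split.
  have := key true; rewrite /osc (_ : \int[stm]_p (chi p * (f p * dtrig true _)) = - osc false t n f).
    by rewrite mulrN => /eqP; rewrite subr_eq0 => /eqP.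
  have [i _] := osc_integrable false sf.
  by rewrite -mulN1r /osc -RintegralZl//; apply: eq_Rintegral => p _; rewrite /dtrig /trig; ring.
by have := key false; rewrite /dtrig -/(trig true) => /eqP; rewrite addr_eq0 => /eqP.
Qed.

(** The operator [1 - D_v^2] acts on the Fourier side as multiplication by
    [1 + st_phase t n v ^+ 2]. Being of even order it does not mix sine and cosine, and its symbol
    has no zero, so frequency 0 is no exception. *)
Definition helm v f : spacetime R -> R := fun p => f p - 'D_v ('D_v f) p.

Lemma osc_helm b f v : real_schwartz f -> real_periodic f -> axis v ->
  osc b t n (helm v f) = (1 + st_phase t n v ^+ 2) * osc b t n f.
Proof.
move=> sf pf av; have sD := real_schwartz_derive v sf; have sDD := real_schwartz_derive v sD.
have -> : osc b t n (helm v f) = osc b t n (fun p => f p + (-1) * 'D_v ('D_v f) p).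
  by congr osc; apply/funext => p; rewrite mulN1r.
rewrite oscD//; have [c1 c2] := osc_derive sf pf av.
have [d1 d2] := osc_derive sD (derive_periodic v pf) av.
by case: b; rewrite ?d1 ?d2 ?c1 ?c2; ring.
Qed.

End decay.

Lemma helm_schwartz v f : real_schwartz f -> real_schwartz (helm v f).
Proof.
by move=> sf; apply: real_schwartzB => //; do 2 apply: real_schwartz_derive.
Qed.

Lemma helm_periodic v f : real_periodic f -> real_periodic (helm v f).
Proof.
move=> pf t x y; rewrite /helm; have p2 := derive_periodic v (derive_periodic v pf).
by rewrite (pf t x y).1 (pf t x y).2 (p2 t x y).1 (p2 t x y).2.
Qed.

Lemma osc_iter_helm b t n f v k : real_schwartz f -> real_periodic f -> axis v ->
  [/\ real_schwartz (iter k (helm v) f), real_periodic (iter k (helm v) f) &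
   osc b t n (iter k (helm v) f) = (1 + st_phase t n v ^+ 2) ^+ k * osc b t n f].
Proof.
move=> sf pf av; elim: k => [|k [s1 p1 e1]] /=; first by rewrite expr0 mul1r.
split; [exact: helm_schwartz|exact: helm_periodic|].
by rewrite osc_helm// e1 [_ ^+ k.+1]exprS mulrA.
Qed.

(** The operator is applied [k] times along each axis; the factors [2 pi] in the phases only help,
    as [(2 pi)^2 >= 1]. *)
Lemma osc_decay f (k : nat) : real_schwartz f -> real_periodic f ->
  exists2 C : R, 0 < C & forall b t n,
    `|osc b t n f| * ((1 + t ^+ 2) * (1 + n.1%:~R ^+ 2) * (1 + n.2%:~R ^+ 2)) ^+ k <= C.
Proof.
move=> sf pf.
have a1 : axis st1 by left. have a2 : axis st2 by right; left. have a3 : axis st3 by right; right.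
pose g := iter k (helm st3) (iter k (helm st2) (iter k (helm st1) f)).
have [s1 p1 _] := osc_iter_helm true 0 0 k sf pf a1.
have [s2 p2 _] := osc_iter_helm true 0 0 k s1 p1 a2.
have [s3 p3 _] := osc_iter_helm true 0 0 k s2 p2 a3.
have [M M0 hM] := schwartz_jw s3.
exists (M * jw_mass 1 + 1) => [|b t n].
  by rewrite ltr_wpDl// mulr_ge0 ?(ltW M0)// jw_mass_ge0.
have [_ /(_ M hM)] := osc_integrable t n b s3.
have [_ _ ->] := osc_iter_helm b t n k s2 p2 a3.
have [_ _ ->] := osc_iter_helm b t n k s1 p1 a2.
have [_ _ ->] := osc_iter_helm b t n k sf pf a1.
move=> h; apply: (@le_trans _ _ (M * jw_mass 1)); last by rewrite lerDl.
move: h.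
have hw (w x : R) : x ^+ 2 <= w ^+ 2 -> (1 + x ^+ 2) ^+ k <= `|(1 + w ^+ 2) ^+ k|.
  move=> xw; rewrite ger0_norm; last by rewrite exprn_ge0// addr_ge0// sqr_ge0.
  by rewrite lerXn2r ?nnegrE ?addr_ge0 ?sqr_ge0// lerD2l.
have p4 : 1 <= (2 * pi : R) ^+ 2 by have := @pi_ge2 R; nra.
have hx (x : R) : x ^+ 2 <= (2 * pi * x) ^+ 2 by rewrite exprMn ler_peMl// sqr_ge0.
have e1 : st_phase t n st1 = 2 * pi * t by rewrite /st_phase /space_phase /=; ring.
have e2 : st_phase t n st2 = 2 * pi * n.1%:~R by rewrite /st_phase /space_phase /=; ring.
have e3 : st_phase t n st3 = 2 * pi * n.2%:~R by rewrite /st_phase /space_phase /=; ring.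
have x0 (x : R) : 0 <= (1 + x ^+ 2) ^+ k by rewrite exprn_ge0// addr_ge0// sqr_ge0.
rewrite e1 e2 e3 !normrM [((1 + t ^+ 2) * _ * _) ^+ k]exprMn [((1 + t ^+ 2) * _) ^+ k]exprMn.
have := x0 t; have := x0 n.1%:~R; have := x0 n.2%:~R.
have := hw _ _ (hx t); have := hw _ _ (hx n.1%:~R); have := hw _ _ (hx n.2%:~R).
move: (`|osc b t n f|) (normr_ge0 (osc b t n f)) (`|(1 + (2 * pi * t) ^+ 2) ^+ k|).
move: (`|(1 + (2 * pi * n.1%:~R) ^+ 2) ^+ k|) (`|(1 + (2 * pi * n.2%:~R) ^+ 2) ^+ k|).
move: ((1 + t ^+ 2) ^+ k) ((1 + n.1%:~R ^+ 2) ^+ k) ((1 + n.2%:~R ^+ 2) ^+ k).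
move=> y1 y2 y3 X2 X3 o o0 X1 h3 h2 h1 y30 y20 y10 h; apply: le_trans h.
rewrite (_ : X3 * (X2 * (X1 * o)) = o * (X1 * X2 * X3)); last by ring.
by apply: ler_wpM2l => //; apply: ler_pM; rewrite ?mulr_ge0//; exact: ler_pM.
Qed.

End integration_by_parts.

(** * Fourier transforms of Schwartz functions and of their products *)

Section schwartz_fourier.
Context {R : realType}.
Local Notation leb := (@lebesgue_measure R).
Local Notation RT := (measurableTypeR R).
Local Notation ST := (RT * (RT * RT))%type.
Local Notation stm := (@st_measure R).
Local Open Scope complex_scope.
Implicit Types u v : spacetime R -> R[i].

Lemma schwartz_real_periodic u : schwartz u ->
  real_periodic (fun p => complex.Re (u p)) /\ real_periodic (fun p => complex.Im (u p)).
Proof. by case=> pu _ _; split=> t x y; rewrite (pu t x y).1 (pu t x y).2. Qed.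

Lemma schwartz_conj u : schwartz u -> schwartz (fun p => conjc (u p)).
Proof.
case=> pu su1 su2; split.
- by move=> t x y; rewrite (pu t x y).1 (pu t x y).2.
- by under eq_fun do rewrite cReJ.
- by under eq_fun do rewrite cImJ; exact: real_schwartzN.
Qed.

Lemma schwartz_mul u v : schwartz u -> schwartz v -> schwartz (fun p => u p * v p).
Proof.
case=> pu u1 u2 [pv v1 v2]; split.
- by move=> t x y; rewrite (pu t x y).1 (pu t x y).2 (pv t x y).1 (pv t x y).2.
- by under eq_fun do rewrite cReM; apply: real_schwartzB; exact: real_schwartzM.
- by under eq_fun do rewrite cImM; apply: real_schwartzD; exact: real_schwartzM.
Qed.

Lemma schwartz_sub u v : schwartz u -> schwartz v -> schwartz (fun p => u p - v p).
Proof.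
case=> pu u1 u2 [pv v1 v2]; split.
- by move=> t x y; rewrite (pu t x y).1 (pu t x y).2 (pv t x y).1 (pv t x y).2.
- by under eq_fun do rewrite cReD cReN; exact: real_schwartzB.
- by under eq_fun do rewrite cImD cImN; exact: real_schwartzB.
Qed.

Lemma schwartz_modulus u : schwartz u -> exists L B : R, [/\ 0 < L, 0 < B,
  st_lipschitz L (fun p => complex.Re (u p)), st_lipschitz L (fun p => complex.Im (u p)) &
  forall p, c1 (u p) <= B * jw (1 + 1) p.1].
Proof.
case=> _ s1 s2; have [L1 L10 l1] := real_schwartz_lipschitz s1.
have [L2 L20 l2] := real_schwartz_lipschitz s2.
have [M1 M10 m1] := schwartz_jw s1; have [M2 M20 m2] := schwartz_jw s2.
exists (L1 + L2), (M1 + M2); split; rewrite ?addr_gt0//.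
- move=> p q; apply: le_trans (l1 p q) _; rewrite ler_wpM2r ?addr_ge0// lerDl ltW//.
- move=> p q; apply: le_trans (l2 p q) _; rewrite ler_wpM2r ?addr_ge0// lerDr ltW//.
- by move=> p; rewrite mulrDl lerD.
Qed.

Lemma schwartz_cmeas u : schwartz u -> cmeas (u : ST -> R[i]).
Proof. by case=> _ s1 s2; split; [exact: (real_schwartz_measurable s1)|exact: (real_schwartz_measurable s2)]. Qed.

Definition slab_weight (B : R) (p : ST) : R := B * (jw (1 + 1) p.1 * (unit_itv p.2.1 * unit_itv p.2.2)).

Lemma nnm_slab_weight B : 0 <= B -> nnm (slab_weight B).
Proof.
move=> B0; apply: nnmM; first exact: nnm_cst.
exact: (nnm_coord (nnm_jw _) (@nnm_unit_itv R) (@nnm_unit_itv R)).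
Qed.

Lemma integral_slab_weight B : 0 <= B -> (\int[stm]_p (slab_weight B p)%:E <= (B * jw_mass 1)%:E)%E.
Proof.
move=> B0; rewrite nnZl//; last exact: (nnm_coord (nnm_jw _) (@nnm_unit_itv R) (@nnm_unit_itv R)).
rewrite (integral_coord (nnm_jw _) (@nnm_unit_itv R) (@nnm_unit_itv R)) !integral_unit_itv !mule1.
by rewrite EFinM; apply: lee_wpmul2l; rewrite ?lee_fin//; exact: integral_jw_le ltr01.
Qed.

Lemma cdom_schwartz u : schwartz u -> exists2 B : R, 0 <= B &
  cdom stm (fun p : ST => (chi p)%:C * u p) (slab_weight B).
Proof.
move=> su; have [L [B [_ B0 _ _ hB]]] := schwartz_modulus su; exists B; first exact: ltW.
split.
- by apply: cmeasM; [apply: cmeas_real; case: (@nnm_chi R)|exact: schwartz_cmeas].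
- exact: nnm_slab_weight (ltW B0).
- exact: le_lt_trans (integral_slab_weight (ltW B0)) (ltry _).
- move=> p; have c0 : 0 <= chi p by case: (@nnm_chi R).
  apply: le_trans (c1M _ _) _; rewrite c1_real (ger0_norm c0) /slab_weight mulrA mulrC ler_wpM2r//.
Qed.

Lemma measurable_st_fourier u n : schwartz u -> cmeas (fun t : RT => st_fourier u t n).
Proof.
move=> su; have [B _ dB] := cdom_schwartz su.
have -> : (fun t => st_fourier u t n) = phase_transform stm time_phase (twist (fun p => (chi p)%:C * u p) n).
  by apply/funext => t; rewrite st_fourier_ft ft_twist.
exact: (cmeas_phase_transform measurable_time_phase ltr01 (cdom_twist n dB)).
Qed.

Lemma st_fourier_osc u t n : schwartz u ->
  complex.Re (st_fourier u t n) = osc true t n (fun p => complex.Re (u p)) + osc false t n (fun p => complex.Im (u p)) /\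
  complex.Im (st_fourier u t n) = osc true t n (fun p => complex.Im (u p)) - osc false t n (fun p => complex.Re (u p)).
Proof.
case=> _ s1 s2; rewrite st_fourier_ft /ft /cint /osc/=.
have [i1 _] := osc_integrable t n true s1; have [i2 _] := osc_integrable t n false s1.
have [i3 _] := osc_integrable t n true s2; have [i4 _] := osc_integrable t n false s2.
split.
  rewrite -RintegralD//; apply: eq_Rintegral => p _.
  by rewrite cexpiN cReM ReZ ImZ cReJ cImJ /cexpi /st_phase /trig/=; ring.
rewrite -RintegralB//; apply: eq_Rintegral => p _.
by rewrite cexpiN cImM ReZ ImZ cReJ cImJ /cexpi /st_phase /trig/=; ring.
Qed.

Definition poly_weight (t : R) (n : int * int) : R :=
  (1 + t ^+ 2) * (1 + n.1%:~R ^+ 2) * (1 + n.2%:~R ^+ 2).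

Lemma poly_weight_ge1 t n : 1 <= poly_weight t n.
Proof.
have h (x : R) : 1 <= 1 + x ^+ 2 by rewrite lerDl sqr_ge0.
by rewrite /poly_weight; apply: mulr_ege1; [exact: mulr_ege1|].
Qed.

Lemma st_fourier_decay u (k : nat) : schwartz u ->
  exists2 C : R, 0 < C & forall t n, c1 (st_fourier u t n) * poly_weight t n ^+ k <= C.
Proof.
move=> su; have [p1 p2] := schwartz_real_periodic su; have [_ s1 s2] := su.
have [C1 C10 h1] := osc_decay k s1 p1; have [C2 C20 h2] := osc_decay k s2 p2.
exists (2 * C1 + 2 * C2) => [|t n]; first by lra.
have P0 : 0 <= poly_weight t n ^+ k by rewrite exprn_ge0// (le_trans ler01)// poly_weight_ge1.
have [e1 e2] := st_fourier_osc t n su; rewrite /c1 e1 e2.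
apply: le_trans (ler_wpM2r P0 (lerD (ler_normD _ _) (ler_normB _ _))) _.
have a1 := h1 true t n; have a2 := h1 false t n; have a3 := h2 true t n; have a4 := h2 false t n.
by move: a1 a2 a3 a4; rewrite -/(poly_weight t n) !mulrDl; lra.
Qed.

Let intc (f : R -> R[i]) (g : R -> R[i]) := (\int[leb]_t (c1 (f t) * c1 (g t))%:E)%E.

(** Moves the frequency [(t, n)] of the product onto the first factor, so that [product_bound_real],
    a statement about a plain integral, covers every frequency. *)
Lemma ft_shift u t n r m : ft (fun p => (chi p)%:C * u p * cexpi (- st_phase t n p)) r m =
  st_fourier u (t + r) (n + m).
Proof.
rewrite st_fourier_ft; apply: eq_cint => p; rewrite -mulrA -cexpiD; congr (_ * cexpi _).
by rewrite /st_phase /space_phase /= !intrD; ring.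
Qed.

Lemma parseval_term_le u v (e t : R) n m : 0 < e -> schwartz u -> schwartz v ->
  ((c1 (parseval_term v e (fun p => (chi p)%:C * u p * cexpi (- st_phase t n p)) m))%:E <=
   \int[leb]_r (c1 (st_fourier u (t + r) (n + m)) * c1 (st_fourier v r m))%:E)%E.
Proof.
move=> e0 su sv; rewrite /parseval_term.
rewrite (@eq_cint _ _ _ leb _ (fun r : RT => (pweight e r)%:C *
  (st_fourier u (t + r) (n + m) * conjc (st_fourier v r m)))); last first.
  by move=> r; rewrite ft_shift -st_fourier_ft.
have [C1 C10 h1] := st_fourier_decay 0 su; have [C2 C20 h2] := st_fourier_decay 0 sv.
have mu' : cmeas (fun r : RT => st_fourier u (t + r) (n + m)).
  have m0 := measurable_st_fourier (n + m) su.
  apply: (cmeas_comp m0); apply: measurable_funD; [exact: measurable_cst|exact: measurable_id].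
have mv' := measurable_st_fourier m sv.
have nw := nnm_pweight e.
have bd r : c1 (st_fourier u (t + r) (n + m)) * c1 (st_fourier v r m) <= C1 * C2.
  apply: ler_pM; rewrite ?c1_ge0//.
    by have := h1 (t + r) (n + m); rewrite expr0 mulr1.
  by have := h2 r m; rewrite expr0 mulr1.
have le1 r : c1 ((pweight e r)%:C * (st_fourier u (t + r) (n + m) * conjc (st_fourier v r m))) <=
    pweight e r * (c1 (st_fourier u (t + r) (n + m)) * c1 (st_fourier v r m)).
  apply: le_trans (c1M _ _) _; rewrite c1_real ger0_norm ?expR_ge0// ler_wpM2l ?expR_ge0//.
  by apply: le_trans (c1M _ _) _; rewrite c1J.
have d : cdom leb (fun r : RT => (pweight e r)%:C * (st_fourier u (t + r) (n + m) * conjc (st_fourier v r m)))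
    (fun r => pweight e r * (C1 * C2)).
  split.
  - apply: cmeasM; first by apply: cmeas_real; case: nw.
    by apply: cmeasM => //; exact: cmeasJ.
  - by apply: nnmM => //; apply: nnm_cst; rewrite mulr_ge0// ltW.
  - by rewrite nnZr ?mulr_ge0 ?(ltW C10) ?(ltW C20)// integral_pweight// -EFinM ltry.
  - by move=> r; apply: le_trans (le1 r) _; rewrite ler_wpM2l ?expR_ge0.
apply: le_trans (c1_cint d) _; apply: nn_le => [||r].
- by apply: cmeas_c1; case: d.
- by apply: nnmM; exact: cmeas_c1.
apply: le_trans (le1 r) _; rewrite ler_piMl ?mulr_ge0 ?c1_ge0//.
by rewrite /pweight -expR0 ler_expR oppr_le0 mulr_ge0// ltW.
Qed.

(** The set [S] depends on [eta] but not on the frequency [(t, n)]: [s], [e] and [N] come from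
    Lipschitz and size constants of [u] and [v], and modulating [u] changes none of them. *)
Lemma product_fourier u v : schwartz u -> schwartz v -> forall eta : R, 0 < eta ->
  exists2 S : seq (int * int), uniq S & forall t n,
    ((c1 (st_fourier (fun p => u p * conjc (v p)) t n))%:E <=
      (pois_floor^-1)%:E * \sum_(m <- S)
         \int[leb]_r (c1 (st_fourier u (t + r) (n + m)) * c1 (st_fourier v r m))%:E + eta%:E)%E.
Proof.
move=> su sv eta0 eta00; have [L [B [L0 B0 l1 l2 hB]]] := schwartz_modulus sv.
have [Bu Bu0 du] := cdom_schwartz su; have [Bv _ dv] := cdom_schwartz sv.
have bV p : c1 (v p) <= B by apply: le_trans (hB p) _; rewrite ler_piMr ?(ltW B0)// jw_le1.
(* The error arrives multiplied by the integral of the function that dominates the modulated [u];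
   this integral is at most [K]. *)
set K := Bu * jw_mass 1 * 2 + 1.
have J0 : 0 <= jw_mass (1 : R) by rewrite jw_mass_ge0.
have K0 : 0 < K by rewrite /K ltr_wpDl//; do 2 apply: mulr_ge0 => //.
pose eta := eta0 / K; have e0 : 0 < eta by rewrite divr_gt0.
(* The scale [s] comes first, then [e] and [N] in terms of it; each is read off from one of the
   three smallness conditions of [kern_error]. *)
pose s := Num.min 1 (eta / 3 / (6 * L)).
have s0 : 0 < s by rewrite lt_min ltr01/= !divr_gt0// mulr_gt0.
have s1 : s <= 1 by rewrite ge_min lexx.
have c1' : 6 * L * s <= eta / 3.
  by rewrite mulrC -ler_pdivlMr ?mulr_gt0// ge_min lexx orbT.
pose e := Num.min 1 (eta / 3 * pois_floor / (2 * B * (2 / s ^+ 2) * jw_mass 1 + 1)).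
have D0 : 0 < 2 * B * (2 / s ^+ 2) * jw_mass 1 + 1.
  rewrite ltr_wpDl// mulr_ge0// mulr_ge0//; first by rewrite mulr_ge0// ltW.
  by rewrite divr_ge0// sqr_ge0.
have ee0 : 0 < e by rewrite lt_min ltr01/= divr_gt0// mulr_gt0 ?pois_floor_gt0// divr_gt0.
have e1 : e <= 1 by rewrite ge_min lexx.
have c3' : 2 * B * (2 * e / s ^+ 2) * jw_mass 1 <= eta / 3 * pois_floor.
  apply: (@le_trans _ _ (e * (2 * B * (2 / s ^+ 2) * jw_mass 1 + 1))).
    rewrite (_ : 2 * B * (2 * e / s ^+ 2) * jw_mass 1 = e * (2 * B * (2 / s ^+ 2) * jw_mass 1)); last by ring.
    by rewrite ler_pM2l// lerDl.
  by rewrite -ler_pdivlMr// ge_min lexx orbT.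
pose N := (Num.truncn (16 * L / s / (eta / 3))).+1.
have c2' : 16 * L / s / N%:R <= eta / 3.
  rewrite ler_pdivrMr ?ltr0n//.
  have := truncnS_gt (16 * L / s / (eta / 3)); rewrite -/N ltr_pdivrMr ?divr_gt0// => /ltW.
  by rewrite [leRHS]mulrC.
exists [seq (i%:Z - N%:Z, j%:Z - N%:Z) | i <- iota 0 (2 * N), j <- iota 0 (2 * N)].
  exact: uniq_box.
move=> t n; pose G (p : ST) := (chi p)%:C * u p * cexpi (- st_phase t n p).
have dG : cdom stm G (fun p => slab_weight Bu p * 2).
  apply: cdomM => // [|p]; last exact: c1_cexpi.
  by apply: cmeas_cexpi; apply: measurable_funN; exact: measurable_st_phase.
have G0 p : ~ in_slab p -> G p = 0.
  by move=> ip; rewrite /G; have [[]//|->] := chiP p; rewrite !mul0r.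
have pv : Defs.periodic v by case: sv.
have := product_bound_real pv L0 B0 l1 l2 bV ee0 e1 s0 s1 (ltn0Sn _ : (0 < N)%N) e0 c1' c2' c3' dv dG G0.
rewrite (_ : cint stm (fun p => G p * conjc (v p)) = st_fourier (fun p => u p * conjc (v p)) t n); last first.
  by rewrite st_fourier_ft; apply: eq_cint => p; rewrite /G -/(st_phase t n p) mulrA mulrAC.
move=> h; apply: (le_trans h); apply: leeD.
  have f0 : 0 <= (pois_floor : R)^-1 by rewrite invr_ge0 ltW// pois_floor_gt0.
  rewrite EFinM; apply: lee_wpmul2l; rewrite ?lee_fin// -sumEFin.
  by apply: lee_sum => m _; exact: parseval_term_le.
apply: (@le_trans _ _ (eta%:E * K%:E)%E); last by rewrite -EFinM lee_fin /eta divfK// gt_eqF.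
apply: lee_wpmul2l; first by rewrite lee_fin ltW.
rewrite nnZr//; last exact: nnm_slab_weight.
apply: (@le_trans _ _ ((Bu * jw_mass 1)%:E * 2%:E)%E); last by rewrite -EFinM lee_fin /K lerDl.
by apply: lee_wpmul2r; rewrite ?lee_fin//; exact: integral_slab_weight.
Qed.

End schwartz_fourier.

(** * The bilinear estimate for smooth functions *)

Section squared_norm.
Context {R : realType}.
Local Notation leb := (@lebesgue_measure R).
Local Notation RT := (measurableTypeR R).
Implicit Types u v : spacetime R -> R[i].

Lemma esum_le_seq (T : choiceType) (a : T -> \bar R) (B : \bar R) :
  (forall S : seq T, uniq S -> (\sum_(n <- S) a n <= B)%E) -> (\esum_(n in [set: T]) a n <= B)%E.
Proof.
move=> h; apply: ge_ereal_sup => _ [A [fA _] <-].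
by rewrite fsbig_finite//; apply: h.
Qed.

Lemma seq_le_esum (T : choiceType) (a : T -> \bar R) (S : seq T) : uniq S ->
  (\sum_(n <- S) a n <= \esum_(n in [set: T]) a n)%E.
Proof.
move=> uS; apply: ereal_sup_ubound; exists [set` S]; last by rewrite -fsbig_seq.
by split => //; exact: finite_seq.
Qed.

Definition jpn (n : int * int) : R := japanese (Num.sqrt (freq_sqr n)).

Definition X_weight (s b t : R) n : R := jpn n `^ (2 * s) * japanese (t + freq_sqr n) `^ (2 * b).

Definition Xsq (s b : R) u : \bar R :=
  (\esum_(n in [set: int * int]) \int[leb]_t (X_weight s b t n * nsq (st_fourier u t n))%:E)%E.

Lemma X_normE s b u : X_norm s b u = (Xsq s b u `^ (2^-1))%E.
Proof. by []. Qed.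

Lemma freq_sqr_ge0 n : 0 <= freq_sqr n :> R.
Proof. by rewrite addr_ge0 ?sqr_ge0. Qed.

Lemma jpn_gt0 n : 0 < jpn n. Proof. exact: japanese_gt0. Qed.

Lemma jpn_sqr n : jpn n ^+ 2 = 1 + freq_sqr n.
Proof.
rewrite /jpn /japanese sqr_sqrtr; last by rewrite addr_ge0// sqr_ge0.
by rewrite sqr_sqrtr// freq_sqr_ge0.
Qed.

Lemma japanese_sqr (x : R) : japanese x ^+ 2 = 1 + x ^+ 2.
Proof. by rewrite sqr_sqrtr// addr_ge0// sqr_ge0. Qed.

Lemma powR_double (x b : R) : 0 <= x -> x `^ (2 * b) = (x ^+ 2) `^ b.
Proof. by move=> x0; rewrite powRrM powR_mulrn. Qed.

Lemma powR_le_nat (x y b : R) (k : nat) : 1 <= x -> x <= y -> b <= k%:R -> x `^ b <= y ^+ k.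
Proof.
move=> x1 xy bk; apply: (@le_trans _ _ (x `^ k%:R)); first by rewrite ler_powR.
rewrite powR_mulrn; last by rewrite (le_trans ler01).
by rewrite lerXn2r// nnegrE (le_trans ler01)// (le_trans x1).
Qed.

Lemma X_weight_ge0 s b t n : 0 <= X_weight s b t n.
Proof. by rewrite mulr_ge0// powR_ge0. Qed.

Lemma freq_le_poly (t : R) n : 1 + freq_sqr n <= poly_weight t n.
Proof.
rewrite /poly_weight /freq_sqr; set a := n.1%:~R ^+ 2; set c := n.2%:~R ^+ 2.
have a0 : 0 <= a by exact: sqr_ge0. have c0 : 0 <= c by exact: sqr_ge0.
have t0 := sqr_ge0 t; have ac : 0 <= a * c by exact: mulr_ge0.
rewrite -mulrA; apply: (@le_trans _ _ (1 * ((1 + a) * (1 + c)))); first by rewrite mul1r; lra.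
by rewrite ler_wpM2r ?mulr_ge0 ?addr_ge0// lerDl.
Qed.

Lemma time_le_poly (t : R) n : 1 + t ^+ 2 <= poly_weight t n.
Proof.
have h (x : R) : 1 <= 1 + x ^+ 2 by rewrite lerDl sqr_ge0.
by rewrite /poly_weight -mulrA ler_peMr ?mulr_ege1// addr_ge0// sqr_ge0.
Qed.

(** The space weight costs [k] powers and the modulation weight [3 k]: with [F = |n|^2] and [P] the
    polynomial weight, [1 + (t + F)^2 <= 2 (1 + t^2) (1 + F)^2 <= 2 P^3]. *)
Lemma X_weight_le s b (k : nat) t n : s <= k%:R -> b <= k%:R ->
  X_weight s b t n <= 2 ^+ k * poly_weight t n ^+ (4 * k).
Proof.
move=> sk bk; have P1 := poly_weight_ge1 t n; have h1 := freq_le_poly t n; have h2 := time_le_poly t n.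
rewrite /X_weight !powR_double ?(ltW (japanese_gt0 _)) ?(ltW (jpn_gt0 _))// jpn_sqr japanese_sqr.
have f0 := freq_sqr_ge0 n; have t0 := sqr_ge0 t.
rewrite (_ : (4 * k)%N = (k + 3 * k)%N); last by lia.
rewrite exprD mulrCA; apply: ler_pM; rewrite ?powR_ge0//.
  by apply: powR_le_nat; rewrite ?lerDl.
rewrite exprM -exprMn; apply: powR_le_nat; rewrite ?lerDl ?sqr_ge0//.
set P := poly_weight t n in P1 h1 h2 *; set F := freq_sqr n in f0 h1 *.
have e1 : 1 + (t + F) ^+ 2 <= 2 * ((1 + t ^+ 2) * (1 + F) ^+ 2).
  have y1 := sqr_ge0 (t - F); have y2 : 0 <= t ^+ 2 * F by rewrite mulr_ge0.
  have y3 : 0 <= t ^+ 2 * F ^+ 2 by rewrite mulr_ge0 ?sqr_ge0.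
  have y4 := sqr_ge0 F.
  rewrite (_ : 1 + (t + F) ^+ 2 = 1 + 2 * t ^+ 2 + 2 * F ^+ 2 - (t - F) ^+ 2); last by ring.
  rewrite [leRHS](_ : _ = 2 + 4 * F + 2 * F ^+ 2 + 2 * t ^+ 2 + 4 * (t ^+ 2 * F) + 2 * (t ^+ 2 * F ^+ 2)); last by ring.
  move: y1 y2 y3 y4 t0 f0 {P1 h1 h2}; move: (t ^+ 2 * F) (t ^+ 2 * F ^+ 2) ((t - F) ^+ 2) (t ^+ 2) (F ^+ 2).
  by move=> *; lra.
apply: (le_trans e1); rewrite ler_pM2l// exprS; apply: ler_pM; rewrite ?addr_ge0 ?sqr_ge0//.
by rewrite lerXn2r// nnegrE; lra.
Qed.

Lemma nsq_le_c1 (z : R[i]) : nsq z <= c1 z ^+ 2.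
Proof.
rewrite /nsq /c1 -[complex.Re z ^+ 2]real_normK ?num_real// -[complex.Im z ^+ 2]real_normK ?num_real//.
have := normr_ge0 (complex.Re z); have := normr_ge0 (complex.Im z); move: (`|_|) (`|_|) => x y *; nra.
Qed.

Lemma c1_le_nsq (z : R[i]) : c1 z ^+ 2 <= 2 * nsq z.
Proof.
rewrite /nsq /c1 -[complex.Re z ^+ 2]real_normK ?num_real// -[complex.Im z ^+ 2]real_normK ?num_real//.
by move: (`|_|) (`|_|) => x y; have := sqr_ge0 (x - y); nra.
Qed.

Lemma nnm_X_weight s b n : nnm (fun t : RT => X_weight s b t n).
Proof.
apply: nnmM; first by apply: nnm_cst; exact: powR_ge0.
have := nnm_shift (freq_sqr n) (@nnm_jw R (- (2 * b))).
by rewrite /jw opprK.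
Qed.

Lemma nnm_Xsq s b u n : schwartz u -> nnm (fun t : RT => X_weight s b t n * nsq (st_fourier u t n)).
Proof. by move=> su; apply: nnmM; [exact: nnm_X_weight|apply: nnm_nsq; exact: measurable_st_fourier]. Qed.

(** Because [1 / (1 + m^2) <= 4 / (1 + (2 m)^2)], it is a coset sum. *)
Lemma sum_inv_square_le (S : seq int) : uniq S -> \sum_(m <- S) (1 + (m%:~R : R) ^+ 2)^-1 <= 4 * coset_bound (1 : R).
Proof.
move=> uS; apply: (@le_trans _ _ (4 * \sum_(m <- S) jw (1 + 1) (0 + 2 * (1 * m)%:~R))).
  rewrite mulr_sumr; apply: ler_sum => m _; rewrite jw2E mul1r add0r exprMn.
  have := sqr_ge0 (m%:~R : R); move: (m%:~R ^+ 2) => x x0.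
  rewrite ler_pdivlMr; last by lra.
  by rewrite mulrC ler_pdivrMr; lra.
by rewrite ler_pM2l//; exact: sum_jw_coset_le.
Qed.

Lemma sum_grid_le (f g : int -> R) (B : R) (S : seq (int * int)) : uniq S ->
  (forall m, 0 <= f m) -> (forall m, 0 <= g m) -> 0 <= B ->
  (forall S, uniq S -> \sum_(m <- S) f m <= B) -> (forall S, uniq S -> \sum_(m <- S) g m <= B) ->
  \sum_(n <- S) f n.1 * g n.2 <= B * B.
Proof.
move=> uS f0 g0 B0 hf hg.
pose S1 := undup (map fst S); pose S2 := undup (map snd S).
apply: (@le_trans _ _ (\sum_(n <- [seq (i, j) | i <- S1, j <- S2]) f n.1 * g n.2)).
  apply: ler_sum_subset => //.
  - by apply: allpairs_uniq; rewrite ?undup_uniq// => -[? ?] [? ?].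
  - by move=> [i j] ij; apply/allpairsP; exists (i, j); rewrite !mem_undup; split=> //; [exact: (map_f fst ij)|exact: (map_f snd ij)].
  - by move=> n _; rewrite mulr_ge0.
rewrite big_allpairs/= -big_distrlr/=; apply: ler_pM; rewrite ?sumr_ge0//.
  by apply: hf; exact: undup_uniq.
by apply: hg; exact: undup_uniq.
Qed.

(** Decay of order [2 k + 1], squared, beats the weight of order [4 k] and leaves more than the
    inverse of [poly_weight], a product of three inverse quadratics. The finiteness is what later
    allows the duality argument to divide by the norm. *)
Lemma Xsq_lty s b u : schwartz u -> (Xsq s b u < +oo)%E.
Proof.
move=> su; pose k := (Num.truncn `|s| + Num.truncn `|b|).+1.
have hk (x : R) : `|x| <= `|s| \/ `|x| <= `|b| -> x <= k%:R.
  have h1 := truncnS_gt `|s|; have h2 := truncnS_gt `|b|.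
  have e1 : (Num.truncn `|s|).+1%:R <= k%:R :> R by rewrite ler_nat /k ltnS leq_addr.
  have e2 : (Num.truncn `|b|).+1%:R <= k%:R :> R by rewrite ler_nat /k ltnS leq_addl.
  by have := ler_norm x => h [h3|h3]; lra.
have [C C0 hC] := st_fourier_decay (2 * k + 1) su.
set D := 2 ^+ k * C ^+ 2; have D0 : 0 <= D by rewrite mulr_ge0 ?exprn_ge0// ltW.
have cb0 : 0 <= coset_bound (1 : R) by exact: coset_bound_ge0.
apply: (@le_lt_trans _ _ (D * (jw_mass 1 * (4 * coset_bound 1 * (4 * coset_bound 1))))%:E); last exact: ltry.
apply: esum_le_seq => S uS.
pose h (n : int * int) : R := (1 + (n.1%:~R : R) ^+ 2)^-1 * (1 + n.2%:~R ^+ 2)^-1.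
have q (x : R) : 0 < 1 + x ^+ 2 by rewrite ltr_pwDl// sqr_ge0.
have h0 n : 0 <= h n by rewrite mulr_ge0// invr_ge0 ltW.
apply: (@le_trans _ _ (\sum_(n <- S) (D * (jw_mass 1 * h n))%:E)%E); last first.
  rewrite sumEFin lee_fin -!mulr_sumr ler_wpM2l// ler_wpM2l ?jw_mass_ge0//.
  apply: (sum_grid_le uS (f := fun m => (1 + (m%:~R : R) ^+ 2)^-1) (g := fun m => (1 + (m%:~R : R) ^+ 2)^-1)) => //.
  - by move=> m; rewrite invr_ge0 ltW.
  - by move=> m; rewrite invr_ge0 ltW.
  - by rewrite mulr_ge0.
  - exact: sum_inv_square_le.
  - exact: sum_inv_square_le.
apply: lee_sum => n _; apply: (@le_trans _ _ (\int[leb]_t (D * h n * jw (1 + 1) t)%:E)%E).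
  have Dh : 0 <= D * h n by rewrite mulr_ge0.
  apply: nn_le => [||t]; first exact: nnm_Xsq.
    by apply: nnmM; [exact: nnm_cst|exact: nnm_jw].
  have P1 := poly_weight_ge1 t n; have P0 : 0 < poly_weight t n by exact: lt_le_trans P1.
  rewrite jw2E (_ : D * h n * _ = D / poly_weight t n); last first.
    by rewrite /h /poly_weight !invfM; ring.
  rewrite ler_pdivlMr//.
  apply: (@le_trans _ _ (2 ^+ k * poly_weight t n ^+ (4 * k) * c1 (st_fourier u t n) ^+ 2 * poly_weight t n ^+ 2)).
    have w1 : X_weight s b t n * nsq (st_fourier u t n) <=
        2 ^+ k * poly_weight t n ^+ (4 * k) * c1 (st_fourier u t n) ^+ 2.
      apply: ler_pM; [exact: X_weight_ge0|exact: nsq_ge0| |exact: nsq_le_c1].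
      by apply: X_weight_le; apply: hk; [left|right].
    apply: ler_pM => //; [|exact: ltW|by rewrite -[leLHS]expr1 ler_weXn2l].
    by apply: mulr_ge0; [exact: X_weight_ge0|exact: nsq_ge0].
  rewrite [leLHS](_ : _ = 2 ^+ k * (c1 (st_fourier u t n) * poly_weight t n ^+ (2 * k + 1)) ^+ 2); last first.
    rewrite [(c1 _ * _) ^+ 2]exprMn -[(_ ^+ (2 * k + 1)) ^+ 2]exprM (_ : ((2 * k + 1) * 2)%N = (4 * k + 2)%N); last by lia.
    have gen (A P4 c P2 : R) : A * P4 * c * P2 = A * (c * (P4 * P2)) by ring.
    by rewrite exprD; exact: gen.
  rewrite ler_pM2l ?exprn_gt0// lerXn2r ?nnegrE ?(ltW C0)//.
  by rewrite mulr_ge0 ?c1_ge0// exprn_ge0// ltW.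
rewrite nnZl; [|by rewrite mulr_ge0|exact: nnm_jw].
rewrite (_ : D * (jw_mass 1 * h n) = D * h n * jw_mass 1); last by ring.
rewrite [leRHS]EFinM; apply: lee_wpmul2l; first by rewrite lee_fin mulr_ge0.
exact: integral_jw_le ltr01.
Qed.

Lemma lee_sum_subset (I : eqType) (S T : seq I) (F : I -> \bar R) :
  uniq S -> uniq T -> {subset S <= T} -> (forall x, 0 <= F x)%E ->
  (\sum_(x <- S) F x <= \sum_(x <- T) F x)%E.
Proof.
move=> uS uT ST F0; rewrite [leRHS](bigID (mem S))/=.
have -> : (\sum_(x <- T | x \in S) F x = \sum_(x <- S) F x)%E.
  rewrite -big_filter; apply: perm_big; apply: uniq_perm; rewrite ?filter_uniq// => x.
  by rewrite mem_filter; apply/andP/idP => [[]//|xS]; split=> //; exact: ST.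
by rewrite leeDl// sume_ge0.
Qed.

Lemma nnm_section1 d1' d2' (T1 : measurableType d1') (T2 : measurableType d2') (f : T1 * T2 -> R) x :
  nnm f -> nnm (fun y => f (x, y)).
Proof. by case=> mf f0; split=> // ; exact: (measurableT_comp mf (pair1_measurable x)). Qed.

Section bilinear.
Variable s : R.

Lemma freq_sqrD n m : freq_sqr (n + m) = freq_sqr n + freq_sqr m + 2 * (dotz n m)%:~R :> R.
Proof. by rewrite /freq_sqr /dotz /= !intrD !intrM; ring. Qed.

Lemma jpn_sub n m : jpn n <= 2 * (jpn (n + m) * jpn m).
Proof.
have g0 x : 0 <= jpn x by exact: ltW (jpn_gt0 x).
rewrite -(@ler_pXn2r _ 2)// ?nnegrE ?mulr_ge0// !exprMn !jpn_sqr.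
have f1 := freq_sqr_ge0 (n + m); have f2 := freq_sqr_ge0 m.
have f3 := mulr_ge0 f1 f2.
have h : freq_sqr n <= 2 * freq_sqr (n + m) + 2 * freq_sqr m :> R.
  rewrite /freq_sqr /= !intrD.
  have := sqr_ge0 (n.1%:~R + m.1%:~R + m.1%:~R : R); have := sqr_ge0 (n.2%:~R + m.2%:~R + m.2%:~R : R).
  by move: (n.1%:~R) (n.2%:~R) (m.1%:~R) (m.2%:~R) => a b c e; nra.
by rewrite (_ : 2 ^+ 2 * _ = 4 + 4 * freq_sqr (n + m) + 4 * freq_sqr m + 4 * (freq_sqr (n + m) * freq_sqr m));
  [lra|ring].
Qed.

Lemma jpn_split n m : 0 <= s -> jpn n `^ s <= 2 `^ s * (jpn (n + m) `^ s * jpn m `^ s).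
Proof.
move=> s0; have g0 x : 0 <= jpn x by exact: ltW (jpn_gt0 x).
rewrite -powRM// -powRM ?mulr_ge0//; apply: ge0_ler_powR; rewrite ?nnegrE ?mulr_ge0//.
exact: jpn_sub.
Qed.

(* [modulated a u n x] is the weighted Fourier transform in the variable [x = tau + |n|^2]. *)
Definition modulated (a : R) u (n : int * int) (x : RT) : R :=
  jpn n `^ s * jw a x * c1 (st_fourier u (x - freq_sqr n) n).

Lemma nnm_modulated a u n : schwartz u -> nnm (modulated a u n).
Proof.
move=> su; apply: nnmM.
  by apply: nnmM; [apply: nnm_cst; exact: powR_ge0|exact: nnm_jw].
exact: (nnm_shift (- freq_sqr n) (cmeas_c1 (measurable_st_fourier n su))).
Qed.

Lemma modulated_ge0 a u n x : 0 <= modulated a u n x.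
Proof. by rewrite mulr_ge0 ?c1_ge0// mulr_ge0 ?powR_ge0. Qed.

Lemma X_weightE b t n : X_weight s b t n = (jpn n `^ s * jw (- b) (t + freq_sqr n)) ^+ 2.
Proof.
rewrite [RHS]exprMn (jw_sqr (- b) (t + freq_sqr n)) /X_weight /jw mulNr opprK [b * 2]mulrC.
by congr (_ * _); rewrite mulrC powRrM powR_mulrn// powR_ge0.
Qed.

Lemma modulated_sqr b u n : schwartz u ->
  (\int[leb]_x (modulated (- b) u n x ^+ 2)%:E =
   \int[leb]_t (X_weight s b t n * c1 (st_fourier u t n) ^+ 2)%:E)%E.
Proof.
move=> su; rewrite -(nn_shift (freq_sqr n)); last by apply: nnmX; exact: nnm_modulated.
by apply: eq_integral => t _; rewrite /modulated X_weightE addrK exprMn.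
Qed.

(** Normalising by [2 * L] instead of [L] absorbs the factor 2 of [c1_le_nsq]. *)
Lemma modulated_mass b u S (L : R) : schwartz u -> uniq S -> 0 < L ->
  (Xsq s b u <= (L ^+ 2)%:E)%E ->
  (\sum_(n <- S) \int[leb]_x ((modulated (- b) u n x / (2 * L)) ^+ 2)%:E <= 1)%E.
Proof.
move=> su uS L0 hL.
have n1 n : nnm (fun t : RT => X_weight s b t n * nsq (st_fourier u t n)) by exact: nnm_Xsq.
apply: (@le_trans _ _ (((2 * L ^+ 2)^-1)%:E * \sum_(n <- S) \int[leb]_t (X_weight s b t n * nsq (st_fourier u t n))%:E)%E).
  rewrite ge0_sume_distrr; last by move=> n _; exact: nn_ge0.
  apply: lee_sum => n _; rewrite -nnZl ?invr_ge0 ?mulr_ge0 ?(ltW L0)//.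
  rewrite (_ : \int[leb]_x _ = \int[leb]_x (((2 * L)^-1) ^+ 2 * modulated (- b) u n x ^+ 2)%:E)%E; last first.
    by apply: eq_integral => x _; rewrite exprMn mulrC.
  have nm2 : nnm (fun x => modulated (- b) u n x ^+ 2) by apply: nnmX; exact: nnm_modulated.
  rewrite (nnZl _ (sqr_ge0 _) nm2).
  rewrite modulated_sqr// -nnZl ?sqr_ge0//; last first.
    by apply: nnmM; [exact: nnm_X_weight|apply: nnmX; apply: cmeas_c1; exact: measurable_st_fourier].
  apply: nn_le => [||t].
  - apply: nnmM; first by apply: nnm_cst; exact: sqr_ge0.
    by apply: nnmM; [exact: nnm_X_weight|apply: nnmX; apply: cmeas_c1; exact: measurable_st_fourier].
  - by apply: nnmM => //; apply: nnm_cst; rewrite invr_ge0 mulr_ge0// sqr_ge0.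
  rewrite (_ : ((2 * L)^-1) ^+ 2 = (2 * L ^+ 2)^-1 * 2^-1); last by field; rewrite gt_eqF.
  rewrite [leLHS](_ : _ = (2 * L ^+ 2)^-1 * (X_weight s b t n * (2^-1 * c1 (st_fourier u t n) ^+ 2))); last by ring.
  apply: ler_wpM2l; first by rewrite invr_ge0 mulr_ge0// sqr_ge0.
  apply: ler_wpM2l; first exact: X_weight_ge0.
  by have := c1_le_nsq (st_fourier u t n); lra.
apply: (@le_trans _ _ (((2 * L ^+ 2)^-1)%:E * (L ^+ 2)%:E)%E).
  apply: lee_wpmul2l; first by rewrite lee_fin invr_ge0 mulr_ge0// sqr_ge0.
  by apply: le_trans hL; exact: seq_le_esum.
rewrite -EFinM lee_fin (_ : _ * _ = 2^-1); first by lra.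
by field; rewrite gt_eqF.
Qed.

End bilinear.

End squared_norm.

(** * From the trilinear form to the norm of a product *)

Section bilinear_estimate.
Context {R : realType}.
Local Notation leb := (@lebesgue_measure R).
Local Notation RT := (measurableTypeR R).
Implicit Types u v : spacetime R -> R[i].
Variables (s d1 d2 : R).
Hypotheses (s0 : 0 <= s) (d20 : 0 < d2) (d18 : d1 <= 8^-1).

Let et := 2 * d2.
Let et0 : 0 < et. Proof. by rewrite mulr_gt0. Qed.
Let b2 := 2^-1 + d2.
Let b0 := - 2^-1 + d1.
(** The factors come from the mollification, from splitting [<n>^s], from the normalisations
    [2 * L1] and [2 * L2], and from the trilinear estimate. *)
Let K := pois_floor^-1 * 2 `^ s * (2 * 2 * trilinear_bound et).

Let mod_u u n x : c1 (st_fourier u (x - freq_sqr n) n) =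
  (jpn n `^ s)^-1 * jw ((1 + et) / 2) x * modulated s (- b2) u n x.
Proof.
rewrite /modulated; set p := jpn n `^ s.
have p0 : p != 0 by rewrite gt_eqF// powR_gt0// jpn_gt0.
have -> : jw ((1 + et) / 2) x = (jw (- b2) x)^-1.
  by rewrite /jw opprK -powRN; congr (_ `^ _); rewrite /b2 /et; field.
have j0 : jw (- b2) x != 0 by rewrite gt_eqF// powR_gt0// japanese_gt0.
by rewrite -invfM mulKf// mulf_neq0.
Qed.

(** The dual function is the weighted transform [F0] of the product itself, normalised by its norm
    [r] over the finite set [S]. The trilinear estimate then gives [r^2 <= r C L1 L2 + eta D] for
    every [eta], and [r] may be cancelled because it is known beforehand to be finite. *)
Lemma bilinear_Xsq : exists2 C : R, 0 < C & forall u v (L1 L2 : R), schwartz u -> schwartz v ->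
  0 < L1 -> 0 < L2 -> (Xsq s b2 u <= (L1 ^+ 2)%:E)%E -> (Xsq s b2 v <= (L2 ^+ 2)%:E)%E ->
  (Xsq s b0 (fun p => (u p * conjc (v p))%R) <= ((C * (L1 * L2)) ^+ 2)%:E)%E.
Proof.
exists (`|K| + 1) => [|u v L1 L2 su sv L10 L20 hu hv]; first by rewrite ltr_wpDl.
set C := `|K| + 1.
have d18' : d1 * 8 <= 1 by rewrite -ler_pdivlMr// div1r.
set W := fun p => (u p * conjc (v p))%R.
have sW : schwartz W by apply: schwartz_mul => //; exact: schwartz_conj.
pose F0 := modulated s (- b0) W; have nF n : nnm (F0 n) by exact: nnm_modulated.
have L120 : 0 < L1 * L2 by rewrite mulr_gt0.
apply: esum_le_seq => S uS.
pose a : R := fine (\sum_(n <- S) \int[leb]_x (F0 n x ^+ 2)%:E)%E.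
have A0 : (0 <= \sum_(n <- S) \int[leb]_x (F0 n x ^+ 2)%:E)%E.
  by apply: sume_ge0 => n _; apply: nn_ge0; exact: nnmX.
have Afin : (\sum_(n <- S) \int[leb]_x (F0 n x ^+ 2)%:E < +oo)%E.
  apply: (@le_lt_trans _ _ (2%:E * Xsq s b0 W)%E); last first.
    apply: lte_mul_pinfty; rewrite ?lee_fin//; exact: Xsq_lty.
  apply: (@le_trans _ _ (2%:E * \sum_(n <- S) \int[leb]_t (X_weight s b0 t n * nsq (st_fourier W t n))%:E)%E).
    rewrite ge0_sume_distrr; last by move=> n _; apply: nn_ge0; exact: nnm_Xsq.
    apply: lee_sum => n _; rewrite modulated_sqr// -nnZl//; last exact: nnm_Xsq.
    apply: nn_le => [||t].
    - by apply: nnmM; [exact: nnm_X_weight|apply: nnmX; apply: cmeas_c1; exact: measurable_st_fourier].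
    - by apply: nnmM; [exact: nnm_cst|exact: nnm_Xsq].
    by rewrite [leRHS]mulrCA; apply: ler_wpM2l; [exact: X_weight_ge0|exact: c1_le_nsq].
  by apply: lee_wpmul2l; rewrite ?lee_fin//; exact: seq_le_esum.
have aE : (\sum_(n <- S) \int[leb]_x (F0 n x ^+ 2)%:E = a%:E)%E by rewrite fineK// ge0_fin_numE.
apply: (@le_trans _ _ a%:E).
  rewrite -aE; apply: lee_sum => n _; rewrite modulated_sqr//; apply: nn_le => [||t].
  - exact: nnm_Xsq.
  - by apply: nnmM; [exact: nnm_X_weight|apply: nnmX; apply: cmeas_c1; exact: measurable_st_fourier].
  by rewrite ler_wpM2l ?X_weight_ge0// nsq_le_c1.
rewrite lee_fin; have a0 : 0 <= a by rewrite fine_ge0.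
have [->|a_neq0] := eqVneq a 0; first exact: sqr_ge0.
have ap : 0 < a by rewrite lt_def a_neq0.
set r := Num.sqrt a; have r0 : 0 < r by rewrite sqrtr_gt0.
have r2 : r ^+ 2 = a by rewrite sqr_sqrtr.
suff : r <= C * (L1 * L2).
  move=> rC; rewrite -r2 lerXn2r// nnegrE; first exact: ltW.
  by rewrite mulr_ge0 ?(ltW L120)// addr_ge0.
(* The factor of the error [eta] of [product_fourier]. It may depend on [u], [v] and [S], which stay
   fixed while [eta] tends to 0. *)
have [D hD] : exists D : R, (\sum_(n <- S) \int[leb]_x (F0 n x * (jpn n `^ s))%:E <= D%:E)%E.
  have [B B0 hB] := st_fourier_decay 1 sW.
  exists (\sum_(n <- S) (jpn n `^ s * B * jpn n `^ s * jw_mass 1)).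
  rewrite -sumEFin; apply: lee_sum => n _; have p0 := powR_ge0 (jpn n) s.
  rewrite nnZr// -/(jpn n `^ s) (_ : jpn n `^ s * B * jpn n `^ s * jw_mass 1 = (jpn n `^ s * B * jw_mass 1) * jpn n `^ s); last by ring.
  rewrite EFinM; apply: lee_wpmul2r; first by rewrite lee_fin.
  rewrite -(nn_shift (freq_sqr n))//.
  apply: (@le_trans _ _ (\int[leb]_x (jpn n `^ s * B * jw (1 + 1) x)%:E)%E).
    apply: nn_le => [||t]; first exact: nnm_shift.
      by apply: nnmM; [apply: nnm_cst; rewrite mulr_ge0// ltW|exact: nnm_jw].
    rewrite /F0 /modulated addrK -!mulrA ler_wpM2l//.
    have jb : jw (- b0) (t + freq_sqr n) <= 1 by apply: jw_le1; rewrite /b0; lra.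
    apply: (@le_trans _ _ (1 * c1 (st_fourier W t n))); first by rewrite ler_wpM2r// c1_ge0.
    rewrite mul1r jw2E ler_pdivlMr; last by rewrite ltr_pwDl// sqr_ge0.
    by apply: le_trans (hB t n); rewrite expr1 ler_wpM2l ?c1_ge0// time_le_poly.
  rewrite nnZl; [|by rewrite mulr_ge0// ltW|exact: nnm_jw].
  by rewrite [in leRHS]EFinM; apply: lee_wpmul2l; rewrite ?lee_fin ?mulr_ge0 ?(ltW B0)//; exact: integral_jw_le ltr01.
(* The norm [r] normalises [F0] over [S] only; the cut to [S] keeps the mass at most 1 on the larger
   index set used below. *)
pose f0 n (x : RT) : R := (n \in S)%:R * (F0 n x / r).
pose f1 n (x : RT) : R := modulated s (- b2) u n x / (2 * L1).
pose f2 n (x : RT) : R := modulated s (- b2) v n x / (2 * L2).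
have ndiv (g : RT -> R) (c : R) : nnm g -> 0 < c -> nnm (fun x => g x / c).
  by move=> ng c0; apply: nnmM => //; apply: nnm_cst; rewrite invr_ge0 ltW.
have n0 n : nnm (f0 n) by apply: nnmM; [apply: nnm_cst; rewrite ler0n|exact: ndiv].
have n1 n : nnm (f1 n) by apply: ndiv; [exact: nnm_modulated|rewrite mulr_gt0].
have n2 n : nnm (f2 n) by apply: ndiv; [exact: nnm_modulated|rewrite mulr_gt0].
have m0 : mass1 f0.
  split=> // T uT; rewrite (bigID (mem S))/= [X in (_ + X)%E]big1 ?adde0; last first.
    move=> n nS; rewrite /f0 (negbTE nS); under eq_integral do rewrite mul0r expr0n/=.
    by rewrite integral0.
  rewrite -big_filter; apply: (@le_trans _ _ (\sum_(n <- S) ((a^-1)%:E * \int[leb]_x (F0 n x ^+ 2)%:E))%E).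
    apply: (@le_trans _ _ (\sum_(n <- [seq n <- T | n \in S]) ((a^-1)%:E * \int[leb]_x (F0 n x ^+ 2)%:E))%E).
      rewrite big_seq [leRHS]big_seq; apply: lee_sum => n; rewrite mem_filter => /andP[nS _].
      rewrite -nnZl ?invr_ge0//; last exact: nnmX.
      rewrite le_eqVlt; apply/orP; left; apply/eqP; apply: eq_integral => x _.
      by rewrite /f0 nS mul1r exprMn exprVn r2 mulrC.
    apply: lee_sum_subset; rewrite ?filter_uniq//.
      by move=> n; rewrite mem_filter => /andP[].
    by move=> n; apply: mule_ge0; [rewrite lee_fin invr_ge0|apply: nn_ge0; exact: nnmX].
  rewrite -ge0_sume_distrr; last by move=> n _; apply: nn_ge0; exact: nnmX.
  by rewrite aE -EFinM mulVf.
have m1 : mass1 f1 by split=> // T uT; exact: modulated_mass.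
have m2 : mass1 f2 by split=> // T uT; exact: modulated_mass.
pose G n m (p : RT * RT) := jw (3 / 8) p.1 * jw ((1 + et) / 2) p.2 * jw ((1 + et) / 2) (p.1 + p.2 + 2 * (dotz n m)%:~R) *
   (f0 n p.1 * f2 m p.2 * f1 (n + m) (p.1 + p.2 + 2 * (dotz n m)%:~R)).
have nG n m : nnm (G n m).
  apply: nnmM.
    apply: nnmM; last exact: (nnm_addc _ (nnm_jw _)).
    by apply: nnmM; [exact: (nnm_fst (nnm_jw _))|exact: (nnm_snd (nnm_jw _))].
  apply: nnmM; last exact: (nnm_addc _ (n1 _)).
  by apply: nnmM; [exact: (nnm_fst (n0 _))|exact: (nnm_snd (n2 _))].
pose k := pois_floor^-1 * 2 `^ s * (2 * L1 * (2 * L2)) * r.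
have pf0 : 0 <= (pois_floor : R)^-1 by rewrite invr_ge0 ltW// pois_floor_gt0.
have k0 : 0 <= k by rewrite !mulr_ge0 ?powR_ge0// ltW.
have D0 : 0 <= D.
  by rewrite -lee_fin; apply: le_trans hD; apply: sume_ge0 => n _; apply: nn_ge0; apply: nnmM => //; apply: nnm_cst; exact: powR_ge0.
have main (eta : R) : 0 < eta -> a <= r * (C * (L1 * L2)) + eta * D.
  move=> eta0; have [S' uS' hS'] := product_fourier su sv eta0.
  have pt n x : n \in S -> ((F0 n x ^+ 2)%:E <= k%:E * \sum_(m <- S') \int[leb]_y (G n m (x, y))%:E +
      (eta * (F0 n x * jpn n `^ s))%:E)%E.
    move=> nS; have F00 : 0 <= F0 n x by exact: modulated_ge0.
    have jp0 : 0 <= jpn n `^ s by exact: powR_ge0.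
    (* Here [d1 <= 1/8] enters: the output exponent [1/2 - d1] is at least 3/8. *)
    have jw38 : jw (- b0) x <= jw (3 / 8) x.
      by rewrite /jw ler_powR ?japanese_ge1// /b0; lra.
    set t := x - freq_sqr n.
    set c := c1 (st_fourier W t n).
    apply: (@le_trans _ _ ((F0 n x * (jpn n `^ s * jw (3 / 8) x))%:E * c%:E)%E).
      rewrite -EFinM lee_fin [leRHS](_ : _ = F0 n x * (jpn n `^ s * jw (3 / 8) x * c)); last by exact: (esym (mulrA _ _ _)).
      rewrite expr2; apply: ler_wpM2l => //; rewrite /F0 /modulated -/t -/c.
      by apply: ler_wpM2r; [exact: c1_ge0|exact: ler_wpM2l].
    have q0 : 0 <= F0 n x * (jpn n `^ s * jw (3 / 8) x).
      by apply: mulr_ge0 => //; apply: mulr_ge0 => //; exact: jw_ge0.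
    apply: (le_trans (lee_wpmul2l _ (hS' t n))); first by rewrite lee_fin.
    have i0 m : nnm (fun y : RT => c1 (st_fourier u (t + y) (n + m)) * c1 (st_fourier v y m)).
      apply: nnmM; last by apply: cmeas_c1; exact: measurable_st_fourier.
      exact: (nnm_shiftl t (cmeas_c1 (measurable_st_fourier (n + m) su))).
    have S0 : (0 <= \sum_(m <- S') \int[leb]_y (c1 (st_fourier u (t + y) (n + m)) * c1 (st_fourier v y m))%:E)%E.
      by apply: sume_ge0 => m _; exact: nn_ge0.
    rewrite ge0_muleDr ?mule_ge0 ?lee_fin ?(ltW eta0)//; apply: leeD; last first.
      rewrite -EFinM lee_fin mulrC ler_wpM2l ?(ltW eta0)// ler_wpM2l// ler_piMr// jw_le1//; lra.
    have q1 : 0 <= F0 n x * (jpn n `^ s * jw (3 / 8) x) * pois_floor^-1 by apply: mulr_ge0.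
    rewrite muleA -EFinM ge0_sume_distrr; last by move=> m _; exact: (nn_ge0 _ (i0 m)).
    rewrite [leRHS]ge0_sume_distrr; last by move=> m _; exact: (nn_ge0 _ (nnm_section1 _ (nG n m))).
    apply: lee_sum => m _; rewrite -(nn_shift (- freq_sqr m) (i0 m)).
    have i1 : nnm (fun y : RT => c1 (st_fourier u (t + (y - freq_sqr m)) (n + m)) * c1 (st_fourier v (y - freq_sqr m) m)).
      exact: (nnm_shift (- freq_sqr m) (i0 m)).
    rewrite -(nnZl _ q1 i1) -(nnZl _ k0 (nnm_section1 x (nG n m))).
    apply: nn_le => [||y].
    - by apply: nnmM => //; exact: nnm_cst.
    - by apply: nnmM; [exact: nnm_cst|exact: (nnm_section1 _ (nG n m))].
    (* The resonance identity: with modulation [x] at [n] and [y] at [m], the modulation at [n + m]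
       is [x + y + 2 (n . m)]. *)
    rewrite (_ : t + (y - freq_sqr m) = (x + y + 2 * (dotz n m)%:~R) - freq_sqr (n + m)); last first.
      by rewrite freq_sqrD /t; ring.
    set z := x + y + 2 * (dotz n m)%:~R.
    rewrite !mod_u // /G /= -/z /f0 /f1 /f2 nS mul1r /k.
    have ps := jpn_split n m s0.
    have g1 : 0 < jpn (n + m) `^ s by rewrite powR_gt0// jpn_gt0.
    have g2 : 0 < jpn m `^ s by rewrite powR_gt0// jpn_gt0.
    have y1 := modulated_ge0 s (- b2) u (n + m) z; have y2 := modulated_ge0 s (- b2) v m y.
    have j1 := @jw_ge0 R (3 / 8) x; have j2 := @jw_ge0 R ((1 + et) / 2) y; have j3 := @jw_ge0 R ((1 + et) / 2) z.
    move: ps g1 g2 y1 y2 j1 j2 j3 F00 jp0.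
    move: (jpn n `^ s) (jpn (n + m) `^ s) (jpn m `^ s) (modulated _ _ u _ _) (modulated _ _ v _ _).
    move: (jw (3 / 8) x) (jw _ y) (jw _ z) (F0 n x) (2 `^ s) => J1 J2 J3 F P g g1 g2 U V ps g10 g20 U0 V0 J10 J20 J30 F0' g0.
    rewrite [leLHS](_ : _ = (g / (g1 * g2)) * (F * J1 * pois_floor^-1 * J3 * U * J2 * V)); last first.
      by field; rewrite !gt_eqF ?pois_floor_gt0.
    rewrite [leRHS](_ : _ = P * (F * J1 * pois_floor^-1 * J3 * U * J2 * V)); last first.
      by field; rewrite !gt_eqF ?pois_floor_gt0.
    by rewrite ler_wpM2r ?mulr_ge0// ler_pdivrMr// mulr_gt0.
  rewrite -lee_fin -aE.
  pose H n (x : RT) : \bar R := (\sum_(m <- S') \int[leb]_y (G n m (x, y))%:E)%E.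
  have Jm n m : measurable_fun setT (fun x : RT => (\int[leb]_y (G n m (x, y))%:E)%E).
    apply: (measurable_fun_fubini_tonelli_F (fun p => (G n m p)%:E)); first exact: (nnmE (nG n m)).
    by move=> p; exact: (nnm_ge0 p (nG n m)).
  have J0 n m x : (0 <= \int[leb]_y (G n m (x, y))%:E)%E by apply: nn_ge0; exact: (nnm_section1 _ (nG n m)).
  have Hm n : measurable_fun setT (H n) by apply: emeasurable_sum.
  have H0 n x : (0 <= H n x)%E by apply: sume_ge0.
  apply: (@le_trans _ _ (\sum_(n <- S) (k%:E * \sum_(m <- S') \int[leb \x leb]_p (G n m p)%:E +
      eta%:E * \int[leb]_x (F0 n x * jpn n `^ s)%:E))%E).
    rewrite big_seq [leRHS]big_seq; apply: lee_sum => n nS.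
    have nFj : nnm (fun x : RT => F0 n x * jpn n `^ s) by apply: nnmM => //; apply: nnm_cst; exact: powR_ge0.
    apply: (@le_trans _ _ (\int[leb]_x (k%:E * H n x + (eta * (F0 n x * jpn n `^ s))%:E))%E).
      apply: ge0_le_integral => //.
      - by move=> x _; rewrite lee_fin sqr_ge0.
      - exact: nnmE (nnmX 2 (nF n)).
      - apply: emeasurable_funD; first exact: measurable_funeM.
        by apply: nnmE; apply: nnmM => //; apply: nnm_cst; exact: ltW.
      - by move=> x _; exact: pt.
    rewrite ge0_integralD//; last 4 first.
    - by move=> x _; apply: mule_ge0; rewrite ?lee_fin.
    - exact: measurable_funeM.
    - by move=> x _; rewrite lee_fin; apply: mulr_ge0; [exact: ltW|case: nFj].
    - by apply: nnmE; apply: nnmM => //; apply: nnm_cst; exact: ltW.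
    rewrite nnZl ?(ltW eta0)//; apply: leeD => //.
    rewrite ge0_integralZl_EFin//; apply: lee_wpmul2l; rewrite ?lee_fin//.
    rewrite ge0_integral_sum//; apply: lee_sum => m _.
    rewrite (@fubini_tonelli1 _ _ _ _ _ leb leb (fun p => (G n m p)%:E))//; first exact: (nnmE (nG n m)).
    by move=> p; exact: (nnm_ge0 p (nG n m)).
  rewrite big_split/= EFinD; apply: leeD; last first.
    rewrite -ge0_sume_distrr; last first.
      by move=> n _; apply: nn_ge0; apply: nnmM => //; apply: nnm_cst; exact: powR_ge0.
    by rewrite EFinM; apply: lee_wpmul2l => //; rewrite lee_fin ltW.
  have G0 n m : (0 <= \int[leb \x leb]_p (G n m p)%:E)%E by apply: nn_ge0; exact: nG.
  rewrite -ge0_sume_distrr; last by move=> n _; apply: sume_ge0.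
  (* A common index set for both sums: the terms are nonnegative, so enlarging is harmless, and the
     trilinear bound does not see the set, hence not the [eta] on which [S'] depends. *)
  set T := undup (S ++ S'); have uT : uniq T by exact: undup_uniq.
  have tri := trilinear_mass1 et0 m0 m1 m2 uT.
  apply: (@le_trans _ _ (k%:E * (trilinear_bound et)%:E)%E).
    apply: lee_wpmul2l; rewrite ?lee_fin//; apply: le_trans tri.
    apply: (@le_trans _ _ (\sum_(n <- S) \sum_(m <- T) \int[leb \x leb]_p (G n m p)%:E)%E).
      apply: lee_sum => n _; apply: lee_sum_subset => // m mS; by rewrite mem_undup mem_cat mS orbT.
    apply: lee_sum_subset => //; first by move=> m mS; rewrite mem_undup mem_cat mS.
    by move=> n; apply: sume_ge0.
  rewrite -EFinM lee_fin /k.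
  rewrite (_ : _ * r * _ = r * (K * (L1 * L2))); last by rewrite /K; ring.
  by rewrite ler_pM2l// ler_pM2r// /C; have := ler_norm K; lra.
have ar : r * r <= r * (C * (L1 * L2)).
  rewrite -expr2 r2; apply/ler_addgt0Pr => e e0.
  apply: le_trans (main (e / (D + 1)) _) _; first by rewrite divr_gt0// ltr_wpDl.
  by rewrite lerD2l mulrAC ler_pdivrMr ?ltr_wpDl// ler_pM2l// lerDl.
by rewrite ler_pM2l in ar.
Qed.

End bilinear_estimate.

(** * Limits in L^2 and restriction to the slab *)

Section L2_completeness.
Context d (T : measurableType d) (R : realType) (m : {measure set T -> \bar R}).
Variables (rho : T -> R) (a : nat -> T -> R).
Hypotheses (nrho : nnm rho) (frho : (\int[m]_x (rho x)%:E < +oo)%E).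
Hypotheses (ma : forall k, measurable_fun setT (a k)).
Hypothesis a_supp : forall k x, a k x = 0 \/ 1 <= rho x.
Hypothesis a_cauchy : forall e : R, 0 < e -> exists N : nat, forall j k, (N <= j)%N -> (N <= k)%N ->
  (\int[m]_x ((a j x - a k x) ^+ 2)%:E <= e%:E)%E.

Let half (j : nat) : R := 2^-1 ^+ j.
Let half_gt0 j : 0 < half j. Proof. by rewrite exprn_gt0// invr_gt0. Qed.

Let sum_half n : \sum_(j < n) half j <= 2.
Proof.
suff -> : \sum_(j < n) half j = 2 - 2 * half n by have := half_gt0 n; lra.
elim: n => [|n ih]; first by rewrite big_ord0 /half expr0; ring.
by rewrite big_ord_recr/= ih /half exprS; field.
Qed.

Lemma nneseries_le (u : nat -> \bar R) (B : \bar R) : (forall n, (0 <= u n)%E) ->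
  (forall n, (\sum_(j < n) u j <= B)%E) -> (\sum_(j <oo) u j <= B)%E.
Proof.
move=> u0 uB; apply: lime_le; first by apply: is_cvg_nneseries => n _ _; exact: u0.
by apply: nearW => n; rewrite big_mkord; exact: uB.
Qed.

(** Riesz-Fischer with a limit given at every point. Along a subsequence with increments of L^2 norm
    at most [2^-j] the increments are also small in L^1, because they live where the integrable
    [rho] is at least 1; so the subsequence converges almost everywhere, and Fatou's lemma returns
    to L^2. Taking the upper limit everywhere makes [f] measurable and zero wherever all terms are
    zero. *)
Lemma L2_limit : exists2 f : T -> R, measurable_fun setT f /\ (forall x, (forall k, a k x = 0) -> f x = 0) &
  forall e : R, 0 < e -> exists N : nat, forall k, (N <= k)%N ->
    (\int[m]_x ((a k x - f x) ^+ 2)%:E <= e%:E)%E.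
Proof.
have /choice[K hK] : forall i : nat, exists N : nat, forall j k, (N <= j)%N -> (N <= k)%N ->
    (\int[m]_x ((a j x - a k x) ^+ 2)%:E <= (half i ^+ 2)%:E)%E.
  by move=> i; apply: a_cauchy; rewrite exprn_gt0.
(* Adding up the thresholds, plus [j], makes the indices nondecreasing and at least both [K j] and
   [j]. *)
pose n (j : nat) : nat := (j + \sum_(i < j.+1) K i)%N.
have nK j : (K j <= n j)%N by rewrite /n big_ord_recr/=; lia.
have nS j : (n j <= n j.+1)%N by rewrite /n [X in (_ <= _ + X)%N]big_ord_recr/=; lia.
have nj j : (j <= n j)%N by rewrite /n; lia.
pose b j := a (n j); have mb j : measurable_fun setT (b j) by exact: ma.
pose dd j x := b j.+1 x - b j x.
have mdd j : measurable_fun setT (dd j) by exact: measurable_funB.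
have ndd2 j : nnm (fun x => dd j x ^+ 2) by split=> [|x]; [exact: measurable_funX|exact: sqr_ge0].
have ndd1 j : nnm (fun x => `|dd j x|) by split=> //; exact: measurableT_comp.
have i2 j : (\int[m]_x (dd j x ^+ 2)%:E <= (half j ^+ 2)%:E)%E.
  by apply: hK; [exact: leq_trans (nK j) (nS j)|exact: nK].
set I := fine (\int[m]_x (rho x)%:E)%E.
have I0 : 0 <= I by rewrite fine_ge0// nn_ge0.
have IE : (\int[m]_x (rho x)%:E = I%:E)%E by rewrite fineK// ge0_fin_numE// nn_ge0.
have i1 j : (\int[m]_x `|dd j x|%:E <= (half j * (I + 1))%:E)%E.
  have h0 := half_gt0 j.
  have n3 : nnm (fun x => half j * rho x) by apply: nnmM => //; apply: nnm_cst; exact: ltW.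
  have hi0 : 0 <= (half j)^-1 by rewrite invr_ge0 ltW.
  have n4 : nnm (fun x => (half j)^-1 * dd j x ^+ 2) by apply: nnmM => //; exact: nnm_cst.
  (* Pointwise [|d| <= h rho + d^2 / h] with [h = half j], the support hypothesis being needed where
     [d] is nonzero; both terms integrate to a multiple of [h]. *)
  apply: (@le_trans _ _ (\int[m]_x (half j * rho x + (half j)^-1 * dd j x ^+ 2)%:E)%E).
    apply: nn_le => // [|x]; first exact: nnmD.
    have [d0|d0] := eqVneq (dd j x) 0.
      rewrite d0 normr0 expr0n/= mulr0 addr0 mulr_ge0 ?(ltW h0)//; by case: nrho.
    have r1 : 1 <= rho x.
      have [e1|//] := a_supp (n j.+1) x; have [e2|//] := a_supp (n j) x.
      by move: d0; rewrite /dd /b e1 e2 subrr eqxx.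
    apply: (@le_trans _ _ (half j * 1 + (half j)^-1 * dd j x ^+ 2)); last by rewrite lerD2r ler_pM2l.
    rewrite mulr1 -[dd j x ^+ 2]real_normK ?num_real//.
    move: (`|dd j x|) (normr_ge0 (dd j x)) => y y0.
    have [hy|hy] := leP y (half j); first by rewrite -[leLHS]addr0 lerD// mulr_ge0// sqr_ge0.
    by rewrite -[leLHS]add0r lerD ?(ltW h0)// mulrC ler_pdivlMr// expr2 ler_wpM2l// ltW.
  rewrite nnD// nnZl ?(ltW h0)// nnZl// IE mulrDr mulr1 [leRHS]EFinD EFinM; apply: leeD => //.
  apply: (le_trans (lee_wpmul2l _ (i2 j))); first by rewrite lee_fin.
  by rewrite -EFinM lee_fin expr2 mulKf// gt_eqF.
pose G x := (\sum_(j <oo) `|dd j x|%:E)%E.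
have G0 x : (0 <= G x)%E by apply: nneseries_ge0 => j _ _; rewrite lee_fin.
have mG : measurable_fun setT G.
  by apply: ge0_emeasurable_sum => [j x _ _|j _]; [rewrite lee_fin|exact: nnmE].
have iG : (\int[m]_x G x < +oo)%E.
  rewrite integral_nneseries//; last by move=> j; exact: nnmE.
  apply: (@le_lt_trans _ _ (2 * (I + 1))%:E); last exact: ltry.
  apply: nneseries_le => [j|N]; first exact: nn_ge0.
  apply: (@le_trans _ _ (\sum_(j < N) (half j * (I + 1))%:E)%E); first by apply: lee_sum => j _.
  by rewrite sumEFin lee_fin -mulr_suml ler_wpM2r ?sum_half// addr_ge0.
have aeG : {ae m, forall x, setT x -> G x \is a fin_num}.
  apply: integrable_ae => //; apply/integrableP; split=> //.
  by under eq_integral do rewrite gee0_abs//.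
pose f x := fine (limn_esup (fun j => (b j x)%:E)).
have bf x (l : R) : b ^~ x @ \oo --> l -> f x = l.
  move=> bl; rewrite /f; have bl' : (fun j => (b j x)%:E) @ \oo --> l%:E.
    by apply: cvg_EFin; [exact: nearW|exact: bl].
  by rewrite (cvg_limn_einf_sup bl').2.
have cb x : G x \is a fin_num -> b ^~ x @ \oo --> f x.
  move=> Gx; suff : cvgn (b ^~ x) by move=> /cvg_ex[l bl]; rewrite (bf _ _ bl).
  have cs : cvgn [normed series (fun j => dd j x)].
    apply: nondecreasing_is_cvgn.
      by apply/nondecreasing_seqP => k; rewrite /= seriesSr lerDl.
    exists (fine (G x)) => _ [k _ <-]; rewrite -lee_fin fineK// /series/= -sumEFin.
    by apply: (@nneseries_lim_ge _ (fun j => `|dd j x|%:E) xpredT 0) => j _ _; rewrite lee_fin.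
  have /cvg_ex[l sl] := normed_cvg cs.
  apply/cvg_ex; exists (b 0%N x + l).
  rewrite (_ : b ^~ x = (fun k => b 0%N x + series (fun j => dd j x) k)).
    by apply: cvgD => //; exact: cvg_cst.
  apply/funext; elim=> [|k ih]; first by rewrite /series/= big_geq// addr0.
  by rewrite /series/= big_nat_recr//= addrA -[X in _ = X + _]ih /dd addrC subrK.
have mf : measurable_fun setT f.
  apply: (measurableT_comp (fine_measurable measurableT)).
  by apply: measurable_fun_limn_esup => j; exact/measurable_EFinP.
exists f; first split=> // x x0.
  apply: bf; rewrite (_ : b ^~ x = fun=> 0); first exact: cvg_cst.
  by apply/funext => j; exact: x0.
move=> e e0; have [N hN] := a_cauchy e0; exists N => k Nk.
pose u j := (\int[m]_x ((a k x - b j x) ^+ 2)%:E)%E.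
have mk j : measurable_fun setT (fun x => ((a k x - b j x) ^+ 2)%:E).
  by apply/measurable_EFinP; apply: measurable_funX; exact: measurable_funB.
have fat := @fatou _ _ _ m setT measurableT (fun j x => ((a k x - b j x) ^+ 2)%:E) mk
  (fun j x _ => sqr_ge0 _).
apply: (@le_trans _ _ (limn_einf u)); last first.
  rewrite limn_einf_lim; apply: lime_le; first exact: is_cvg_einfs.
  apply: nearW => i; apply: (@le_trans _ _ (u (maxn i N))).
    by apply: ereal_inf_lbound; exists (maxn i N) => //=; exact: leq_maxl.
  by apply: hN => //; apply: leq_trans (nj _); exact: leq_maxr.
apply: le_trans fat; rewrite le_eqVlt; apply/orP; left; apply/eqP.
have mlim : measurable_fun setT (fun x => limn_einf (fun j => ((a k x - b j x) ^+ 2)%:E)).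
  rewrite /limn_einf; apply: measurableT_comp => //.
  by apply: measurable_fun_limn_esup => j; exact: measurableT_comp.
apply: ge0_ae_eq_integral => //.
- by apply/measurable_EFinP; apply: measurable_funX; exact: measurable_funB.
- by move=> x _; rewrite lee_fin sqr_ge0.
- move=> x _; rewrite limn_einf_lim; apply: lime_ge; first exact: is_cvg_einfs.
  by apply: nearW => i; apply: le_ereal_inf_tmp => _ [j _ <-]; rewrite lee_fin sqr_ge0.
apply: filterS aeG => x Gx _; have {}Gx := cb _ (Gx Logic.I).
have cl : (fun j => ((a k x - b j x) ^+ 2)%:E) @ \oo --> ((a k x - f x) ^+ 2)%:E.
  apply: cvg_EFin; first exact: nearW.
  have c1 : (fun j => a k x - b j x) @ \oo --> a k x - f x by apply: cvgB => //; exact: cvg_cst.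
  exact: (cvgM c1 c1).
by rewrite (cvg_limn_einf_sup cl).1.
Qed.

End L2_completeness.

(** * The norm on smooth functions: triangle inequality and L^2 bound *)

Section X_norm_theory.
Context {R : realType}.
Local Notation leb := (@lebesgue_measure R).
Local Notation RT := (measurableTypeR R).
Local Notation ST := (RT * (RT * RT))%type.
Local Notation stm := (@st_measure R).
Local Open Scope complex_scope.
Implicit Types u v : spacetime R -> R[i].

Definition xnorm (s b : R) u : R := Num.sqrt (fine (Xsq s b u)).

Lemma xnorm_ge0 s b u : 0 <= xnorm s b u. Proof. exact: sqrtr_ge0. Qed.

Lemma Xsq_ge0 s b u : (0 <= Xsq s b u)%E.
Proof.
apply: esum_ge0 => n _; apply: integral_ge0 => t _.
by rewrite lee_fin mulr_ge0 ?X_weight_ge0 ?nsq_ge0.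
Qed.

Lemma XsqE s b u : schwartz u -> Xsq s b u = (xnorm s b u ^+ 2)%:E.
Proof.
move=> su; rewrite /xnorm sqr_sqrtr ?fine_ge0 ?Xsq_ge0// fineK//.
by rewrite ge0_fin_numE ?Xsq_ge0// Xsq_lty.
Qed.

Lemma X_norm_xnorm s b u : schwartz u -> X_norm s b u = (xnorm s b u)%:E.
Proof.
move=> su; rewrite X_normE XsqE// poweR_EFin; congr EFin.
by rewrite -powR_mulrn ?xnorm_ge0// -powRrM mulfV ?pnatr_eq0// powRr1 ?xnorm_ge0.
Qed.

Lemma st_fourierB u v t n : schwartz u -> schwartz v ->
  st_fourier (fun p => u p - v p) t n = st_fourier u t n - st_fourier v t n.
Proof.
move=> su sv; rewrite !st_fourier_ft /ft.
have [B _ dB] := cdom_schwartz su; have [D _ dD] := cdom_schwartz sv.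
have h f a : cdom stm f a -> cdom stm (fun p => f p * cexpi (- st_phase t n p)) (fun p => a p * 2).
  move=> df; apply: cdomM => // [|p]; last exact: c1_cexpi.
  by apply: cmeas_cexpi; apply: measurable_funN; exact: measurable_st_phase.
rewrite -(cintB (h _ _ dB) (h _ _ dD)).
by apply: eq_cint => p; rewrite mulrBr mulrBl.
Qed.

Lemma nsqD_le (l : R) (z1 z2 : R[i]) : 0 < l -> nsq (z1 + z2) <= (1 + l) * nsq z1 + (1 + l^-1) * nsq z2.
Proof.
move=> l0; rewrite /nsq cReD cImD.
have h (x y : R) : (x + y) ^+ 2 <= (1 + l) * x ^+ 2 + (1 + l^-1) * y ^+ 2.
  have e : (1 + l) * x ^+ 2 + (1 + l^-1) * y ^+ 2 - (x + y) ^+ 2 = l * (x - l^-1 * y) ^+ 2.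
    by field; rewrite gt_eqF.
  by rewrite -subr_ge0 e mulr_ge0 ?sqr_ge0// ltW.
by have := h (complex.Re z1) (complex.Re z2); have := h (complex.Im z1) (complex.Im z2); lra.
Qed.

(** The optimal [l] is [z / y], formed after enlarging both by [e / 2]. It turns the pointwise bound
    [nsqD_le] into Minkowski's inequality without a scalar product. *)
Lemma le_add_of_sqr (x y z : R) : 0 <= x -> 0 <= y -> 0 <= z ->
  (forall l, 0 < l -> x ^+ 2 <= (1 + l) * y ^+ 2 + (1 + l^-1) * z ^+ 2) -> x <= y + z.
Proof.
move=> x0 y0 z0 h; apply/ler_addgt0Pr => e e0; pose y' := y + e / 2; pose z' := z + e / 2.
have yy : 0 < y' by rewrite /y'; lra.
have zz : 0 < z' by rewrite /z'; lra.
have l0 : 0 < z' / y' by rewrite divr_gt0.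
have {}h := h _ l0.
have : x ^+ 2 <= (y' + z') ^+ 2.
  apply: (le_trans h); apply: (@le_trans _ _ ((1 + z' / y') * y' ^+ 2 + (1 + (z' / y')^-1) * z' ^+ 2)).
    apply: lerD; apply: ler_wpM2l; rewrite ?lerXn2r ?nnegrE ?(ltW yy) ?(ltW zz)//.
    - by rewrite addr_ge0// ltW.
    - by rewrite /y'; lra.
    - by rewrite addr_ge0// invr_ge0 ltW.
    - by rewrite /z'; lra.
  rewrite (_ : _ + _ = (y' + z') ^+ 2)//.
  by field; rewrite !gt_eqF.
rewrite ler_pXn2r ?nnegrE//; last by rewrite addr_ge0// ltW.
by rewrite /y' /z'; lra.
Qed.

Lemma xnorm_triangle s b u v : schwartz u -> schwartz v ->
  xnorm s b u <= xnorm s b v + xnorm s b (fun p => u p - v p).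
Proof.
move=> su sv; have sd := schwartz_sub su sv.
apply: le_add_of_sqr; rewrite ?xnorm_ge0// => l l0.
have c1 : 0 <= 1 + l by rewrite addr_ge0// ltW.
have c2 : 0 <= 1 + l^-1 by rewrite addr_ge0// invr_ge0 ltW.
suff : (Xsq s b u <= (1 + l)%:E * Xsq s b v + (1 + l^-1)%:E * Xsq s b (fun p => (u p - v p)%R))%E.
  have E1 := XsqE s b su; have E2 := XsqE s b sv; have E3 := XsqE s b sd.
  by rewrite E1 E2 E3 -(EFinM (1 + l)) -(EFinM (1 + l^-1)) -EFinD lee_fin.
apply: esum_le_seq => S uS.
apply: (@le_trans _ _ (\sum_(n <- S) ((1 + l)%:E * \int[leb]_t (X_weight s b t n * nsq (st_fourier v t n))%:E +
   (1 + l^-1)%:E * \int[leb]_t (X_weight s b t n * nsq (st_fourier (fun p => (u p - v p)%R) t n))%:E))%E).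
  apply: lee_sum => n _.
  have n1 := nnm_Xsq s b n sv; have n2 := nnm_Xsq s b n sd.
  rewrite -(nnZl _ c1 n1) -(nnZl _ c2 n2) -nnD; last 2 first.
  - by apply: nnmM => //; exact: nnm_cst.
  - by apply: nnmM => //; exact: nnm_cst.
  apply: nn_le => [||t]; first exact: nnm_Xsq.
    by apply: nnmD; apply: nnmM => //; exact: nnm_cst.
  rewrite [leRHS](_ : _ = X_weight s b t n * ((1 + l) * nsq (st_fourier v t n) +
     (1 + l^-1) * nsq (st_fourier (fun p => u p - v p) t n))); last by ring.
  apply: ler_wpM2l; first exact: X_weight_ge0.
  have := nsqD_le (st_fourier v t n) (st_fourier (fun p => u p - v p) t n) l0.
  by rewrite st_fourierB// [_ + (_ - _)]addrC subrK.
have g (c : R) w : 0 <= c -> schwartz w ->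
    (\sum_(n <- S) (c%:E * \int[leb]_t (X_weight s b t n * nsq (st_fourier w t n))%:E) <= c%:E * Xsq s b w)%E.
  move=> c0 sw; rewrite -ge0_sume_distrr; last by move=> n _; apply: nn_ge0; exact: nnm_Xsq.
  by apply: lee_wpmul2l; [rewrite lee_fin|exact: seq_le_esum].
by rewrite big_split/=; apply: leeD; [exact: (g _ _ c1 sv)|exact: (g _ _ c2 sd)].
Qed.

(** Two uses: [bilinear_Xsq] asks for positive bounds where a norm may vanish, and the infimum
    defining [XT_norm] is only approached. *)
Lemma le_of_perturbed (C x y z : R) : 0 < C -> 0 <= y -> 0 <= z ->
  (forall e, 0 < e -> x <= C * ((y + e) * (z + e))) -> x <= C * (y * z).
Proof.
move=> C0 y0 z0 h; apply/ler_addgt0Pr => e e0.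
pose k := Num.min 1 (e / (C * (y + z + 1))).
have D0 : 0 < C * (y + z + 1) by rewrite mulr_gt0//; lra.
have k0 : 0 < k by rewrite lt_min ltr01/= divr_gt0.
have k1 : k <= 1 by rewrite ge_min lexx.
have k2 : k * (C * (y + z + 1)) <= e by rewrite -ler_pdivlMr// ge_min lexx orbT.
apply: (le_trans (h _ k0)); apply: (@le_trans _ _ (C * (y * z) + k * (C * (y + z + 1)))); last by rewrite lerD2l.
rewrite (_ : C * (y * z) + _ = C * (y * z + k * (y + z + 1))); last by ring.
by rewrite ler_pM2l//; nra.
Qed.

Lemma sqr_le_perturbed (y e : R) : 0 <= y -> 0 < e -> y ^+ 2 <= (y + e) ^+ 2.
Proof. by move=> y0 e0; rewrite ler_pXn2r ?nnegrE//; lra. Qed.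

Lemma bilinear_xnorm (s d1 d2 : R) : 0 <= s -> 0 < d2 -> d1 <= 8^-1 -> exists2 C : R, 0 < C &
  forall u v, schwartz u -> schwartz v ->
  xnorm s (- 2^-1 + d1) (fun p => u p * conjc (v p)) <=
    C * (xnorm s (2^-1 + d2) u * xnorm s (2^-1 + d2) v).
Proof.
move=> s0 d20 d18; have [C C0 hC] := bilinear_Xsq s0 d20 d18; exists C => // u v su sv.
have sw : schwartz (fun p => u p * conjc (v p)) by apply: schwartz_mul => //; exact: schwartz_conj.
have y0 := xnorm_ge0 s (2^-1 + d2) u; have z0 := xnorm_ge0 s (2^-1 + d2) v.
apply: (le_of_perturbed C0 y0 z0) => e e0.
have hu : (Xsq s (2^-1 + d2) u <= ((xnorm s (2^-1 + d2) u + e) ^+ 2)%:E)%E.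
  by rewrite (XsqE _ _ su) lee_fin; exact: (sqr_le_perturbed y0 e0).
have hv : (Xsq s (2^-1 + d2) v <= ((xnorm s (2^-1 + d2) v + e) ^+ 2)%:E)%E.
  by rewrite (XsqE _ _ sv) lee_fin; exact: (sqr_le_perturbed z0 e0).
have hw := hC u v _ _ su sv (ltr_wpDl y0 e0) (ltr_wpDl z0 e0) hu hv.
rewrite (XsqE _ _ sw) lee_fin in hw; have x0 := xnorm_ge0 s (- 2^-1 + d1) (fun p => u p * conjc (v p)).
move: hw x0 y0 z0; move: (xnorm s _ u) (xnorm s _ v) (xnorm s _ _) => y z x hw x0 y0 z0.
move: hw; rewrite ler_pXn2r// nnegrE.
by apply: mulr_ge0; [exact: ltW|apply: mulr_ge0; rewrite addr_ge0// ltW].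
Qed.

(* The integral is the Fourier transform of [|u|^2] at the origin. *)
Lemma slab_L2_le (s b : R) u : 0 <= s -> 0 <= b -> schwartz u ->
  (\int[stm]_p (chi p * nsq (u p))%:E <= (2 * pois_floor^-1 * xnorm s b u ^+ 2)%:E)%E.
Proof.
move=> s0 b0 su; have sw : schwartz (fun p => u p * conjc (u p)) by apply: schwartz_mul => //; exact: schwartz_conj.
have f0 : 0 <= (pois_floor : R)^-1 by rewrite invr_ge0 ltW// pois_floor_gt0.
have nchi := @nnm_chi R; have [B B0 dB] := cdom_schwartz sw.
have nu : nnm (fun p : ST => chi p * nsq (u p)) by apply: nnmM => //; apply: nnm_nsq; exact: schwartz_cmeas.
have fin : (\int[stm]_p (chi p * nsq (u p))%:E)%E \is a fin_num.
  have := integrable_fin_num measurableT (cdom_Re dB).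
  rewrite (_ : \int[stm]_p (EFin \o _) p = \int[stm]_p (chi p * nsq (u p))%:E)%E//.
  by apply: eq_integral => p _ /=; rewrite mulcJ ReZ.
have e0 : st_fourier (fun p => u p * conjc (u p)) 0 0 = (fine (\int[stm]_p (chi p * nsq (u p))%:E))%:C%E.
  rewrite st_fourier_ft /ft; transitivity (cint stm (fun p => (chi p * nsq (u p))%:C)).
    apply: eq_cint => p; have -> : - (2 * pi * (p.1 * 0 + space_phase 0 p)) = 0.
      by rewrite /space_phase /= !mulr0z !mul0r mulr0 !addr0 mulr0 oppr0.
    have c0 : cexpi 0 = 1 :> R[i] by rewrite /cexpi cos0 sin0.
    by rewrite c0 mulr1 mulcJ; exact: (esym (rmorphM (real_complex R) _ _)).
  apply/eqP; rewrite eq_complex; apply/andP; split; apply/eqP; first by [].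
  by rewrite /cint /Rintegral /= integral0.
apply/lee_addgt0Pr => e ep.
have [S uS hS] := product_fourier su su ep; have := hS 0 0.
rewrite e0 c1_real ger0_norm ?fine_ge0 ?nn_ge0// fineK// => h; apply: (le_trans h); apply: leeD => //.
rewrite (_ : 2 * pois_floor^-1 * xnorm s b u ^+ 2 = pois_floor^-1 * (2 * xnorm s b u ^+ 2)); last by ring.
rewrite (EFinM (pois_floor^-1)); apply: lee_wpmul2l; first by rewrite lee_fin.
rewrite (EFinM 2) -XsqE//; apply: (@le_trans _ _ (2%:E * \sum_(n <- S) \int[leb]_t (X_weight s b t n * nsq (st_fourier u t n))%:E)%E); last first.
  by apply: lee_wpmul2l; rewrite ?lee_fin//; exact: seq_le_esum.
rewrite ge0_sume_distrr; last by move=> n _; apply: nn_ge0; exact: nnm_Xsq.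
apply: lee_sum => n _; rewrite -nnZl//; last exact: nnm_Xsq.
have mc : nnm (fun t : RT => c1 (st_fourier u t n)) by apply: cmeas_c1; exact: measurable_st_fourier.
apply: (@le_trans _ _ (\int[leb]_t (c1 (st_fourier u t n) * c1 (st_fourier u t n))%:E)%E).
  by rewrite le_eqVlt; apply/orP; left; apply/eqP; apply: eq_integral => t _; rewrite !add0r.
apply: nn_le => [||t]; first exact: nnmM.
  by apply: nnmM; [exact: nnm_cst|exact: nnm_Xsq].
rewrite -expr2; apply: (le_trans (c1_le_nsq _)); rewrite ler_wpM2l// ler_peMl ?nsq_ge0//.
rewrite /X_weight; apply: mulr_ege1.
  by rewrite -[leLHS](powRr0 (jpn n)) ler_powR ?mulr_ge0// /jpn japanese_ge1.
by rewrite -[leLHS](powRr0 (japanese (t + freq_sqr n))) ler_powR ?mulr_ge0// japanese_ge1.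
Qed.

End X_norm_theory.

(** * Square-integrable functions on the slab and limits of their products *)

Section slab_limits.
Context {R : realType}.
Local Notation RT := (measurableTypeR R).
Local Notation ST := (RT * (RT * RT))%type.
Local Notation stm := (@st_measure R).
Local Open Scope complex_scope.
Variables (T : R) (T0 : 0 < T).

Definition tchi (p : ST) : R := \1_(`]- T, T[%classic : set RT) p.1 * chi p.

Lemma nnm_tchi : nnm tchi.
Proof.
have h : nnm (\1_(`]- T, T[%classic : set RT) : RT -> R) by apply: nnm_indic; exact: measurable_itv.
apply: nnmM; last exact: nnm_chi.
by case: h => h1 h2; split=> //; exact: measurableT_comp.
Qed.

Lemma tchi01 p : tchi p = 0 \/ tchi p = 1.
Proof.
rewrite /tchi indicE; case: (_ \in _); last by left; rewrite mul0r.
by have [[_ ->]|->] := chiP p; [right; rewrite mul1r|left; rewrite mulr0].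
Qed.

Lemma tchi_le_chi p : tchi p <= chi p.
Proof.
have c0 : 0 <= chi p by case: (@nnm_chi R).
by rewrite /tchi indicE; case: (_ \in _); rewrite ?mul1r ?mul0r.
Qed.

Lemma tchi_lty : (\int[stm]_p (tchi p)%:E < +oo)%E.
Proof.
have h : nnm (\1_(`]- T, T[%classic : set RT) : RT -> R) by apply: nnm_indic; exact: measurable_itv.
rewrite (_ : (\int[stm]_p (tchi p)%:E = \int[stm]_p ((\1_(`]- T, T[%classic : set RT) : RT -> R) p.1 * (unit_itv p.2.1 * unit_itv p.2.2))%:E)%E)//.
rewrite (integral_coord h (@nnm_unit_itv R) (@nnm_unit_itv R)) !integral_unit_itv !mule1.
have mI : measurable (`]- T, T[%classic : set RT) by exact: measurable_itv.
by rewrite integral_indic//= setIT lebesgue_measure_itv/=; case: ifP; rewrite ltry.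
Qed.

Lemma cintegral_slab (f : spacetime R -> R[i]) :
  cintegral (slab T) f = cint stm (fun p : ST => (tchi p)%:C * f p).
Proof.
have e (g : spacetime R -> R) : \int[stm]_(p in (slab T : set ST)) g p = \int[stm]_p (tchi p * g p).
  rewrite Rintegral_mkcond; apply: eq_Rintegral => p _.
  rewrite patchE /tchi /chi /unit_itv !indicE -!natrM !mulnb.
  have -> : (p \in (slab T : set ST)) = (p.1 \in `]- T, T[%classic) && ((p.2.1 \in `[0, 1]%classic) && (p.2.2 \in `[0, 1]%classic)).
    apply/idP/idP; rewrite !inE /slab /unit_square/=; first by move=> [h1 [h2 h3]]; rewrite !mem_set.
    by move=> /andP[h1 /andP[h2 h3]]; split; [exact: set_mem h1|split; [exact: set_mem h2|exact: set_mem h3]].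
  by case: (_ && _); rewrite ?mul1r ?mul0r.
rewrite /cintegral /cint !e; apply/eqP; rewrite eq_complex/=; apply/andP; split; apply/eqP;
  apply: eq_Rintegral => p _; by rewrite ?ReZ ?ImZ.
Qed.

Lemma tchi_idem p : tchi p * tchi p = tchi p.
Proof. by have [->|->] := tchi01 p; rewrite ?mulr0 ?mulr1. Qed.

(** Vanishing off the slab is included: as the slab has finite measure, such functions are
    integrable against bounded ones, by [L2_bdd_cdom]. *)
Definition L2f (f : ST -> R[i]) : Prop := [/\ cmeas f, forall p, tchi p = 0 -> f p = 0 &
  (\int[stm]_p (nsq (f p))%:E < +oo)%E].

Definition L2to (F : nat -> ST -> R[i]) f := forall e : R, 0 < e -> exists N : nat,
  forall k, (N <= k)%N -> (\int[stm]_p (nsq (F k p - f p))%:E <= e%:E)%E.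

Lemma nsqN (z : R[i]) : nsq (- z) = nsq z.
Proof. by rewrite /nsq cReN cImN !sqrrN. Qed.

Lemma nsqJ (z : R[i]) : nsq (conjc z) = nsq z.
Proof. by rewrite /nsq cReJ cImJ sqrrN. Qed.

Lemma nsq_add_le (z1 z2 : R[i]) : nsq (z1 + z2) <= 2 * nsq z1 + 2 * nsq z2.
Proof. by have := @nsqD_le R 1 z1 z2 ltr01; rewrite invr1 (_ : 1 + 1 = 2). Qed.

Lemma L2f_sub f g : L2f f -> L2f g -> L2f (fun p => f p - g p).
Proof.
move=> [mf f0 ff] [mg g0 fg]; split.
- by apply: cmeasD => //; exact: cmeasN.
- by move=> p p0; rewrite f0// g0// subrr.
have n1 := nnm_nsq mf; have n2 := nnm_nsq mg.
apply: (@le_lt_trans _ _ (\int[stm]_p (2 * nsq (f p) + 2 * nsq (g p))%:E)%E).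
  apply: nn_le => [||p].
  - by apply: nnm_nsq; apply: cmeasD => //; exact: cmeasN.
  - by apply: nnmD; apply: nnmM => //; exact: nnm_cst.
  by have := nsq_add_le (f p) (- g p); rewrite nsqN.
rewrite nnD; [|by apply: nnmM => //; exact: nnm_cst|by apply: nnmM => //; exact: nnm_cst].
by rewrite !nnZl//; apply: lte_add_pinfty; apply: lte_mul_pinfty; rewrite ?lee_fin.
Qed.

Lemma c1_sqr_le (z : R[i]) (e : R) : 0 < e -> c1 z <= e + 2 / e * nsq z.
Proof.
move=> e0; have := c1_le_nsq z; have := c1_ge0 z; move: (c1 z) (nsq z) => x y x0 xy.
have [h|h] := leP x e.
  by rewrite -[leLHS]addr0 lerD// mulr_ge0 ?divr_ge0 ?(ltW e0)//; have := sqr_ge0 x; lra.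
rewrite -[leLHS]add0r lerD ?(ltW e0)// mulrAC ler_pdivlMr//.
by apply: le_trans xy; rewrite expr2 ler_wpM2l// ltW.
Qed.

Lemma c1_mul_le (z1 z2 : R[i]) (e : R) : 0 < e -> c1 (z1 * z2) <= e * nsq z1 + e^-1 * nsq z2.
Proof.
move=> e0; apply: le_trans (c1M _ _) _.
have h1 := c1_le_nsq z1; have h2 := c1_le_nsq z2.
have i0 : 0 < e^-1 by rewrite invr_gt0.
have h : 0 <= e * (c1 z1 - e^-1 * c1 z2) ^+ 2 by rewrite mulr_ge0 ?sqr_ge0// ltW.
have e' : e * (c1 z1 - e^-1 * c1 z2) ^+ 2 = e * c1 z1 ^+ 2 - 2 * (c1 z1 * c1 z2) + e^-1 * c1 z2 ^+ 2.
  by field; rewrite gt_eqF.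
rewrite e' in h.
have k1 : e * c1 z1 ^+ 2 <= e * (2 * nsq z1) by rewrite ler_pM2l.
have k2 : e^-1 * c1 z2 ^+ 2 <= e^-1 * (2 * nsq z2) by rewrite ler_pM2l.
by move: h k1 k2; rewrite !(mulrCA _ 2); lra.
Qed.

Lemma L2_mul_cdom f g (h : ST -> R[i]) (B : R) : L2f f -> L2f g -> cmeas h -> 0 <= B ->
  (forall p, c1 (h p) <= B) ->
  cdom stm (fun p => f p * g p * h p) (fun p => (nsq (f p) + nsq (g p)) * B).
Proof.
move=> [mf f0 ff] [mg g0 fg] mh B0 hB; have n1 := nnm_nsq mf; have n2 := nnm_nsq mg.
apply: cdomM => //; split.
- exact: cmeasM.
- exact: nnmD.
- by rewrite nnD//; exact: lte_add_pinfty.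
- by move=> p; have := @c1_mul_le (f p) (g p) 1 ltr01; rewrite invr1 !mul1r.
Qed.

Lemma L2_bdd_cdom f (h : ST -> R[i]) (B : R) : L2f f -> cmeas h -> 0 <= B ->
  (forall p, c1 (h p) <= B) -> cdom stm (fun p => f p * h p) (fun p => (tchi p + 2 * nsq (f p)) * B).
Proof.
move=> [mf f0 ff] mh B0 hB; have n1 := nnm_nsq mf; have nt := nnm_tchi.
apply: cdomM => //; split=> //.
- by apply: nnmD => //; apply: nnmM => //; exact: nnm_cst.
- rewrite nnD//; last by apply: nnmM => //; exact: nnm_cst.
  by apply: lte_add_pinfty; [exact: tchi_lty|rewrite nnZl//; apply: lte_mul_pinfty; rewrite ?lee_fin].
- move=> p; have [h0|h1] := tchi01 p; first by rewrite f0// /c1 normr0 addr0 h0 add0r mulr_ge0// nsq_ge0.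
  by have := @c1_sqr_le (f p) 1 ltr01; rewrite h1 divr1.
Qed.

Definition cto (z : nat -> R[i]) (l : R[i]) := forall e : R, 0 < e -> exists N : nat,
  forall k, (N <= k)%N -> c1 (z k - l) <= e.

Lemma cto_unique z l l' : cto z l -> cto z l' -> l = l'.
Proof.
move=> zl zl'; suff h : c1 (l - l') <= 0.
  have := Re_le_c1 (l - l'); have := Im_le_c1 (l - l') => h1 h2.
  have r0 : complex.Re (l - l') = 0 by apply/eqP; rewrite -normr_le0 (le_trans h2).
  have i0 : complex.Im (l - l') = 0 by apply/eqP; rewrite -normr_le0 (le_trans h1).
  by apply/eqP; rewrite -subr_eq0 eq_complex r0 i0 !eqxx.
apply/ler_addgt0Pr => e e0; rewrite add0r.
have e2 : 0 < e / 2 by rewrite divr_gt0.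
have [N1 h1] := zl _ e2; have [N2 h2] := zl' _ e2.
have := h1 (maxn N1 N2) (leq_maxl _ _); have := h2 (maxn N1 N2) (leq_maxr _ _).
set w := z _ => a b; rewrite (_ : l - l' = - (w - l) + (w - l')); last by ring.
by apply: le_trans (c1D _ _) _; rewrite c1N; lra.
Qed.

Lemma cto_Re z l : cto z l <-> (fun k => complex.Re (z k)) @ \oo --> complex.Re l /\
  (fun k => complex.Im (z k)) @ \oo --> complex.Im l.
Proof.
split=> [zl|[zr zi] e e0].
  split; apply/cvgrPdist_le => e e0; have [N hN] := zl e e0; exists N => // k Nk.
    by rewrite distrC -cReN -cReD; apply: le_trans (Re_le_c1 _) (hN k Nk).
  by rewrite distrC -cImN -cImD; apply: le_trans (Im_le_c1 _) (hN k Nk).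
have e2 : 0 < e / 2 by rewrite divr_gt0.
have /cvgrPdist_le/(_ _ e2)[N1 _ h1] := zr; have /cvgrPdist_le/(_ _ e2)[N2 _ h2] := zi.
exists (maxn N1 N2) => k; rewrite geq_max => /andP[k1 k2].
have /= a1 := h1 k k1; have /= a2 := h2 k k2.
by rewrite /c1 cReD cImD cReN cImN (distrC (complex.Re (z k))) (distrC (complex.Im (z k))); lra.
Qed.

Lemma L2_mul_cvg F G f g (h : ST -> R[i]) (B : R) : (forall k, L2f (F k)) -> (forall k, L2f (G k)) ->
  L2f f -> L2f g -> L2to F f -> L2to G g -> cmeas h -> 0 <= B -> (forall p, c1 (h p) <= B) ->
  cto (fun k => cint stm (fun p => F k p * G k p * h p)) (cint stm (fun p => f p * g p * h p)).
Proof.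
move=> LF LG Lf Lg Ff Gg mh B0 hB e e0.
have Ig n : L2f n -> exists2 I : R, 0 < I & (\int[stm]_p (nsq (n p))%:E <= I%:E)%E.
  case=> mn _ fn; have nn := nnm_nsq mn; exists (fine (\int[stm]_p (nsq (n p))%:E)%E + 1).
    by rewrite ltr_wpDl// fine_ge0// nn_ge0.
  by rewrite EFinD fineK ?ge0_fin_numE ?nn_ge0// leeDl.
have [I I0 hI] := Ig f Lf; have [J J0 hJ] := Ig g Lg.
(* F G - f g = (F - f) (G - g) + (F - f) g + f (G - g) *)
pose B1 := B + 1; have B10 : 0 < B1 by rewrite ltr_wpDl.
pose d := e / (4 * B1); have d0 : 0 < d by rewrite divr_gt0// mulr_gt0.
(* In the mixed products AM-GM is weighted so that the limits [f] and [g] contribute only [d / 2]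
   each; [m1] is then chosen small enough to beat the inverse weights on the differences. *)
pose eI := d / (2 * I); have eI0 : 0 < eI by rewrite divr_gt0// mulr_gt0.
pose eJ := d / (2 * J); have eJ0 : 0 < eJ by rewrite divr_gt0// mulr_gt0.
pose m1 := Num.min (d / 2) (Num.min (eJ * (d / 2)) (eI * (d / 2))).
have dd0 : 0 < d / 2 by rewrite divr_gt0.
have m10 : 0 < m1.
  by rewrite /m1 !lt_min dd0/=; apply/andP; split; apply: mulr_gt0.
have [N1 h1] := Ff _ m10; have [N2 h2] := Gg _ m10.
exists (maxn N1 N2) => k; rewrite geq_max => /andP[k1 k2].
have {}h1 := h1 k k1; have {}h2 := h2 k k2.
have LFf := L2f_sub (LF k) Lf; have LGg := L2f_sub (LG k) Lg.
have D1 := L2_mul_cdom (LF k) (LG k) mh B0 hB; have D2 := L2_mul_cdom Lf Lg mh B0 hB.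
rewrite -(cintB D1 D2) -lee_fin.
have D3 : exists a, cdom stm (fun p => F k p * G k p * h p - f p * g p * h p) a.
  have [a1 b1 cc1 e1] := D1; have [a2 b2 cc2 e2] := D2; eexists; split; last first.
  - by move=> p; apply: le_trans (c1D _ _) _; rewrite c1N; apply: lerD; [exact: e1|exact: e2].
  - by rewrite nnD//; exact: lte_add_pinfty.
  - exact: nnmD.
  - by apply: cmeasD => //; exact: cmeasN.
have [a {}D3] := D3; apply: le_trans (c1_cint D3) _.
have [mF _ fF] := LFf; have [mG _ fG] := LGg; have [mf _ ff] := Lf; have [mg _ fg] := Lg.
have nF := nnm_nsq mF; have nG := nnm_nsq mG; have nf := nnm_nsq mf; have ng := nnm_nsq mg.
have ki0 : 0 <= eI^-1 + 1 by rewrite addr_ge0// invr_ge0 ltW.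
have kj0 : 0 <= eJ^-1 + 1 by rewrite addr_ge0// invr_ge0 ltW.
pose Fd p := nsq (F k p - f p); pose Gd p := nsq (G k p - g p).
have nFd : nnm Fd by []. have nGd : nnm Gd by [].
apply: (@le_trans _ _ (\int[stm]_p (B1 * ((eJ^-1 + 1) * Fd p + ((eI^-1 + 1) * Gd p + (eJ * nsq (g p) + eI * nsq (f p)))))%:E)%E).
  apply: nn_le => [||p]; first by apply: cmeas_c1; case: D3.
    apply: nnmM; first by apply: nnm_cst; exact: ltW.
    by do ! [apply: nnmD | apply: nnmM => //; apply: nnm_cst => //; exact: ltW].
  rewrite (_ : _ - _ = ((F k p - f p) * (G k p - g p) + (g p * (F k p - f p) + f p * (G k p - g p))) * h p); last by ring.
  apply: le_trans (c1M _ _) _; rewrite mulrC; apply: ler_pM; rewrite ?c1_ge0//.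
    by apply: le_trans (hB p) _; rewrite lerDl.
  apply: le_trans (c1D _ _) _; apply: (@le_trans _ _ (_ + (_ + _))); first by apply: lerD; [|exact: c1D].
  have q1 := @c1_mul_le (F k p - f p) (G k p - g p) 1 ltr01.
  have q2 := @c1_mul_le (g p) (F k p - f p) eJ eJ0.
  have q3 := @c1_mul_le (f p) (G k p - g p) eI eI0.
  move: q1 q2 q3; rewrite invr1 !mul1r !mulrDl !mul1r -/(Fd p) -/(Gd p); lra.
rewrite nnZl ?(ltW B10)//; last first.
  by do ! [apply: nnmD | apply: nnmM => //; apply: nnm_cst => //; exact: ltW].
rewrite nnD; [|by apply: nnmM => //; exact: nnm_cst|]; last first.
  by do ! [apply: nnmD | apply: nnmM => //; apply: nnm_cst => //; exact: ltW].
rewrite nnD; [|by apply: nnmM => //; exact: nnm_cst|]; last first.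
  by do ! [apply: nnmD | apply: nnmM => //; apply: nnm_cst => //; exact: ltW].
rewrite nnD; [|by apply: nnmM => //; apply: nnm_cst; exact: ltW|by apply: nnmM => //; apply: nnm_cst; exact: ltW].
rewrite nnZl// nnZl// nnZl ?(ltW eJ0)// nnZl ?(ltW eI0)//.
apply: (@le_trans _ _ (B1%:E * (((eJ^-1 + 1) * m1)%:E + (((eI^-1 + 1) * m1)%:E + ((eJ * J)%:E + (eI * I)%:E))))%E).
  apply: lee_wpmul2l; first by rewrite lee_fin ltW.
  rewrite (EFinM (eJ^-1 + 1)) (EFinM (eI^-1 + 1)) (EFinM eJ) (EFinM eI).
  by apply: leeD; [|apply: leeD; [|apply: leeD]]; apply: lee_wpmul2l; rewrite ?lee_fin// ltW.
rewrite -!EFinD -EFinM lee_fin.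
have mm1 : m1 <= d / 2 by rewrite ge_min lexx.
have mm2 : m1 <= eJ * (d / 2) by rewrite !ge_min lexx orbT.
have mm3 : m1 <= eI * (d / 2) by rewrite !ge_min lexx !orbT.
have r1 : (eJ^-1 + 1) * m1 <= d.
  have : eJ^-1 * m1 <= d / 2 by rewrite mulrC ler_pdivrMr// mulrC.
  by rewrite mulrDl mul1r; lra.
have r2 : (eI^-1 + 1) * m1 <= d.
  have : eI^-1 * m1 <= d / 2 by rewrite mulrC ler_pdivrMr// mulrC.
  by rewrite mulrDl mul1r; lra.
have r3 : eJ * J = d / 2 by rewrite /eJ; field; rewrite gt_eqF.
have r4 : eI * I = d / 2 by rewrite /eI; field; rewrite gt_eqF.
rewrite r3 r4; apply: (@le_trans _ _ (B1 * (3 * d))); first by rewrite ler_pM2l//; lra.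
by rewrite /d (_ : B1 * _ = 3 / 4 * e); [lra|field; rewrite gt_eqF].
Qed.

End slab_limits.

(** * Densities of restrictions to the slab *)

Section extensions.
Context {R : realType}.
Local Notation RT := (measurableTypeR R).
Local Notation ST := (RT * (RT * RT))%type.
Local Notation stm := (@st_measure R).
Local Open Scope complex_scope.

Section one_extension.
Variables (s b T : R) (s0 : 0 <= s) (b0 : 0 <= b) (T0 : 0 < T).

Definition cutoff (u : spacetime R -> R[i]) (p : ST) : R[i] := (tchi T p)%:C * u p.

Lemma nsq_real (r : R) (z : R[i]) : nsq (r%:C * z) = r ^+ 2 * nsq z.
Proof. by rewrite nsqM; congr (_ * _); rewrite /nsq/= expr0n addr0. Qed.

Lemma cutoff_L2_le u : schwartz u ->
  (\int[stm]_p (nsq (cutoff u p))%:E <= (2 * pois_floor^-1 * xnorm s b u ^+ 2)%:E)%E.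
Proof.
move=> su; have mu' := schwartz_cmeas su; apply: le_trans (slab_L2_le s0 b0 su).
have nt := nnm_tchi T; have nc := @nnm_chi R.
apply: nn_le => [||p].
- by apply: nnm_nsq; apply: cmeasM => //; apply: cmeas_real; case: nt.
- by apply: nnmM => //; exact: nnm_nsq.
rewrite nsq_real expr2 tchi_idem ler_wpM2r ?nsq_ge0//; exact: tchi_le_chi.
Qed.

Lemma cutoff_L2f u : schwartz u -> L2f T (cutoff u).
Proof.
move=> su; split.
- apply: cmeasM; last exact: schwartz_cmeas.
  by apply: cmeas_real; case: (nnm_tchi T).
- by move=> p p0; rewrite /cutoff p0 mul0r.
- exact: le_lt_trans (cutoff_L2_le su) (ltry _).
Qed.

Lemma cutoffB u v p : cutoff u p - cutoff v p = cutoff (fun p => u p - v p) p.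
Proof. by rewrite /cutoff mulrBr. Qed.

Lemma X_seq_xnorm_cauchy (U : X_space s b) (e : R) : 0 < e -> exists N : nat, forall j k,
  (N <= j)%N -> (N <= k)%N -> xnorm s b (fun p => X_seq U j p - X_seq U k p) < e.
Proof.
move=> e0; have [N hN] := X_seq_cauchy U e0; exists N => j k Nj Nk.
rewrite -lte_fin -X_norm_xnorm; first exact: hN.
by apply: schwartz_sub; exact: X_seq_schwartz.
Qed.

(** A Cauchy sequence for the norm is Cauchy in L^2 of the slab by [cutoff_L2_le]; real and
    imaginary parts then converge separately by [L2_limit], with [tchi T] as the integrable bound of
    the support. *)
Lemma X_limit (U : X_space s b) : exists2 f, L2f T f & L2to (fun k => cutoff (X_seq U k)) f.
Proof.
pose F k := cutoff (X_seq U k); have sU k := X_seq_schwartz U k.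
have LF k : L2f T (F k) by exact: cutoff_L2f.
have pf0 : 0 < (pois_floor : R)^-1 by rewrite invr_gt0 pois_floor_gt0.
have cF (e : R) : 0 < e -> exists N : nat, forall j k, (N <= j)%N -> (N <= k)%N ->
    (\int[stm]_p (nsq (F j p - F k p))%:E <= e%:E)%E.
  move=> e0; pose d := Num.sqrt (e / (2 * pois_floor^-1)).
  have q0 : 0 < e / (2 * pois_floor^-1) by rewrite divr_gt0// mulr_gt0.
  have d0 : 0 < d by rewrite sqrtr_gt0.
  have [N hN] := X_seq_xnorm_cauchy U d0; exists N => j k Nj Nk.
  under eq_integral do rewrite cutoffB.
  apply: (le_trans (cutoff_L2_le (schwartz_sub (sU j) (sU k)))).
  rewrite lee_fin mulrC -ler_pdivlMr ?mulr_gt0//.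
  rewrite -[leRHS]sqr_sqrtr ?(ltW q0)// -/d ler_pXn2r ?nnegrE ?xnorm_ge0 ?(ltW d0)//.
  exact: ltW (hN j k Nj Nk).
have mR k : measurable_fun setT (fun p => complex.Re (F k p)) by case: (LF k) => -[].
have mI k : measurable_fun setT (fun p => complex.Im (F k p)) by case: (LF k) => -[].
have suppt k p : tchi T p = 0 -> F k p = 0 by case: (LF k) => _ h _; exact: h.
have part (pr : R[i] -> R) : (forall k, measurable_fun setT (fun p => pr (F k p))) -> pr 0 = 0 ->
    (forall z z', pr (z - z') = pr z - pr z') -> (forall z, pr z ^+ 2 <= nsq z) ->
    exists2 f : ST -> R, measurable_fun setT f /\ (forall p, tchi T p = 0 -> f p = 0) &
    forall e : R, 0 < e -> exists N : nat, forall k, (N <= k)%N -> (\int[stm]_p ((pr (F k p) - f p) ^+ 2)%:E <= e%:E)%E.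
  move=> mp p0 pB pn.
  have [|e e0|f [mf f0] hf] := @L2_limit _ _ _ stm (tchi T) (fun k p => pr (F k p)) (nnm_tchi T) (tchi_lty T) mp.
  - by move=> k p; have [h|->] := tchi01 T p; [left; rewrite suppt|right].
  - have [N hN] := cF e e0; exists N => j k Nj Nk; apply: le_trans (hN j k Nj Nk).
    apply: nn_le => [||p].
    + by split=> [|p]; [apply: measurable_funX; exact: measurable_funB|exact: sqr_ge0].
    + by apply: nnm_nsq; apply: cmeasD; [case: (LF j)|apply: cmeasN; case: (LF k)].
    + by rewrite -pB.
  exists f => //; split=> // p tp; apply: f0 => k; by rewrite suppt.
have [fR [mfR fR0] hR] : exists2 f : ST -> R, measurable_fun setT f /\ (forall p, tchi T p = 0 -> f p = 0) &
    forall e : R, 0 < e -> exists N : nat, forall k, (N <= k)%N -> (\int[stm]_p ((complex.Re (F k p) - f p) ^+ 2)%:E <= e%:E)%E.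
  apply: part => // [[a c] [a' c']//|z]; by rewrite lerDl sqr_ge0.
have [fI [mfI fI0] hI] : exists2 f : ST -> R, measurable_fun setT f /\ (forall p, tchi T p = 0 -> f p = 0) &
    forall e : R, 0 < e -> exists N : nat, forall k, (N <= k)%N -> (\int[stm]_p ((complex.Im (F k p) - f p) ^+ 2)%:E <= e%:E)%E.
  apply: part => // [[a c] [a' c']//|z]; by rewrite lerDr sqr_ge0.
pose f p : R[i] := Complex (fR p) (fI p).
have mf : cmeas f by split.
have lim : L2to F f.
  move=> e e0; have e2 : 0 < e / 2 by rewrite divr_gt0.
  have [N1 h1] := hR _ e2; have [N2 h2] := hI _ e2; exists (maxn N1 N2) => k.
  rewrite geq_max => /andP[k1 k2].
  have n1 : nnm (fun p => (complex.Re (F k p) - fR p) ^+ 2).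
    by split=> [|p]; [apply: measurable_funX; exact: measurable_funB|exact: sqr_ge0].
  have n2 : nnm (fun p => (complex.Im (F k p) - fI p) ^+ 2).
    by split=> [|p]; [apply: measurable_funX; exact: measurable_funB|exact: sqr_ge0].
  rewrite (_ : (\int[stm]_p (nsq (F k p - f p))%:E = \int[stm]_p ((complex.Re (F k p) - fR p) ^+ 2 +
     (complex.Im (F k p) - fI p) ^+ 2)%:E)%E); last first.
    by apply: eq_integral => p _; rewrite /nsq cReD cImD cReN cImN.
  rewrite (nnD _ n1 n2) (_ : e = e / 2 + e / 2); last by field.
  by rewrite EFinD; apply: leeD; [exact: h1|exact: h2].
exists f => //; split=> //; first by move=> p tp; rewrite /f fR0// fI0.
have [N hN] := lim 1 ltr01; have [mF _ fF] := LF N; have nF := nnm_nsq mF.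
have nd : nnm (fun p => nsq (F N p - f p)) by apply: nnm_nsq; apply: cmeasD => //; exact: cmeasN.
apply: (@le_lt_trans _ _ (\int[stm]_p (2 * nsq (F N p) + 2 * nsq (F N p - f p))%:E)%E).
  apply: nn_le => [||p]; first exact: nnm_nsq.
    by apply: nnmD; apply: nnmM => //; exact: nnm_cst.
  have := nsq_add_le (F N p) (- (F N p - f p)); rewrite nsqN.
  by rewrite (_ : F N p + - (F N p - f p) = f p)//; ring.
rewrite nnD; [|by apply: nnmM => //; exact: nnm_cst|by apply: nnmM => //; exact: nnm_cst].
rewrite !nnZl//; apply: lte_add_pinfty; apply: lte_mul_pinfty; rewrite ?lee_fin//.
exact: le_lt_trans (hN N (leqnn N)) (ltry _).
Qed.

Lemma test_bounded (psi : test_fun T) : cmeas (psi : ST -> R[i]) /\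
  exists2 B : R, 0 <= B & forall p, c1 (psi p) <= B.
Proof.
have sp := test_schwartz psi; split; first exact: schwartz_cmeas.
have [L [B [_ B0 _ _ hB]]] := schwartz_modulus sp; exists B; first exact: ltW.
by move=> p; apply: le_trans (hB p) _; rewrite ler_piMr ?(ltW B0)// jw_le1.
Qed.

(** A test function vanishes for [|t| >= r] with some [r < T], so a pairing does not notice the cut
    to the open time interval. *)
Lemma test_cutoff (psi : test_fun T) p : (chi p)%:C * psi p = (tchi T p)%:C * psi p.
Proof.
have [r [rT hr]] := test_supp psi; rewrite /tchi indicE.
case: (boolP (p.1 \in _)) => [_|]; first by rewrite mul1r.
rewrite notin_setE/= in_itv/= => /negP; rewrite -ltr_norml -leNgt => Tp.
by case: p Tp => t x /= Tp; rewrite hr ?mulr0// ltW// (lt_le_trans rT).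
Qed.

Definition pair_with (f : ST -> R[i]) (psi : test_fun T) : R[i] := cint stm (fun p => f p * psi p).

Lemma pairing_cutoff u (psi : test_fun T) :
  cintegral (setT `*` unit_square) (fun p => u p * psi p) = pair_with (cutoff u) psi.
Proof.
rewrite cintegral_chi; apply: eq_cint => p.
by rewrite mulrCA test_cutoff mulrCA /cutoff mulrA.
Qed.

Lemma L2f_tchi : L2f T (fun p => (tchi T p)%:C).
Proof.
split; first by apply: cmeas_real; case: (nnm_tchi T).
- by move=> p ->.
- rewrite (_ : (\int[stm]_p (nsq (tchi T p)%:C)%:E = \int[stm]_p (tchi T p)%:E)%E); first exact: tchi_lty.
  by apply: eq_integral => p _; rewrite /nsq/= expr0n addr0 expr2 tchi_idem.
Qed.

Lemma L2to_cst (f : ST -> R[i]) : L2to (fun=> f) f.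
Proof.
move=> e e0; exists 0%N => k _; under eq_integral do rewrite subrr /nsq/= !expr0n addr0.
by rewrite integral0 lee_fin ltW.
Qed.

Lemma L2f_cutoff f p : L2f T f -> f p * (tchi T p)%:C = f p.
Proof. by case=> _ f0 _; have [h|->] := tchi01 T p; rewrite ?mulr1// f0// mul0r. Qed.

(** A pairing is a product with the constant sequence [tchi T], itself in L^2, so [L2_mul_cvg]
    applies. *)
Lemma pair_cvg F f (psi : test_fun T) : (forall k, L2f T (F k)) -> L2f T f -> L2to F f ->
  cto (fun k => pair_with (F k) psi) (pair_with f psi).
Proof.
move=> LF Lf Ff; have [mp [B B0 hB]] := test_bounded psi.
have := L2_mul_cvg LF (fun=> L2f_tchi) Lf L2f_tchi Ff (L2to_cst _) mp B0 hB.
have e g : L2f T g -> cint stm (fun p => g p * (tchi T p)%:C * psi p) = pair_with g psi.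
  by move=> Lg; apply: eq_cint => p; rewrite L2f_cutoff.
by rewrite e//; under eq_fun do rewrite e//.
Qed.

Lemma restricts_density (U : X_space s b) (u : st_distribution T) f :
  restricts_to U u -> L2f T f -> L2to (fun k => cutoff (X_seq U k)) f ->
  forall psi, u psi = pair_with f psi.
Proof.
move=> Uu Lf Ff psi; have LF k := cutoff_L2f (X_seq_schwartz U k).
apply: (cto_unique _ (pair_cvg psi LF Lf Ff)).
have := Uu psi; rewrite /= => -[hR hI]; apply/cto_Re; split.
  rewrite (_ : (fun k => _) = (fun k => complex.Re (cintegral (setT `*` unit_square) (fun p => X_seq U k p * psi p))))//.
  by apply/funext => k; rewrite pairing_cutoff.
rewrite (_ : (fun k => _) = (fun k => complex.Im (cintegral (setT `*` unit_square) (fun p => X_seq U k p * psi p))))//.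
by apply/funext => k; rewrite pairing_cutoff.
Qed.

End one_extension.

Lemma measurable_slab (T : R) : measurable (slab T : set ST).
Proof.
apply: measurableX; first exact: measurable_itv.
by apply: measurableX; exact: measurable_itv.
Qed.

Lemma has_densityP (T : R) (u : st_distribution T) (f : ST -> R[i]) (a : ST -> R) :
  cdom stm f a -> (forall p, tchi T p = 0 -> f p = 0) ->
  (forall psi, u psi = pair_with f psi) -> has_density u f.
Proof.
move=> df f0 uf; split.
  have mS := measurable_slab T.
  by split; apply: (integrableS measurableT mS (@subsetT _ _)); [exact: (cdom_Re df)|exact: (cdom_Im df)].
move=> psi; rewrite uf cintegral_slab; apply: eq_cint => p; rewrite mulrA; congr (_ * _).
by have [h|->] := tchi01 T p; [rewrite f0// mulr0|rewrite mul1r].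
Qed.

End extensions.

(** * Products in the completion and the passage to the infimum *)

Section products.
Context {R : realType}.
Local Notation RT := (measurableTypeR R).
Local Notation ST := (RT * (RT * RT))%type.
Local Notation stm := (@st_measure R).
Local Open Scope complex_scope.

Section fixed_time.
Variable T : R.

Lemma test_mul_supp (v : spacetime R -> R[i]) (psi : test_fun T) :
  exists r : R, r < T /\ forall t x, r <= `|t| -> v (t, x) * psi (t, x) = 0.
Proof.
by have [r [rT hr]] := test_supp psi; exists r; split=> // t x tr; rewrite hr// mulr0.
Qed.

Definition test_mul v (sv : schwartz v) (psi : test_fun T) : test_fun T :=
  TestFun (schwartz_mul sv (test_schwartz psi)) (test_mul_supp v psi).

Lemma test_conj_supp (psi : test_fun T) :
  exists r : R, r < T /\ forall t x, r <= `|t| -> conjc (psi (t, x)) = 0.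
Proof.
have [r [rT hr]] := test_supp psi; exists r; split=> // t x tr; rewrite hr//.
by apply/eqP; rewrite eq_complex/= oppr0 !eqxx.
Qed.

Definition test_conj (psi : test_fun T) : test_fun T :=
  TestFun (schwartz_conj (test_schwartz psi)) (test_conj_supp psi).

Lemma conjc_realC (r : R) : conjc r%:C = r%:C.
Proof. by apply/eqP; rewrite eq_complex/= oppr0 !eqxx. Qed.

Lemma L2f_conj f : L2f T f -> L2f T (fun p => conjc (f p)).
Proof.
move=> [mf f0 ff]; split; first exact: cmeasJ.
- by move=> p p0; rewrite f0// (conjc_realC 0).
- by under eq_integral do rewrite nsqJ.
Qed.

Lemma L2to_conj (F : nat -> ST -> R[i]) f :
  L2to F f -> L2to (fun k p => conjc (F k p)) (fun p => conjc (f p)).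
Proof.
move=> Ff e e0; have [N hN] := Ff e e0; exists N => k Nk.
by under eq_integral do rewrite -cJB nsqJ; exact: hN.
Qed.

(** Two densities of one distribution are exchanged inside a product without comparing them almost
    everywhere: [conjc (V k) * psi] is a test function, on which [f] and [f'] agree, and [V k] tends
    to [g] in L^2 of the slab. *)
Lemma pair_with_swapl f f' g (V : nat -> spacetime R -> R[i]) : L2f T f -> L2f T f' -> L2f T g ->
  (forall psi : test_fun T, pair_with f psi = pair_with f' psi) ->
  (forall k, schwartz (V k)) -> (forall k, L2f T (cutoff T (V k))) -> L2to (fun k => cutoff T (V k)) g ->
  forall psi : test_fun T,
  pair_with (fun p => f p * conjc (g p)) psi = pair_with (fun p => f' p * conjc (g p)) psi.
Proof.
move=> Lf Lf' Lg ff' sV LV Vg psi; have [mp [B B0 hB]] := test_bounded psi.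
have LVJ k := L2f_conj (LV k).
have lim h : L2f T h -> cto (fun k => pair_with h (test_mul (schwartz_conj (sV k)) psi))
    (pair_with (fun p => h p * conjc (g p)) psi).
  move=> Lh; have c := L2_mul_cvg (fun=> Lh) LVJ Lh (L2f_conj Lg) (L2to_cst h) (L2to_conj Vg) mp B0 hB.
  rewrite (_ : (fun k => pair_with h _) =
    (fun k => cint stm (fun p => h p * conjc (cutoff T (V k) p) * psi p)))//.
  apply/funext => k; apply: eq_cint => p /=.
  by rewrite /cutoff cJM conjc_realC [in RHS](mulrA (h p)) (L2f_cutoff _ Lh) mulrA.
apply: (cto_unique (lim f Lf)); have := lim f' Lf'.
rewrite (_ : (fun k => pair_with f' _) = (fun k => pair_with f (test_mul (schwartz_conj (sV k)) psi)))//.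
by apply/funext => k; rewrite ff'.
Qed.

(** Exchanges the two factors, so that [pair_with_swapl] also treats the second one. *)
Lemma pair_with_conj f g (psi : test_fun T) : L2f T f -> L2f T g ->
  pair_with (fun p => f p * conjc (g p)) psi =
  conjc (pair_with (fun p => g p * conjc (f p)) (test_conj psi)).
Proof.
move=> Lf Lg; have [mp [B B0 hB]] := test_bounded (test_conj psi).
have d := L2_mul_cdom Lg (L2f_conj Lf) mp B0 hB.
rewrite /pair_with -(cintJ d); apply: eq_cint => p.
by rewrite !cJM /= !conjcK (mulrC (f p)).
Qed.

End fixed_time.

Lemma cvgn_cauchy_tail (x : nat -> R) :
  (forall e, 0 < e -> exists N, forall k, (N <= k)%N -> `|x N - x k| < e) -> cvgn x.
Proof.
move=> h; apply/cauchy_cvgP/cauchy_exP => e e0; have [N hN] := h e e0.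
by exists (x N); exists N => // k /= Nk; rewrite -ball_normE/=; exact: hN.
Qed.

Lemma distr_lt (x y a c e : R) : x <= y + a -> y <= x + c -> a < e -> c < e -> `|x - y| < e.
Proof. by move=> *; rewrite ltr_norml; apply/andP; split; lra. Qed.

Lemma quarterD_lt (e : R) : 0 < e -> e / 4 + e / 4 < e. Proof. by move=> *; lra. Qed.

Lemma distr_lt1_le (l a m : R) : `|l - a| < 1 -> l + 1 <= m -> a <= m.
Proof. by rewrite ltr_norml => /andP[]; lra. Qed.

Lemma X_space_norm_cvg (s b : R) (U : X_space s b) : exists l : R, [/\ 0 <= l,
  (fun k => xnorm s b (X_seq U k)) @ \oo --> l & X_space_norm U = l%:E].
Proof.
have sU k := X_seq_schwartz U k.
have cv : cvgn (fun k => xnorm s b (X_seq U k)).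
  apply: cvgn_cauchy_tail => e e0; have [N hN] := X_seq_xnorm_cauchy U e0.
  exists N => k Nk.
  have h1 := xnorm_triangle s b (sU N) (sU k); have h2 := xnorm_triangle s b (sU k) (sU N).
  have g1 := hN N k (leqnn N) Nk; have g2 := hN k N Nk (leqnn N).
  exact: (distr_lt h1 h2 g1 g2).
exists (limn (fun k => xnorm s b (X_seq U k))); split=> //.
  by apply: limr_ge => //; apply: nearW => k; exact: xnorm_ge0.
rewrite /X_space_norm (_ : (fun k => X_norm s b (X_seq U k)) = (fun k => (xnorm s b (X_seq U k))%:E)).
  by apply: cvg_lim => //; apply: cvg_EFin; [exact: nearW|exact: cv].
by apply/funext => k; rewrite (X_norm_xnorm _ _ (sU k)).
Qed.

Section bilinear.
Variables (s b b' C : R) (s0 : 0 <= s) (b0 : 0 <= b) (C0 : 0 < C).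
Hypothesis bilinear : forall u v : spacetime R -> R[i], schwartz u -> schwartz v ->
  xnorm s b' (fun p => u p * conjc (v p)) <= C * (xnorm s b u * xnorm s b v).

(** By [w j - w k = (U j - U k) conj (V j) + U k conj (V j - V k)] and the bilinear bound. [M]
    bounds both norms along the tails, and [d] makes each of the two terms at most [e / 4]. *)
Lemma X_product (U V : X_space s b) :
  exists W : X_space s b', X_seq W = (fun k p => X_seq U k p * conjc (X_seq V k p)).
Proof.
have sU k := X_seq_schwartz U k; have sV k := X_seq_schwartz V k.
pose w k (p : spacetime R) := X_seq U k p * conjc (X_seq V k p).
have sw k : schwartz (w k) by apply: schwartz_mul => //; exact: schwartz_conj.
suff cw : forall e : R, 0 < e -> exists N : nat, forall j k : nat, (N <= j)%N -> (N <= k)%N ->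
    (X_norm s b' (fun p => (w j p - w k p)%R) < e%:E)%E by exists (XSpace sw cw).
move=> e e0; have [lU [lU0 cU _]] := X_space_norm_cvg U; have [lV [lV0 cV _]] := X_space_norm_cvg V.
have /cvgrPdist_lt/(_ _ ltr01)[N1 _ h1] := cU; have /cvgrPdist_lt/(_ _ ltr01)[N2 _ h2] := cV.
pose M := lU + lV + 2; have M0 : 0 < M by rewrite /M; lra.
have MU : lU + 1 <= M by rewrite /M; lra.
have MV : lV + 1 <= M by rewrite /M; lra.
pose d := e / (4 * C * M); have d0 : 0 < d by rewrite divr_gt0// !mulr_gt0.
have [N3 h3] := X_seq_xnorm_cauchy U d0; have [N4 h4] := X_seq_xnorm_cauchy V d0.
exists (maxn (maxn N1 N2) (maxn N3 N4)) => j k; rewrite !geq_max.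
move=> /andP[/andP[j1 j2] /andP[j3 j4]] /andP[/andP[k1 k2] /andP[k3 k4]].
have sUd := schwartz_sub (sU j) (sU k); have sVd := schwartz_sub (sV j) (sV k).
have sd := schwartz_sub (sw j) (sw k).
have s1 : schwartz (fun p => (X_seq U j p - X_seq U k p) * conjc (X_seq V j p)).
  by apply: (schwartz_mul sUd); exact: schwartz_conj.
rewrite (X_norm_xnorm _ _ sd) lte_fin; apply: (le_lt_trans (xnorm_triangle s b' sd s1)).
have -> : (fun p => (w j p - w k p) - (X_seq U j p - X_seq U k p) * conjc (X_seq V j p)) =
    (fun p => X_seq U k p * conjc (X_seq V j p - X_seq V k p)).
  by apply/funext => p; rewrite cJB /w; ring.
have a1 := bilinear sUd (sV j); have a2 := bilinear (sU k) sVd.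
have q1 := h3 j k j3 k3; have q2 := h4 j k j4 k4.
have r1 : xnorm s b (X_seq U k) <= M.
  exact: (distr_lt1_le (h1 k k1) MU).
have r2 : xnorm s b (X_seq V j) <= M.
  exact: (distr_lt1_le (h2 j j2) MV).
have t1 : xnorm s b (fun p => X_seq U j p - X_seq U k p) * xnorm s b (X_seq V j) <= d * M.
  exact: (ler_pM (xnorm_ge0 _ _ _) (xnorm_ge0 _ _ _) (ltW q1) r2).
have t2 : xnorm s b (X_seq U k) * xnorm s b (fun p => X_seq V j p - X_seq V k p) <= d * M.
  by rewrite (mulrC d); exact: (ler_pM (xnorm_ge0 _ _ _) (xnorm_ge0 _ _ _) r1 (ltW q2)).
have u1 := le_trans a1 (ler_wpM2l (ltW C0) t1); have u2 := le_trans a2 (ler_wpM2l (ltW C0) t2).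
apply: (le_lt_trans (lerD u1 u2)).
rewrite (_ : C * (d * M) = e / 4); last by rewrite /d; field; rewrite !gt_eqF.
exact: quarterD_lt.
Qed.

Lemma X_product_norm (U V : X_space s b) (W : X_space s b') (lU lV : R) :
  X_seq W = (fun k p => X_seq U k p * conjc (X_seq V k p)) ->
  X_space_norm U = lU%:E -> X_space_norm V = lV%:E -> (X_space_norm W <= (C * (lU * lV))%:E)%E.
Proof.
move=> eW eU eV; have [a [a0 cU nU]] := X_space_norm_cvg U; have [c [c0 cV nV]] := X_space_norm_cvg V.
have [l [l0 cW ->]] := X_space_norm_cvg W.
move: eU eV; rewrite nU nV => -[<-] [<-]; rewrite lee_fin.
have cM : (fun k => C * (xnorm s b (X_seq U k) * xnorm s b (X_seq V k))) @ \oo --> C * (a * c).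
  by apply: cvgMr; exact: cvgM.
apply: (ler_cvg_to cW cM); apply: nearW => k; rewrite eW.
by apply: bilinear; exact: X_seq_schwartz.
Qed.

Variable T : R.

Lemma restricts_product (U V : X_space s b) (W : X_space s b') (f g : ST -> R[i]) :
  X_seq W = (fun k p => X_seq U k p * conjc (X_seq V k p)) ->
  L2f T f -> L2to (fun k => cutoff T (X_seq U k)) f ->
  L2f T g -> L2to (fun k => cutoff T (X_seq V k)) g ->
  restricts_to W (fun psi : test_fun T => pair_with (fun p => f p * conjc (g p)) psi).
Proof.
move=> eW Lf Ff Lg Gg psi /=; have [mp [B B0 hB]] := test_bounded psi.
have LF k := cutoff_L2f T s0 b0 (X_seq_schwartz U k).
have LG k := L2f_conj (cutoff_L2f T s0 b0 (X_seq_schwartz V k)).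
have c := L2_mul_cvg LF LG Lf (L2f_conj Lg) Ff (L2to_conj Gg) mp B0 hB.
have e k : cint stm (fun p => cutoff T (X_seq U k) p * conjc (cutoff T (X_seq V k) p) * psi p) =
    cintegral (setT `*` unit_square) (fun p => X_seq W k p * psi p).
  rewrite pairing_cutoff; apply: eq_cint => p; rewrite eW /cutoff cJM conjc_realC.
  have tt : (tchi T p)%:C * (tchi T p)%:C = (tchi T p)%:C :> R[i].
    by rewrite -(rmorphM (real_complex R)) tchi_idem.
  move: tt; move: (X_seq U k p) (conjc (X_seq V k p)) (psi p) (tchi T p)%:C => x y z t tt.
  by rewrite -[in RHS]tt; ring.
have {}e := funext e; rewrite e in c.
by have /cto_Re := c.
Qed.

Lemma XT_norm_fin (u : st_distribution T) : in_XT s b u ->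
  exists2 y : R, 0 <= y & XT_norm s b u = y%:E.
Proof.
case=> U hU; have [l [l0 _ nU]] := X_space_norm_cvg U.
have le : (XT_norm s b u <= l%:E)%E by rewrite -nU; apply: ereal_inf_lbound; exists U.
have ge : (0 <= XT_norm s b u)%E.
  apply: le_ereal_inf_tmp => _ [V hV <-]; have [m [m0 _ ->]] := X_space_norm_cvg V.
  by rewrite lee_fin.
exists (fine (XT_norm s b u)); first exact: fine_ge0.
by rewrite fineK// ge0_fin_numE// (le_lt_trans le) ?ltry.
Qed.

Lemma XT_norm_adherent (u : st_distribution T) (y e : R) : XT_norm s b u = y%:E -> 0 < e ->
  exists U : X_space s b, exists l : R, [/\ restricts_to U u, X_space_norm U = l%:E, 0 <= l & l <= y + e].
Proof.
move=> yu e0; have fin : XT_norm s b u \is a fin_num by rewrite yu.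
have [_ [U hU <-]] := lb_ereal_inf_adherent e0 fin.
rewrite -/(XT_norm s b u) yu; have [l [l0 _ nU]] := X_space_norm_cvg U.
by rewrite nU -EFinD lte_fin => ly; exists U, l; split=> //; exact: ltW.
Qed.

Lemma XT_product (u v : st_distribution T) : in_XT s b u -> in_XT s b v ->
  exists w : st_distribution T, [/\ is_mul_conj u v w, in_XT s b' w &
    (XT_norm s b' w <= C%:E * XT_norm s b u * XT_norm s b v)%E].
Proof.
move=> hu hv; have [y y0 yu] := XT_norm_fin hu; have [z z0 zv] := XT_norm_fin hv.
have [U hU] := hu; have [V hV] := hv.
have [f Lf Ff] := X_limit T s0 b0 U; have [g Lg Gg] := X_limit T s0 b0 V.
have fu := restricts_density s0 b0 hU Lf Ff; have gv := restricts_density s0 b0 hV Lg Gg.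
pose w (psi : test_fun T) := pair_with (fun p => f p * conjc (g p)) psi.
have mone : cmeas (fun _ : ST => 1 : R[i]) by exact: cmeas_cst.
have one_le (p : ST) : c1 (1 : R[i]) <= 1 by rewrite (c1_real 1) normr1.
(* The distribution [w] is built from one pair of extensions. That every other pair has a product
   restricting to the same [w] is what allows nearly optimal extensions in the bound of its norm. *)
have all_W (U' V' : X_space s b) : restricts_to U' u -> restricts_to V' v -> exists W : X_space s b',
    X_seq W = (fun k p => X_seq U' k p * conjc (X_seq V' k p)) /\ restricts_to W w.
  move=> hU' hV'; have [W eW] := X_product U' V'; exists W; split=> //.
  have [f' Lf' Ff'] := X_limit T s0 b0 U'; have [g' Lg' Gg'] := X_limit T s0 b0 V'.
  have fu' := restricts_density s0 b0 hU' Lf' Ff'; have gv' := restricts_density s0 b0 hV' Lg' Gg'.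
  have ff' (psi : test_fun T) : pair_with f psi = pair_with f' psi by rewrite -fu fu'.
  have gg' (psi : test_fun T) : pair_with g psi = pair_with g' psi by rewrite -gv gv'.
  rewrite (_ : w = (fun psi => pair_with (fun p => f' p * conjc (g' p)) psi)).
    exact: (restricts_product eW Lf' Ff' Lg' Gg').
  apply/funext => psi; rewrite /w.
  have LV k := cutoff_L2f T s0 b0 (X_seq_schwartz V k).
  have LU k := cutoff_L2f T s0 b0 (X_seq_schwartz U' k).
  (* First [f] is replaced by [f'] against [g], then [g] by [g'] against [f'] after conjugation. *)
  rewrite (pair_with_swapl Lf Lf' Lg ff' (X_seq_schwartz V) LV Gg psi).
  rewrite (pair_with_conj psi Lf' Lg) (pair_with_conj psi Lf' Lg').
  by rewrite (pair_with_swapl Lg Lg' Lf' gg' (X_seq_schwartz U') LU Ff').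
exists w; split.
- exists f, g; split.
  + apply: (has_densityP _ _ fu); last by case: Lf.
    by have := L2_bdd_cdom Lf mone ler01 one_le; under eq_fun do rewrite mulr1; exact.
  + apply: (has_densityP _ _ gv); last by case: Lg.
    by have := L2_bdd_cdom Lg mone ler01 one_le; under eq_fun do rewrite mulr1; exact.
  + apply: (has_densityP (u := w)) => //; last by move=> p p0; case: Lf => _ -> //; rewrite mul0r.
    by have := L2_mul_cdom Lf (L2f_conj Lg) mone ler01 one_le; under eq_fun do rewrite mulr1; exact.
- by have [W [_ hW]] := all_W U V hU hV; exists W.
have [W [_ hW]] := all_W U V hU hV.
rewrite yu zv -!EFinM -mulrA.
have bound e : 0 < e -> (XT_norm s b' w <= (C * ((y + e) * (z + e)))%:E)%E.
  move=> e0; have [U' [l [hU' nU l0 ly]]] := XT_norm_adherent yu e0.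
  have [V' [m [hV' nV m0 mz]]] := XT_norm_adherent zv e0.
  have [W' [eW hW']] := all_W U' V' hU' hV'.
  apply: (@le_trans _ _ (X_space_norm W')); first by apply: ereal_inf_lbound; exists W'.
  apply: (le_trans (X_product_norm eW nU nV)); rewrite lee_fin ler_pM2l//.
  exact: ler_pM.
have fin : XT_norm s b' w = (fine (XT_norm s b' w))%:E.
  rewrite fineK// ge0_fin_numE; first by apply: (le_lt_trans (bound 1 ltr01)); rewrite ltry.
  apply: le_ereal_inf_tmp => _ [W' _ <-]; have [m [m0 _ ->]] := X_space_norm_cvg W'.
  by rewrite lee_fin.
rewrite fin lee_fin; apply: le_of_perturbed => // e e0.
by rewrite -lee_fin -fin; exact: bound.
Qed.

End bilinear.

End products.

Unset Implicit Arguments.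

Theorem proposition1p3 (R : realType) :
  exists delta0 : R, 0 < delta0 /\
  forall delta1 delta2 : R, 0 < delta2 -> delta2 < delta1 -> delta1 < delta0 ->
  forall s : R, 0 <= s ->
  exists C : R, 0 < C /\
  forall T : R, 0 < T -> T <= 1 ->
  forall u v : st_distribution T,
    in_XT s (2^-1 + delta2) u -> in_XT s (2^-1 + delta2) v ->
  exists w : st_distribution T,
    [/\ is_mul_conj u v w,
        in_XT s (- 2^-1 + delta1) w &
        (XT_norm s (- 2^-1 + delta1) w <=
           C%:E * XT_norm s (2^-1 + delta2) u * XT_norm s (2^-1 + delta2) v)%E].
Proof.
(* The value 1/8 makes [1/2 - delta1] at least 3/8, the exponent of the output weight in the
   trilinear estimate. *)
exists 8^-1; split; first by rewrite invr_gt0.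
move=> d1 d2 d20 d21 d18 s s0.
have [C C0 hC] := bilinear_xnorm s0 d20 (ltW d18); exists C; split=> // T T0 _ u v hu hv.
apply: (XT_product (b := 2^-1 + d2) s0 _ C0 hC hu hv).
by rewrite addr_ge0 ?invr_ge0 ?ler0n// ltW.
Qed.
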